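(* The dimension of the space $\mathcal L^{2,2}$ is not stable under small deformations of the Iwasawa manifold: there is a holomorphic deformation $M_a$, $a\in\mathbb C$ with $|a|<1$, of the Iwasawa manifold $M_0$ by invariant complex structures, such that each $M_a$ admits invariant balanced Hermitian structures, $\dim\mathcal L^{2,2}(M_0,F)=7$ for any invariant balanced Hermitian structure $F$ on $M_0$, and $\dim\mathcal L^{2,2}(M_a,F)=5$ for $0<|a|<1$ and any invariant balanced Hermitian structure $F$ on $M_a$.
   Context: The Iwasawa manifold $M_0$ is the compact quotient of the complex 3-dimensional Heisenberg group by a lattice, with its natural complex structure; it has a basis of invariant $(1,0)$-forms with $d\omega^1=d\omega^2=0$, $d\omega^3=\omega^1\wedge\omega^2$. Invariant complex structures and metrics on the underlying nilmanifold are those induced by left-invariant ones on the Lie group. A Hermitian structure is identified with its fundamental $(1,1)$-form $F$; in complex dimension 3 it is balanced if $dF^2=0$. For a compact complex manifold $M$ of complex dimension 3 with a nowhere vanishing closed $(3,0)$-form and a balanced Hermitian structure $F$, $$\mathcal L^{2,2}(M,F)=\{\alpha\in\Omega^{2,2}(M)\mid d\alpha=0,\ \partial\bar\partial( *\alpha)=0,\ \alpha\wedge F=0\},$$ where $\Omega^{2,2}$ denotes smooth complex $(2,2)$-forms and $*$ is the Hodge star operator of the Hermitian metric. *)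

(* Defs.v *)
From HB Require Import structures.
From mathcomp Require Import all_boot all_order all_algebra.
From mathcomp Require Import all_classical all_reals all_analysis.
From mathcomp Require Import complex.

Set Implicit Arguments.
Unset Strict Implicit.
Unset Printing Implicit Defensive.

Import Order.TTheory GRing.Theory Num.Theory.
Import numFieldNormedType.Exports.

Local Open Scope classical_set_scope.
Local Open Scope ring_scope.
Local Open Scope complex_scope.

(* Differential forms are written in the global coordinates of R^n: tangent
   vectors are columns, covectors are rows, and an endomorphism J of the
   tangent space acts on a covector t by t *m J. *)

(** * Exterior algebra of the complexified dual of R^n *)

(* [u S] is the coefficient of [u] on dx_i1 /\ ... /\ dx_ik, where
   i1 < ... < ik are the elements of [S]. *)
Definition ext (R : realType) (n : nat) := {ffun {set 'I_n} -> R[i]}.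

(* dx_A /\ dx_B = ext_sign A B * dx_(A :|: B) for disjoint A and B. *)
Definition ext_sign (R : realType) (n : nat) (A B : {set 'I_n}) : R[i] :=
  (-1) ^+ #|[pred p : 'I_n * 'I_n |
              [&& p.1 \in A, p.2 \in B & (p.2 < p.1)%N]]|.

Definition ebasis (R : realType) (n : nat) (S : {set 'I_n}) : ext R n :=
  [ffun T : {set 'I_n} => (T == S)%:R].

Definition escale (R : realType) (n : nat) (c : R[i]) (u : ext R n) : ext R n :=
  [ffun S : {set 'I_n} => c * u S].

Definition wedge (R : realType) (n : nat) (u v : ext R n) : ext R n :=
  [ffun S : {set 'I_n} =>
    \sum_(A : {set 'I_n} | A \subset S)
      ext_sign R A (S :\: A)%SET * u A * v (S :\: A)%SET].

Definition covector (R : realType) (n : nat) (t : 'rV[R[i]]_n) : ext R n :=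
  \sum_(i < n) escale (t 0 i) (ebasis R [set i]%SET).

(* The algebra morphism sending each covector t to t *m A. *)
Definition ext_map (R : realType) (n m : nat) (A : 'M[R[i]]_(n, m))
    (u : ext R n) : ext R m :=
  \sum_(S : {set 'I_n})
    escale (u S)
      (\big[@wedge R m/ebasis R finset.set0]_(i <- enum S) covector (row i A)).

Definition cplx_mx (R : realType) (n m : nat) (A : 'M[R]_(n, m)) :
    'M[R[i]]_(n, m) := map_mx (real_complex R) A.

(** * Types with respect to an almost complex structure at a point *)

(* t *m proj10 J is the (1,0)-part of the covector t, i.e. its component in
   the eigenspace t *m J = 'i t. *)
Definition proj10 (R : realType) (n : nat) (J : 'M[R]_n) : 'M[R[i]]_n :=
  2%:R^-1 *: (1%:M - 'i *: cplx_mx J).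

Definition proj01 (R : realType) (n : nat) (J : 'M[R]_n) : 'M[R[i]]_n :=
  2%:R^-1 *: (1%:M + 'i *: cplx_mx J).

(* Expand each dx_i as the sum of its (1,0)- and (0,1)-parts, and keep the
   products of p factors of type (1,0) and q factors of type (0,1). *)
Definition type_proj (R : realType) (n : nat) (J : 'M[R]_n) (p q : nat)
    (u : ext R n) : ext R n :=
  \sum_(S : {set 'I_n})
    \sum_(A : {set 'I_n} | [&& A \subset S, #|A| == p & #|(S :\: A)%SET| == q])
      escale (u S * ext_sign R A (S :\: A)%SET)
        (wedge (ext_map (proj10 J) (ebasis R A))
               (ext_map (proj01 J) (ebasis R (S :\: A)%SET))).

(* The bilinear form of a 2-form, with (dx /\ dy)(d/dx, d/dy) = 1. *)
Definition two_form_mx (R : realType) (n : nat) (u : ext R n) : 'M[R[i]]_n :=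
  \matrix_(i, j) (if (i < j)%N then u [set i; j]%SET
                  else if (j < i)%N then - u [set i; j]%SET else 0).

(* g(v, w) = F(v, J w) *)
Definition metric_mx (R : realType) (n : nat) (J : 'M[R]_n) (F : ext R n) :
    'M[R[i]]_n :=
  two_form_mx F *m cplx_mx J.

(* F^m / m! in real dimension n = 2m *)
Definition volume (R : realType) (n : nat) (F : ext R n) : ext R n :=
  escale (n./2`!)%:R^-1 (iter n./2 (wedge F) (ebasis R finset.set0)).

(* The C-linear Hodge star, characterized by u /\ *v = <u, v> vol, where < , >
   is the C-bilinear extension of the inner product of g on forms, so that
   <dx_A, v> = (ext_map g^-1 v) A. *)
Definition hodge (R : realType) (n : nat) (J : 'M[R]_n) (F u : ext R n) :
    ext R n :=
  [ffun T : {set 'I_n} =>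
    ext_sign R (~: T)%SET T * ext_map (invmx (metric_mx J F)) u (~: T)%SET
    * volume F finset.setT].

(** * Smooth functions and forms on open subsets of R^n *)

Definition partial (R : realType) (n : nat) (i : 'I_n.+1)
    (f : 'rV[R]_n.+1 -> R) : 'rV[R]_n.+1 -> R :=
  fun x => 'D_(delta_mx 0 i) f x.

(* All iterated partial derivatives exist and are continuous on U, which is
   meant to be open. *)
Definition smooth_on (R : realType) (n : nat) (U : set 'rV[R]_n.+1)
    (f : 'rV[R]_n.+1 -> R) : Prop :=
  forall (s : seq 'I_n.+1) (x : 'rV[R]_n.+1), U x ->
    {for x, continuous (foldr (@partial R n) f s)} /\
    forall i : 'I_n.+1, derivable (foldr (@partial R n) f s) x (delta_mx 0 i).

Definition csmooth_on (R : realType) (n : nat) (U : set 'rV[R]_n.+1)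
    (f : 'rV[R]_n.+1 -> R[i]) : Prop :=
  smooth_on U (fun x => complex.Re (f x)) /\
  smooth_on U (fun x => complex.Im (f x)).

Definition cpartial (R : realType) (n : nat) (i : 'I_n.+1)
    (f : 'rV[R]_n.+1 -> R[i]) (x : 'rV[R]_n.+1) : R[i] :=
  partial i (fun y => complex.Re (f y)) x +i*
  partial i (fun y => complex.Im (f y)) x.

Definition jacobian_mx (R : realType) (n m : nat)
    (f : 'rV[R]_n.+1 -> 'rV[R]_m.+1) (x : 'rV[R]_n.+1) : 'M[R]_(m.+1, n.+1) :=
  \matrix_(i, j) partial j (fun y => f y 0 i) x.

Definition dform (R : realType) (n : nat) := 'rV[R]_n.+1 -> ext R n.+1.

Definition smooth_form (R : realType) (n : nat) (a : dform R n) : Prop :=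
  forall S : {set 'I_n.+1}, csmooth_on setT (fun x => a x S).

Definition fwedge (R : realType) (n : nat) (a b : dform R n) : dform R n :=
  fun x => wedge (a x) (b x).

Definition ext_d (R : realType) (n : nat) (a : dform R n) : dform R n :=
  fun x => \sum_(i < n.+1)
    wedge (ebasis R [set i]%SET)
          [ffun S : {set 'I_n.+1} => cpartial i (fun y => a y S) x].

Definition pullback (R : realType) (n m : nat)
    (f : 'rV[R]_n.+1 -> 'rV[R]_m.+1) (a : dform R m) : dform R n :=
  fun x => ext_map (cplx_mx (jacobian_mx f x)) (a (f x)).

(** * Complex structures *)

Definition acs (R : realType) (n : nat) := 'rV[R]_n.+1 -> 'M[R]_n.+1.

(* An almost complex structure on U which is induced by local holomorphic
   coordinates. *)
Definition complex_structure_on (R : realType) (n : nat)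
    (U : set 'rV[R]_n.+1) (J : acs R n) : Prop :=
  [/\ forall i j, smooth_on U (fun x => J x i j),
      forall x, U x -> J x *m J x = - 1%:M
    & forall x, U x ->
        exists (V : set 'rV[R]_n.+1) (z : 'I_(n.+1)./2 -> 'rV[R]_n.+1 -> R[i]),
          [/\ open V, V x, V `<=` U, forall k, csmooth_on V (z k)
            & forall y, V y ->
                let dz := \matrix_(k, j) cpartial j (z k) y in
                dz *m cplx_mx (J y) = 'i *: dz /\ row_free dz]].

Definition holomorphic_on (R : realType) (n m : nat) (U : set 'rV[R]_n.+1)
    (J : acs R n) (J' : acs R m) (f : 'rV[R]_n.+1 -> 'rV[R]_m.+1) : Prop :=
  (forall i, smooth_on U (fun x => f x 0 i)) /\
  forall x, U x -> J' (f x) *m jacobian_mx f x = jacobian_mx f x *m J x.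

(* Multiplication by 'i on C^m = R^2m, with coordinates x_(2k) + i x_(2k+1). *)
Definition std_acs (R : realType) (n : nat) : acs R n :=
  fun _ => \matrix_(i, j) (((i == j.+1 :> nat) && ~~ odd j)%:R
                         - ((j == i.+1 :> nat) && ~~ odd i)%:R).

Definition of_type (R : realType) (n : nat) (J : acs R n) (p q : nat)
    (a : dform R n) : Prop :=
  forall x, type_proj (J x) p q (a x) = a x.

Definition del (R : realType) (n : nat) (J : acs R n) (a : dform R n) :
    dform R n :=
  fun x => \sum_(p < n.+2) \sum_(q < n.+2)
    type_proj (J x) p.+1 q (ext_d (fun y => type_proj (J y) p q (a y)) x).

Definition delbar (R : realType) (n : nat) (J : acs R n) (a : dform R n) :
    dform R n :=
  fun x => \sum_(p < n.+2) \sum_(q < n.+2)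
    type_proj (J x) p q.+1 (ext_d (fun y => type_proj (J y) p q (a y)) x).

Definition star (R : realType) (n : nat) (J : acs R n) (F a : dform R n) :
    dform R n :=
  fun x => hodge (J x) (F x) (a x).

(* F is the fundamental form of a Hermitian metric: a smooth real (1,1)-form
   such that F(v, J v) > 0 for every nonzero tangent vector v. *)
Definition hermitian_structure (R : realType) (n : nat) (J : acs R n)
    (F : dform R n) : Prop :=
  [/\ smooth_form F, of_type J 1 1 F,
      forall x S, complex.Im (F x S) = 0
    & forall x (v : 'cV[R]_n.+1), v != 0 ->
        0 < ((cplx_mx v)^T *m metric_mx (J x) (F x) *m cplx_mx v) 0 0].

(** * The complex Heisenberg group and its compact quotients *)

(* C^3 is identified with R^6 through x |-> (zc 0 x, zc 1 x, zc 2 x). *)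
Definition zc (R : realType) (k : nat) (x : 'rV[R]_6) : R[i] :=
  x 0 (inord k.*2) +i* x 0 (inord k.*2.+1).

Definition realify (R : realType) (n : nat) (z : nat -> R[i]) : 'rV[R]_n :=
  \row_i (if odd i then complex.Im (z i./2) else complex.Re (z i./2)).

(* (z1, z2, z3) stands for the upper unitriangular matrix
   [1 z1 z3; 0 1 z2; 0 0 1]; the unit is 0. *)
Definition heis_mul (R : realType) (x y : 'rV[R]_6) : 'rV[R]_6 :=
  realify 6 (fun k => zc k x + zc k y + (k == 2)%:R * (zc 0 x * zc 1 y)).

(* A discrete cocompact subgroup. *)
Definition heis_lattice (R : realType) (Gam : set 'rV[R]_6) : Prop :=
  [/\ Gam 0,
      forall x y, Gam x -> Gam y -> Gam (heis_mul x y),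
      forall x, Gam x -> exists2 y, Gam y & heis_mul x y = 0,
      \forall x \near (0 : 'rV[R]_6), Gam x -> x = 0
    & exists2 K : set 'rV[R]_6, compact K &
        forall x, exists g k, [/\ Gam g, K k & x = heis_mul g k]].

(* Forms on the quotient of the group by left translations by Gam are the
   Gam-invariant forms on the group; the case Gam = setT gives the
   left-invariant forms. *)
Definition invariant_form (R : realType) (Gam : set 'rV[R]_6)
    (a : dform R 5) : Prop :=
  forall g, Gam g -> pullback (heis_mul g) a = a.

Definition invariant_acs (R : realType) (J : acs R 5) : Prop :=
  forall g, holomorphic_on setT J J (heis_mul g).

Definition invariant_balanced (R : realType) (J : acs R 5) (F : dform R 5) :
    Prop :=
  [/\ hermitian_structure J F, invariant_form setT F
    & forall x, ext_d (fwedge F F) x = 0].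

Definition L22 (R : realType) (Gam : set 'rV[R]_6) (J : acs R 5)
    (F : dform R 5) : set (dform R 5) :=
  [set a | [/\ smooth_form a /\ invariant_form Gam a,
               of_type J 2 2 a,
               forall x, ext_d a x = 0,
               forall x, del J (delbar J (star J F a)) x = 0
             & forall x, fwedge a F x = 0]].

(* The set L of forms is a complex vector space with a basis of k elements. *)
Definition has_dim (R : realType) (n : nat) (L : set (dform R n)) (k : nat) :
    Prop :=
  exists e : 'I_k -> dform R n,
    let comb (c : 'I_k -> R[i]) : dform R n :=
      fun x => \sum_(i < k) escale (c i) (e i x) in
    (forall a, L a <-> exists c, a = comb c) /\
    (forall c, (forall x, comb c x = 0) -> forall i, c i = 0).

(** * Holomorphic families over the unit disc *)

(* The coordinates of a point (x, a) of the product of the group with C are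
   those of x followed by those of a. *)
Definition family_domain (R : realType) : set 'rV[R]_(6 + 2) :=
  [set p | `| (p 0 (rshift 6 0) +i* p 0 (rshift 6 1)) | < 1].

Definition base_point (R : realType) (a : R[i]) : 'rV[R]_2 :=
  realify 2 (fun _ => a).

(* The complex structure which J induces on the fibre over a. *)
Definition fibre_acs (R : realType) (J : acs R 7) (a : R[i]) : acs R 5 :=
  fun x => @ulsubmx R 6 2 6 2 (J (row_mx x (base_point a))).

(* The total space is (Gam \ group) x disc with a complex structure for which
   the projection to the disc, which is a proper submersion, is holomorphic;
   up to diffeomorphism every holomorphic family of compact complex manifolds
   over the disc has this form. *)
Definition holomorphic_family (R : realType) (Gam : set 'rV[R]_6)
    (J : acs R 7) : Prop :=
  [/\ complex_structure_on (@family_domain R) J,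
      forall g, Gam g ->
        holomorphic_on (@family_domain R) J J
          (fun p => row_mx (heis_mul g (@lsubmx R 1 6 2 p)) (@rsubmx R 1 6 2 p))
    & holomorphic_on (@family_domain R) J (@std_acs R 1) (@rsubmx R 1 6 2)].

(* Main.v *)
(* The deformation M_a is the one whose holomorphic coordinates are
   z_0 + a conj(z_0), z_1 and z_2. An invariant balanced metric becomes diagonal
   after a triangular change of the invariant coframe; balancedness forces the one
   off-diagonal entry that would alter the structure equations to vanish when
   a <> 0. A form in L^{2,2} then satisfies a harmonic system, and integration by
   parts against an invariant mean on the quotient shows that the derivatives of
   its coefficients vanish: it is invariant. Among the nine coefficients of an
   invariant (2,2)-form, the second order condition kills one and the trace
   condition is one more equation, which leaves 7; closedness is automatic for
   a = 0 and kills exactly two further coefficients for a <> 0, which leaves 5. *)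

Require Import Defs.
From HB Require Import structures.
From mathcomp Require Import all_boot all_order all_algebra.
From mathcomp Require Import all_classical all_reals all_analysis.
From mathcomp Require Import complex.
From mathcomp Require Import ring lra.

Import Order.TTheory GRing.Theory Num.Theory.
Import numFieldNormedType.Exports.

Set Implicit Arguments.
Unset Strict Implicit.
Unset Printing Implicit Defensive.

Local Open Scope classical_set_scope.
Local Open Scope ring_scope.
Local Open Scope complex_scope.

(** The invariance step rests on two facts. A solution of the harmonic system of the form
    $\partial\bar\partial v$ vanishes, because integrating by parts twice moves
    $\partial\bar\partial$ onto the conjugate of its star. And for a closed form $u$ and conjugate
    frame fields $X_p, X_q$, Cartan's formula gives $-\partial\bar\partial(\iota_p\iota_q u) =
    (L+T)u$ with $L = X_pX_q$ acting on coefficients and $T$ coming from the torsion. For the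
    central pair $T=0$, so $u$ is constant along the centre. For the other pairs $T$ is not zero,
    which is the main obstacle; but it lowers the number of central factors of the coframe, so
    $T^3=0$, and it commutes with $L$. Hence $L^3 = (L+T)(L^2-LT+T^2)$, so $L^3u$ is exact as well
    as harmonic, thus zero, and symmetry of $L$ brings this down to $X_pu = X_qu = 0$. The mean is a
    limit of finite averages along an ultrafilter, defined on all bounded functions; additivity,
    positivity and invariance under right translations are what the argument uses. *)

(** * Creation and annihilation operators on an exterior algebra *)

Section FermionOperators.
Context {K : comPzRingType} {n : nat}.
Implicit Types (u v : {ffun {set 'I_n} -> K}) (S T : {set 'I_n}) (i j : 'I_n).

(** The sign gained when the generator $i$, placed in front, moves past $j$ towards its increasing
    position. [sg] and [xsg] extend it multiplicatively to sets, so that signs are products over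
    elements rather than powers of a count of inversions. *)
Definition flip i j : K := if (j < i)%N then -1 else 1.

Definition sg i S : K := \prod_(b in S) flip i b.

Definition xsg S T : K := \prod_(a in S) sg a T.

Definition esc (c : K) u : {ffun {set 'I_n} -> K} := [ffun S : {set 'I_n} => c * u S].

(** [eps i] is exterior multiplication by the $i$-th generator and [iot i] below is contraction with
    the $i$-th basis vector. Their anticommutation relations replace manipulations of the sum that
    defines the wedge. *)
Definition eps i u : {ffun {set 'I_n} -> K} :=
  [ffun S : {set 'I_n} => if i \in S then sg i (S :\ i)%SET * u (S :\ i)%SET else 0].

Definition iot i u : {ffun {set 'I_n} -> K} :=
  [ffun S : {set 'I_n} => if i \in S then 0 else sg i S * u (i |: S)%SET].

Definition par u : {ffun {set 'I_n} -> K} :=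
  [ffun S : {set 'I_n} => (-1) ^+ #|S| * u S].

(** The top coefficient of $u\wedge v$ (see [wedge_top]), written over an arbitrary commutative ring
    so that it also applies to coefficients that are functions. *)
Definition pairing u v : K :=
  \sum_(S : {set 'I_n}) xsg S (~: S)%SET * (u S * v (~: S)%SET).

Lemma eps_is_additive i : zmod_morphism (eps i).
Proof.
move=> u v; apply/ffunP => S; rewrite !ffunE.
by case: ifP => _; rewrite ?subr0// mulrBr.
Qed.
HB.instance Definition _ i := GRing.isZmodMorphism.Build _ _ (eps i) (eps_is_additive i).

Lemma iot_is_additive i : zmod_morphism (iot i).
Proof.
move=> u v; apply/ffunP => S; rewrite !ffunE.
by case: ifP => _; rewrite ?subr0// mulrBr.
Qed.
HB.instance Definition _ i := GRing.isZmodMorphism.Build _ _ (iot i) (iot_is_additive i).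

Lemma esc_is_additive c : zmod_morphism (esc c).
Proof. by move=> u v; apply/ffunP => S; rewrite !ffunE mulrBr. Qed.
HB.instance Definition _ c := GRing.isZmodMorphism.Build _ _ (esc c) (esc_is_additive c).

Lemma par_is_additive : zmod_morphism par.
Proof. by move=> u v; apply/ffunP => S; rewrite !ffunE mulrBr. Qed.
HB.instance Definition _ := GRing.isZmodMorphism.Build _ _ par par_is_additive.

Lemma escA c d u : esc c (esc d u) = esc (c * d) u.
Proof. by apply/ffunP => S; rewrite !ffunE mulrA. Qed.

Lemma esc1 u : esc 1 u = u.
Proof. by apply/ffunP => S; rewrite !ffunE mul1r. Qed.

Lemma escN c u : esc (- c) u = - esc c u.
Proof. by apply/ffunP => S; rewrite !ffunE mulNr. Qed.

Lemma esc0 u : esc 0 u = 0.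
Proof. by apply/ffunP => S; rewrite !ffunE mul0r. Qed.

Lemma escDl c d u : esc (c + d) u = esc c u + esc d u.
Proof. by apply/ffunP => S; rewrite !ffunE mulrDl. Qed.

Lemma eps_esc i c u : eps i (esc c u) = esc c (eps i u).
Proof. by apply/ffunP => S; rewrite !ffunE; case: ifP; rewrite ?mulr0// mulrCA. Qed.

Lemma iot_esc i c u : iot i (esc c u) = esc c (iot i u).
Proof. by apply/ffunP => S; rewrite !ffunE; case: ifP; rewrite ?mulr0// mulrCA. Qed.

Lemma par_esc c u : par (esc c u) = esc c (par u).
Proof. by apply/ffunP => S; rewrite !ffunE mulrCA. Qed.

Lemma flip_sq i j : flip i j * flip i j = 1.
Proof. by rewrite /flip; case: ifP; rewrite ?mulrNN mulr1. Qed.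

Lemma flipC i j : i != j -> flip i j * flip j i = -1.
Proof.
rewrite /flip -val_eqE /= => ij.
by case: ltngtP ij; rewrite ?mulr1 ?mul1r.
Qed.

Lemma flipCN i j : i != j -> flip i j = - flip j i.
Proof. by move=> ij; rewrite -[LHS]mulr1 -(flip_sq j i) mulrA flipC// mulN1r. Qed.

Lemma sg_sq i S : sg i S * sg i S = 1.
Proof. by rewrite /sg -big_split big1//= => b _; rewrite flip_sq. Qed.

Lemma sgU1 i j S : j \notin S -> sg i (j |: S)%SET = flip i j * sg i S.
Proof. by move=> jS; rewrite /sg big_setU1. Qed.

Lemma sgD1 i j S : j \in S -> sg i S = flip i j * sg i (S :\ j)%SET.
Proof. by move=> jS; rewrite -sgU1 ?finset.setD11 ?finset.setD1K. Qed.

Lemma sg_setD i S T : T \subset S -> sg i S = sg i T * sg i (S :\: T)%SET.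
Proof. by move=> /finset.setIidPr TS; rewrite /sg (big_setID T)/= TS. Qed.

Lemma xsgU1l i S T : i \notin S -> xsg (i |: S)%SET T = sg i T * xsg S T.
Proof. by move=> iS; rewrite /xsg big_setU1. Qed.

Lemma xsg0l T : xsg finset.set0 T = 1.
Proof. by rewrite /xsg big_set0. Qed.

Lemma xsg_sq S T : xsg S T * xsg S T = 1.
Proof. by rewrite /xsg -big_split big1//= => a _; rewrite sg_sq. Qed.

(** Each $a\in S$ is compared with $i$ from the other side, and [flip a i] is minus [flip i a]; this
    yields one sign per element of $S$. *)
Lemma xsgU1r i S T : i \notin S -> i \notin T ->
  xsg S (i |: T)%SET = (-1) ^+ #|S| * sg i S * xsg S T.
Proof.
move=> iS iT; rewrite /xsg.
under eq_bigr => a _ do rewrite sgU1//.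
rewrite big_split/=; congr (_ * _).
rewrite -(prodr_const (mem S) (-1 : K)) /sg -big_split/=; apply: eq_bigr => a aS.
have ai : a != i by apply: contraNneq iS => <-.
by rewrite -(flipC ai) -mulrA flip_sq mulr1.
Qed.

Lemma eps_eps i j u : eps i (eps j u) = - eps j (eps i u).
Proof.
apply/ffunP => S; rewrite !ffunE.
have [->|ij] := eqVneq i j.
  by case: ifP => _; rewrite ?oppr0// finset.setD11 mulr0 oppr0.
rewrite !finset.in_setD1 ij eq_sym ij/=.
case: (boolP (i \in S)) => iS; case: (boolP (j \in S)) => jS; rewrite /= ?mulr0 ?oppr0//.
rewrite (@sgD1 i j (S :\ i)%SET) ?(@sgD1 j i (S :\ j)%SET) ?finset.in_setD1 ?iS ?jS ?ij ?andbT// 1?eq_sym//.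
by rewrite !finset.setDDl (finset.setUC [set j]%SET) (flipCN ij); ring.
Qed.

Lemma eps_eps0 i u : eps i (eps i u) = 0.
Proof.
by apply/ffunP => S; rewrite !ffunE; case: ifP => _; rewrite ?finset.setD11 ?mulr0.
Qed.

Lemma iot_iot i j u : iot i (iot j u) = - iot j (iot i u).
Proof.
apply/ffunP => S; rewrite !ffunE !finset.in_setU1.
have [->|ij] := eqVneq i j.
  by case: ifP => _; rewrite ?oppr0//= mulr0 oppr0.
rewrite /=.
case: (boolP (i \in S)) => iS; case: (boolP (j \in S)) => jS; rewrite /= ?mulr0 ?oppr0//.
by rewrite (sgU1 _ iS) (sgU1 _ jS) finset.setUCA (flipCN ij); ring.
Qed.

Lemma iot_iot0 i u : iot i (iot i u) = 0.
Proof.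
by apply/ffunP => S; rewrite !ffunE; case: ifP => _; rewrite ?finset.setU11 ?mulr0.
Qed.

Lemma iot_eps i j u : i != j -> iot i (eps j u) = - eps j (iot i u).
Proof.
move=> ij; apply/ffunP => S; rewrite !ffunE !finset.in_setU1 finset.in_setD1.
rewrite ?(eq_sym j i) ?(negbTE ij)/=.
case: (boolP (i \in S)) => iS; case: (boolP (j \in S)) => jS; rewrite /= ?mulr0 ?oppr0//.
have iSj : i \notin (S :\ j)%SET by rewrite finset.in_setD1 (negbTE iS) andbF.
have E : ((i |: S) :\ j = i |: (S :\ j))%SET.
  apply/setP => x; rewrite !finset.inE.
  by have [->|] := eqVneq x i; rewrite ?ij.
rewrite E sgU1// (sgD1 i jS).
have := flipC ij; move: (flip i j) (flip j i) (sg i _) (sg j _) (u _) => f g a b c fg.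
by transitivity (f * g * (a * b * c)); [ring | rewrite fg; ring].
Qed.

Lemma iot_eps_eq i u : iot i (eps i u) = u - eps i (iot i u).
Proof.
apply/ffunP => S; rewrite !ffunE finset.setU11 finset.setD11.
case: (boolP (i \in S)) => iS; first by rewrite mulrA sg_sq mul1r finset.setD1K// subrr.
by rewrite finset.setU1K// mulrA sg_sq mul1r subr0.
Qed.

Lemma par_eps i u : par (eps i u) = - eps i (par u).
Proof.
apply/ffunP => S; rewrite !ffunE; case: ifP => iS; last by rewrite mulr0 oppr0.
by rewrite (cardsD1 i S) iS exprS; ring.
Qed.

Lemma par_iot i u : par (iot i u) = - iot i (par u).
Proof.
apply/ffunP => S; rewrite !ffunE; case: ifPn => iS; first by rewrite mulr0 oppr0.
by rewrite (cardsU1 i S) iS exprS; ring.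
Qed.

Lemma par_par u : par (par u) = u.
Proof. by apply/ffunP => S; rewrite !ffunE mulrA -exprMn mulrNN mulr1 expr1n mul1r. Qed.

(** The generator moves from the front of $u$ to its back, past all factors of $u$; [par] records
    the sign. *)
Lemma pairing_eps i u v : pairing (eps i u) v = pairing (par u) (eps i v).
Proof.
rewrite /pairing.
rewrite [LHS](bigID (fun S : {set 'I_n} => i \in S))/= [X in _ + X]big1 ?addr0; last first.
  by move=> S /negbTE iS; rewrite ffunE iS mul0r mulr0.
rewrite [RHS](bigID (fun S : {set 'I_n} => i \notin S))/= [X in _ + X]big1 ?addr0; last first.
  by move=> S; rewrite negbK => iS; rewrite [X in _ * (_ * X)]ffunE finset.in_setC iS !mulr0.
rewrite (reindex_onto (fun T => i |: T)%SET (fun S => S :\ i)%SET)/=; last first.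
  by move=> S iS; rewrite finset.setD1K.
apply: eq_big => [T|T /andP[_ /eqP iT]].
  rewrite finset.setU11/=; apply/eqP/idP => [<-|]; first by rewrite finset.setD11.
  exact: finset.setU1K.
have {}iT : i \notin T by rewrite -iT finset.setD11.
have E : (~: (i |: T) = (~: T) :\ i)%SET.
  by apply/setP => x; rewrite !finset.inE negb_or.
have E2 : (~: T = i |: ((~: T) :\ i))%SET by rewrite finset.setD1K// finset.inE.
rewrite !ffunE finset.setU11 finset.in_setC iT finset.setU1K// E xsgU1l//.
rewrite [in RHS]E2 xsgU1r ?finset.setD11// -E2.
have := exprMn #|T| (-1 : K) (-1 : K); rewrite mulrNN mulr1 expr1n; set p := _ ^+ _ => /esym pp.
set s := sg i T; set a := u _; set b := v _; set c := sg i _; set d := xsg _ _.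
by transitivity ((p * p) * (c * d * s * a * b)); [rewrite pp; ring | ring].
Qed.

(** Contraction is an antiderivation, and a contracted form has no top coefficient. *)
Lemma pairing_iot i u v : pairing (iot i u) v = - pairing (par u) (iot i v).
Proof.
rewrite /pairing.
rewrite [LHS](bigID (fun S : {set 'I_n} => i \notin S))/= [X in _ + X]big1 ?addr0; last first.
  by move=> S; rewrite negbK => iS; rewrite ffunE iS mul0r mulr0.
rewrite [in RHS](bigID (fun S : {set 'I_n} => i \in S))/= [X in _ + X]big1 ?addr0; last first.
  by move=> S iS; rewrite [X in _ * (_ * X)]ffunE finset.in_setC iS mulr0 mulr0.
rewrite [in RHS](reindex_onto (fun T => i |: T)%SET (fun S => S :\ i)%SET)/=; last first.
  by move=> S iS; rewrite finset.setD1K.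
rewrite -sumrN; apply: eq_big => [T|T iT].
  rewrite finset.setU11/=; apply/idP/eqP => [|<-]; last by rewrite finset.setD11.
  exact: finset.setU1K.
have E : (~: (i |: T) = (~: T) :\ i)%SET.
  by apply/setP => x; rewrite !finset.inE negb_or.
have E2 : (~: T = i |: ((~: T) :\ i))%SET by rewrite finset.setD1K// finset.inE.
rewrite !ffunE (negbTE iT) !finset.inE eqxx/= E xsgU1l// -E2.
rewrite [in LHS]E2 xsgU1r ?finset.setD11// -E2 cardsU1 iT exprS.
have := sg_sq i T; set s := sg i T => ss.
have := sg_sq i (~: T :\ i)%SET; set c := sg i (_ :\ _)%SET => cc.
set p := _ ^+ _; set a := u _; set b := v _; set d := xsg _ _.
transitivity ((s * s) * (p * d * a * b)); first by ring.
by transitivity ((c * c) * (p * d * a * b)); [rewrite ss cc | ring].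
Qed.

Definition dot u v : K := \sum_(S : {set 'I_n}) u S * v S.

(** The Hodge star for which the generators are orthonormal; [pairing_star0] is its
    characterization. *)
Definition star0 u : {ffun {set 'I_n} -> K} :=
  [ffun T : {set 'I_n} => xsg (~: T)%SET T * u (~: T)%SET].

Lemma pairing_star0 w u : pairing w (star0 u) = dot w u.
Proof.
apply: eq_bigr => S _; rewrite ffunE finset.setCK.
have := xsg_sq S (~: S)%SET; move: (xsg _ _) => s ss.
by transitivity (s * s * (w S * u S)); [ring | rewrite ss mul1r].
Qed.

Lemma pairing0r u : pairing u 0 = 0.
Proof. by rewrite /pairing big1// => S _; rewrite ffunE !mulr0. Qed.

Lemma pairingDl u v w : pairing (u + v) w = pairing u w + pairing v w.
Proof. by rewrite /pairing -big_split; apply: eq_bigr => S _; rewrite ffunE /=; ring. Qed.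

Lemma pairingDr u v w : pairing w (u + v) = pairing w u + pairing w v.
Proof. by rewrite /pairing -big_split; apply: eq_bigr => S _; rewrite ffunE /=; ring. Qed.

Lemma pairingNl u v : pairing (- u) v = - pairing u v.
Proof. by rewrite /pairing -sumrN; apply: eq_bigr => S _; rewrite ffunE /=; ring. Qed.

Lemma pairingNr u v : pairing u (- v) = - pairing u v.
Proof. by rewrite /pairing -sumrN; apply: eq_bigr => S _; rewrite ffunE /=; ring. Qed.

Lemma pairing_escl c u v : pairing (esc c u) v = c * pairing u v.
Proof. by rewrite /pairing mulr_sumr; apply: eq_bigr => S _; rewrite ffunE /=; ring. Qed.

Lemma pairing_escr c u v : pairing u (esc c v) = c * pairing u v.
Proof. by rewrite /pairing mulr_sumr; apply: eq_bigr => S _; rewrite ffunE /=; ring. Qed.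

End FermionOperators.

(** Elements are added below all previous ones, so that multiplying by the new generator produces a
    basis form with no sign. *)
Lemma ord_set_ind (n : nat) (P : {set 'I_n} -> Prop) :
  P finset.set0 ->
  (forall (i : 'I_n) (S : {set 'I_n}), (forall b, b \in S -> (i < b)%N) -> P S -> P (i |: S)%SET) ->
  forall S, P S.
Proof.
move=> P0 PS S; have [k] := ubnP #|S|; elim: k S => // k IH S.
have [->//|[i0 i0S]] := set_0Vmem S.
case: (arg_minnP (fun x : 'I_n => val x) i0S) => i iS imin leSk.
rewrite -(finset.setD1K iS); apply: PS => [b|].
  rewrite !finset.inE => /andP[bi bS]; rewrite ltn_neqAle imin// andbT.
  by rewrite eq_sym.
by apply: IH; move: leSk; rewrite (cardsD1 i S) [i \in S]iS add1n ltnS.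
Qed.

Lemma enum_setU1_min (n : nat) (i : 'I_n) (S : {set 'I_n}) :
  (forall b, b \in S -> (i < b)%N) -> enum (i |: S)%SET = i :: enum S.
Proof.
move=> iS.
have srt (T : {set 'I_n}) : sorted (fun x y : 'I_n => (x < y)%N) (enum T).
  rewrite {1}/enum_mem -enumT; apply: sorted_filter; first exact: ltn_trans.
  by have := iota_ltn_sorted 0 n; rewrite -val_enum_ord sorted_map.
apply: (@irr_sorted_eq _ (fun x y : 'I_n => (x < y)%N)).
- exact: ltn_trans.
- exact: ltnn.
- exact: srt.
- rewrite /= path_min_sorted ?srt//; apply/allP => b; rewrite mem_enum.
  exact: iS.
- by move=> b; rewrite inE !mem_enum !finset.inE.
Qed.

(** * The wedge product and the universal property of the exterior algebra *)

Section ExteriorAlgebra.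
Context {R : realType}.
Local Notation C := R[i].

Lemma escaleE n (c : C) (u : ext R n) : escale c u = esc c u.
Proof. by []. Qed.

Lemma ext_signE n (A B : {set 'I_n}) : ext_sign R A B = xsg A B.
Proof.
rewrite /ext_sign /xsg -(prodr_const _ (-1 : C)).
rewrite /sg (pair_big_dep (mem A) (fun _ b => b \in B) (fun a b => flip a b))/=.
rewrite [RHS](bigID (fun p : 'I_n * 'I_n => (p.2 < p.1)%N))/= [X in _ * X]big1; last first.
  by move=> p /andP[_ /negbTE ab]; rewrite /flip ab.
rewrite mulr1; apply: eq_big => p; first by rewrite inE andbA.
by rewrite inE => /and3P[_ _ ab]; rewrite /flip ab.
Qed.

Lemma ebasis_sum n (u : ext R n) :
  u = \sum_(S : {set 'I_n}) esc (u S) (ebasis R S).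
Proof.
apply/ffunP => T; rewrite sum_ffunE (bigD1 T)//= !ffunE eqxx mulr1 big1 ?addr0// => S ST.
by rewrite !ffunE eq_sym (negbTE ST) mulr0.
Qed.

Lemma eps_ebasis n (i : 'I_n) (S : {set 'I_n}) : i \notin S ->
  eps i (ebasis R S) = esc (sg i S) (ebasis R (i |: S)%SET).
Proof.
move=> iS; apply/ffunP => T; rewrite !ffunE.
have [->|nT] := eqVneq T (i |: S)%SET; first by rewrite finset.setU11 finset.setU1K ?eqxx.
case: ifPn => iT; last by rewrite mulr0.
have [E|_] := eqVneq (T :\ i)%SET S; last by rewrite !mulr0.
by rewrite -E finset.setD1K ?eqxx in nT.
Qed.

Lemma eps_ebasis_in n (i : 'I_n) (S : {set 'I_n}) : i \in S ->
  eps i (ebasis R S) = 0.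
Proof.
move=> iS; apply/ffunP => T; rewrite !ffunE; case: ifP => // iT.
have [E|_] := eqVneq (T :\ i)%SET S; last by rewrite mulr0.
by rewrite -E finset.setD11 in iS.
Qed.

Lemma sg_min n (i : 'I_n) (S : {set 'I_n}) :
  (forall b, b \in S -> (i < b)%N) -> sg i S = 1 :> C.
Proof.
by move=> iS; rewrite /sg big1// => b /iS ib; rewrite /flip ltnNge (ltnW ib).
Qed.

Lemma min_notin n (i : 'I_n) (S : {set 'I_n}) :
  (forall b, b \in S -> (i < b)%N) -> i \notin S.
Proof. by move=> iS; apply/negP => /iS; rewrite ltnn. Qed.

Lemma eps_ebasis_min n (i : 'I_n) (S : {set 'I_n}) :
  (forall b, b \in S -> (i < b)%N) ->
  eps i (ebasis R S) = ebasis R (i |: S)%SET.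
Proof. by move=> iS; rewrite eps_ebasis ?min_notin// sg_min// esc1. Qed.

(** Forms are spanned by words in the [eps i] applied to the unit, so a linear identity has only to
    be propagated through one [eps i]. *)
Lemma ext_ind n (P : ext R n -> Prop) :
  (forall u v, P u -> P v -> P (u + v)) -> (forall c u, P u -> P (esc c u)) ->
  P (ebasis R finset.set0) -> (forall i u, P u -> P (eps i u)) -> forall u, P u.
Proof.
move=> PD PZ P1 Pe u; rewrite [u]ebasis_sum.
elim/big_ind: _ => [|//|S _]; first by rewrite -(esc0 (ebasis R finset.set0)); apply: PZ.
apply: PZ; elim/ord_set_ind: S => // i S iS PS.
by rewrite -eps_ebasis_min//; apply: Pe.
Qed.

Section Universal.
Context {n : nat} {W : zmodType} (sc : C -> W -> W) (r : 'I_n -> W -> W)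
  (th : ext R n -> W).
Context (rB : forall i, zmod_morphism (r i)).
Context (thB : zmod_morphism th).
Context (r_sc : forall i c w, r i (sc c w) = sc c (r i w)).
Context (th_sc : forall c u, th (esc c u) = sc c (th u)).
Context (rr : forall i j w, r i (r j w) = - r j (r i w)).
Context (rr0 : forall i w, r i (r i w) = 0).
Context (th_min : forall (i : 'I_n) (S : {set 'I_n}), (forall b, b \in S -> (i < b)%N) ->
  th (ebasis R (i |: S)%SET) = r i (th (ebasis R S))).

Let th0 : th 0 = 0. Proof. by rewrite -[in LHS](subrr (0 : ext R n)) thB subrr. Qed.
Let r0 i : r i 0 = 0. Proof. by rewrite -[in LHS](subrr (0 : W)) rB subrr. Qed.
Let thN u : th (- u) = - th u. Proof. by rewrite -(sub0r u) thB th0 sub0r. Qed.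
Let rN i u : r i (- u) = - r i u. Proof. by rewrite -(sub0r u) rB r0 sub0r. Qed.
Let thD u v : th (u + v) = th u + th v. Proof. by rewrite -[v in LHS]opprK thB thN opprK. Qed.
Let rD i u v : r i (u + v) = r i u + r i v. Proof. by rewrite -[v in LHS]opprK rB rN opprK. Qed.

(** The hypothesis [th_min] treats only an index below all others, the case without sign. For a
    general index $i$ and a set with minimum $k<i$, the anticommutation of [eps] on one side and of
    [r] on the other moves $i$ past $k$, and induction applies to the rest. *)
Lemma ext_universal i u : th (eps i u) = r i (th u).
Proof.
rewrite [u]ebasis_sum.
apply: (big_ind (fun u => th (eps i u) = r i (th u))).
- by rewrite raddf0 th0 r0.
- by move=> x y Ex Ey; rewrite raddfD thD Ex Ey thD rD.
move=> S _; rewrite eps_esc !th_sc r_sc; congr sc; elim/ord_set_ind: S.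
  by rewrite eps_ebasis_min ?th_min// => b; rewrite finset.inE.
move=> k S kS IH; rewrite -[in LHS]eps_ebasis_min// th_min//.
case: (ltngtP k i) => ki.
- rewrite eps_eps thN rr -IH; congr (- _).
  case: (boolP (i \in S)) => iS; first by rewrite eps_ebasis_in// raddf0 th0 r0.
  rewrite eps_ebasis// eps_esc !th_sc r_sc; congr sc.
  have ikS b : b \in (i |: S)%SET -> (k < b)%N.
    by rewrite !finset.inE => /orP[/eqP->//|/kS].
  by rewrite eps_ebasis_min// th_min.
- have ikS b : b \in (k |: S)%SET -> (i < b)%N.
    by rewrite !finset.inE => /orP[/eqP->//|/kS]; apply: ltn_trans.
  by rewrite -th_min// [eps k _]eps_ebasis_min// eps_ebasis_min// th_min.
- by rewrite (val_inj ki) eps_eps0 th0 rr0.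
Qed.

End Universal.

Lemma wedge_is_additive n (u : ext R n) : zmod_morphism (wedge u).
Proof.
move=> v w; apply/ffunP => S; rewrite !ffunE -sumrB.
by apply: eq_bigr => A _; rewrite !ffunE mulrBr.
Qed.
HB.instance Definition _ n u :=
  GRing.isZmodMorphism.Build _ _ (@wedge R n u) (wedge_is_additive u).

Lemma wedgeBl n (u v w : ext R n) : wedge (u - v) w = wedge u w - wedge v w.
Proof.
apply/ffunP => S; rewrite !ffunE -sumrB.
by apply: eq_bigr => A _; rewrite !ffunE mulrBr mulrBl.
Qed.

Lemma wedge0l n (w : ext R n) : wedge 0 w = 0.
Proof. by rewrite -[X in wedge X _](subrr (0 : ext R n)) wedgeBl subrr. Qed.

Lemma wedgeNl n (u w : ext R n) : wedge (- u) w = - wedge u w.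
Proof. by rewrite -(sub0r u) wedgeBl wedge0l sub0r. Qed.

Lemma wedgeDl n (u v w : ext R n) : wedge (u + v) w = wedge u w + wedge v w.
Proof. by rewrite -[v in LHS]opprK wedgeBl wedgeNl opprK. Qed.

Lemma wedge_suml n (I : Type) (s : seq I) P (f : I -> ext R n) w :
  wedge (\sum_(i <- s | P i) f i) w = \sum_(i <- s | P i) wedge (f i) w.
Proof.
apply: (big_morph (fun u => wedge u w)); last exact: wedge0l.
by move=> u v; rewrite wedgeDl.
Qed.

Lemma wedge_escl n c (u w : ext R n) : wedge (esc c u) w = esc c (wedge u w).
Proof.
apply/ffunP => S; rewrite !ffunE mulr_sumr.
by apply: eq_bigr => A _; rewrite !ffunE; ring.
Qed.

Lemma wedge_escr n c (u w : ext R n) : wedge u (esc c w) = esc c (wedge u w).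
Proof.
apply/ffunP => S; rewrite !ffunE mulr_sumr.
by apply: eq_bigr => A _; rewrite !ffunE; ring.
Qed.

Lemma wedge1l n (u : ext R n) : wedge (ebasis R finset.set0) u = u.
Proof.
apply/ffunP => S; rewrite !ffunE (bigD1 finset.set0) ?finset.sub0set//=.
rewrite ffunE eqxx finset.setD0 ext_signE xsg0l !mul1r big1 ?addr0// => A /andP[_ A0].
by rewrite ffunE (negbTE A0) mulr0 mul0r.
Qed.

(** This is the one instance of associativity derived from the defining sum, by sorting the subsets
    $A$ according to whether they contain $i$. The later ones are reduced to it by [ext_ind]. *)
Lemma eps_wedge n i (u v : ext R n) : wedge (eps i u) v = eps i (wedge u v).
Proof.
apply/ffunP => S; rewrite !ffunE.
case: ifPn => iS; last first.
  apply: big1 => A AS; rewrite ffunE; case: ifPn => iA; last by rewrite mulr0 mul0r.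
  by rewrite (fintype.subsetP AS _ iA) in iS.
rewrite mulr_sumr [LHS](bigID (fun A : {set 'I_n} => i \in A))/=.
rewrite [X in _ + X]big1 ?addr0; last first.
  by move=> A /andP[_ /negbTE iA]; rewrite ffunE iA mulr0 mul0r.
rewrite (reindex_onto (fun T => i |: T)%SET (fun S => S :\ i)%SET)/=; last first.
  by move=> T /andP[_ iT]; rewrite finset.setD1K.
apply: eq_big => [T|T].
  rewrite finset.setU11 andbT finset.subsetD1 finset.subUset finset.sub1set iS/=.
  congr andb; apply/eqP/idP => [<-|]; first by rewrite finset.setD11.
  exact: finset.setU1K.
rewrite finset.setU11 andbT finset.subUset finset.sub1set iS/= => /andP[TS /eqP iT].
have {}iT : i \notin T by rewrite -iT finset.setD11.
rewrite ffunE finset.setU11 finset.setU1K// !ext_signE xsgU1l// -finset.setDDl.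
rewrite [in RHS](@sg_setD _ _ i (S :\ i)%SET T) ?finset.subsetD1 ?TS//.
have := sg_sq i T; move: (sg i T) (sg i _) (xsg _ _) (u T) (v _) => s c d a b ss.
by ring.
Qed.

Lemma wedge_ebasis1 n i (u : ext R n) : wedge (ebasis R [set i]%SET) u = eps i u.
Proof.
rewrite -(finset.setU0 [set i]%SET) -eps_ebasis_min ?eps_wedge ?wedge1l//.
by move=> b; rewrite finset.inE.
Qed.

End ExteriorAlgebra.

(** * Multiplication by covectors, contraction with vectors, and pullback *)

HB.lock Definition cov (R : realType) (n : nat) (t : 'rV[R[i]]_n) (u : ext R n) : ext R n :=
  \sum_(i < n) esc (t 0 i) (eps i u).

(** Here the row [t] holds the components of a tangent vector, not of a covector. *)
HB.lock Definition ctr (R : realType) (n : nat) (t : 'rV[R[i]]_n) (u : ext R n) : ext R n :=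
  \sum_(i < n) esc (t 0 i) (iot i u).

Section CovectorOperators.
Context {R : realType}.
Local Notation C := R[i].

Lemma covE n (t : 'rV[C]_n) u : cov t u = \sum_(i < n) esc (t 0 i) (eps i u).
Proof. by rewrite cov.unlock. Qed.

Lemma ctrE n (t : 'rV[C]_n) u : ctr t u = \sum_(i < n) esc (t 0 i) (iot i u).
Proof. by rewrite ctr.unlock. Qed.

Lemma cov_is_additive n (t : 'rV[C]_n) : zmod_morphism (cov t).
Proof. by move=> u v; rewrite !covE -sumrB; apply: eq_bigr => i _; rewrite !raddfB. Qed.
HB.instance Definition _ n (t : 'rV[C]_n) :=
  GRing.isZmodMorphism.Build _ _ (cov t) (cov_is_additive t).

Lemma ctr_is_additive n (t : 'rV[C]_n) : zmod_morphism (ctr t).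
Proof. by move=> u v; rewrite !ctrE -sumrB; apply: eq_bigr => i _; rewrite !raddfB. Qed.
HB.instance Definition _ n (t : 'rV[C]_n) :=
  GRing.isZmodMorphism.Build _ _ (ctr t) (ctr_is_additive t).

Lemma esc_sum n (I : Type) (s : seq I) P (f : I -> ext R n) c :
  esc c (\sum_(i <- s | P i) f i) = \sum_(i <- s | P i) esc c (f i).
Proof. exact: raddf_sum. Qed.

Lemma cov_esc n (t : 'rV[C]_n) c u : cov t (esc c u) = esc c (cov t u).
Proof. by rewrite !covE esc_sum; apply: eq_bigr => i _; rewrite eps_esc !escA mulrC. Qed.

Lemma ctr_esc n (t : 'rV[C]_n) c u : ctr t (esc c u) = esc c (ctr t u).
Proof. by rewrite !ctrE esc_sum; apply: eq_bigr => i _; rewrite iot_esc !escA mulrC. Qed.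

Lemma cov_wedge n (t : 'rV[C]_n) u v : wedge (cov t u) v = cov t (wedge u v).
Proof.
by rewrite !covE wedge_suml; apply: eq_bigr => i _; rewrite wedge_escl eps_wedge.
Qed.

Lemma covectorE n (t : 'rV[C]_n) : covector t = cov t (ebasis R finset.set0).
Proof.
rewrite covE; apply: eq_bigr => i _; rewrite escaleE eps_ebasis_min ?finset.setU0// => b.
by rewrite finset.inE.
Qed.

Lemma wedge_covector n (t : 'rV[C]_n) u : wedge (covector t) u = cov t u.
Proof. by rewrite covectorE cov_wedge wedge1l. Qed.

Lemma cov_eps n (t : 'rV[C]_n) i u : cov t (eps i u) = - eps i (cov t u).
Proof.
rewrite !covE raddf_sum -sumrN; apply: eq_bigr => j _.
by rewrite /= eps_esc eps_eps raddfN.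
Qed.

Lemma cov_cov n (t s : 'rV[C]_n) u : cov t (cov s u) = - cov s (cov t u).
Proof.
rewrite [cov s u]covE raddf_sum /= [in RHS]covE -sumrN; apply: eq_bigr => j _.
by rewrite cov_esc cov_eps raddfN.
Qed.

Lemma ext2_eq0 n (u : ext R n) : u = - u -> u = 0.
Proof.
move=> uu; apply/ffunP => S; have := congr1 (fun w : ext R n => w S) uu.
rewrite !ffunE => /eqP; rewrite -subr_eq0 opprK -mulr2n mulrn_eq0/= => /eqP.
exact.
Qed.

Lemma cov_cov0 n (t : 'rV[C]_n) u : cov t (cov t u) = 0.
Proof. exact/ext2_eq0/cov_cov. Qed.

Lemma par_ebasis n (S : {set 'I_n}) :
  par (ebasis R S) = esc ((-1) ^+ #|S|) (ebasis R S).
Proof.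
by apply/ffunP => T; rewrite !ffunE; case: eqVneq => [->|_]//; rewrite !mulr0.
Qed.

Lemma wedge_eps n (u v : ext R n) i : wedge u (eps i v) = wedge (eps i (par u)) v.
Proof.
move: u; apply: ext_ind => [u w Eu Ew|c u Eu||j u Eu].
- by rewrite wedgeDl Eu Ew !raddfD wedgeDl.
- by rewrite wedge_escl Eu par_esc eps_esc wedge_escl.
- by rewrite par_ebasis finset.cards0 expr0 esc1 eps_wedge !wedge1l.
- by rewrite par_eps raddfN/= eps_wedge Eu -eps_wedge eps_eps wedgeNl.
Qed.

Lemma ext_map_ebasis n m (A : 'M[C]_(n, m)) S : ext_map A (ebasis R S) =
  \big[@wedge R m/ebasis R finset.set0]_(i <- enum S) covector (row i A).
Proof.
rewrite /ext_map (bigD1 S)//= big1 ?addr0.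
  by rewrite ffunE eqxx escaleE esc1.
by move=> T TS; rewrite ffunE (negbTE TS) escaleE esc0.
Qed.

Lemma ext_map_is_additive n m (A : 'M[C]_(n, m)) : zmod_morphism (ext_map A).
Proof.
move=> u v; rewrite /ext_map -sumrB; apply: eq_bigr => S _.
by rewrite !ffunE !escaleE escDl escN.
Qed.
HB.instance Definition _ n m (A : 'M[C]_(n, m)) :=
  GRing.isZmodMorphism.Build _ _ (ext_map A) (ext_map_is_additive A).

Lemma ext_map_esc n m (A : 'M[C]_(n, m)) c u : ext_map A (esc c u) = esc c (ext_map A u).
Proof.
rewrite /ext_map esc_sum; apply: eq_bigr => S _.
by rewrite !escaleE ffunE escA.
Qed.

Lemma ext_map1 n m (A : 'M[C]_(n, m)) :
  ext_map A (ebasis R finset.set0) = ebasis R finset.set0.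
Proof. by rewrite ext_map_ebasis finset.enum_set0 big_nil. Qed.

(** The universal property with the anticommuting operators [cov (row i A)]; only increasing
    products, where [ext_map] is given by its definition, have to be checked. *)
Lemma ext_map_eps n m (A : 'M[C]_(n, m)) i u :
  ext_map A (eps i u) = cov (row i A) (ext_map A u).
Proof.
apply: (@ext_universal R n (ext R m) esc (fun i => cov (row i A))) => //.
- by move=> k u1 u2; rewrite raddfB.
- by move=> u1 u2; rewrite raddfB.
- by move=> *; rewrite cov_esc.
- by move=> *; rewrite ext_map_esc.
- by move=> *; rewrite cov_cov.
- by move=> *; rewrite cov_cov0.
- move=> k S kS; rewrite !ext_map_ebasis enum_setU1_min// big_cons.
  by rewrite wedge_covector.
Qed.

Lemma ext_map_cov n m (A : 'M[C]_(n, m)) t u :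
  ext_map A (cov t u) = cov (t *m A) (ext_map A u).
Proof.
rewrite !covE raddf_sum/=.
under eq_bigr => i _ do rewrite ext_map_esc ext_map_eps !covE esc_sum.
rewrite exchange_big/=; apply: eq_bigr => j _.
rewrite mxE; transitivity (\sum_(i < n) esc (t 0 i * A i j) (eps j (ext_map A u))).
  by apply: eq_bigr => i _; rewrite escA mxE.
by apply/ffunP => S; rewrite sum_ffunE ffunE mulr_suml; apply: eq_bigr => i _; rewrite ffunE.
Qed.

Lemma ext_map_wedge n m (A : 'M[C]_(n, m)) u v :
  ext_map A (wedge u v) = wedge (ext_map A u) (ext_map A v).
Proof.
move: u; apply: ext_ind => [u w Eu Ew|c u Eu||j u Eu].
- by rewrite wedgeDl !raddfD/= wedgeDl Eu Ew.
- by rewrite !(ext_map_esc, wedge_escl) Eu.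
- by rewrite ext_map1 !wedge1l.
- by rewrite eps_wedge !ext_map_eps cov_wedge Eu.
Qed.

Lemma ext_map_comp n m p (A : 'M[C]_(n, m)) (B : 'M[C]_(m, p)) u :
  ext_map B (ext_map A u) = ext_map (A *m B) u.
Proof.
move: u; apply: ext_ind => [u w Eu Ew|c u Eu||j u Eu].
- by rewrite !raddfD/= Eu Ew.
- by rewrite !ext_map_esc Eu.
- by rewrite !ext_map1.
- by rewrite !ext_map_eps ext_map_cov Eu row_mul.
Qed.

Lemma cov_delta n (i : 'I_n) (u : ext R n) : cov (delta_mx 0 i) u = eps i u.
Proof.
rewrite !covE (bigD1 i)//= big1 ?addr0 ?mxE ?eqxx ?esc1// => j ji.
by rewrite mxE (negbTE ji) andbF esc0.
Qed.

Lemma ext_map_id n (u : ext R n) : ext_map 1%:M u = u.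
Proof.
move: u; apply: ext_ind => [u w Eu Ew|c u Eu||j u Eu].
- by rewrite !raddfD/= Eu Ew.
- by rewrite !ext_map_esc Eu.
- by rewrite !ext_map1.
- by rewrite !ext_map_eps Eu row1 cov_delta.
Qed.

Lemma iot_cov n i (t : 'rV[C]_n) u : iot i (cov t u) = esc (t 0 i) u - cov t (iot i u).
Proof.
rewrite !covE raddf_sum/= (bigD1 i)//= [in RHS](bigD1 i)//=.
rewrite iot_esc iot_eps_eq raddfB/= opprD addrA; congr (_ + _).
by rewrite -sumrN; apply: eq_bigr => j ji; rewrite iot_esc iot_eps 1?eq_sym// raddfN.
Qed.

Lemma ctr_cov n (t s : 'rV[C]_n) u :
  ctr t (cov s u) = esc ((t *m s^T) 0 0) u - cov s (ctr t u).
Proof.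
rewrite {1}ctrE; under eq_bigr => i _ do rewrite iot_cov raddfB/= -cov_esc escA.
rewrite sumrB; congr (_ - _); last by rewrite !ctrE raddf_sum.
apply/ffunP => S; rewrite sum_ffunE ffunE mxE mulr_suml.
by apply: eq_bigr => i _; rewrite ffunE mxE.
Qed.

Lemma iot_ebasis0 n i : iot i (ebasis R (finset.set0 : {set 'I_n})) = 0.
Proof.
apply/ffunP => S; rewrite !ffunE; case: ifP => // iS.
case: eqP => [E|_]; last by rewrite mulr0.
by have := finset.setU11 i S; rewrite E finset.inE.
Qed.

(** Contracting a pulled back form with a basis vector is pulling back the contraction with the
    image of that vector, and column $i$ of $A$ is this image. *)
Lemma iot_ext_map n m (A : 'M[C]_(n, m)) i u :
  iot i (ext_map A u) = ext_map A (ctr (col i A)^T u).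
Proof.
move: u; apply: ext_ind => [u w Eu Ew|c u Eu||j u Eu].
- by rewrite !raddfD/= Eu Ew.
- by rewrite ctr_esc !ext_map_esc iot_esc Eu.
- rewrite ext_map1 iot_ebasis0 !ctrE big1 ?raddf0// => j _.
  by rewrite iot_ebasis0 raddf0.
- rewrite ext_map_eps iot_cov Eu -(cov_delta j u) ctr_cov raddfB/= ext_map_esc ext_map_cov.
  congr (esc _ _ - cov _ _); last by rewrite -rowE.
  rewrite [RHS]mxE (bigD1 j)//= !mxE !eqxx mulr1 big1 ?addr0// => k kj.
  by rewrite !mxE (negbTE kj) mulr0.
Qed.

End CovectorOperators.

(** * The Hodge star and the type decomposition in an adapted coframe *)

Section StarAndTypes.
Context {R : realType}.
Local Notation C := R[i].

Lemma dotDl n (u v w : ext R n) : dot (u + v) w = dot u w + dot v w.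
Proof. by rewrite /dot -big_split; apply: eq_bigr => S _; rewrite ffunE mulrDl. Qed.

Lemma dotDr n (u v w : ext R n) : dot u (v + w) = dot u v + dot u w.
Proof. by rewrite /dot -big_split; apply: eq_bigr => S _; rewrite ffunE mulrDr. Qed.

Lemma dot0r n (u : ext R n) : dot u 0 = 0.
Proof. by rewrite /dot big1// => S _; rewrite ffunE mulr0. Qed.

Lemma dotZl n c (u v : ext R n) : dot (esc c u) v = c * dot u v.
Proof. by rewrite /dot mulr_sumr; apply: eq_bigr => S _; rewrite ffunE mulrA. Qed.

Lemma dotZr n c (u v : ext R n) : dot u (esc c v) = c * dot u v.
Proof. by rewrite /dot mulr_sumr; apply: eq_bigr => S _; rewrite ffunE mulrCA. Qed.

Lemma dot_ebasis n S (v : ext R n) : dot (ebasis R S) v = v S.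
Proof.
rewrite /dot (bigD1 S)//= ffunE eqxx mul1r big1 ?addr0// => T TS.
by rewrite ffunE (negbTE TS) mul0r.
Qed.

Lemma dot_eps n i (u v : ext R n) : dot (eps i u) v = dot u (iot i v).
Proof.
rewrite /dot [LHS](bigID (fun S : {set 'I_n} => i \in S))/= [X in _ + X]big1 ?addr0; last first.
  by move=> S /negbTE iS; rewrite ffunE iS mul0r.
rewrite [RHS](bigID (fun S : {set 'I_n} => i \notin S))/= [X in _ + X]big1 ?addr0; last first.
  by move=> S; rewrite negbK => iS; rewrite [X in _ * X]ffunE iS mulr0.
rewrite (reindex_onto (fun T => i |: T)%SET (fun S => S :\ i)%SET)/=; last first.
  by move=> S iS; rewrite finset.setD1K.
apply: eq_big => [T|T /andP[_ /eqP iT]].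
  rewrite finset.setU11/=; apply/eqP/idP => [<-|]; first by rewrite finset.setD11.
  exact: finset.setU1K.
have {}iT : i \notin T by rewrite -iT finset.setD11.
by rewrite !ffunE finset.setU11 (negbTE iT) finset.setU1K//; ring.
Qed.

Lemma dot_cov n (t : 'rV[C]_n) (u v : ext R n) : dot (cov t u) v = dot u (ctr t v).
Proof.
rewrite !covE !ctrE.
have dots (f : 'I_n -> ext R n) w : dot w (\sum_i f i) = \sum_i dot w (f i).
  by apply: (big_morph (dot w)); [move=> *; rewrite dotDr | rewrite dot0r].
have dotsl (f : 'I_n -> ext R n) w : dot (\sum_i f i) w = \sum_i dot (f i) w.
  apply: (big_morph (fun u => dot u w)); first by move=> *; rewrite dotDl.
  by rewrite /dot big1// => S _; rewrite ffunE mul0r.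
by rewrite dots dotsl; apply: eq_bigr => i _; rewrite dotZl dotZr dot_eps.
Qed.

Lemma eps_set0 n i (u : ext R n) : eps i u finset.set0 = 0.
Proof. by rewrite ffunE finset.inE. Qed.

Lemma ext_map_set0 n m (A : 'M[C]_(n, m)) u : ext_map A u finset.set0 = u finset.set0.
Proof.
move: u; apply: ext_ind => [u w Eu Ew|c u Eu||j u Eu].
- by rewrite raddfD !ffunE Eu Ew.
- by rewrite ext_map_esc !ffunE Eu.
- by rewrite ext_map1 !ffunE !eqxx.
- rewrite ext_map_eps eps_set0 !covE sum_ffunE big1// => i _.
  by rewrite ffunE eps_set0 mulr0.
Qed.

Lemma dot_ext_map n m (A : 'M[C]_(n, m)) u v :
  dot (ext_map A u) v = dot u (ext_map A^T v).
Proof.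
move: u v; apply: (@ext_ind _ _ (fun u => forall v, dot (ext_map A u) v = dot u (ext_map A^T v))).
- by move=> u w Eu Ew v; rewrite raddfD !dotDl Eu Ew.
- by move=> c u Eu v; rewrite ext_map_esc !dotZl Eu.
- by move=> v; rewrite ext_map1 !dot_ebasis ext_map_set0.
- move=> j u Eu v; rewrite ext_map_eps dot_cov Eu dot_eps iot_ext_map.
  by rewrite -tr_row trmxK.
Qed.

Lemma pairing_ebasis n S (u : ext R n) :
  pairing (ebasis R S) u = xsg S (~: S)%SET * u (~: S)%SET.
Proof.
rewrite /pairing (bigD1 S)//= ffunE eqxx mul1r big1 ?addr0// => T TS.
by rewrite ffunE (negbTE TS) mul0r mulr0.
Qed.

Lemma pairing_inj n (u v : ext R n) : (forall w, pairing w u = pairing w v) -> u = v.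
Proof.
move=> uv; apply/ffunP => S; have := uv (ebasis R (~: S)%SET).
rewrite !pairing_ebasis finset.setCK => /(congr1 (fun z => xsg (~: S)%SET S * z)).
by rewrite !mulrA xsg_sq !mul1r.
Qed.

Lemma wedge_top n (u v : ext R n) : wedge u v finset.setT = pairing u v.
Proof.
rewrite ffunE; apply: eq_big => [S|S _]; first by rewrite finset.subsetT.
by rewrite finset.setTD ext_signE mulrA.
Qed.

Definition homog n k (u : ext R n) := forall S : {set 'I_n}, #|S| != k -> u S = 0.

Lemma homog_eps n k i (u : ext R n) : homog k u -> homog k.+1 (eps i u).
Proof.
move=> uk S Sk; rewrite ffunE; case: ifP => // iS; rewrite uk ?mulr0//.
by apply: contraNneq Sk => <-; rewrite (cardsD1 i S) iS.
Qed.

Lemma homog_ext_map n m (A : 'M[C]_(n, m)) (S : {set 'I_n}) :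
  homog #|S| (ext_map A (ebasis R S)).
Proof.
elim/ord_set_ind: S => [|i S iS IH].
  rewrite finset.cards0 ext_map1 => S; rewrite cards_eq0 => S0.
  by rewrite ffunE (negbTE S0).
rewrite -eps_ebasis_min// ext_map_eps cardsU1 min_notin//= => T Tk.
by rewrite !covE sum_ffunE big1// => j _; rewrite ffunE (homog_eps j IH) ?mulr0.
Qed.

(** This is the determinant of $A$ seen through its action on top forms; multiplicativity then comes
    from functoriality of [ext_map]. *)
Definition top_coef n (A : 'M[C]_n) : C := ext_map A (ebasis R finset.setT) finset.setT.

Lemma ext_map_top n (A : 'M[C]_n) u :
  ext_map A u finset.setT = top_coef A * u finset.setT.
Proof.
rewrite [in LHS](ebasis_sum u) raddf_sum sum_ffunE (bigD1 finset.setT)//= big1 ?addr0.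
  by rewrite ext_map_esc ffunE mulrC.
move=> S ST; rewrite ext_map_esc ffunE homog_ext_map ?mulr0//.
by apply: contraNneq ST; rewrite eqEcard finset.subsetT => ->/=.
Qed.

Lemma top_coef_mul n (A B : 'M[C]_n) : top_coef (A *m B) = top_coef A * top_coef B.
Proof. by rewrite /top_coef -ext_map_comp ext_map_top mulrC. Qed.

Lemma top_coef1 n : top_coef (1%:M : 'M[C]_n) = 1.
Proof. by rewrite /top_coef ext_map_id ffunE eqxx. Qed.

Lemma top_coef_neq0 n (A : 'M[C]_n) : A \in unitmx -> top_coef A != 0.
Proof.
move=> uA; apply/eqP => A0; have := top_coef_mul A (invmx A).
by rewrite mulmxV// top_coef1 A0 mul0r => /eqP; rewrite oner_eq0.
Qed.

Lemma pairing_ext_map n (A : 'M[C]_n) u v :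
  pairing (ext_map A u) (ext_map A v) = top_coef A * pairing u v.
Proof. by rewrite -!wedge_top -ext_map_wedge ext_map_top. Qed.

Lemma ext_mapVK n (A : 'M[C]_n) u : A \in unitmx -> ext_map A (ext_map (invmx A) u) = u.
Proof. by move=> uA; rewrite ext_map_comp mulVmx// ext_map_id. Qed.

Lemma ext_mapKV n (A : 'M[C]_n) u : A \in unitmx -> ext_map (invmx A) (ext_map A u) = u.
Proof. by move=> uA; rewrite ext_map_comp mulmxV// ext_map_id. Qed.

(* This is Jacobi's identity on complementary minors; it is read off from the
   invariance of the pairing up to the top coefficient. *)
Lemma star0_ext_map n (A : 'M[C]_n) u : A \in unitmx ->
  star0 (ext_map (invmx A)^T u) = esc (top_coef A)^-1 (ext_map A (star0 u)).
Proof.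
move=> uA; apply: pairing_inj => w; rewrite -(ext_mapVK w uA).
set w' := ext_map _ w; rewrite pairing_star0 dot_ext_map.
rewrite ext_map_comp -trmx_mul mulmxV// trmx1 ext_map_id.
by rewrite pairing_escr pairing_ext_map pairing_star0 mulrA mulVf ?mul1r// top_coef_neq0.
Qed.

(** For the metric $B^TGB$, raising the indices of a form pulled back by $B$ cancels $B$ on one side
    and leaves $G^{-1}(B^{-1})^T$, to which [star0_ext_map] applies. In the coframe $B$ the star
    thus depends only on the Gram matrix $G$ and on a scalar. *)
Lemma hodge_frame n (J : 'M[R]_n) (F : ext R n) (B G : 'M[C]_n) u :
  B \in unitmx -> G \in unitmx -> metric_mx J F = B^T *m G *m B ->
  hodge J F (ext_map B u) =
  esc (volume F finset.setT * (top_coef B)^-1) (ext_map B (star0 (ext_map (invmx G) u))).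
Proof.
move=> uB uG E; rewrite -escA -star0_ext_map// ext_map_comp.
apply/ffunP => T; rewrite !ffunE ext_signE ext_map_comp E.
have -> : B *m invmx (B^T *m G *m B) = invmx G *m (invmx B)^T.
  have uBT : B^T \in unitmx by rewrite unitmx_tr.
  have uM : B^T *m G *m B \in unitmx by rewrite !unitmx_mul uBT uG uB.
  apply: (can_inj (mulmxK uM)); rewrite mulmxKV// trmx_inv -!mulmxA.
  by rewrite (mulKmx uBT) (mulKmx uG).
by ring.
Qed.

Lemma two_form_mxE n (u : ext R n) i j :
  two_form_mx u i j = iot j (iot i u) finset.set0.
Proof.
rewrite mxE !ffunE finset.setU0 !finset.inE ?orbF.
rewrite /sg big_set0 big_set1 mul1r /flip (eq_sym i).
case: (ltngtP i j) => [ij|ij|/val_inj->]; last by rewrite eqxx.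
  by rewrite -val_eqE/= gtn_eqF// mul1r.
by rewrite -val_eqE/= ltn_eqF// mulN1r.
Qed.

Lemma two_form_mx_ext_map n m (B : 'M[C]_(n, m)) u :
  two_form_mx (ext_map B u) = B^T *m two_form_mx u *m B.
Proof.
apply/matrixP => i j; rewrite two_form_mxE !iot_ext_map ext_map_set0.
rewrite mxE {1}ctrE sum_ffunE; apply: eq_bigr => l _.
rewrite ffunE !ctrE raddf_sum sum_ffunE [X in _ = X * _]mxE mulr_suml mulr_sumr/=; apply: eq_bigr => k _.
by rewrite iot_esc ffunE -two_form_mxE; move: (two_form_mx u) => M; rewrite !mxE; ring.
Qed.

Lemma par_ext_map n m (A : 'M[C]_(n, m)) u : par (ext_map A u) = ext_map A (par u).
Proof.
move: u; apply: ext_ind => [u w Eu Ew|c u Eu||j u Eu].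
- by rewrite !raddfD/= Eu Ew.
- by rewrite !(ext_map_esc, par_esc) Eu.
- by rewrite ext_map1 !par_ebasis !finset.cards0 !expr0 !esc1 ext_map1.
- rewrite par_eps raddfN/= !ext_map_eps -Eu !covE raddf_sum -sumrN/=.
  by apply: eq_bigr => i _; rewrite par_esc par_eps raddfN.
Qed.

Lemma wedge_cov n (u v : ext R n) t : wedge u (cov t v) = cov t (wedge (par u) v).
Proof.
rewrite !covE raddf_sum/=; apply: eq_bigr => i _.
by rewrite wedge_escr wedge_eps eps_wedge.
Qed.

(** A family [w p q] holds all type components of a form at once. Multiplication by a (1,0)-covector
    shifts the first index and by a (0,1)-covector the second; components of negative index are
    zero. *)
Definition shift_p n (w : nat -> nat -> ext R n) (f : ext R n -> ext R n) p q :=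
  if p is p'.+1 then f (w p' q) else 0.

Definition shift_q n (w : nat -> nat -> ext R n) (f : ext R n -> ext R n) p q :=
  if q is q'.+1 then f (w p q') else 0.

Lemma type_proj_is_additive n (J : 'M[R]_n) p q : zmod_morphism (type_proj J p q).
Proof.
move=> u v; rewrite /type_proj -sumrB; apply: eq_bigr => S _; rewrite -sumrB.
by apply: eq_bigr => A _; rewrite !escaleE !ffunE mulrBl escDl escN.
Qed.
HB.instance Definition _ n (J : 'M[R]_n) p q :=
  GRing.isZmodMorphism.Build _ _ (type_proj J p q) (type_proj_is_additive J p q).

Lemma type_proj_esc n (J : 'M[R]_n) p q c u :
  type_proj J p q (esc c u) = esc c (type_proj J p q u).
Proof.
rewrite /type_proj esc_sum; apply: eq_bigr => S _; rewrite esc_sum.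
by apply: eq_bigr => A _; rewrite !escaleE ffunE escA mulrA.
Qed.

Lemma type_proj_ebasis n (J : 'M[R]_n) p q (S : {set 'I_n}) :
  type_proj J p q (ebasis R S) =
  \sum_(A : {set 'I_n} | [&& A \subset S, #|A| == p & #|(S :\: A)%SET| == q])
    esc (ext_sign R A (S :\: A)%SET)
        (wedge (ext_map (proj10 J) (ebasis R A))
               (ext_map (proj01 J) (ebasis R (S :\: A)%SET))).
Proof.
rewrite /type_proj (bigD1 S)//= [X in _ + X]big1 ?addr0; last first.
  move=> T TS; apply: big1 => A _.
  by rewrite ffunE (negbTE TS) mul0r escaleE esc0.
by apply: eq_bigr => A _; rewrite ffunE eqxx mul1r escaleE.
Qed.


Lemma covD n (t : 'rV[C]_n) u v : cov t (u + v) = cov t u + cov t v.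
Proof. exact: raddfD. Qed.

Lemma covB n (t : 'rV[C]_n) u v : cov t (u - v) = cov t u - cov t v.
Proof. exact: raddfB. Qed.

Lemma covr0 n (t : 'rV[C]_n) : cov t 0 = 0.
Proof. exact: raddf0. Qed.

Lemma escr0 n c : esc c (0 : ext R n) = 0.
Proof. exact: raddf0. Qed.

Definition shift2 n (t s : 'rV[C]_n) (w : nat -> nat -> ext R n) p q : ext R n :=
  shift_p w (cov t) p q + shift_q w (cov s) p q.

Lemma shift2B n (t s : 'rV[C]_n) : zmod_morphism (shift2 t s).
Proof.
move=> u v; apply/funext => p; apply/funext => q; rewrite !fctE /shift2.
have e (a b c d : ext R n) : (a - b) + (c - d) = (a + c) - (b + d).
  by rewrite opprD addrACA.
rewrite -e /shift_p /shift_q.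
by case: p => [|p]; case: q => [|q]; rewrite ?covB ?subr0.
Qed.

Lemma shift2_esc n (t s : 'rV[C]_n) c w p q :
  shift2 t s (fun p q => esc c (w p q)) p q = esc c (shift2 t s w p q).
Proof.
rewrite /shift2 (raddfD (esc c))/= /shift_p /shift_q.
by case: p => [|p]; case: q => [|q]; rewrite ?cov_esc ?escr0.
Qed.

Lemma shift2C n (t s t' s' : 'rV[C]_n) w :
  shift2 t s (shift2 t' s' w) = - shift2 t' s' (shift2 t s w).
Proof.
have e a b c d : cov t (cov t' a + cov s' b) + cov s (cov t' c + cov s' d) =
   - (cov t' (cov t a + cov s c) + cov s' (cov t b + cov s d)).
  by rewrite !covD (cov_cov t t') (cov_cov t s') (cov_cov s t') (cov_cov s s') !opprD addrACA.
apply/funext => p; apply/funext => q; rewrite !fctE /shift2 /shift_p /shift_q.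
have := e (if p is p'.+2 then w p' q else 0)
          (if p is p'.+1 then if q is q'.+1 then w p' q' else 0 else 0)
          (if p is p'.+1 then if q is q'.+1 then w p' q' else 0 else 0)
          (if q is q'.+2 then w p q' else 0).
by case: p => [|[|p]]; case: q => [|[|q]]; rewrite /= ?(covr0, add0r, addr0).
Qed.

Lemma shift2_shift2 n (t s : 'rV[C]_n) w : shift2 t s (shift2 t s w) = 0.
Proof.
by apply/funext => p; apply/funext => q; apply: ext2_eq0; rewrite {1}shift2C.
Qed.

Section Shuffle.
Context {n : nat} (J : 'M[R]_n).
Local Notation tp p q u := (type_proj J p q u).

(** In the defining sum the new covector goes either into the (1,0)-product, when $i\in A$, or into
    the (0,1)-product. In the second case it has to cross the $p$ factors of the first product, and
    the sign cancels the one in [xsgU1r]. *)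
Lemma type_proj_min p q (i : 'I_n) (S : {set 'I_n}) :
  (forall b, b \in S -> (i < b)%N) ->
  tp p q (ebasis R (i |: S)%SET) =
  shift_p (fun p q => tp p q (ebasis R S)) (cov (row i (proj10 J))) p q +
  shift_q (fun p q => tp p q (ebasis R S)) (cov (row i (proj01 J))) p q.
Proof.
move=> iS; have niS := min_notin iS.
have minA (A : {set 'I_n}) : A \subset S -> forall b, b \in A -> (i < b)%N.
  by move=> /fintype.subsetP AS b /AS /iS.
rewrite type_proj_ebasis (bigID (fun A : {set 'I_n} => i \in A))/=; congr (_ + _).
  case: p => [|p]/=.
    apply: big1 => A /andP[/and3P[_]]; rewrite cards_eq0 => /eqP-> _.
    by rewrite finset.inE.
  rewrite type_proj_ebasis raddf_sum/=.
  rewrite (reindex_onto (fun T => i |: T)%SET (fun S => S :\ i)%SET)/=; last first.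
    by move=> T /andP[_ iT]; rewrite finset.setD1K.
  apply: eq_big => [T|T].
    rewrite finset.setU11 andbT finset.subUset finset.sub1set finset.setU11/=.
    have [iT|iT] := boolP (i \in T).
      rewrite [X in _ && X](_ : _ = false) ?andbF; last first.
        by apply/negbTE/negP => /eqP E; rewrite -E finset.setD11 in iT.
      case: (boolP (T \subset S)) => //= TS.
      by rewrite (fintype.subsetP TS _ iT) in niS.
    rewrite finset.setU1K// eqxx andbT cardsU1 iT add1n eqSS.
    congr [&& _, _ & _].
      apply/idP/idP => [TS|]; last by move=> TS; apply: fintype.subset_trans TS (finset.subsetU1 _ _).
      apply/fintype.subsetP => x xT; have := fintype.subsetP TS _ xT.
      by rewrite !finset.inE => /orP[/eqP xi|//]; rewrite -xi xT in iT.
    congr (_ == _); apply: eq_card => x; rewrite !finset.inE.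
    by have [->|] := eqVneq x i; rewrite //= (negbTE niS) !andbF.
  move=> /andP[/andP[/and3P[TS _ _] _] /eqP iT].
  have {}iT : i \notin T by rewrite -iT finset.setD11.
  have {}TS : T \subset S.
    apply/fintype.subsetP => x xT.
    have := fintype.subsetP TS x; rewrite !finset.inE xT orbT => /(_ isT) /orP[/eqP xi|//].
    by rewrite -xi xT in iT.
  have E : ((i |: S) :\: (i |: T) = S :\: T)%SET.
    apply/setP => x; rewrite !finset.inE.
    by have [->|] := eqVneq x i; rewrite //= (negbTE niS) !andbF.
  rewrite E !ext_signE xsgU1l// cov_esc; congr esc.
    rewrite -[RHS]mul1r; congr (_ * _); apply: sg_min => b; rewrite !finset.inE => /andP[_].
    exact: iS.
  by rewrite -eps_ebasis_min ?ext_map_eps ?cov_wedge//; apply: minA.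
rewrite /shift_q; case: q => [|q]/=.
  apply: big1 => A /andP[/and3P[_ _]]; rewrite cards_eq0 => /eqP E iA.
  have : i \in ((i |: S) :\: A)%SET by rewrite !finset.inE iA eqxx.
  by rewrite E finset.inE.
rewrite type_proj_ebasis raddf_sum/=.
apply: eq_big => [T|T].
  have [iT|iT] := boolP (i \in T).
    rewrite andbF; case: (boolP (T \subset S)) => //= TS.
    by rewrite (fintype.subsetP TS _ iT) in niS.
  rewrite andbT; congr [&& _, _ & _].
    apply/idP/idP => [TS|]; last by move=> TS; apply: fintype.subset_trans TS (finset.subsetU1 _ _).
    apply/fintype.subsetP => x xT; have := fintype.subsetP TS _ xT.
    by rewrite !finset.inE => /orP[/eqP xi|//]; rewrite -xi xT in iT.
  rewrite -[RHS]eqSS; congr (_ == _); rewrite -[in RHS]add1n.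
  have <- : (i |: (S :\: T) = (i |: S) :\: T)%SET.
    by apply/setP => x; rewrite !finset.inE; have [->|] := eqVneq x i; rewrite ?iT.
  by rewrite cardsU1 !finset.inE (negbTE niS) andbF.
move=> /andP[/and3P[TS _ _] iT].
have {}TS : T \subset S.
  apply/fintype.subsetP => x xT.
  have := fintype.subsetP TS x xT; rewrite !finset.inE => /orP[/eqP xi|//].
  by rewrite -xi xT in iT.
have E : ((i |: S) :\: T = i |: (S :\: T))%SET.
  by apply/setP => x; rewrite !finset.inE; have [->|] := eqVneq x i; rewrite ?iT.
have minD b : b \in (S :\: T)%SET -> (i < b)%N.
  by rewrite finset.inE => /andP[_]; apply: iS.
have niD := min_notin minD; have minT := minA _ TS; have niT := min_notin minT.
rewrite E !ext_signE xsgU1r// -eps_ebasis_min// ext_map_eps wedge_cov.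
rewrite sg_min// mulr1.
rewrite par_ext_map par_ebasis ext_map_esc wedge_escl !cov_esc escA; congr esc.
by rewrite mulrAC -exprMn mulrNN mulr1 expr1n mul1r.
Qed.

(** The universal property is used with values in families of forms: all types must be treated
    together, since multiplication by a generator mixes neighbouring types. *)
Lemma type_proj_eps p q i u :
  tp p q (eps i u) = shift_p (fun p q => tp p q u) (cov (row i (proj10 J))) p q +
                     shift_q (fun p q => tp p q u) (cov (row i (proj01 J))) p q.
Proof.
pose r i (w : nat -> nat -> ext R n) := shift2 (row i (proj10 J)) (row i (proj01 J)) w.
pose th u := fun p q : nat => tp p q u.
pose sc c (w : nat -> nat -> ext R n) := fun p q : nat => (esc c (w p q) : ext R n).
have : th (eps i u) = r i (th u); last by move=> /(congr1 (fun w => w p q)).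
apply: (@ext_universal _ n _ sc r th).
- by move=> k; apply: shift2B.
- by move=> u1 u2; apply/funext => p'; apply/funext => q'; rewrite /th (raddfB (type_proj J p' q')).
- by move=> k c w; apply/funext => p'; apply/funext => q'; apply: shift2_esc.
- by move=> c w; apply/funext => p'; apply/funext => q'; rewrite /th /sc type_proj_esc.
- by move=> k l w; apply: shift2C.
- by move=> k w; apply: shift2_shift2.
- by move=> k S kS; apply/funext => p'; apply/funext => q'; exact: type_proj_min.
Qed.

Lemma type_proj_cov p q t u :
  tp p q (cov t u) = shift_p (fun p q => tp p q u) (cov (t *m proj10 J)) p q +
                     shift_q (fun p q => tp p q u) (cov (t *m proj01 J)) p q.
Proof.
have covM (A : 'M[C]_n) v : cov (t *m A) v = \sum_(i < n) esc (t 0 i) (cov (row i A) v).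
  rewrite covE; under [RHS]eq_bigr => i _ do rewrite covE esc_sum.
  rewrite exchange_big/=; apply: eq_bigr => j _.
  apply/ffunP => S; rewrite sum_ffunE ffunE mxE mulr_suml; apply: eq_bigr => i _.
  by rewrite !ffunE !mxE mulrA.
rewrite {1}covE raddf_sum/=.
under eq_bigr => i _ do rewrite type_proj_esc type_proj_eps raddfD/=.
rewrite big_split/=; congr (_ + _).
  by case: p => [|p]; rewrite /= ?covM// big1// => i _; rewrite escr0.
by case: q => [|q]; rewrite /shift_q ?covM// big1// => i _; rewrite escr0.
Qed.

End Shuffle.

(** The type projection when the generators indexed by [hol] have type (1,0) and the others type
    (0,1). *)
Definition typ n (hol : {set 'I_n}) (p q : nat) (u : ext R n) : ext R n :=
  [ffun S : {set 'I_n} =>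
    if (#|(S :&: hol)%SET| == p) && (#|(S :\: hol)%SET| == q) then u S else 0].

Lemma typ_is_additive n (hol : {set 'I_n}) p q : zmod_morphism (typ hol p q).
Proof.
by move=> u v; apply/ffunP => S; rewrite !ffunE; case: ifP; rewrite ?subr0.
Qed.
HB.instance Definition _ n (hol : {set 'I_n}) p q :=
  GRing.isZmodMorphism.Build _ _ (typ hol p q) (typ_is_additive hol p q).

Lemma typ_esc n (hol : {set 'I_n}) p q c u : typ hol p q (esc c u) = esc c (typ hol p q u).
Proof. by apply/ffunP => S; rewrite !ffunE; case: ifP; rewrite ?mulr0. Qed.

Lemma typ_eps n (hol : {set 'I_n}) p q i u : typ hol p q (eps i u) =
  if i \in hol then shift_p (fun p q => typ hol p q u) (eps i) p q
  else shift_q (fun p q => typ hol p q u) (eps i) p q.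
Proof.
have cI (S : {set 'I_n}) : i \in S ->
    #|(S :&: hol)%SET| = ((i \in hol) + #|((S :\ i) :&: hol)%SET|)%N.
  move=> iS; rewrite (cardsD1 i) !finset.inE iS/=; congr (_ + _)%N.
  by apply: eq_card => x; rewrite !finset.inE andbA.
have cD (S : {set 'I_n}) : i \in S ->
    #|(S :\: hol)%SET| = ((i \notin hol) + #|((S :\ i) :\: hol)%SET|)%N.
  move=> iS; rewrite (cardsD1 i) !finset.inE iS andbT/=; congr (_ + _)%N.
  by apply: eq_card => x; rewrite !finset.inE andbCA.
apply/ffunP => S; rewrite ffunE [eps i u S]ffunE; case: (boolP (i \in S)) => iS; last first.
  rewrite if_same; case: (i \in hol).
    by case: p => [|p]; rewrite /= ffunE// (negbTE iS).
  by case: q => [|q]; rewrite /shift_q/= ffunE// (negbTE iS).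
rewrite cI// cD//; case: (boolP (i \in hol)) => ih/=.
  case: p => [|p]; first by rewrite /= [RHS]ffunE.
  rewrite [RHS]ffunE iS [X in _ = _ * X]ffunE add1n eqSS add0n.
  by case: ifP; rewrite ?mulr0.
case: q => [|q]; first by rewrite /shift_q [RHS]ffunE andbF.
rewrite [RHS]ffunE iS [X in _ = _ * X]ffunE add1n eqSS add0n.
by case: ifP; rewrite ?mulr0.
Qed.

(** In a coframe made of eigenvectors of $J$, taking a type component only selects coefficients. *)
Lemma type_proj_frame n (J : 'M[R]_n) (B : 'M[C]_n) (hol : {set 'I_n}) p q u :
  (forall i, row i B *m proj10 J = if i \in hol then row i B else 0) ->
  (forall i, row i B *m proj01 J = if i \in hol then 0 else row i B) ->
  type_proj J p q (ext_map B u) = ext_map B (typ hol p q u).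
Proof.
move=> BP BQ.
have cov0 v : cov (0 : 'rV[C]_n) v = 0.
  by rewrite !covE big1// => i _; rewrite mxE esc0.
move: u p q; apply: (@ext_ind _ _ (fun u => forall p q,
   type_proj J p q (ext_map B u) = ext_map B (typ hol p q u))).
- by move=> u w Eu Ew p q; rewrite !raddfD/= Eu Ew.
- by move=> c u Eu p q; rewrite typ_esc !ext_map_esc type_proj_esc Eu.
- move=> p q; rewrite ext_map1 type_proj_ebasis.
  have -> : typ hol p q (ebasis R finset.set0) =
            if (p == 0) && (q == 0) then ebasis R finset.set0 else 0.
    apply/ffunP => S; rewrite !ffunE.
    have [->|S0] := eqVneq S finset.set0.
      rewrite finset.set0I finset.set0D !cards0 (eq_sym 0%N p) (eq_sym 0%N q).
      by case: ifP; rewrite !ffunE ?eqxx.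
    by rewrite if_same; case: ifP; rewrite !ffunE ?(negbTE S0).
  case: ifP => [/andP[/eqP-> /eqP->]|pq].
    rewrite (bigD1 finset.set0) ?finset.sub0set ?finset.setD0 ?cards0//= big1 ?addr0.
      by rewrite !ext_map1 wedge1l ext_signE xsg0l esc1.
    by move=> A; rewrite finset.subset0 => /andP[/andP[/eqP-> _]]; rewrite eqxx.
  rewrite raddf0 big1// => A; rewrite finset.subset0 => /and3P[/eqP->].
  by rewrite finset.setD0 cards0 => /eqP p0 /eqP q0; rewrite -p0 -q0 in pq.
- move=> i u Eu p q; rewrite ext_map_eps type_proj_cov BP BQ typ_eps.
  case: ifP => _.
    rewrite /shift_q; case: q => [|q]; rewrite ?cov0 addr0;
    by case: p => [|p]; rewrite /= ?(raddf0 (ext_map B))// Eu ext_map_eps.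
  rewrite /shift_p; case: p => [|p]; rewrite ?cov0 add0r;
  by case: q => [|q]; rewrite /shift_q/= ?(raddf0 (ext_map B))// Eu ext_map_eps.
Qed.

End StarAndTypes.

(** * The algebra morphism induced by an involution of the generators *)

Section Swap.
Context {K : comPzRingType} {n : nat} (b : 'I_n -> 'I_n).
Context (bK : involutive b).
Implicit Types (u v : {ffun {set 'I_n} -> K}) (S T : {set 'I_n}) (i j : 'I_n).

Definition inv_sign i j : K := flip i j * flip (b i) (b j).

(* The sign of the permutation which sorts the image under [b] of the
   increasing enumeration of [S]. *)
Definition swap_sign S : K :=
  \prod_(i in S) \prod_(j in S) if (i < j)%N then inv_sign i j else 1.

(* The algebra morphism sending the i-th generator to the (b i)-th one. *)
Definition swap u : {ffun {set 'I_n} -> K} :=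
  [ffun S : {set 'I_n} => swap_sign S * u (b @: S)%SET].

Lemma swap_is_additive : zmod_morphism swap.
Proof. by move=> u v; apply/ffunP => S; rewrite !ffunE mulrBr. Qed.
HB.instance Definition _ := GRing.isZmodMorphism.Build _ _ swap swap_is_additive.

Lemma swap_esc c u : swap (esc c u) = esc c (swap u).
Proof. by apply/ffunP => S; rewrite !ffunE mulrCA. Qed.

Lemma imset_bK S : (b @: (b @: S) = S)%SET.
Proof.
by rewrite -imset_comp (eq_imset _ (_ : _ =1 id)) ?imset_id// => x /=; rewrite bK.
Qed.

Lemma mem_imset_b i S : (i \in b @: S)%SET = (b i \in S).
Proof. by rewrite -[i in LHS]bK mem_imset//; apply: inv_inj. Qed.

Lemma sg_imset_b i S : sg (b i) (b @: S)%SET = \prod_(j in S) flip (b i) (b j) :> K.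
Proof. by rewrite /sg big_imset//= => x y _ _; apply: (inv_inj bK). Qed.

Lemma inv_signC i j : inv_sign i j = inv_sign j i.
Proof.
have [->//|ij] := eqVneq i j.
have bij : b i != b j by rewrite (inj_eq (inv_inj bK)).
by rewrite /inv_sign (flipCN ij) (flipCN bij) mulrNN.
Qed.

Lemma swap_signU1 i S : i \notin S ->
  swap_sign (i |: S)%SET = swap_sign S * (sg i S * sg (b i) (b @: S)%SET).
Proof.
move=> iS; rewrite sg_imset_b /swap_sign big_setU1//= big_setU1//= ltnn mul1r.
under [X in _ * X]eq_bigr => j _ do rewrite big_setU1//=.
rewrite [X in _ * X]big_split/= mulrA [RHS]mulrC; congr (_ * _).
rewrite /sg -!big_split/=; apply: eq_bigr => j jS.
rewrite -/(inv_sign i j); have ij : i != j by apply: contraNneq iS => ->.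
rewrite (inv_signC j); case: ltngtP => [_|_|/val_inj E]; rewrite ?mulr1 ?mul1r//.
by rewrite E eqxx in ij.
Qed.

Lemma swap_sign0 : swap_sign finset.set0 = 1.
Proof. by rewrite /swap_sign big_set0. Qed.

Lemma swap_sign_sq S : swap_sign S * swap_sign S = 1.
Proof.
elim/ord_set_ind: S => [|i S iS IH]; first by rewrite swap_sign0 mulr1.
rewrite swap_signU1 ?min_notin//.
have := @sg_sq K n i S; have := @sg_sq K n (b i) (b @: S)%SET.
move: IH; move: (swap_sign S) (@sg K n i S) (@sg K n (b i) _) => s t r ss rr tt.
by transitivity ((s * s) * (t * t) * (r * r)); [ring | rewrite ss tt rr !mulr1].
Qed.

Lemma swap_signU S T : [forall x, ~~ ((x \in S) && (x \in T))] ->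
  swap_sign (S :|: T)%SET =
  swap_sign S * swap_sign T * (xsg S T * xsg (b @: S)%SET (b @: T)%SET).
Proof.
elim/ord_set_ind: S => [_|i S iS IH dST].
  by rewrite finset.set0U imset0 !xsg0l swap_sign0 !mul1r mulr1.
have niS := min_notin iS.
have iT : i \notin T by move/forallP: dST => /(_ i); rewrite finset.setU11.
have {}IH := IH _.
rewrite -finset.setUA (swap_signU1 niS) (@swap_signU1 i (S :|: T)%SET); last first.
  by rewrite finset.in_setU (negbTE niS).
rewrite IH; last first.
  apply/forallP => x; move/forallP: dST => /(_ x); rewrite finset.in_setU1.
  by apply: contra => /andP[-> ->]; rewrite orbT.
have nbi : b i \notin (b @: S)%SET by rewrite mem_imset//; apply: inv_inj.
rewrite imsetU1 !xsgU1l//.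
have -> : sg i (S :|: T)%SET = sg i S * sg i T :> K.
  rewrite (@sg_setD K n i (S :|: T)%SET S) ?finset.subsetUl//; congr (_ * sg i _).
  apply/setP => x; rewrite !finset.inE; move/forallP: dST => /(_ x).
  by rewrite !finset.inE; case: (x \in S); case: (x \in T); rewrite ?orbT.
have -> : sg (b i) (b @: (S :|: T))%SET = sg (b i) (b @: S)%SET * sg (b i) (b @: T)%SET :> K.
  rewrite imsetU (@sg_setD K n (b i) _ (b @: S)%SET) ?finset.subsetUl//; congr (_ * sg (b i) _).
  apply/setP => x; rewrite !finset.inE !mem_imset_b; move/forallP: dST => /(_ (b x)).
  by rewrite !finset.inE; case: (b x \in S); case: (b x \in T); rewrite ?orbT.
by ring.
Qed.

Lemma swap_eps i u : swap (eps i u) = eps (b i) (swap u).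
Proof.
apply/ffunP => S; rewrite !ffunE mem_imset_b; case: (boolP (b i \in S)) => biS; last by rewrite mulr0.
have biS' : b i \notin (S :\ b i)%SET by rewrite finset.setD11.
rewrite -[in swap_sign S](finset.setD1K biS) swap_signU1// bK.
have -> : (b @: (S :\ b i) = (b @: S) :\ i)%SET.
  apply/setP => x; rewrite !finset.inE !mem_imset_b !finset.inE.
  by rewrite (inj_eq (inv_inj bK)).
have := @sg_sq K n i ((b @: S) :\ i)%SET.
move: (@sg K n i _) (@sg K n (b i) _) (swap_sign _) (u _) => s t r x ss.
by transitivity ((s * s) * (r * t * x)); [ring | rewrite ss; ring].
Qed.

Lemma swap_iot i u : swap (iot i u) = iot (b i) (swap u).
Proof.
apply/ffunP => S; rewrite !ffunE mem_imset_b; case: (boolP (b i \in S)) => biS; first by rewrite mulr0.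
rewrite swap_signU1// bK imsetU1 bK.
have := @sg_sq K n (b i) S.
move: (@sg K n i _) (@sg K n (b i) _) (swap_sign _) (u _) => s t r x ss.
by transitivity ((t * t) * (r * s * x)); [rewrite ss; ring | ring].
Qed.

Lemma swapK u : swap (swap u) = u.
Proof.
apply/ffunP => S; rewrite !ffunE imset_bK mulrA.
suff -> : swap_sign (b @: S)%SET = swap_sign S by rewrite swap_sign_sq mul1r.
elim/ord_set_ind: S => [|i S iS IH]; first by rewrite imset0.
have niS := min_notin iS.
rewrite imsetU1 !swap_signU1// ?IH ?bK ?imset_bK 1?mulrACA; last first.
  by rewrite mem_imset//; apply: inv_inj.
by congr (_ * _); rewrite mulrC.
Qed.

(** The scalar is the sign of the involution as a permutation of all generators, that is, the factor
    by which it multiplies the volume form. *)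
Lemma star0_swap u : star0 (swap u) = esc (swap_sign [set: 'I_n]%SET) (swap (star0 u)).
Proof.
apply/ffunP => T; rewrite !ffunE.
have E : (b @: (~: T) = ~: (b @: T))%SET.
  by apply/setP => x; rewrite !finset.inE !mem_imset_b !finset.inE.
rewrite -(finset.setUCr T) finset.setUC swap_signU; last first.
  by apply/forallP => x; rewrite finset.inE; case: (x \in T).
rewrite E; set s := swap_sign _; set t := swap_sign _; set x := xsg _ T; set y := xsg _ _.
have ss : t * t = 1 := swap_sign_sq _; have yy : y * y = 1 := xsg_sq _ _.
transitivity ((t * t) * (y * y) * (x * (s * u (~: (b @: T))%SET))); last by ring.
by rewrite ss yy !mul1r.
Qed.

End Swap.

(** * Solutions of the harmonic system have invariant coefficients *)

Notation o0 := (@Ordinal 6 0 isT).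
Notation o1 := (@Ordinal 6 1 isT).
Notation o2 := (@Ordinal 6 2 isT).
Notation o3 := (@Ordinal 6 3 isT).
Notation o4 := (@Ordinal 6 4 isT).
Notation o5 := (@Ordinal 6 5 isT).

Definition bar6 (i : 'I_6) : 'I_6 := inord (if (i < 3)%N then i + 3 else i - 3).

Lemma bar6E : [/\ bar6 o0 = o3, bar6 o1 = o4 & bar6 o2 = o5] /\
              [/\ bar6 o3 = o0, bar6 o4 = o1 & bar6 o5 = o2].
Proof. by split; split; apply/val_inj; rewrite /= inordK. Qed.

Lemma ord6P (P : 'I_6 -> Prop) :
  P o0 -> P o1 -> P o2 -> P o3 -> P o4 -> P o5 -> forall i, P i.
Proof.
move=> p0 p1 p2 p3 p4 p5 [[|[|[|[|[|[|//]]]]]] Hi];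
  by rewrite (bool_irrelevance Hi isT).
Qed.

Lemma bar6K : involutive bar6.
Proof.
have [[e0 e1 e2] [e3 e4 e5]] := bar6E.
by elim/ord6P; rewrite ?(e0, e1, e2, e3, e4, e5).
Qed.

Lemma addr5ACA (V : zmodType) (a b c d e a' b' c' d' e' : V) :
  (a + b + c + (d + e)) + (a' + b' + c' + (d' + e')) =
  ((a + a') + (b + b') + (c + c')) + ((d + d') + (e + e')).
Proof.
rewrite addrACA [X in _ + X]addrACA; congr (_ + _).
by rewrite addrACA [X in X + _]addrACA.
Qed.

(* The double complex of forms on a nilmanifold whose left-invariant (1,0)-forms
   e_0, e_1, e_2 satisfy de_0 = de_1 = 0 and
   de_2 = k (e_0 - al conj(e_0)) /\ e_1, the index i + 3 standing for the
   conjugate of e_i. *)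
Section HarmonicForms.
Context {A : comPzRingType} {M : zmodType} (X : 'I_6 -> A -> A) (cj : A -> A) (m : A -> M).
Context (k al alc : A) (w : {set 'I_6} -> A).
Context (XB : forall i, zmod_morphism (X i)).
Context (XM : forall i f g, X i (f * g) = X i f * g + f * X i g).
Context (X2C : forall i f, X o2 (X i f) = X i (X o2 f)).
Context (X5C : forall i f, X o5 (X i f) = X i (X o5 f)).
Context (XC : forall i j f, X o2 f = 0 -> X o5 f = 0 -> X i (X j f) = X j (X i f)).
Context (cjB : zmod_morphism cj).
Context (cjM : forall f g, cj (f * g) = cj f * cj g).
Context (cj1 : cj 1 = 1).
Context (cjK : involutive cj).
Context (cjX : forall i f, cj (X i f) = X (bar6 i) (cj f)).
Context (mB : zmod_morphism m).
Context (mX : forall i f, m (X i f) = 0).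
Context (m_pos : forall f, m (f * cj f) = 0 -> f = 0).
Context (m_wpos : forall u : {ffun {set 'I_6} -> A},
  m (\sum_(S : {set 'I_6}) w S * (u S * cj (u S))) = 0 -> u = 0).
Context (Xk : forall i, X i k = 0).
Context (Xal : forall i, X i al = 0).
Context (Xalc : forall i, X i alc = 0).
Context (Xw : forall i S, X i (w S) = 0).
Context (cjk : cj k = k).
Context (cjal : cj al = alc).
Context (cjw : forall S, cj (w S) = w S).

HB.instance Definition _ i := GRing.isZmodMorphism.Build A A (X i) (XB i).
HB.instance Definition _ := GRing.isZmodMorphism.Build A A cj cjB.
HB.instance Definition _ := GRing.isZmodMorphism.Build A M m mB.

Local Notation V := {ffun {set 'I_6} -> A}.
Implicit Types (u v : V) (i j l : 'I_6) (c : A) (f g : A).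

Local Notation cst c := (forall i, X i c = 0).

Lemma cstM c d : cst c -> cst d -> cst (c * d).
Proof. by move=> cc cd i; rewrite XM (cc i) (cd i) mul0r mulr0 addr0. Qed.

Lemma cstN c : cst c -> cst (- c).
Proof. by move=> cc i; rewrite raddfN/= (cc i) oppr0. Qed.

Definition Xv i u : V := [ffun S : {set 'I_6} => X i (u S)].

Lemma Xv_is_additive i : zmod_morphism (Xv i).
Proof. by move=> u v; apply/ffunP => S; rewrite !ffunE raddfB. Qed.
HB.instance Definition _ i := GRing.isZmodMorphism.Build V V (Xv i) (Xv_is_additive i).

Lemma X_flip i j l f : X i (flip j l * f) = flip j l * X i f.
Proof. by rewrite /flip; case: ifP => _; rewrite ?mul1r// !mulN1r raddfN. Qed.

Lemma X_sg i j (S : {set 'I_6}) f : X i (sg j S * f) = sg j S * X i f.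
Proof.
rewrite /sg; elim: (index_enum _) f => [|b s IH] f; first by rewrite !big_nil !mul1r.
by rewrite !big_cons; case: ifP => _; rewrite ?IH// -!mulrA X_flip IH.
Qed.

Lemma Xv_eps i j u : Xv i (eps j u) = eps j (Xv i u).
Proof. by apply/ffunP => S; rewrite !ffunE; case: ifP => _; rewrite ?raddf0// X_sg. Qed.

Lemma Xv_iot i j u : Xv i (iot j u) = iot j (Xv i u).
Proof. by apply/ffunP => S; rewrite !ffunE; case: ifP => _; rewrite ?raddf0// X_sg. Qed.

Lemma Xv_esc i c u : cst c -> Xv i (esc c u) = esc c (Xv i u).
Proof. by move=> cc; apply/ffunP => S; rewrite !ffunE XM (cc i) mul0r add0r. Qed.

Lemma Xv_par i u : Xv i (par u) = par (Xv i u).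
Proof.
apply/ffunP => S; rewrite !ffunE; elim: #|S| => [|p IH]; first by rewrite !expr0 !mul1r.
by rewrite !exprS -!mulrA !mulN1r raddfN/= IH.
Qed.

Lemma Xv_swap i u : Xv i (swap bar6 u) = swap bar6 (Xv i u).
Proof.
apply/ffunP => S; rewrite !ffunE /swap_sign /inv_sign.
have step s g (G : 'I_6 -> A) : (forall a f, X i (G a * f) = G a * X i f) ->
    X i (\prod_(a <- s | a \in S) G a * g) = \prod_(a <- s | a \in S) G a * X i g.
  move=> HG; elim: s g => [|b s IH] g; first by rewrite !big_nil !mul1r.
  by rewrite !big_cons; case: ifP => _; rewrite ?IH// -!mulrA HG IH.
apply: (step) => a f; apply: (step) => b g; case: ifP => _; rewrite ?mul1r//.
by rewrite -!mulrA !X_flip.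
Qed.

Lemma Xv_star0 i u : Xv i (star0 u) = star0 (Xv i u).
Proof.
apply/ffunP => S; rewrite !ffunE /xsg; elim: (index_enum _) (u _) => [|b s IH] f.
  by rewrite !big_nil !mul1r.
by rewrite !big_cons; case: ifP => _; rewrite ?IH// -!mulrA X_sg IH.
Qed.

Definition wgt u : V := [ffun S : {set 'I_6} => w S * u S].

Lemma Xv_wgt i u : Xv i (wgt u) = wgt (Xv i u).
Proof. by apply/ffunP => S; rewrite !ffunE XM Xw mul0r add0r. Qed.

Definition first_order i u : V := eps i (Xv i u).
Definition cubic c i j l u : V := esc c (eps i (eps j (iot l u))).

Lemma first_order_is_additive i : zmod_morphism (first_order i).
Proof. by move=> u v; rewrite /first_order !raddfB. Qed.
HB.instance Definition _ i :=
  GRing.isZmodMorphism.Build V V (first_order i) (first_order_is_additive i).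

Lemma cubic_is_additive c i j l : zmod_morphism (cubic c i j l).
Proof. by move=> u v; rewrite /cubic !raddfB. Qed.
HB.instance Definition _ c i j l :=
  GRing.isZmodMorphism.Build V V (cubic c i j l) (cubic_is_additive c i j l).

(** The torsion is divided by type: the (2,0)-part of $de_2$ and the (1,1)-part of $de_5$ raise the
    holomorphic degree and belong to [dl]; the (1,1)-part of $de_2$ and the (0,2)-part of $de_5$
    belong to [db]. *)
Definition dl u := first_order o0 u + first_order o1 u + first_order o2 u +
  (cubic k o0 o1 o2 u + cubic (- (k * alc)) o0 o4 o5 u).
Definition db u := first_order o3 u + first_order o4 u + first_order o5 u +
  (cubic k o3 o4 o5 u + cubic (- (k * al)) o3 o1 o2 u).

Lemma dl_is_additive : zmod_morphism dl.
Proof. by move=> u v; rewrite /dl !raddfB/= -addr5ACA -!opprD. Qed.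
HB.instance Definition _ := GRing.isZmodMorphism.Build V V dl dl_is_additive.

Lemma db_is_additive : zmod_morphism db.
Proof. by move=> u v; rewrite /db !raddfB/= -addr5ACA -!opprD. Qed.
HB.instance Definition _ := GRing.isZmodMorphism.Build V V db db_is_additive.

Let cstkal : cst (- (k * al)). Proof. exact/cstN/cstM. Qed.
Let cstkalc : cst (- (k * alc)). Proof. exact/cstN/cstM. Qed.

Lemma fo_iot i j u : i != j ->
  first_order i (iot j u) + iot j (first_order i u) = 0.
Proof.
by move=> ij; rewrite /first_order Xv_iot iot_eps 1?eq_sym// subrr.
Qed.

Lemma fo_iot_eq i u : first_order i (iot i u) + iot i (first_order i u) = Xv i u.
Proof. by rewrite /first_order Xv_iot iot_eps_eq addrC subrK. Qed.

Lemma fo_eps i j u : first_order i (eps j u) + eps j (first_order i u) = 0.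
Proof. by rewrite /first_order Xv_eps eps_eps addNr. Qed.

Lemma cubic_iot c i j l p u : p != i -> p != j ->
  cubic c i j l (iot p u) + iot p (cubic c i j l u) = 0.
Proof.
move=> pi pj; rewrite /cubic iot_esc iot_eps// iot_eps// iot_iot !raddfN/= opprK.
by rewrite addNr.
Qed.

Lemma cubic_iot1 c i j l u : i != j ->
  cubic c i j l (iot i u) + iot i (cubic c i j l u) = esc c (eps j (iot l u)).
Proof.
move=> ij; rewrite /cubic iot_esc iot_eps_eq iot_eps// iot_iot.
by rewrite raddfB/= !raddfN/= opprK addrC addrK.
Qed.

Lemma cubicC c i j l u : cubic c i j l u = - cubic c j i l u.
Proof. by rewrite /cubic eps_eps raddfN. Qed.

Lemma cubic_iot2 c i j l u : i != j ->
  cubic c i j l (iot j u) + iot j (cubic c i j l u) = - esc c (eps i (iot l u)).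
Proof.
by move=> ij; rewrite !(cubicC c i j) raddfN/= -opprD cubic_iot1// eq_sym.
Qed.

Lemma cubic_eps c i j l p u : p != l ->
  cubic c i j l (eps p u) + eps p (cubic c i j l u) = 0.
Proof.
move=> pl; rewrite /cubic eps_esc iot_eps 1?eq_sym//.
have -> : eps i (eps j (- eps p (iot l u))) = - eps p (eps i (eps j (iot l u))).
  by rewrite raddfN/= (eps_eps j) opprK (eps_eps i).
by rewrite raddfN addNr.
Qed.

Lemma dl_acom p u : dl (iot p u) + iot p (dl u) =
  (first_order o0 (iot p u) + iot p (first_order o0 u)) +
  (first_order o1 (iot p u) + iot p (first_order o1 u)) +
  (first_order o2 (iot p u) + iot p (first_order o2 u)) +
  ((cubic k o0 o1 o2 (iot p u) + iot p (cubic k o0 o1 o2 u)) +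
   (cubic (- (k * alc)) o0 o4 o5 (iot p u) + iot p (cubic (- (k * alc)) o0 o4 o5 u))).
Proof. by rewrite /dl !raddfD/= addr5ACA. Qed.

Lemma db_acom p u : db (iot p u) + iot p (db u) =
  (first_order o3 (iot p u) + iot p (first_order o3 u)) +
  (first_order o4 (iot p u) + iot p (first_order o4 u)) +
  (first_order o5 (iot p u) + iot p (first_order o5 u)) +
  ((cubic k o3 o4 o5 (iot p u) + iot p (cubic k o3 o4 o5 u)) +
   (cubic (- (k * al)) o3 o1 o2 (iot p u) + iot p (cubic (- (k * al)) o3 o1 o2 u))).
Proof. by rewrite /db !raddfD/= addr5ACA. Qed.

(** Cartan's formula, separated by type: the anticommutator of [dl] or [db] with a contraction is
    the derivative of the coefficients, if any, plus the torsion terms in which the contracted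
    covector occurs. For the central indices 2 and 5 no torsion term appears, since $e_2$ and $e_5$
    occur in no $de_i$. *)
Lemma dl_iot0 u : dl (iot o0 u) + iot o0 (dl u) = 
  Xv o0 u + (esc k (eps o1 (iot o2 u)) + esc (- (k * alc)) (eps o4 (iot o5 u))).
Proof. by rewrite dl_acom fo_iot_eq (@fo_iot o1 o0)// (@fo_iot o2 o0)// (@cubic_iot1 k o0 o1 o2)// (@cubic_iot1 _ o0 o4 o5)// ?addr0 ?add0r. Qed.

Lemma dl_iot1 u : dl (iot o1 u) + iot o1 (dl u) = Xv o1 u - esc k (eps o0 (iot o2 u)).
Proof. by rewrite dl_acom (@fo_iot o0 o1)// fo_iot_eq (@fo_iot o2 o1)// (@cubic_iot2 k o0 o1 o2)// (@cubic_iot _ o0 o4 o5 o1)// ?addr0 ?add0r. Qed.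

Lemma dl_iot2 u : dl (iot o2 u) + iot o2 (dl u) = Xv o2 u.
Proof. by rewrite dl_acom (@fo_iot o0 o2)// (@fo_iot o1 o2)// fo_iot_eq (@cubic_iot k o0 o1 o2 o2)// (@cubic_iot _ o0 o4 o5 o2)// ?addr0 ?add0r. Qed.

Lemma dl_iot3 u : dl (iot o3 u) + iot o3 (dl u) = 0.
Proof. by rewrite dl_acom (@fo_iot o0 o3)// (@fo_iot o1 o3)// (@fo_iot o2 o3)// (@cubic_iot k o0 o1 o2 o3)// (@cubic_iot _ o0 o4 o5 o3)// ?addr0 ?add0r. Qed.

Lemma dl_iot4 u : dl (iot o4 u) + iot o4 (dl u) = - esc (- (k * alc)) (eps o0 (iot o5 u)).
Proof. by rewrite dl_acom (@fo_iot o0 o4)// (@fo_iot o1 o4)// (@fo_iot o2 o4)// (@cubic_iot k o0 o1 o2 o4)// (@cubic_iot2 _ o0 o4 o5)// ?addr0 ?add0r. Qed.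

Lemma dl_iot5 u : dl (iot o5 u) + iot o5 (dl u) = 0.
Proof. by rewrite dl_acom (@fo_iot o0 o5)// (@fo_iot o1 o5)// (@fo_iot o2 o5)// (@cubic_iot k o0 o1 o2 o5)// (@cubic_iot _ o0 o4 o5 o5)// ?addr0 ?add0r. Qed.

Lemma db_iot0 u : db (iot o0 u) + iot o0 (db u) = 0.
Proof. by rewrite db_acom (@fo_iot o3 o0)// (@fo_iot o4 o0)// (@fo_iot o5 o0)// (@cubic_iot k o3 o4 o5 o0)// (@cubic_iot _ o3 o1 o2 o0)// ?addr0 ?add0r. Qed.

Lemma db_iot1 u : db (iot o1 u) + iot o1 (db u) = - esc (- (k * al)) (eps o3 (iot o2 u)).
Proof. by rewrite db_acom (@fo_iot o3 o1)// (@fo_iot o4 o1)// (@fo_iot o5 o1)// (@cubic_iot k o3 o4 o5 o1)// (@cubic_iot2 _ o3 o1 o2)// ?addr0 ?add0r. Qed.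

Lemma db_iot2 u : db (iot o2 u) + iot o2 (db u) = 0.
Proof. by rewrite db_acom (@fo_iot o3 o2)// (@fo_iot o4 o2)// (@fo_iot o5 o2)// (@cubic_iot k o3 o4 o5 o2)// (@cubic_iot _ o3 o1 o2 o2)// ?addr0 ?add0r. Qed.

Lemma db_iot3 u : db (iot o3 u) + iot o3 (db u) = 
  Xv o3 u + (esc k (eps o4 (iot o5 u)) + esc (- (k * al)) (eps o1 (iot o2 u))).
Proof. by rewrite db_acom fo_iot_eq (@fo_iot o4 o3)// (@fo_iot o5 o3)// (@cubic_iot1 k o3 o4 o5)// (@cubic_iot1 _ o3 o1 o2)// ?addr0 ?add0r. Qed.

Lemma db_iot4 u : db (iot o4 u) + iot o4 (db u) = Xv o4 u - esc k (eps o3 (iot o5 u)).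
Proof. by rewrite db_acom (@fo_iot o3 o4)// fo_iot_eq (@fo_iot o5 o4)// (@cubic_iot2 k o3 o4 o5)// (@cubic_iot _ o3 o1 o2 o4)// ?addr0 ?add0r. Qed.

Lemma db_iot5 u : db (iot o5 u) + iot o5 (db u) = Xv o5 u.
Proof. by rewrite db_acom (@fo_iot o3 o5)// (@fo_iot o4 o5)// fo_iot_eq (@cubic_iot k o3 o4 o5 o5)// (@cubic_iot _ o3 o1 o2 o5)// ?addr0 ?add0r. Qed.

(** All $e_i$ other than $e_2$ and $e_5$ are closed. *)
Lemma dl_eps i u : i != o2 -> i != o5 -> dl (eps i u) = - eps i (dl u).
Proof.
move=> i2 i5; apply/eqP; rewrite -addr_eq0 /dl !raddfD/= addr5ACA.
by rewrite !fo_eps !cubic_eps ?addr0.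
Qed.

Lemma db_eps i u : i != o2 -> i != o5 -> db (eps i u) = - eps i (db u).
Proof.
move=> i2 i5; apply/eqP; rewrite -addr_eq0 /db !raddfD/= addr5ACA.
by rewrite !fo_eps !cubic_eps ?addr0.
Qed.

Lemma dl_esc c u : cst c -> dl (esc c u) = esc c (dl u).
Proof.
by move=> cc; rewrite /dl /first_order /cubic !Xv_esc// !iot_esc !eps_esc !raddfD/= !escA !(mulrC c).
Qed.

Lemma db_esc c u : cst c -> db (esc c u) = esc c (db u).
Proof.
by move=> cc; rewrite /db /first_order /cubic !Xv_esc// !iot_esc !eps_esc !raddfD/= !escA !(mulrC c).
Qed.

(** Forms whose coefficients are constant along the centre of the group; on their coefficients all
    frame fields commute ([XvC]). *)
Definition central u := Xv o2 u = 0 /\ Xv o5 u = 0.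

Lemma XvC i j u : Xv o2 u = 0 -> Xv o5 u = 0 -> Xv i (Xv j u) = Xv j (Xv i u).
Proof.
move=> u2 u5; apply/ffunP => S; rewrite !ffunE XC//.
  by have := congr1 (fun z : V => z S) u2; rewrite !ffunE.
by have := congr1 (fun z : V => z S) u5; rewrite !ffunE.
Qed.

Lemma Xv2C i u : Xv o2 (Xv i u) = Xv i (Xv o2 u).
Proof. by apply/ffunP => S; rewrite !ffunE X2C. Qed.

Lemma Xv5C i u : Xv o5 (Xv i u) = Xv i (Xv o5 u).
Proof. by apply/ffunP => S; rewrite !ffunE X5C. Qed.

Lemma dl_Xv i u : (forall j, Xv j (Xv i u) = Xv i (Xv j u)) -> dl (Xv i u) = Xv i (dl u).
Proof.
move=> C; rewrite /dl /first_order /cubic !C -!Xv_iot -!Xv_eps -!Xv_esc//.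
by rewrite !raddfD.
Qed.

Lemma db_Xv i u : (forall j, Xv j (Xv i u) = Xv i (Xv j u)) -> db (Xv i u) = Xv i (db u).
Proof.
move=> C; rewrite /db /first_order /cubic !C -!Xv_iot -!Xv_eps -!Xv_esc//.
by rewrite !raddfD.
Qed.

Lemma m_pairing_X i u v : m (pairing (Xv i u) v) = - m (pairing u (Xv i v)).
Proof.
apply/eqP; rewrite -addr_eq0 -raddfD/= -[X in _ == X](mX i (pairing u v)); apply/eqP.
congr m; rewrite /pairing -big_split raddf_sum/=; apply: eq_bigr => S _.
rewrite /xsg !ffunE -mulrDr -XM; elim: (index_enum _) => [|a s IH].
  by rewrite !big_nil !mul1r.
by rewrite !big_cons; case: ifP => _ //; rewrite -!mulrA X_sg IH.
Qed.

Lemma m_pairing_fo i u v :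
  m (pairing (first_order i u) v) = - m (pairing (par u) (first_order i v)).
Proof. by rewrite /first_order pairing_eps -Xv_par m_pairing_X Xv_eps. Qed.

(** The contracted index differs from both multiplied ones, so moving the operators across produces
    no trace term. This is where unimodularity of the group enters Stokes' formula. *)
Lemma pairing_cubic c i j l u v : l != i -> l != j ->
  pairing (cubic c i j l u) v = - pairing (par u) (cubic c i j l v).
Proof.
move=> li lj; rewrite /cubic pairing_escl pairing_escr pairing_eps par_eps pairingNl.
rewrite pairing_eps par_par pairing_iot opprK iot_eps// iot_eps//.
by rewrite raddfN/= opprK eps_eps pairingNr; ring.
Qed.

Lemma m_pairing_dl u v : m (pairing (dl u) v) = - m (pairing (par u) (dl v)).
Proof.
rewrite /dl !pairingDl !pairingDr !raddfD/= !m_pairing_fo !pairing_cubic//.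
by rewrite !raddfN/= -!opprD.
Qed.

Lemma m_pairing_db u v : m (pairing (db u) v) = - m (pairing (par u) (db v)).
Proof.
rewrite /db !pairingDl !pairingDr !raddfD/= !m_pairing_fo !pairing_cubic//.
by rewrite !raddfN/= -!opprD.
Qed.

Lemma par_fo i u : par (first_order i u) = - first_order i (par u).
Proof. by rewrite /first_order par_eps Xv_par. Qed.

Lemma par_cubic c i j l u : par (cubic c i j l u) = - cubic c i j l (par u).
Proof.
by rewrite /cubic par_esc par_eps par_eps par_iot (raddfN (eps j)) opprK raddfN.
Qed.

Lemma par_db u : par (db u) = - db (par u).
Proof. by rewrite /db !(raddfD par)/= !par_fo !par_cubic -!opprD. Qed.

Definition cjv u : V := [ffun S : {set 'I_6} => cj (u S)].
(** Complex conjugation of forms in the coframe: conjugate coefficients, and $e_i$ exchanged with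
    its conjugate. *)
Definition conjv u : V := swap bar6 (cjv u).

Lemma cjv_is_additive : zmod_morphism cjv.
Proof. by move=> u v; apply/ffunP => S; rewrite !ffunE raddfB. Qed.
HB.instance Definition _ := GRing.isZmodMorphism.Build V V cjv cjv_is_additive.

Lemma conjv_is_additive : zmod_morphism conjv.
Proof. by move=> u v; rewrite /conjv !raddfB. Qed.
HB.instance Definition _ := GRing.isZmodMorphism.Build V V conjv conjv_is_additive.

Lemma cj0 : cj 0 = 0. Proof. exact: raddf0. Qed.
Lemma cjN f : cj (- f) = - cj f. Proof. exact: raddfN. Qed.

Lemma cj_flip i j : cj (flip i j) = flip i j.
Proof. by rewrite /flip; case: ifP; rewrite ?cjN cj1. Qed.

Lemma cj_sg i (S : {set 'I_6}) : cj (sg i S) = sg i S.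
Proof. by apply: (big_ind (fun x => cj x = x)) => // [x y Ex Ey|b _]; rewrite ?cjM ?Ex ?Ey ?cj_flip. Qed.

Lemma cjv_eps i u : cjv (eps i u) = eps i (cjv u).
Proof. by apply/ffunP => S; rewrite !ffunE; case: ifP => _; rewrite ?cj0// cjM cj_sg. Qed.

Lemma cjv_iot i u : cjv (iot i u) = iot i (cjv u).
Proof. by apply/ffunP => S; rewrite !ffunE; case: ifP => _; rewrite ?cj0// cjM cj_sg. Qed.

Lemma cjv_star0 u : cjv (star0 u) = star0 (cjv u).
Proof.
apply/ffunP => S; rewrite !ffunE cjM; congr (_ * _).
by apply: (big_ind (fun x => cj x = x)) => // [x y Ex Ey|b _]; rewrite ?cjM ?Ex ?Ey ?cj_sg.
Qed.

Lemma cjv_swap u : cjv (swap bar6 u) = swap bar6 (cjv u).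
Proof.
apply/ffunP => S; rewrite !ffunE cjM; congr (_ * _).
apply: (big_ind (fun x => cj x = x)) => // [x y Ex Ey|b _]; first by rewrite cjM Ex Ey.
apply: (big_ind (fun x => cj x = x)) => // [x y Ex Ey|a _]; first by rewrite cjM Ex Ey.
by case: ifP => // _; rewrite cjM !cj_flip.
Qed.

Lemma cjv_wgt u : cjv (wgt u) = wgt (cjv u).
Proof. by apply/ffunP => S; rewrite !ffunE cjM cjw. Qed.

Lemma conjv_eps i u : conjv (eps i u) = eps (bar6 i) (conjv u).
Proof. by rewrite /conjv cjv_eps swap_eps//; apply: bar6K. Qed.

Lemma conjv_iot i u : conjv (iot i u) = iot (bar6 i) (conjv u).
Proof. by rewrite /conjv cjv_iot swap_iot//; apply: bar6K. Qed.

Lemma conjv_Xv i u : conjv (Xv i u) = Xv (bar6 i) (conjv u).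
Proof.
by rewrite /conjv Xv_swap; congr swap; apply/ffunP => S; rewrite !ffunE cjX.
Qed.

Lemma conjv_esc c u : conjv (esc c u) = esc (cj c) (conjv u).
Proof.
by rewrite /conjv -swap_esc; congr swap; apply/ffunP => S; rewrite !ffunE cjM.
Qed.

Lemma conjv_fo i u : conjv (first_order i u) = first_order (bar6 i) (conjv u).
Proof. by rewrite /first_order conjv_eps conjv_Xv. Qed.

Lemma conjv_cubic c i j l u :
  conjv (cubic c i j l u) = cubic (cj c) (bar6 i) (bar6 j) (bar6 l) (conjv u).
Proof. by rewrite /cubic conjv_esc !conjv_eps conjv_iot. Qed.

Lemma conjv_dl u : conjv (dl u) = db (conjv u).
Proof.
have [[e0 e1 e2] [e3 e4 e5]] := bar6E; rewrite /dl /db !(raddfD conjv)/=.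
rewrite !conjv_fo !conjv_cubic e0 e1 e2 e4 e5.
by rewrite cjN cjM cjk -cjal cjK.
Qed.

Lemma conjv_db u : conjv (db u) = dl (conjv u).
Proof.
have [[e0 e1 e2] [e3 e4 e5]] := bar6E; rewrite /dl /db !(raddfD conjv)/=.
rewrite !conjv_fo !conjv_cubic e1 e2 e3 e4 e5.
by rewrite cjN cjM cjk cjal.
Qed.

(** In a coframe where the metric is diagonal with inverse weights given by [w], [swap bar6 (wgt u)]
    is $u$ with its indices raised, so the last condition is the second order equation for the Hodge
    star of $u$, up to a scalar. *)
Definition harmonic_form u :=
  [/\ dl u = 0, db u = 0 & dl (db (star0 (swap bar6 (wgt u)))) = 0].

Lemma Xv_star i u :
  Xv i (star0 (swap bar6 (wgt u))) = star0 (swap bar6 (wgt (Xv i u))).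
Proof. by rewrite Xv_star0 Xv_swap Xv_wgt. Qed.

Lemma central_db u : central u -> central (db u).
Proof.
move=> [u2 u5]; split.
  by rewrite -db_Xv => [|j]; [rewrite u2 raddf0 | rewrite Xv2C].
by rewrite -db_Xv => [|j]; [rewrite u5 raddf0 | rewrite Xv5C].
Qed.

Lemma central_Xv i u : central u -> central (Xv i u).
Proof. by move=> [u2 u5]; rewrite /central Xv2C Xv5C u2 u5 !raddf0. Qed.

Lemma central_eps i u : central u -> central (eps i u).
Proof. by move=> [u2 u5]; rewrite /central !Xv_eps u2 u5 !raddf0. Qed.

Lemma central_iot i u : central u -> central (iot i u).
Proof. by move=> [u2 u5]; rewrite /central !Xv_iot u2 u5 !raddf0. Qed.

Lemma central_esc c u : cst c -> central u -> central (esc c u).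
Proof. by move=> cc [u2 u5]; rewrite /central !Xv_esc// u2 u5 !raddf0. Qed.

Lemma centralD u v : central u -> central v -> central (u + v).
Proof. by move=> [u2 u5] [v2 v5]; rewrite /central !raddfD/= u2 u5 v2 v5 addr0. Qed.

Lemma centralN u : central u -> central (- u).
Proof. by move=> [u2 u5]; rewrite /central !raddfN/= u2 u5 oppr0. Qed.

Lemma central_star u : central u -> central (star0 (swap bar6 (wgt u))).
Proof.
move=> [u2 u5]; rewrite /central !Xv_star u2 u5.
have -> : wgt 0 = 0 by apply/ffunP => S; rewrite !ffunE mulr0.
have -> : swap bar6 0 = 0 :> V by rewrite raddf0.
by split; apply/ffunP => S; rewrite !ffunE mulr0.
Qed.

Lemma harmonic_Xv i u :
  (forall j v, Xv j (Xv i v) = Xv i (Xv j v)) \/ central u ->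
  harmonic_form u -> harmonic_form (Xv i u).
Proof.
move=> C [du bu su].
have {}C v : (central u -> central v) -> forall j, Xv j (Xv i v) = Xv i (Xv j v).
  by case: C => [C _ j|cu /(_ cu)[v2 v5] j]; [rewrite C | rewrite XvC].
split; [by rewrite dl_Xv ?du ?raddf0//; apply: C |
        by rewrite db_Xv ?bu ?raddf0//; apply: C |].
rewrite -Xv_star db_Xv; last by apply: C => /central_star.
by rewrite dl_Xv ?su ?raddf0//; apply: C => /central_star/central_db.
Qed.

(* Stokes' formula: an exact form is orthogonal to the harmonic ones. *)
Lemma harmonic_exact u v : harmonic_form u -> u = dl (db v) -> u = 0.
Proof.
move=> [_ _ su] uv; apply: m_wpos.
have -> : \sum_(S : {set 'I_6}) w S * (u S * cj (u S)) = pairing u (star0 (wgt (cjv u))).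
  by rewrite pairing_star0; apply: eq_bigr => S _; rewrite !ffunE; ring.
(* Conjugation exchanges [dl] with [db] and carries the star of $u$ to that of its conjugate, up to
   the sign of the swap, which is constant and squares to 1. *)
have bd : db (dl (star0 (wgt (cjv u)))) = 0.
  have : conjv (dl (db (star0 (swap bar6 (wgt u))))) = 0 by rewrite su raddf0.
  rewrite conjv_dl conjv_db /conjv cjv_star0 cjv_swap cjv_wgt star0_swap; last exact: bar6K.
  rewrite swap_esc swapK; last exact: bar6K.
  set s := swap_sign _ _; have ss : s * s = 1 by apply: swap_sign_sq; apply: bar6K.
  have cs : cst s.
    move=> i; rewrite /s /swap_sign.
    have step (I : eqType) (r : seq I) P (G : I -> A) : (forall a, X i (G a) = 0) -> X i (\prod_(a <- r | P a) G a) = 0.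
      move=> HG; apply: (big_ind (fun x => X i x = 0)) => // [|x y Ex Ey]; last by rewrite XM Ex Ey mul0r mulr0 addr0.
      apply: (addrI (X i 1)); rewrite addr0.
      by have := XM i 1 1; rewrite !mulr1 mul1r => <-.
    have X1 : X i 1 = 0.
      apply: (addrI (X i 1)); rewrite addr0.
      by have := XM i 1 1; rewrite !mulr1 mul1r => <-.
    have XF a b : X i (flip a b) = 0.
      by rewrite /flip; case: ifP => _; rewrite ?raddfN/= ?X1 ?oppr0.
    apply: (step) => a; apply: (step) => b; case: ifP => // _.
    by rewrite /inv_sign XM !XF mul0r mulr0 addr0.
  move: (s) ss cs => {}s ss cs; rewrite (dl_esc _ cs) (db_esc _ cs) => E.
  by rewrite -[LHS]esc1 -ss -escA E (raddf0 (esc s)).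
rewrite {1}uv m_pairing_dl -raddfN/= -pairingNl par_db opprK m_pairing_db bd.
by rewrite pairing0r raddf0 oppr0.
Qed.

Lemma m_X_parts i f g : m (X i f * g) = - m (f * X i g).
Proof. by apply/eqP; rewrite -addr_eq0 -raddfD/= -XM mX. Qed.

(** Integration by parts gives $m(|X_{\bar\imath}f|^2) = -m(\bar f\, X_iX_{\bar\imath}f)$. *)
Lemma X_bar_eq0 i f : X i (X (bar6 i) f) = 0 -> X (bar6 i) f = 0.
Proof.
move=> E; apply: m_pos; rewrite cjX bar6K mulrC m_X_parts mulrC.
by rewrite E mul0r raddf0 oppr0.
Qed.

(** Two integrations by parts show that $D$ is symmetric for the mean, so $D^2g=0$ forces $Dg=0$;
    applied to $Df$ and then to $f$, this brings $D^3f=0$ down to $Df=0$. Centrality lets the two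
    fields be exchanged to treat $X_if$ as well. *)
Lemma X_cube_eq0 i f (D := fun f => X i (X (bar6 i) f)) :
  X o2 f = 0 -> X o5 f = 0 -> D (D (D f)) = 0 -> X i f = 0 /\ X (bar6 i) f = 0.
Proof.
move=> f2 f5 D3.
pose Z g := X o2 g = 0 /\ X o5 g = 0.
have ZX j g : Z g -> Z (X j g) by move=> [g2 g5]; rewrite /Z X2C X5C g2 g5 !raddf0.
have ZD g : Z g -> Z (D g) by move=> Zg; apply/ZX/ZX.
have sq g : Z g -> D (D g) = 0 -> D g = 0.
  move=> Zg DD; apply: m_pos.
  rewrite {1}/D !m_X_parts opprK !cjX bar6K.
  have -> : X (bar6 i) (X i (X (bar6 i) (X i (cj g)))) = cj (D (D g)).
    by rewrite /D !cjX bar6K.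
  by rewrite DD raddf0 mulr0 raddf0.
have Zf : Z f by [].
have Df : D f = 0 by apply: (sq _ Zf); apply: (sq _ (ZD _ Zf)).
split; last exact: X_bar_eq0.
by have := @X_bar_eq0 (bar6 i) f; rewrite bar6K; apply; rewrite XC.
Qed.

(** For closed $u$ the anticommutators with $\iota_2$ and $\iota_5$, which have no torsion terms,
    give $X_2X_5u = -\partial\bar\partial\iota_2\iota_5u$. This form is again harmonic since central
    fields commute with all operators, so it is zero, and $X_2$, $X_5$ are conjugate to each
    other. *)
Lemma harmonic_central u : harmonic_form u -> central u.
Proof.
move=> hu; have [du bu _] := hu.
have C2 j v : Xv j (Xv o2 v) = Xv o2 (Xv j v) by rewrite Xv2C.
have C5 j v : Xv j (Xv o5 v) = Xv o5 (Xv j v) by rewrite Xv5C.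
have h : harmonic_form (Xv o2 (Xv o5 u)).
  by apply: harmonic_Xv; [left=> j v; rewrite C2 | apply: harmonic_Xv => //; left].
have E : Xv o2 (Xv o5 u) = dl (db (- iot o2 (iot o5 u))).
  have d5 : dl (Xv o5 u) = 0 by rewrite dl_Xv ?du ?raddf0// => j; rewrite C5.
  have e5 : Xv o5 u = db (iot o5 u) by rewrite -db_iot5 bu raddf0 addr0.
  rewrite -dl_iot2 d5 raddf0 addr0 raddfN/=; congr dl.
  by apply/eqP; rewrite -addr_eq0 addrC e5 db_iot2.
have E0 := harmonic_exact h E.
have E0' S : X o2 (X o5 (u S)) = 0.
  by have := congr1 (fun z : V => z S) E0; rewrite !ffunE.
have [[_ _ b2] [_ _ b5]] := bar6E.
split; apply/ffunP => S; rewrite !ffunE.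
  by have := @X_bar_eq0 o5 (u S); rewrite b5; apply; rewrite X5C.
by have := @X_bar_eq0 o2 (u S); rewrite b2; apply.
Qed.

(** Give a monomial as weight its number of factors among $e_2$, $e_5$. The last three fields
    express through contractions that $N$ lowers the weight: the image has weight at most 1, weight
    at most 1 goes to weight 0, and weight 0 goes to zero. Hence a product of three such operators
    vanishes. *)
Record weight_lowering (N : V -> V) : Prop := {
  wl_additive : zmod_morphism N;
  wl_central : forall u, central u -> central (N u);
  wl_Xv : forall i u, N (Xv i u) = Xv i (N u);
  wl_dl : forall u, central u -> dl (N u) = N (dl u);
  wl_db : forall u, central u -> db (N u) = N (db u);
  wl_2 : forall u, iot o2 (iot o5 (N u)) = 0;
  wl_1 : forall u, iot o2 (iot o5 u) = 0 -> iot o2 (N u) = 0 /\ iot o5 (N u) = 0;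
  wl_0 : forall u, iot o2 u = 0 -> iot o5 u = 0 -> N u = 0 }.

Lemma wl_zero : weight_lowering (fun => 0).
Proof.
split=> [u v|u _|i u|u _|u _|u|u _|//]; rewrite ?subr0 ?(raddf0 (Xv _)) ?(raddf0 dl) ?(raddf0 db)//.
- by split; rewrite (raddf0 (Xv _)).
- by rewrite !(raddf0 (iot _)).
- by split; rewrite (raddf0 (iot _)).
Qed.

Lemma wl_opp N : weight_lowering N -> weight_lowering (fun u => - N u).
Proof.
move=> [NB Nc NX Nd Nb N2 N1 N0]; split=> [u v|u cu|i u|u cu|u cu|u|u E|u E2 E5].
- by rewrite NB opprB addrC opprK.
- exact/centralN/Nc.
- by rewrite NX raddfN.
- by rewrite raddfN/= Nd.
- by rewrite raddfN/= Nb.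
- by rewrite !raddfN/= N2 oppr0.
- by have [E2 E5] := N1 _ E; rewrite !raddfN/= E2 E5 oppr0.
- by rewrite N0 ?oppr0.
Qed.

Lemma wl_add N N' : weight_lowering N -> weight_lowering N' ->
  weight_lowering (fun u => N u + N' u).
Proof.
move=> [NB Nc NX Nd Nb N2 N1 N0] [NB' Nc' NX' Nd' Nb' N2' N1' N0'].
split=> [u v|u cu|i u|u cu|u cu|u|u E|u E2 E5].
- by rewrite NB NB' opprD addrACA.
- by apply: centralD; [apply: Nc | apply: Nc'].
- by rewrite NX NX' raddfD.
- by rewrite raddfD/= Nd// Nd'.
- by rewrite raddfD/= Nb// Nb'.
- by rewrite !raddfD/= N2 N2' addr0.
- have [E2 E5] := N1 _ E; have [E2' E5'] := N1' _ E.
  by rewrite !raddfD/= E2 E5 E2' E5' addr0.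
- by rewrite N0 ?N0' ?addr0.
Qed.

(** This operator replaces a central factor $e_j$ by a closed one. It commutes with [dl] and [db] on
    central forms because both of its constituents anticommute with them there. *)
Lemma wl_eps_iot c i j : cst c -> i != o2 -> i != o5 -> j = o2 \/ j = o5 ->
  weight_lowering (fun u => esc c (eps i (iot j u))).
Proof.
move=> cc i2 i5 j25.
have dj u : central u -> dl (iot j u) = - iot j (dl u).
  move=> [u2 u5]; apply/eqP; rewrite -addr_eq0.
  by case: j25 => ->; rewrite ?dl_iot2 ?dl_iot5 ?u2.
have bj u : central u -> db (iot j u) = - iot j (db u).
  move=> [u2 u5]; apply/eqP; rewrite -addr_eq0.
  by case: j25 => ->; rewrite ?db_iot2 ?db_iot5 ?u5.
split=> [u v|u cu|l u|u cu|u cu|u|u E|u E2 E5].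
- by rewrite !raddfB.
- exact/central_esc/central_eps/central_iot.
- by rewrite Xv_esc// Xv_eps Xv_iot.
- by rewrite dl_esc// dl_eps// dj// (raddfN (eps i)) opprK.
- by rewrite db_esc// db_eps// bj// (raddfN (eps i)) opprK.
- rewrite !iot_esc (@iot_eps _ _ o5) 1?eq_sym// (raddfN (iot o2))/= (@iot_eps _ _ o2) 1?eq_sym// opprK.
  suff -> : iot o2 (iot o5 (iot j u)) = 0 by rewrite (raddf0 (eps i)) (raddf0 (esc c)).
  case: j25 => ->; last by rewrite iot_iot0 (raddf0 (iot o2)).
  by rewrite (iot_iot o5) (raddfN (iot o2))/= iot_iot0 oppr0.
- rewrite !iot_esc (@iot_eps _ _ o5) 1?eq_sym// (@iot_eps _ _ o2) 1?eq_sym//.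
  have E' : iot o5 (iot o2 u) = 0 by rewrite iot_iot E oppr0.
  by case: j25 => ->; rewrite !iot_iot0 ?E ?E' !(raddf0 (eps i)) oppr0 !(raddf0 (esc c)).
- by case: j25 => ->; rewrite ?E2 ?E5 (raddf0 (eps i)) (raddf0 (esc c)).
Qed.

Section PairVanish.
Context (p : 'I_6) (N N' P P' : V -> V).
Context (wN : weight_lowering N) (wN' : weight_lowering N').
Context (wP : weight_lowering P) (wP' : weight_lowering P').
Context (dp : forall u, dl (iot p u) + iot p (dl u) = Xv p u + N u).
Context (bp : forall u, db (iot p u) + iot p (db u) = P u).
Context (bq : forall u, db (iot (bar6 p) u) + iot (bar6 p) (db u) = Xv (bar6 p) u + N' u).
Context (dq : forall u, dl (iot (bar6 p) u) + iot (bar6 p) (dl u) = P' u).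

HB.instance Definition _ := GRing.isZmodMorphism.Build V V N (wl_additive wN).
HB.instance Definition _ := GRing.isZmodMorphism.Build V V N' (wl_additive wN').
HB.instance Definition _ := GRing.isZmodMorphism.Build V V P (wl_additive wP).
HB.instance Definition _ := GRing.isZmodMorphism.Build V V P' (wl_additive wP').

Let q := bar6 p.
Let lap u := Xv p (Xv q u).
(** Every summand contains at least one weight lowering operator, whence the vanishing of the
    cube. *)
Let nilp u := (Xv p (N' u) + N (Xv q u)) + (N (N' u) - P (P' u)).

Let closed u := dl u = 0 /\ db u = 0.

(** Move [db] and then [dl] across the two contractions by the four anticommutators. The mixed ones,
    $P$ and $P'$, are what produces the product $PP'$ in the remainder. *)
Lemma lap_nilp_exact u : central u -> closed u ->
  lap u + nilp u = dl (db (- iot p (iot q u))).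
Proof.
move=> cu [du bu].
have cx : central (Xv q u + N' u) by apply: centralD; [apply: central_Xv | apply: wl_central].
have dx : dl (Xv q u + N' u) = 0.
  rewrite raddfD/= (wl_dl wN' cu) dl_Xv; last by move=> j; case: cu => *; rewrite XvC.
  by rewrite du !raddf0 addr0.
have b1 : db (iot q u) = Xv q u + N' u by rewrite -bq bu raddf0 addr0.
have d1 : dl (iot q u) = P' u by rewrite -dq du raddf0 addr0.
have b2 : db (iot p (iot q u)) = P (iot q u) - iot p (Xv q u + N' u).
  by apply/eqP; rewrite eq_sym subr_eq -b1 bp.
have d2 : dl (iot p (Xv q u + N' u)) = Xv p (Xv q u + N' u) + N (Xv q u + N' u).
  by rewrite -dp dx raddf0 addr0.
rewrite !raddfN/= b2 raddfB/= (wl_dl wP) ?d1; last exact: central_iot.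
by rewrite d2 opprB !raddfD/= /lap /nilp !addrA.
Qed.

(** Write $L$ for [lap] and $T$ for [nilp]. Since $LT=TL$ and $T^3=0$, $L^3u = (L+T)z$ with
    $z=(L^2-LT+T^2)u$ closed and central, so $L^3u$ is exact by [lap_nilp_exact]. It is also
    harmonic, since $L$ commutes with the system on central forms, so it vanishes. *)
Lemma pair_vanish u : harmonic_form u -> central u -> Xv p u = 0 /\ Xv q u = 0.
Proof.
move=> hu cu; have [du bu _] := hu.
have lapB : zmod_morphism lap by move=> x y; rewrite /lap !raddfB.
have nilpB : zmod_morphism nilp.
  have sh (a b c d a' b' c' d' : V) : a - a' + (b - b') + (c - c' + (- d - - d')) =
    a + b + (c - d) - (a' + b' + (c' - d')).
    by rewrite !opprD !opprK [RHS]addrACA; congr (_ + _); rewrite addrACA.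
  by move=> x y; rewrite /nilp !raddfB/= sh.
pose L : {additive V -> V} := HB.pack lap (GRing.isZmodMorphism.Build V V lap lapB).
pose T : {additive V -> V} := HB.pack nilp (GRing.isZmodMorphism.Build V V nilp nilpB).
have lc x : central x -> central (lap x) by move=> cx; apply/central_Xv/central_Xv.
have nc x : central x -> central (nilp x).
  move=> cx; apply: centralD; apply: centralD; last apply: centralN.
  - exact/central_Xv/(wl_central wN').
  - exact/(wl_central wN)/central_Xv.
  - exact/(wl_central wN)/(wl_central wN').
  - exact/(wl_central wP)/(wl_central wP').
have dX i x : central x -> dl (Xv i x) = Xv i (dl x).
  by move=> [x2 x5]; apply: dl_Xv => j; rewrite XvC.
have bX i x : central x -> db (Xv i x) = Xv i (db x).
  by move=> [x2 x5]; apply: db_Xv => j; rewrite XvC.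
have ld x : central x -> dl x = 0 -> dl (lap x) = 0.
  by move=> cx dx; rewrite /lap dX ?dX ?dx ?raddf0//; apply: central_Xv.
have lb x : central x -> db x = 0 -> db (lap x) = 0.
  by move=> cx dx; rewrite /lap bX ?bX ?dx ?raddf0//; apply: central_Xv.
have nd x : central x -> dl x = 0 -> dl (nilp x) = 0.
  move=> cx dx; have cN' := wl_central wN' cx; have cP' := wl_central wP' cx.
  have cX := central_Xv q cx.
  rewrite /nilp !raddfD raddfN/= (dX _ _ cN') (wl_dl wN' cx) (wl_dl wN cX) (dX _ _ cx).
  by rewrite (wl_dl wN cN') (wl_dl wN' cx) (wl_dl wP cP') (wl_dl wP' cx) dx !raddf0 !addr0.
have nb x : central x -> db x = 0 -> db (nilp x) = 0.
  move=> cx dx; have cN' := wl_central wN' cx; have cP' := wl_central wP' cx.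
  have cX := central_Xv q cx.
  rewrite /nilp !raddfD raddfN/= (bX _ _ cN') (wl_db wN' cx) (wl_db wN cX) (bX _ _ cx).
  by rewrite (wl_db wN cN') (wl_db wN' cx) (wl_db wP cP') (wl_db wP' cx) dx !raddf0 !addr0.
have XNX (Q : V -> V) i x : weight_lowering Q -> central x ->
    Q (Xv i x) = Xv i (Q x) by move=> wQ _; apply: wl_Xv.
have ln x : central x -> lap (nilp x) = nilp (lap x).
  move=> cx; have [x2 x5] := cx.
  have LX i y : central y -> lap (Xv i y) = Xv i (lap y).
    move=> cy; have [y2 y5] := cy; have [z2 z5] := central_Xv q cy.
    by rewrite /lap (XvC q i y2 y5) (XvC p i z2 z5).
  have LQ (Q : V -> V) y : weight_lowering Q -> central y -> lap (Q y) = Q (lap y).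
    by move=> wQ cy; rewrite /lap !(wl_Xv wQ).
  have cN' := wl_central wN' cx; have cP' := wl_central wP' cx.
  have LD y z : lap (y + z) = lap y + lap z by apply: (raddfD L).
  have LN y : lap (- y) = - lap y by apply: (raddfN L).
  rewrite /nilp !LD LN (LX _ _ cN') (LQ _ _ wN' cx) (LQ _ _ wN) ?(LX _ _ cx); last exact: central_Xv.
  by rewrite (LQ _ _ wN cN') (LQ _ _ wN' cx) (LQ _ _ wP cP') (LQ _ _ wP' cx).
have n3 x : nilp (nilp (nilp x)) = 0.
  have n2 y : iot o2 (iot o5 (nilp y)) = 0.
    rewrite /nilp !raddfD !raddfN/= -!(wl_Xv wN') (wl_2 wN') (wl_2 wN) (wl_2 wN) (wl_2 wP).
    by rewrite oppr0 !addr0.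
  have n1 y : iot o2 (iot o5 y) = 0 -> iot o2 (nilp y) = 0 /\ iot o5 (nilp y) = 0.
    move=> Ey; have EX : iot o2 (iot o5 (Xv q y)) = 0 by rewrite -!Xv_iot Ey raddf0.
    have EX' : iot o2 (iot o5 (Xv p y)) = 0 by rewrite -!Xv_iot Ey raddf0.
    have [a1 a2] := wl_1 wN' EX'; have [b1 b2] := wl_1 wN EX.
    have [c1 c2] := wl_1 wN (wl_2 wN' y); have [d1 d2] := wl_1 wP (wl_2 wP' y).
    by rewrite /nilp !raddfD !raddfN/= -!(wl_Xv wN') a1 a2 b1 b2 c1 c2 d1 d2 oppr0 !addr0.
  have n0 y : iot o2 y = 0 -> iot o5 y = 0 -> nilp y = 0.
    move=> y2 y5; rewrite /nilp (wl_0 wN' y2 y5) (wl_0 wP' y2 y5) !raddf0 ?(add0r, subr0, addr0, oppr0).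
    by rewrite (wl_0 wN) -?Xv_iot ?y2 ?y5 ?raddf0.
  by have [? ?] := n1 _ (n2 x); apply: n0.
(* The cofactor of $L+T$ in the factorization of $L^3+T^3$. *)
pose z := lap (lap u) - lap (nilp u) + nilp (nilp u).
have cz : central z.
  by apply: centralD; [apply: centralD; [|apply: centralN] |]; auto.
have clz : closed z.
  split; rewrite /z.
    rewrite (raddfD dl) (raddfB dl)/= (ld _ (lc _ cu) (ld _ cu du)) (ld _ (nc _ cu) (nd _ cu du)).
    by rewrite (nd _ (nc _ cu) (nd _ cu du)) subr0 addr0.
  rewrite (raddfD db) (raddfB db)/= (lb _ (lc _ cu) (lb _ cu bu)) (lb _ (nc _ cu) (nb _ cu bu)).
  by rewrite (nb _ (nc _ cu) (nb _ cu bu)) subr0 addr0.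
have E : lap (lap (lap u)) = dl (db (- iot p (iot q z))).
  rewrite -lap_nilp_exact// /z.
  have LD x y : lap (x + y) = lap x + lap y by apply: (raddfD L).
  have LB x y : lap (x - y) = lap x - lap y by apply: (raddfB L).
  have TD x y : nilp (x + y) = nilp x + nilp y by apply: (raddfD T).
  have TB x y : nilp (x - y) = nilp x - nilp y by apply: (raddfB T).
  rewrite LD LB TD TB n3 addr0.
  have sh (a b c : V) : a = a - b + c + (b - c).
    by rewrite -addrA (addrCA c) subrr addr0 subrK.
  by rewrite -(ln _ (lc _ cu)) -(ln _ (nc _ cu)) -(ln _ cu); apply: sh.
have hE : harmonic_form (lap (lap (lap u))).
  have hl x : central x -> harmonic_form x -> harmonic_form (lap x).
    move=> cx hx; apply: harmonic_Xv; first by right; apply: central_Xv.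
    by apply: harmonic_Xv => //; right.
  by apply: (hl _ (lc _ (lc _ cu))); apply: (hl _ (lc _ cu)); apply: hl.
have E0 := harmonic_exact hE E.
have E1 S : X p (u S) = 0 /\ X q (u S) = 0.
  apply: X_cube_eq0.
  - by have := congr1 (fun z : V => z S) cu.1; rewrite !ffunE.
  - by have := congr1 (fun z : V => z S) cu.2; rewrite !ffunE.
  - by have := congr1 (fun z : V => z S) E0; rewrite !ffunE.
by split; apply/ffunP => S; rewrite !ffunE; have [] := E1 S.
Qed.
End PairVanish.

Lemma harmonic_invariant u : harmonic_form u -> forall i, Xv i u = 0.
Proof.
move=> hu; have cu := harmonic_central hu; have [u2 u5] := cu.
have [[b0 b1 b2] _] := bar6E.
have wl c i j := @wl_eps_iot c i j.
have [u0 u3] : Xv o0 u = 0 /\ Xv (bar6 o0) u = 0.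
  apply: (pair_vanish
    (wl_add (wl k o1 o2 Xk isT isT (or_introl erefl)) (wl _ o4 o5 cstkalc isT isT (or_intror erefl)))
    (wl_add (wl k o4 o5 Xk isT isT (or_intror erefl)) (wl _ o1 o2 cstkal isT isT (or_introl erefl)))
    wl_zero wl_zero) => // v.
  - by rewrite dl_iot0.
  - by rewrite db_iot0.
  - by rewrite b0 db_iot3.
  - by rewrite b0 dl_iot3.
(* For this pair the mixed anticommutators are not zero: they carry the (1,1)-parts of $de_2$ and
   $de_5$. For the pair 0, 3 those parts sit in the unmixed anticommutators. *)
have [u1 u4] : Xv o1 u = 0 /\ Xv (bar6 o1) u = 0.
  apply: (pair_vanish
    (wl_opp (wl k o0 o2 Xk isT isT (or_introl erefl)))
    (wl_opp (wl k o3 o5 Xk isT isT (or_intror erefl)))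
    (wl_opp (wl _ o3 o2 cstkal isT isT (or_introl erefl)))
    (wl_opp (wl _ o0 o5 cstkalc isT isT (or_intror erefl)))) => // v.
  - by rewrite dl_iot1.
  - by rewrite db_iot1.
  - by rewrite b1 db_iot4.
  - by rewrite b1 dl_iot4.
rewrite b0 in u3; rewrite b1 in u4.
by elim/ord6P.
Qed.

End HarmonicForms.

(** * Directional derivatives and the symmetry of second partial derivatives *)

Lemma addrDDB (V : zmodType) (x a b : V) : x + a + b - x = a + b.
Proof. by rewrite -(addrA x) [LHS]addrC addKr. Qed.

Lemma ltr_dist_trans (R : realDomainType) (a b c r : R) :
  `|a - b| < r -> `|a - c| < r -> `|b - c| < r + r.
Proof.
move=> ab ac; rewrite (_ : b - c = - (a - b) + (a - c)); last by ring.
by rewrite (le_lt_trans (ler_normD _ _))// normrN ltrD.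
Qed.

Section DirectionalCalculus.
Context {R : realType} {n : nat}.
Local Notation V := 'rV[R]_n.+1.
Implicit Types (f g : V -> R) (x v : V) (i j : 'I_n.+1).

Lemma is_derive_epsP f x v d : is_derive x v f d <->
  forall e, 0 < e -> exists2 r, 0 < r & forall h, h != 0 -> `|h| < r ->
    `|h^-1 * (f (x + h *: v) - f x) - d| < e.
Proof.
split=> [[df <-] e e0|H].
  have /cvgrPdist_lt/(_ e e0) : h^-1 *: ((f \o shift x) (h *: v) - f x) @[h --> 0^'] --> 'D_v f x.
    exact: df.
  rewrite near_withinE => /nbhs_ballP[r /= r0 Hr]; exists r => // h h0 hr.
  have := Hr h; rewrite /ball/= sub0r normrN => /(_ hr h0).
  by rewrite distrC [x + _]addrC.
have C : h^-1 *: ((f \o shift x) (h *: v) - f x) @[h --> 0^'] --> d.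
  apply/cvgrPdist_lt => e /H[r r0 Hr]; rewrite near_withinE.
  apply/nbhs_ballP; exists r => //= h; rewrite /ball/= sub0r normrN => hr h0.
  by rewrite distrC /= [h *: v + x]addrC; apply: Hr.
by apply: DeriveDef; [apply/cvg_ex; exists d | apply: cvg_lim].
Qed.

Lemma continuous_epsP f x : {for x, continuous f} <->
  forall e, 0 < e -> exists2 r, 0 < r & forall y, `|y - x| < r -> `|f y - f x| < e.
Proof.
split=> [/cvgrPdist_lt C e /C /nbhs_ballP[r /= r0 Hr]|H].
  by exists r => // y yx; rewrite distrC; apply: Hr; rewrite -ball_normE /ball_/= distrC.
apply/(@cvgrPdist_lt _ _ _ (nbhs x)) => e /H[r r0 Hr]; apply/nbhs_ballP; exists r => //= y.
by rewrite -ball_normE /ball_/= => yx; rewrite distrC; apply: Hr; rewrite distrC.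
Qed.

Lemma is_derive_line f x v t d : is_derive (x + t *: v) v f d ->
  is_derive t 1 (fun s : R => f (x + s *: v)) d.
Proof.
move=> [df <-]; have E : (fun h : R => h^-1 *: (((fun s : R => f (x + s *: v)) \o shift t) (h *: 1) - f (x + t *: v))) =
    (fun h : R => h^-1 *: ((f \o shift (x + t *: v)) (h *: v) - f (x + t *: v))).
  apply/funext => h /=; congr (_ *: (f _ - _)).
  by rewrite [h%:A]mulr1 scalerDl addrCA addrA.
by apply: DeriveDef; rewrite /derivable /derive E.
Qed.

Lemma MVT_line f v x t : (forall y, derivable f y v) ->
  exists2 s, `|s| <= `|t| & f (x + t *: v) - f x = t * 'D_v f (x + s *: v).
Proof.
move=> df; pose g (s : R) := f (x + s *: v).
have dg (s : R) : is_derive s 1 g ('D_v f (x + s *: v)).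
  by apply: is_derive_line; apply: DeriveDef.
have cg (a b : R) : {within `[a, b], continuous g}.
  by apply: derivable_within_continuous => s _; case: (dg s).
have [t0|t0] := leP 0 t.
  have [s] := MVT_segment t0 (fun s _ => dg s) (cg _ _).
  rewrite in_itv/= => /andP[s0 st]; rewrite /g scale0r addr0 subr0 => E.
  by exists s; [rewrite !ger0_norm | rewrite E mulrC].
have [s] := MVT_segment (ltW t0) (fun s _ => dg s) (cg _ _).
rewrite in_itv/= => /andP[ts s0]; rewrite /g scale0r addr0 sub0r => E.
exists s; first by rewrite !ler0_norm ?lerN2// ltW.
by rewrite -opprB E mulrN opprK mulrC.
Qed.

Lemma is_derive_addv f x v w d : is_derive x v f d ->
  (forall y, derivable f y w) -> {for x, continuous (fun y => 'D_w f y)} ->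
  forall c, is_derive x (v + c *: w) f (d + c * 'D_w f x).
Proof.
move=> /is_derive_epsP dv dw /continuous_epsP cw c; apply/is_derive_epsP => e e0.
have e20 : 0 < e / 2 by rewrite divr_gt0.
have [r1 r10 H1] := dv _ e20.
have ec0 : 0 < e / 2 / (1 + `|c|) by rewrite divr_gt0// ltr_wpDr.
have [r2 r20 H2] := cw _ ec0.
pose K := 1 + `|v| + `|c *: w|.
have K0 : 0 < K by rewrite /K -addrA ltr_wpDr// addr_ge0.
exists (Num.min r1 (r2 / K)); first by rewrite lt_min r10 divr_gt0.
move=> h h0; rewrite lt_min => /andP[hr1]; rewrite ltr_pdivlMr// => hr2.
have [s sc Es] := MVT_line (x + h *: v) (h * c) dw.
rewrite scalerDr scalerA addrA.
have -> : f (x + h *: v + (h * c) *: w) - f x =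
    h * c * 'D_w f (x + h *: v + s *: w) + (f (x + h *: v) - f x).
  by rewrite -Es; ring.
rewrite mulrDr -!mulrA mulKf//.
have -> : c * 'D_w f (x + h *: v + s *: w) + h^-1 * (f (x + h *: v) - f x) - (d + c * 'D_w f x)
  = c * ('D_w f (x + h *: v + s *: w) - 'D_w f x) + (h^-1 * (f (x + h *: v) - f x) - d) by ring.
rewrite (le_lt_trans (ler_normD _ _))// [e]splitr ler_ltD//; last exact: H1.
have : `|'D_w f (x + h *: v + s *: w) - 'D_w f x| < e / 2 / (1 + `|c|).
  apply: H2; rewrite addrDDB (le_lt_trans (ler_normD _ _))//.
  apply: le_lt_trans hr2; rewrite /K mulrDr mulrDr mulr1 -addrA ler_wpDl// lerD//.
    by rewrite normrZ.
  by rewrite !normrZ mulrA ler_wpM2r// -normrM.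
rewrite ltr_pdivlMr ?ltr_wpDr// => H; rewrite normrM; apply: le_trans (ltW H).
by rewrite mulrC ler_wpM2l// lerDr.
Qed.

Lemma is_derive_dir f v : (forall i y, derivable f y (delta_mx 0 i)) ->
  (forall i, continuous (partial i f)) ->
  forall x, is_derive x v f (\sum_i v 0 i * partial i f x).
Proof.
move=> df cf x; rewrite {1}[v]row_sum_delta.
elim: (index_enum _) => [|i s IH].
  by rewrite !big_nil; apply: DeriveDef; [apply: derivable0 | rewrite derive0].
rewrite !big_cons addrC [X in is_derive _ _ _ X]addrC; apply: is_derive_addv => //.
exact: cf.
Qed.

(** The second difference of $f$ over a small parallelogram is symmetric in the two directions, and
    two applications of the mean value theorem turn it into $h^2$ times either mixed derivative at a
    point near $x$. Continuity of both then leaves no gap between them. *)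
Lemma partialC f i j :
  (forall l y, derivable f y (delta_mx 0 l)) ->
  (forall l m y, derivable (partial l f) y (delta_mx 0 m)) ->
  (forall l m, continuous (partial m (partial l f))) ->
  forall x, partial i (partial j f) x = partial j (partial i f) x.
Proof.
move=> df ddf cf x.
have Delta (p q : 'I_n.+1) h : exists s t, [/\ `|s| <= `|h|, `|t| <= `|h| &
    f (x + h *: delta_mx 0 p + h *: delta_mx 0 q) - f (x + h *: delta_mx 0 p)
    - f (x + h *: delta_mx 0 q) + f x =
    h * (h * partial q (partial p f) (x + s *: delta_mx 0 p + t *: delta_mx 0 q))].
  pose g y := f (y + h *: delta_mx 0 q) - f y.
  have dsh y : derivable (fun z => f (z + h *: delta_mx 0 q)) y (delta_mx 0 p) /\
      'D_(delta_mx 0 p) (fun z => f (z + h *: delta_mx 0 q)) y = partial p f (y + h *: delta_mx 0 q).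
    suff : is_derive y (delta_mx 0 p) (fun z => f (z + h *: delta_mx 0 q)) (partial p f (y + h *: delta_mx 0 q)).
      by move=> [].
    apply/is_derive_epsP => e e0.
    have /is_derive_epsP/(_ e e0)[r r0 H] : is_derive (y + h *: delta_mx 0 q) (delta_mx 0 p) f
       (partial p f (y + h *: delta_mx 0 q)) by apply: DeriveDef.
    by exists r => // k k0 kr; rewrite addrAC; apply: H.
  have dg y : derivable g y (delta_mx 0 p) by apply: derivableB => //; apply: (dsh y).1.
  have [s sh Es] := MVT_line x h dg.
  have [t th Et] := MVT_line (x + s *: delta_mx 0 p) h (ddf p q).
  exists s, t; split=> //; rewrite -Et.
  transitivity (g (x + h *: delta_mx 0 p) - g x); first by rewrite /g; ring.
  by rewrite Es deriveB ?(dsh _).2//; apply: (dsh _).1.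
apply/eqP/negPn/negP => nE.
pose e := `|partial i (partial j f) x - partial j (partial i f) x| / 2.
have e0 : 0 < e by rewrite divr_gt0// normr_gt0 subr_eq0.
have [r1 r10 H1] := (continuous_epsP _ _).1 (cf j i x) _ e0.
have [r2 r20 H2] := (continuous_epsP _ _).1 (cf i j x) _ e0.
(* All points met in the second differences lie within $hK$ of $x$. *)
pose K : R := 1 + `|delta_mx 0 i : V| + `|delta_mx 0 j : V|.
have K0 : 0 < K by rewrite /K -addrA ltr_wpDr// addr_ge0.
pose h := Num.min r1 r2 / K / 2.
have h0 : 0 < h by rewrite !divr_gt0// lt_min r10.
have hK : h * K < Num.min r1 r2.
  rewrite /h mulrAC divfK ?gt_eqF// ltr_pdivrMr// ltr_pMr ?ltr1n//.
  by rewrite lt_min r10.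
have small (p q : 'I_n.+1) s t : (p, q) = (i, j) \/ (p, q) = (j, i) ->
   `|s| <= `|h| -> `|t| <= `|h| ->
   `|x + s *: delta_mx 0 p + t *: delta_mx 0 q - x : V| < Num.min r1 r2.
  rewrite (gtr0_norm h0) => pq sh th; apply: le_lt_trans hK.
  rewrite addrDDB (le_trans (ler_normD _ _))// !normrZ.
  rewrite /K !mulrDr -addrA ler_wpDl ?mulr1 ?(ltW h0)//.
  by case: pq => -[-> ->]; [|rewrite [leRHS]addrC]; rewrite lerD// ler_wpM2r.
have [s1 [t1 [sh1 th1 E1]]] := Delta j i h.
have [s2 [t2 [sh2 th2 E2]]] := Delta i j h.
have E : partial i (partial j f) (x + s1 *: delta_mx 0 j + t1 *: delta_mx 0 i) =
    partial j (partial i f) (x + s2 *: delta_mx 0 i + t2 *: delta_mx 0 j).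
  have hn0 : h != 0 by rewrite gt_eqF.
  apply: (mulfI hn0 (mulfI hn0 (etrans (esym E1) (etrans _ E2)))).
  by rewrite (addrAC x (h *: delta_mx 0 j)); congr (_ + _); apply: addrAC.
have := small j i s1 t1 (or_intror erefl) sh1 th1; rewrite lt_min => /andP[/H1 a1 _].
have := small i j s2 t2 (or_introl erefl) sh2 th2; rewrite lt_min => /andP[_ /H2 a2].
have : `|partial i (partial j f) x - partial j (partial i f) x| < e + e.
  move: a1; rewrite E => a1; exact: (ltr_dist_trans a1 a2).
by rewrite /e -splitr ltxx.
Qed.

End DirectionalCalculus.

(** * A closure criterion for smoothness on an open set *)

Section SmoothFunctions.
Context {R : realType} {n : nat} (U : set 'rV[R]_n.+1).
Context (oU : open U).
Local Notation V := 'rV[R]_n.+1.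
Implicit Types (f g : V -> R) (x : V) (i : 'I_n.+1).

Lemma partial_near i f g x : U x -> (forall y, U y -> f y = g y) ->
  partial i f x = partial i g x.
Proof.
move=> Ux fg; apply: near_eq_derive; near=> y; apply: fg; near: y.
exact: open_nbhs_nbhs.
Unshelve. all: by end_near. Qed.

(** A coinduction principle: a class of once differentiable, continuous functions that is stable
    under partial derivatives, up to equality on $U$, consists of smooth functions. Equality on $U$
    is enough because $U$ is open and derivatives are local. *)
Lemma smooth_on_coind (P : (V -> R) -> Prop) :
  (forall f, P f -> forall x, U x -> {for x, continuous f} /\
     forall i, derivable f x (delta_mx 0 i)) ->
  (forall f, P f -> forall i, exists2 g, P g & forall x, U x -> partial i f x = g x) ->
  forall f, P f -> smooth_on U f.
Proof.
move=> P1 P2 f Pf s x Ux.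
have {Pf} [g Pg fg] : exists2 g, P g & forall x, U x -> foldr (@partial R n) f s x = g x.
  elim: s => [|i s [g Pg fg]]; first by exists f.
  have [g' Pg' gg'] := P2 _ Pg i; exists g' => // y Uy /=.
  by rewrite (partial_near i Uy fg) gg'.
have near_fg : {near x, foldr (@partial R n) f s =1 g}.
  near=> y; apply: fg; near: y; exact: open_nbhs_nbhs.
have near_gf : {near x, g =1 foldr (@partial R n) f s}.
  by apply: filterS near_fg => y ->.
have [cg dg] := P1 _ Pg _ Ux; split=> [|i]; last first.
  exact: near_eq_derivable near_gf (dg i).
rewrite /prop_for /continuous_at (fg _ Ux).
exact: (cvg_trans (near_eq_cvg near_gf) cg).
Unshelve. all: by end_near. Qed.

(** The sum, product and quotient rules keep the derivatives inside this class, so [smooth_on_coind]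
    applies to it. Inverses serve for the entries of the complex structure, whose denominator is
    $1-|a|^2$. *)
Inductive smooth_gen : (V -> R) -> Prop :=
| sg_base f : smooth_on U f -> smooth_gen f
| sg_cst c : smooth_gen (fun=> c)
| sg_coord i : smooth_gen (fun x => x 0 i)
| sg_add f g : smooth_gen f -> smooth_gen g -> smooth_gen (fun x => f x + g x)
| sg_mul f g : smooth_gen f -> smooth_gen g -> smooth_gen (fun x => f x * g x)
| sg_inv f : smooth_gen f -> (forall x, U x -> f x != 0) -> smooth_gen (fun x => (f x)^-1).

Lemma is_derive_coord i j (x : V) :
  is_derive x (delta_mx 0 j) (fun y : V => y 0 i) (i == j)%:R.
Proof.
apply/is_derive_epsP => e e0; exists 1 => // h h0 _.
by rewrite !mxE eqxx/= (addrC (x 0 i)) addrK mulKf// subrr normr0.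
Qed.

Lemma smooth_on_partial i f : smooth_on U f -> smooth_on U (partial i f).
Proof. by move=> sf s x Ux; have := sf (rcons s i) x Ux; rewrite foldr_rcons. Qed.

Lemma smooth_gen_smooth f : smooth_gen f -> smooth_on U f.
Proof.
have reg g : smooth_gen g -> forall x, U x -> {for x, continuous g} /\
     forall i, derivable g x (delta_mx 0 i).
  elim=> {g} [g sg|c|j|g h _ IHg _ IHh|g h _ IHg _ IHh|g _ IHg g0] x Ux.
  - exact: (sg [::] x Ux).
  - split=> [|i]; [exact: cst_continuous | exact: derivable_cst].
  - split=> [|i]; [exact: coord_continuous | by case: (is_derive_coord j i x)].
  - have [cg dg] := IHg _ Ux; have [ch dh] := IHh _ Ux.
    split=> [|i]; [exact: (cvgD cg ch) | exact: (derivableD (dg i) (dh i))].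
  - have [cg dg] := IHg _ Ux; have [ch dh] := IHh _ Ux.
    split=> [|i]; [exact: (cvgM cg ch) | exact: (derivableM (dg i) (dh i))].
  - have [cg dg] := IHg _ Ux.
    split=> [|i]; [exact: (cvgV (g0 _ Ux) cg) | exact: (derivableV (g0 _ Ux) (dg i))].
apply: smooth_on_coind => // {}f; elim=> {f} [f sf|c|j|f g sf IHf sg' IHg|f g sf IHf sg' IHg|f sf IHf f0] i.
- by exists (partial i f) => //; apply/sg_base/smooth_on_partial.
- by exists (fun=> 0) => [|x _]; [apply: sg_cst | rewrite /partial derive_cst].
- exists (fun=> (j == i)%:R) => [|x _]; first exact: sg_cst.
  by rewrite /partial; have [_ ->] := is_derive_coord j i x.
- have [f' sf' Ef] := IHf i; have [g' sg'' Eg] := IHg i.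
  exists (fun x => f' x + g' x) => [|x Ux]; first exact: sg_add.
  have [_ df] := reg _ sf _ Ux; have [_ dg] := reg _ sg' _ Ux.
  by rewrite /partial deriveD// -Ef// -Eg.
- have [f' sf' Ef] := IHf i; have [g' sg'' Eg] := IHg i.
  exists (fun x => f x * g' x + g x * f' x) => [|x Ux].
    by apply: sg_add; apply: sg_mul.
  have [_ df] := reg _ sf _ Ux; have [_ dg] := reg _ sg' _ Ux.
  by rewrite /partial (deriveM (df i) (dg i)) -Ef// -Eg.
- have [f' sf' Ef] := IHf i.
  exists (fun x => (-1) * ((f x)^-1 * (f x)^-1 * f' x)) => [|x Ux].
    by apply: sg_mul; [apply: sg_cst | apply: sg_mul => //; apply: sg_mul; apply: sg_inv].
  have [_ df] := reg _ sf _ Ux.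
  rewrite /partial deriveV ?f0// -Ef// mulN1r -invfM -expr2.
  exact: mulNr.
Qed.

End SmoothFunctions.

(** * An invariant mean on the bounded functions of an abelian group *)

Section InvariantMean.
Context {R : realType} {A : zmodType}.
Implicit Types (f g : A -> R) (s : seq A) (n : nat) (t x : A) (M : R).

Definition bdd f M := forall x, `|f x| <= M.

(** The average over the first $n+1$ multiples of $t$; [avg] iterates it over a list of
    translations, thus averages over a box in the subgroup that they generate. *)
Definition avg1 n t f x : R := n.+1%:R^-1 * \sum_(k < n.+1) f (x + t *+ k).

Definition avg n s f : A -> R := foldr (fun t g => avg1 n t g) f s.

Lemma avg_bdd n s f M : bdd f M -> bdd (avg n s f) M.
Proof.
move=> fM; elim: s => //= t s IH x; rewrite /avg1 normrM ger0_norm ?invr_ge0//.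
rewrite mulrC ler_pdivrMr ?ltr0n// (le_trans (ler_norm_sum _ _ _))//.
rewrite (le_trans (ler_sum _ (fun k _ => IH _)))// sumr_const card_ord.
by rewrite -[M *+ _]mulr_natr.
Qed.

Lemma avgD n s f g : avg n s (fun x => f x + g x) = (fun x => avg n s f x + avg n s g x).
Proof.
elim: s => //= t s ->; apply/funext => x; rewrite /avg1 big_split/=.
by rewrite mulrDr.
Qed.

Lemma avgZ n s c f : avg n s (fun x => c * f x) = (fun x => c * avg n s f x).
Proof.
elim: s => //= t s ->; apply/funext => x; rewrite /avg1 -mulr_sumr.
by rewrite mulrCA.
Qed.

Lemma avg_ge0 n s f : (forall x, 0 <= f x) -> forall x, 0 <= avg n s f x.
Proof.
move=> f0; elim: s => //= t s IH x; rewrite /avg1 mulr_ge0 ?invr_ge0//.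
exact: sumr_ge0.
Qed.

Lemma avg_cst n s c : avg n s (fun=> c) = (fun=> c).
Proof.
elim: s => //= t s ->; apply/funext => x; rewrite /avg1 sumr_const card_ord.
by rewrite -[c *+ _]mulr_natl mulKf// pnatr_eq0.
Qed.

Lemma avg_shift n s t f : avg n s (fun x => f (x + t)) = (fun x => avg n s f (x + t)).
Proof.
elim: s => //= u s ->; apply/funext => x; rewrite /avg1; congr (_ * _).
by apply: eq_bigr => k _; rewrite addrAC.
Qed.

(** The average in the direction of the translation telescopes to two boundary terms divided by
    $n+1$, and the other averages do not increase bounds. *)
Lemma avg_shift_bdd n s t f M : bdd f M -> t \in s ->
  bdd (avg n s (fun x => f (x + t) - f x)) (2 * M / n.+1%:R).
Proof.
move=> fM; elim: s => //= u s IH; rewrite inE; case: eqVneq => [-> _|_ /IH Hs].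
  have -> : avg n s (fun x => f (x + u) - f x) = (fun x => avg n s f (x + u) - avg n s f x).
    have -> : (fun x => f (x + u) - f x) = (fun x => f (x + u) + (-1) * f x).
      by apply/funext => x; rewrite mulN1r.
    rewrite avgD avg_shift avgZ.
    by apply/funext => x; rewrite mulN1r.
  move=> x; rewrite /avg1; set g := avg n s f.
  rewrite (eq_bigr (fun k : 'I_n.+1 => g (x + u *+ k.+1) - g (x + u *+ k))); last first.
    by move=> k _; rewrite -addrA -mulrSr.
  rewrite -(big_mkord xpredT (fun k => g (x + u *+ k.+1) - g (x + u *+ k))).
  rewrite (telescope_sumr (fun k => g (x + u *+ k)))// normrM ger0_norm ?invr_ge0//.
  rewrite mulrC ler_pM2r ?invr_gt0 ?ltr0n// (le_trans (ler_normB _ _))//.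
  by rewrite mulr_natl mulr2n lerD//; apply: avg_bdd.
exact: (@avg_bdd n [:: u] _ _ Hs).
Qed.

(** The filter along which the list comes to contain any given translation and $n$ goes to infinity;
    an ultrafilter above it turns bounded families into convergent ones. *)
Definition tails : set_system (seq A * nat) :=
  filter_from setT (fun p : seq A * nat =>
    [set q : seq A * nat | {subset p.1 <= q.1} /\ (p.2 <= q.2)%N]).

Lemma tails_proper : ProperFilter tails.
Proof.
apply: filter_from_proper => [|p _]; last by exists p; split.
apply: filter_from_filter => [|p q _ _]; first by exists ([::], 0%N).
exists (p.1 ++ q.1, maxn p.2 q.2) => // r [/= sub le]; split; split.
- by move=> x xp; apply: sub; rewrite mem_cat xp.
- exact: leq_trans (leq_maxl _ _) le.
- by move=> x xp; apply: sub; rewrite mem_cat xp orbT.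
- exact: leq_trans (leq_maxr _ _) le.
Qed.

Lemma ultra_bounded_cvg (T : Type) (U : set_system T) (u : T -> R) M :
  UltraFilter U -> (forall p, `|u p| <= M) -> cvg (u p @[p --> U]).
Proof.
move=> UU uM; have PU : ProperFilter U := @ultra_proper _ _ UU.
have FK : (u p @[p --> U]) [set` `[- M, M]].
  by apply: (@filterE _ U) => p /=; rewrite in_itv/= -ler_norml.
have [l [_ cl]] := @segment_compact R (- M) M _ _ FK.
apply/cvg_ex; exists l; move=> B nB.
have [//|UB] := @in_ultra_setVsetC _ U (u @^-1` B) UU.
have [y [By /=]] := cl (~` B) B UB nB.
by [].
Qed.

Lemma invariant_mean_exists : exists m : (A -> R) -> R, [/\
  forall f g M N, bdd f M -> bdd g N -> m (fun x => f x + g x) = m f + m g,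
  forall c f M, bdd f M -> m (fun x => c * f x) = c * m f,
  forall f M, bdd f M -> `|m f| <= M,
  forall f M, bdd f M -> (forall x, 0 <= f x) -> 0 <= m f &
  (forall c, m (fun=> c) = c) /\
  forall f M t, bdd f M -> m (fun x => f (x + t)) = m f].
Proof.
have [U [UU tU]] := @ultraFilterLemma _ _ tails_proper.
have PU : ProperFilter U := @ultra_proper _ _ UU.
pose av f p := avg p.2 p.1 f 0.
pose m f : R := lim (av f p @[p --> U]).
have cv f M : bdd f M -> av f p @[p --> U] --> m f.
  move=> fM; have /cvg_ex[l fl] := @ultra_bounded_cvg _ _ (av f) _ UU (fun p => avg_bdd p.2 p.1 fM 0).
  by rewrite /m (cvg_lim _ fl).
exists m; split.
- move=> f g M N fM gN; apply: cvg_lim => //.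
  have -> : av (fun x => f x + g x) = (fun p => av f p + av g p).
    by apply/funext => p; rewrite /av avgD.
  exact: (cvgD (cv _ _ fM) (cv _ _ gN)).
- move=> c f M fM; apply: cvg_lim => //.
  have -> : av (fun x => c * f x) = (fun p => c * av f p).
    by apply/funext => p; rewrite /av avgZ.
  exact: (cvgM (cvg_cst _) (cv _ _ fM)).
- move=> f M fM; have := cv _ _ fM => /cvg_norm H.
  apply: (closed_cvg (fun r => r <= M)) H; first exact: closed_le.
  by apply: (@filterE _ U) => p; apply: avg_bdd.
- move=> f M fM f0; have H := cv _ _ fM.
  apply: limr_ge; first exact: cvgP H.
  by apply: (@filterE _ U) => p; apply: avg_ge0.
split=> [c|f M t fM].
  apply: cvg_lim => //.
  have -> : av (fun=> c) = (fun=> c) by apply/funext => p; rewrite /av avg_cst.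
  exact: cvg_cst.
have M0 : 0 <= M by apply: le_trans (fM 0).
have tM : bdd (fun x => f (x + t)) M by move=> x; apply: fM.
apply/eqP; rewrite -subr_eq0 -normr_le0; apply/ler_addgt0Pr => e e0; rewrite add0r.
have H : `|av (fun x => f (x + t)) p - av f p| @[p --> U] --> `|m (fun x => f (x + t)) - m f|.
  exact: (cvg_norm (cvgB (cv _ _ tM) (cv _ _ fM))).
apply: (closed_cvg (fun r => r <= e)) H; first exact: closed_le.
(* From this $n$ on, the bound $2M/(n+1)$ of [avg_shift_bdd] is at most $e$. *)
apply: tU; pose n := Num.truncn (2 * M / e).
exists ([:: t], n) => // p [/= sp np].
have -> : av (fun x => f (x + t)) p - av f p = av (fun x => f (x + t) - f x) p.
  rewrite /av; have -> : (fun x => f (x + t) - f x) = (fun x => f (x + t) + (-1) * f x).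
    by apply/funext => x; rewrite mulN1r.
  by rewrite avgD avgZ mulN1r.
have tp : t \in p.1 by apply: sp; rewrite inE.
rewrite /av; apply: (@le_trans _ _ (2 * M / p.2.+1%:R)); first exact: (@avg_shift_bdd p.2 p.1 t f M fM tp 0).
rewrite ler_pdivrMr ?ltr0n// [e * _]mulrC -ler_pdivrMr//.
have := truncnS_gt (2 * M / e); rewrite -/n => /ltW H2; apply: (le_trans H2).
by rewrite ler_nat.
Qed.

End InvariantMean.

(** * Left-invariant vector fields on the complex Heisenberg group *)

Section HeisenbergFields.
Context {R : realType}.
Local Notation G := 'rV[R]_6.
Implicit Types (x g : G) (r s i j : 'I_6) (f : G -> R).

(* The structure constants of the group law (z1, z2, z3) in real coordinates:
   z3 receives the product of the z1 of the left factor, with coordinates 0 and 1,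
   by the z2 of the right factor, with coordinates 2 and 3. *)
Definition beta r : 'M[R]_6 := \matrix_(i, j)
  (((r == o2) && (i == o0) && (j == o4))%:R + ((r == o2) && (i == o1) && (j == o5))%:R +
   ((r == o3) && (i == o0) && (j == o5))%:R - ((r == o3) && (i == o1) && (j == o4))%:R).

Lemma big_ord6 (T : Type) (idx : T) (op : Monoid.law idx) (F : 'I_6 -> T) :
  \big[op/idx]_(i < 6) F i = op (F o0) (op (F o1) (op (F o2) (op (F o3) (op (F o4) (F o5))))).
Proof.
rewrite !big_ord_recl big_ord0 Monoid.mulm1.
by congr (op (F _) (op (F _) (op (F _) (op (F _) (op (F _) (F _)))))); apply/val_inj.
Qed.

(** The entry [beta r i j] is nonzero only for $i\in\{0,1\}$, $r\in\{2,3\}$ and $j\in\{4,5\}$: what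
    the product creates is never an input of another product. This is two-step nilpotency, and the
    next two lemmas are the same fact for the other positions. *)
Lemma beta_beta r s : beta r *m beta s = 0.
Proof.
apply/matrixP => i j; rewrite !mxE big1// => l _; rewrite !mxE.
elim/ord6P: l => /=; rewrite ?andbF ?andFb /= ?(mulr0, mul0r, addr0, subr0, add0r, oppr0)//.
Qed.

Lemma beta_out r i s : beta r i s *: beta s = 0.
Proof.
apply/matrixP => k l; rewrite !mxE.
elim/ord6P: s => /=; rewrite ?andbF ?andFb /= ?(mulr0, mul0r, addr0, subr0, add0r, oppr0)//.
Qed.

Lemma beta_in r s : delta_mx 0 r *m beta r = 0 :> G.
Proof.
apply/rowP => j; rewrite -rowE !mxE.
by elim/ord6P: r => /=; rewrite ?andbF ?andFb /= ?(mulr0, mul0r, addr0, subr0, add0r, oppr0).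
Qed.

Lemma heis_mulE g x : heis_mul g x = g + x + \sum_r x 0 r *: (g *m beta r).
Proof.
have e0 : inord 0.*2 = o0 :> 'I_6 by apply/val_inj; rewrite /= inordK.
have e1 : inord 0.*2.+1 = o1 :> 'I_6 by apply/val_inj; rewrite /= inordK.
have e2 : inord 1.*2 = o2 :> 'I_6 by apply/val_inj; rewrite /= inordK.
have e3 : inord 1.*2.+1 = o3 :> 'I_6 by apply/val_inj; rewrite /= inordK.
have e4 : inord 2.*2 = o4 :> 'I_6 by apply/val_inj; rewrite /= inordK.
have e5 : inord 2.*2.+1 = o5 :> 'I_6 by apply/val_inj; rewrite /= inordK.
apply/rowP => j; rewrite !mxE big_ord6/= !mxE !big_ord6/= !mxE.
elim/ord6P: j => /=; rewrite ?(e0, e1, e2, e3, e4, e5)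
  ?(mulr0, mul0r, addr0, subr0, add0r, oppr0, mulr1, mul1r)//=; ring.
Qed.

(** The left-invariant field that equals the $r$-th coordinate vector at the unit. *)
Definition yv r x : G := delta_mx 0 r + x *m beta r.

Lemma yv_out r x s : (yv r x) 0 s *: beta s = (r == s)%:R *: beta s.
Proof.
rewrite /yv !mxE eqxx eq_sym scalerDl [X in _ + X](_ : _ = 0) ?addr0//.
rewrite scaler_suml big1// => i _; rewrite -scalerA beta_out scaler0.
by [].
Qed.

(** Left translation is affine and carries the straight line through $x$ in the direction of the
    field to the corresponding line through $gx$. By [yv_flow] these lines are the integral curves
    of the field. *)
Lemma heis_mul_flow g x r t :
  heis_mul g (x + t *: yv r x) = heis_mul g x + t *: yv r (heis_mul g x).
Proof.
rewrite !heis_mulE.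
have -> : \sum_s (x + t *: yv r x) 0 s *: (g *m beta s) =
    \sum_s x 0 s *: (g *m beta s) + t *: (g *m beta r).
  transitivity (\sum_s (x 0 s *: (g *m beta s) + t *: ((r == s)%:R *: (g *m beta s)))).
    apply: eq_bigr => s _; have -> : (x + t *: yv r x) 0 s = x 0 s + t * yv r x 0 s by rewrite !mxE.
    rewrite scalerDl -scalerA.
    by congr (_ + t *: _); rewrite !scalemxAr yv_out.
  rewrite big_split/=; congr (_ + _); rewrite (bigD1 r)//= eqxx scale1r big1 ?addr0//.
  by move=> s sr; rewrite eq_sym (negbTE sr) scale0r scaler0.
rewrite /yv !mulmxDl mulmx_suml [X in _ + _ *: (_ + (_ + X))]big1 ?addr0; last first.
  by move=> s _; rewrite -scalemxAl -mulmxA beta_beta mulmx0 scaler0.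
rewrite !scalerDr [in RHS](addrA (t *: delta_mx 0 r)) [in RHS](addrAC (t *: delta_mx 0 r)).
by rewrite !addrA; congr (_ + _); rewrite -!addrA; congr (_ + (_ + _)); rewrite addrA addrC.
Qed.

Lemma heis_mul_exp x r t : heis_mul x (t *: delta_mx 0 r) = x + t *: yv r x.
Proof.
rewrite heis_mulE /yv scalerDr addrA; congr (_ + _).
rewrite (bigD1 r)//= !mxE !eqxx mulr1 big1 ?addr0//.
by move=> s sr; rewrite !mxE (negbTE sr) andbF mulr0 scale0r.
Qed.

Lemma yv_flow r x t : yv r (x + t *: yv r x) = yv r x.
Proof.
rewrite {1}/yv mulmxDl -scalemxAl {2}/yv mulmxDl beta_in// -mulmxA beta_beta mulmx0.
by rewrite addr0 scaler0 addr0.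
Qed.

Definition smooth f := smooth_on setT f.
Definition Yr r f x : R := \sum_i yv r x 0 i * partial i f x.

Lemma smooth_gen_setT f : smooth_gen setT f -> smooth f.
Proof. exact/smooth_gen_smooth/openT. Qed.

Lemma smoothD f f' : smooth f -> smooth f' -> smooth (fun x => f x + f' x).
Proof. move=> sf sg; exact: (smooth_gen_setT (sg_add (sg_base sf) (sg_base sg))). Qed.

Lemma smoothM f f' : smooth f -> smooth f' -> smooth (fun x => f x * f' x).
Proof. move=> sf sg; exact: (smooth_gen_setT (sg_mul (sg_base sf) (sg_base sg))). Qed.

Lemma smooth_cst (c : R) : smooth (fun=> c).
Proof. exact/smooth_gen_setT/sg_cst. Qed.

Lemma smooth_coord i : smooth (fun x => x 0 i).
Proof. exact/smooth_gen_setT/sg_coord. Qed.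

Lemma smoothN f : smooth f -> smooth (fun x => - f x).
Proof.
move=> sf; have := smoothM (smooth_cst (-1)) sf.
by congr smooth; apply/funext => x; rewrite mulN1r.
Qed.

Lemma smoothB f f' : smooth f -> smooth f' -> smooth (fun x => f x - f' x).
Proof. move=> sf sg; exact: (smoothD sf (smoothN sg)). Qed.

Lemma smooth_sum (I : Type) (l : seq I) (F : I -> G -> R) :
  (forall a, smooth (F a)) -> smooth (fun x => \sum_(a <- l) F a x).
Proof.
move=> sF; elim: l => [|a l IH].
  by have := smooth_cst 0; congr smooth; apply/funext => x; rewrite big_nil.
by have := smoothD (sF a) IH; congr smooth; apply/funext => x; rewrite big_cons.
Qed.

Lemma smooth_partial i f : smooth f -> smooth (partial i f).
Proof. exact: smooth_on_partial. Qed.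

Lemma smooth_derivable f : smooth f -> forall i x, derivable f x (delta_mx 0 i).
Proof. by move=> sf i x; exact: (sf [::] x I).2. Qed.

Lemma smooth_continuous f : smooth f -> continuous f.
Proof. by move=> sf x; exact: (sf [::] x I).1. Qed.

Lemma smooth_dir f v : smooth f -> forall x,
  is_derive x v f (\sum_i v 0 i * partial i f x).
Proof.
move=> sf; apply: is_derive_dir => [i y|i]; first exact: smooth_derivable.
exact/smooth_continuous/smooth_partial.
Qed.

Lemma smooth_partialC f i j : smooth f -> forall x,
  partial i (partial j f) x = partial j (partial i f) x.
Proof.
move=> sf; apply: partialC => *; first exact: smooth_derivable.
  exact/smooth_derivable/smooth_partial.
exact/smooth_continuous/smooth_partial/smooth_partial.
Qed.

Lemma smooth_yv r i : smooth (fun x => yv r x 0 i).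
Proof.
have := smoothD (smooth_cst ((delta_mx 0 r : G) 0 i))
  (smooth_sum (index_enum 'I_6) (fun k => smoothM (smooth_coord k) (smooth_cst (beta r k i)))).
by congr smooth; apply/funext => x; rewrite !mxE.
Qed.

Lemma smooth_Yr r f : smooth f -> smooth (Yr r f).
Proof.
by move=> sf; apply: smooth_sum => i; apply: smoothM; [apply: smooth_yv | apply: smooth_partial].
Qed.

Lemma partialD i f f' x : smooth f -> smooth f' ->
  partial i (fun y => f y + f' y) x = partial i f x + partial i f' x.
Proof. by move=> sf sg; apply: deriveD; apply: smooth_derivable. Qed.

Lemma partialM i f f' x : smooth f -> smooth f' ->
  partial i (fun y => f y * f' y) x = f x * partial i f' x + f' x * partial i f x.
Proof. by move=> sf sg; apply: deriveM; apply: smooth_derivable. Qed.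

Lemma partial_cst i (c : R) x : partial i (fun=> c) x = 0.
Proof. exact: derive_cst. Qed.

Lemma partialZ i c f x : smooth f -> partial i (fun y => c * f y) x = c * partial i f x.
Proof.
move=> sf; rewrite (partialM i x (smooth_cst c) sf) partial_cst mulr0 addr0.
by [].
Qed.

Lemma partial_coord i j x : partial i (fun y : G => y 0 j) x = (j == i)%:R.
Proof. by rewrite /partial; have [_ ->] := is_derive_coord j i x. Qed.

Lemma partial_sum i (I : Type) (l : seq I) (F : I -> G -> R) x :
  (forall a, smooth (F a)) ->
  partial i (fun y => \sum_(a <- l) F a y) x = \sum_(a <- l) partial i (F a) x.
Proof.
move=> sF; elim: l => [|a l IH].
  rewrite big_nil -[RHS](partial_cst i 0 x); congr partial.
  by apply/funext => y; rewrite big_nil.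
rewrite big_cons -IH -partialD//; last exact: smooth_sum.
by congr partial; apply/funext => y; rewrite big_cons.
Qed.

Lemma partial_yv i r j x : partial i (fun y => yv r y 0 j) x = beta r i j.
Proof.
have -> : (fun y => yv r y 0 j) =
    (fun y => (delta_mx 0 r : G) 0 j + \sum_k beta r k j * y 0 k).
  by apply/funext => y; rewrite !mxE; congr (_ + _); apply: eq_bigr => k _; rewrite mulrC.
have sZ k : smooth (fun y : G => beta r k j * y 0 k).
  exact: smoothM (smooth_cst _) (smooth_coord _).
rewrite partialD ?partial_cst ?add0r; [|exact: smooth_cst|exact: smooth_sum].
rewrite partial_sum// (bigD1 i)//= partialZ ?partial_coord ?eqxx ?mulr1; last exact: smooth_coord.
rewrite big1 ?addr0// => k ki.
by rewrite partialZ ?partial_coord ?(negbTE ki) ?mulr0//; apply: smooth_coord.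
Qed.

Lemma YrM r f f' x : smooth f -> smooth f' ->
  Yr r (fun y => f y * f' y) x = Yr r f x * f' x + f x * Yr r f' x.
Proof.
move=> sf sg; rewrite /Yr mulr_suml mulr_sumr -big_split/=.
by apply: eq_bigr => i _; rewrite partialM//; ring.
Qed.

Lemma YrD r f f' x : smooth f -> smooth f' ->
  Yr r (fun y => f y + f' y) x = Yr r f x + Yr r f' x.
Proof.
move=> sf sg; rewrite /Yr -big_split/=.
by apply: eq_bigr => i _; rewrite partialD//; ring.
Qed.

Lemma Yr_cst r (c : R) x : Yr r (fun=> c) x = 0.
Proof. by rewrite /Yr big1// => i _; rewrite partial_cst mulr0. Qed.

Lemma YrZ r c f x : smooth f -> Yr r (fun y => c * f y) x = c * Yr r f x.
Proof.
move=> sf; rewrite (YrM r x (smooth_cst c) sf) Yr_cst mul0r add0r.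
by [].
Qed.

Lemma Yr_Yr r s f x : smooth f -> Yr r (Yr s f) x =
  \sum_i \sum_j yv r x 0 i * yv s x 0 j * partial i (partial j f) x +
  \sum_j beta s r j * partial j f x.
Proof.
move=> sf; have sm j : smooth (fun y => yv s y 0 j * partial j f y).
  by apply: smoothM; [apply: smooth_yv | apply: smooth_partial].
have E i : partial i (Yr s f) x =
    \sum_j (yv s x 0 j * partial i (partial j f) x + partial j f x * beta s i j).
  rewrite (partial_sum i _ x sm); apply: eq_bigr => j _.
  by rewrite (partialM i x (smooth_yv s j) (smooth_partial j sf)) partial_yv.
rewrite {1}/Yr (eq_bigr (fun i => \sum_j (yv r x 0 i * yv s x 0 j * partial i (partial j f) x +
  yv r x 0 i * beta s i j * partial j f x))); last first.
  by move=> i _; rewrite E mulr_sumr; apply: eq_bigr => j _; ring.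
under eq_bigr => i _ do rewrite big_split/=.
rewrite big_split/=; congr (_ + _).
rewrite exchange_big/=; apply: eq_bigr => j _.
have <- : (yv r x *m beta s) 0 j = beta s r j.
  by rewrite /yv mulmxDl -mulmxA beta_beta mulmx0 addr0 -rowE mxE.
by rewrite mxE mulr_suml; apply: eq_bigr => i _; ring.
Qed.

Lemma Yr_bracket r s f x : smooth f ->
  Yr r (Yr s f) x - Yr s (Yr r f) x = \sum_j (beta s r j - beta r s j) * partial j f x.
Proof.
move=> sf; rewrite (Yr_Yr r s x sf) (Yr_Yr s r x sf).
under [RHS]eq_bigr => j _ do rewrite mulrBl.
rewrite [RHS]sumrB.
set A := \sum_i _; set B := \sum_i \sum_j _; have -> : A = B.
  rewrite /A exchange_big/=; apply: eq_bigr => i _; apply: eq_bigr => j _.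
  by rewrite smooth_partialC// [yv r x 0 j * _]mulrC.
by rewrite opprD addrACA subrr add0r.
Qed.

Lemma beta_central s : s = o4 \/ s = o5 -> beta s = 0.
Proof.
move=> s45; apply/matrixP => i j; rewrite !mxE.
by case: s45 => ->; rewrite /= !addr0 subr0.
Qed.

Lemma beta_col r i j : j != o4 -> j != o5 -> beta r i j = 0.
Proof.
by move=> /negbTE j4 /negbTE j5; rewrite mxE j4 j5 !andbF !addr0 subr0.
Qed.

Lemma Yr_central s f x : s = o4 \/ s = o5 -> Yr s f x = partial s f x.
Proof.
move=> s45; rewrite /Yr /yv beta_central// mulmx0 addr0 (bigD1 s)//= mxE !eqxx mul1r.
by rewrite big1 ?addr0// => i si; rewrite mxE (negbTE si) andbF mul0r.
Qed.

Lemma Yr_comm_central r s f x : smooth f -> s = o4 \/ s = o5 ->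
  Yr r (Yr s f) x = Yr s (Yr r f) x.
Proof.
move=> sf s45; apply/eqP; rewrite -subr_eq0 Yr_bracket// big1// => j _.
rewrite (beta_central s45) [X in X - _]mxE sub0r mxE.
by case: s45 => ->; rewrite /= ?andbF /= !addr0 subr0 oppr0 mul0r.
Qed.

(** All brackets lie in the span of the two central fields, which kill $f$. *)
Lemma Yr_comm r s f x : smooth f -> (forall y, Yr o4 f y = 0) -> (forall y, Yr o5 f y = 0) ->
  Yr r (Yr s f) x = Yr s (Yr r f) x.
Proof.
move=> sf f4 f5; apply/eqP; rewrite -subr_eq0 Yr_bracket// big1// => j _.
have p4 : partial o4 f x = 0 by rewrite -(Yr_central f x (or_introl erefl)).
have p5 : partial o5 f x = 0 by rewrite -(Yr_central f x (or_intror erefl)).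
have [->|j4] := eqVneq j o4; first by rewrite p4 mulr0.
have [->|j5] := eqVneq j o5; first by rewrite p5 mulr0.
by rewrite !beta_col// subrr mul0r.
Qed.

Lemma YrE r f x : smooth f -> Yr r f x = 'D_(yv r x) f x.
Proof. by move=> sf; have [_ ->] := smooth_dir (yv r x) sf x. Qed.

Lemma Yr_invariant r f g : smooth f -> (forall x, f (heis_mul g x) = f x) ->
  forall x, Yr r f (heis_mul g x) = Yr r f x.
Proof.
move=> sf fg x; rewrite !YrE// /derive.
have -> // : (fun h : R => h^-1 *: ((f \o shift (heis_mul g x)) (h *: yv r (heis_mul g x)) -
    f (heis_mul g x))) = (fun h : R => h^-1 *: ((f \o shift x) (h *: yv r x) - f x)).
apply/funext => h /=; congr (_ *: (_ - _)); last exact: fg.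
by rewrite ![h *: _ + _]addrC -heis_mul_flow fg.
Qed.

Lemma Yr_MVT r f x t : smooth f -> exists2 s, `|s| <= `|t| &
  f (x + t *: yv r x) - f x = t * Yr r f (x + s *: yv r x).
Proof.
move=> sf; have [|s st E] := @MVT_line _ _ f (yv r x) x t.
  by move=> y; case: (smooth_dir (yv r x) sf y).
exists s => //; rewrite E; congr (_ * _).
by rewrite (YrE _ _ sf) yv_flow.
Qed.

End HeisenbergFields.

(** * A right-invariant mean on the group and integration on the quotient *)

Section HeisenbergMean.
Context {R : realType}.
Local Notation G := 'rV[R]_6.
Implicit Types (x y g h w z : G) (f : G -> R) (M c : R).

Lemma heis_mulA x y z : heis_mul x (heis_mul y z) = heis_mul (heis_mul x y) z.
Proof.
rewrite !heis_mulE.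
have -> : \sum_r (y + z + \sum_r0 z 0 r0 *: (y *m beta r0)) 0 r *: (x *m beta r) =
    \sum_r y 0 r *: (x *m beta r) + \sum_r z 0 r *: (x *m beta r).
  rewrite -big_split/=; apply: eq_bigr => r _.
  have e0 : (\sum_r0 z 0 r0 *: (y *m beta r0)) 0 r *: (x *m beta r) = 0.
    rewrite scalemxAr (_ : _ *: beta r = 0) ?mulmx0// summxE scaler_suml big1// => s _.
    rewrite !mxE -scalerA scaler_suml big1 ?scaler0// => i _.
    by rewrite -scalerA beta_out scaler0.
  by rewrite [(y + z + _) 0 r]mxE [(y + z) 0 r]mxE !scalerDl e0 addr0.
have -> : \sum_r z 0 r *: ((x + y + \sum_r0 y 0 r0 *: (x *m beta r0)) *m beta r) =
    \sum_r z 0 r *: (x *m beta r) + \sum_r z 0 r *: (y *m beta r).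
  rewrite -big_split/=; apply: eq_bigr => r _.
  rewrite !mulmxDl mulmx_suml [X in _ *: (_ + X)]big1 ?addr0 ?scalerDr// => s _.
  by rewrite -scalemxAl -mulmxA beta_beta mulmx0 scaler0.
move: (\sum_r z 0 r *: (y *m _)) (\sum_r y 0 r *: (x *m _)) (\sum_r z 0 r *: (x *m _)).
by move=> a b c; apply/rowP => j; rewrite !mxE; ring.
Qed.

Definition heis_div y x : G := (x - y) - \sum_r (x - y) 0 r *: (y *m beta r).

Lemma heis_mul_div y x : heis_mul y (heis_div y x) = x.
Proof.
rewrite heis_mulE /heis_div; set v := x - y.
have -> : \sum_r (v - \sum_r0 v 0 r0 *: (y *m beta r0)) 0 r *: (y *m beta r) =
    \sum_r v 0 r *: (y *m beta r).
  apply: eq_bigr => r _.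
  have e0 : (\sum_r0 v 0 r0 *: (y *m beta r0)) 0 r *: (y *m beta r) = 0.
    rewrite scalemxAr (_ : _ *: beta r = 0) ?mulmx0// summxE scaler_suml big1// => s _.
    rewrite !mxE -scalerA scaler_suml big1 ?scaler0// => i _.
    by rewrite -scalerA beta_out scaler0.
  move: e0; move: (\sum_r0 _) => W e0.
  have -> : (v - W) 0 r = v 0 r - W 0 r by rewrite !mxE.
  by rewrite scalerBl e0 subr0.
by rewrite addrA subrK /v addrC subrK.
Qed.

Lemma heis_mulr_continuous h : continuous (fun x => heis_mul x h).
Proof.
pose c (i : 'I_6) : G := delta_mx 0 i + \sum_r h 0 r *: row i (beta r).
have -> : (fun x => heis_mul x h) = (fun=> h) + \sum_(i < 6) (fun x : G => x 0 i *: c i).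
  apply/funext => x; rewrite fctE fct_sumE heis_mulE addrAC [LHS]addrC; congr (_ + _).
  rewrite {1}[x]row_sum_delta; under [RHS]eq_bigr => i _ do rewrite scalerDr.
  rewrite big_split/=; congr (_ + _); under eq_bigr => r _ do rewrite mulmx_sum_row scaler_sumr.
  rewrite exchange_big/=; apply: eq_bigr => i _; rewrite scaler_sumr.
  by apply: eq_bigr => r _; rewrite !scalerA mulrC.
move=> x; apply: differentiable_continuous; apply: differentiableD; first exact: differentiable_cst.
by apply: differentiable_sum => i; apply: differentiableZl; apply: differentiable_coord.
Qed.

(** Right translations are the ones required: they are the flows of left-invariant fields, while
    functions on the quotient are periodic under left translations. *)
Definition heis_mean_spec (m : (G -> R) -> R) := [/\
  forall f f' M N, bdd f M -> bdd f' N -> m (fun x => f x + f' x) = m f + m f',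
  forall c f M, bdd f M -> m (fun x => c * f x) = c * m f,
  forall f M, bdd f M -> `|m f| <= M,
  forall f M c, bdd f M -> (forall x, c <= f x) -> c <= m f &
  forall f M h, bdd f M -> m (fun x => f (heis_mul x h)) = m f].

(** The mean of the additive group is applied twice, first in the central coordinates $z$ and then
    in the others $w$. Right multiplication by $h$ is $(w,z)\mapsto(w+h, z+T(w))$: for fixed $w$ a
    translation in $z$, and then a translation in $w$. *)
Lemma heis_mean_exists : exists m, heis_mean_spec m.
Proof.
have [m [mD mZ mB m0 [mc mT]]] := @invariant_mean_exists R G.
pose mix w z : G := \row_j (if (j < 4)%N then w 0 j else z 0 j).
pose mm f := m (fun w => m (fun z => f (mix w z))).
have b1 f M : bdd f M -> bdd (fun w => m (fun z => f (mix w z))) M.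
  by move=> fM w; apply: mB => z; apply: fM.
exists mm; split.
- move=> f f' M N fM fN; rewrite /mm -(mD _ _ M N (b1 _ _ fM) (b1 _ _ fN)).
  by congr m; apply/funext => w; rewrite (mD _ _ M N (fun z => fM (mix w z)) (fun z => fN (mix w z))).
- move=> c f M fM; rewrite /mm -(mZ c _ M (b1 _ _ fM)).
  by congr m; apply/funext => w; rewrite (mZ c _ M (fun z => fM (mix w z))).
- by move=> f M fM; apply: mB; apply: b1.
- move=> f M c fM fc.
  have ge F N : bdd F N -> (forall w, c <= F w) -> c <= m F.
    move=> FN Fc; rewrite -subr_ge0.
    have nc : `|- c| <= `|c| by rewrite normrN.
    have cc : bdd (fun _ : G => - c) `|c| by move=> w; exact: nc.
    have := m0 (fun w => F w + - c) (N + `|c|).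
    rewrite (mD _ _ N `|c| FN cc) mc; apply.
      by move=> w; rewrite (le_trans (ler_normD _ _))// lerD.
    by move=> w; rewrite subr_ge0.
  apply: (ge _ M (b1 _ _ fM)) => w; apply: (ge _ M) => [z|z]; [exact: fM | exact: fc].
- move=> f M h fM.
  pose T w : G := h + \sum_r h 0 r *: (w *m beta r).
  have E w z : heis_mul (mix w z) h = mix (w + h) (z + T w).
    rewrite heis_mulE /T.
    have e r : mix w z *m beta r = w *m beta r.
      apply/rowP => j; rewrite !mxE; apply: eq_bigr => i _.
      case: (ltnP i 4) => i4; first by rewrite mxE i4.
      have i0 : (i == o0) = false by apply/eqP => i1; rewrite i1 in i4.
      have i1 : (i == o1) = false by apply/eqP => i1; rewrite i1 in i4.
      have -> : (beta r : 'M[R]_6) i j = 0.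
        by rewrite mxE i0 i1 !andbF /= !addr0 subr0.
      by rewrite !mulr0.
    rewrite (eq_bigr (fun r => h 0 r *: (w *m beta r))); last by move=> r _; rewrite e.
    have hS (j : 'I_6) : (j < 4)%N -> (\sum_r h 0 r *: (w *m beta r)) 0 j = 0.
      move=> j4; rewrite summxE big1// => r _; rewrite !mxE big1 ?mulr0// => i _.
      by rewrite beta_col ?mulr0//; apply/eqP => j5; rewrite j5 in j4.
    move: hS; move: (\sum_r h 0 r *: (w *m beta r)) => S hS.
    apply/rowP => j; rewrite !mxE; case: ltnP => j4; last by rewrite -addrA.
    by rewrite hS// addr0.
  rewrite /mm.
  transitivity (m (fun w => m (fun z => f (mix (w + h) z)))).
    congr m; apply/funext => w.
    transitivity (m (fun z => f (mix (w + h) (z + T w)))).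
      by congr m; apply/funext => z; rewrite E.
    apply: (mT (fun z => f (mix (w + h) z)) M) => z; exact: fM.
  exact: (mT (fun w => m (fun z => f (mix w z))) M h (b1 _ _ fM)).
Qed.

Section Quotient.
Context (Gam : set G) (hGam : heis_lattice Gam).
Context (m : (G -> R) -> R) (hm : heis_mean_spec m).

Definition lattice_periodic (T : Type) (f : G -> T) :=
  forall g, Gam g -> forall x, f (heis_mul g x) = f x.

Lemma periodic_bounded f : continuous f -> lattice_periodic f -> exists M, bdd f M.
Proof.
move=> cf pf; have [_ _ _ _ [K cK HK]] := hGam.
have cfK : compact (f @` K) by apply: continuous_compact => //; apply: continuous_subspaceT.
have [M [_ HM]] := compact_bounded cfK.
exists (M + 1) => x; have [g [k [Gg Kk ->]]] := HK x; rewrite pf//.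
by apply: (HM (M + 1)); [rewrite ltrDl | exists k].
Qed.

(** The difference quotient of $f$ along right multiplication by a one-parameter subgroup has mean
    zero. It converges uniformly to the derivative, because the second derivative is periodic, hence
    bounded. *)
Lemma mean_Yr r f : smooth f -> lattice_periodic f -> m (Yr r f) = 0.
Proof.
move=> sf pf; have [mD mZ mB _ mT] := hm.
have pY : lattice_periodic (Yr r f) by move=> g Gg; apply: Yr_invariant => // x; apply: pf.
have sY := smooth_Yr r sf.
have pYY : lattice_periodic (Yr r (Yr r f)) by move=> g Gg; apply: Yr_invariant => // x; apply: pY.
have [M fM] := periodic_bounded (smooth_continuous sf) pf.
have [N YN] := periodic_bounded (smooth_continuous sY) pY.
have [L YL] := periodic_bounded (smooth_continuous (smooth_Yr r sY)) pYY.
have L0 : 0 <= L by apply: le_trans (YL 0).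
apply/eqP; rewrite -normr_le0; apply/ler_addgt0Pr => e e0; rewrite add0r.
(* The error of the quotient is at most $tL\le e$; the summand 1 covers the case $L=0$. *)
pose t := e / (L + 1).
have t0 : 0 < t by rewrite divr_gt0// ltr_wpDl.
pose q x := t^-1 * (f (heis_mul x (t *: delta_mx 0 r)) - f x).
have near x : `|q x - Yr r f x| <= e.
  have [s st E] := Yr_MVT r x t sf.
  rewrite /q heis_mul_exp E mulKf ?gt_eqF//.
  have [s' st' E'] := Yr_MVT r x s sY.
  rewrite E' normrM (le_trans (ler_pM _ _ st (YL _)))//.
  rewrite gtr0_norm// /t -mulrA ler_piMr ?(ltW e0)// mulrC ler_pdivrMr ?mul1r ?ltr_wpDl//.
  by rewrite lerDl.
have qE : (fun x => q x) = (fun x => t^-1 * (f (heis_mul x (t *: delta_mx 0 r)) + (-1) * f x)).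
  by apply/funext => x; rewrite /q mulN1r.
have bN : bdd (fun x => (-1) * f x) M by move=> x; rewrite mulN1r normrN.
have bT : bdd (fun x => f (heis_mul x (t *: delta_mx 0 r))) M by move=> x.
have bq1 : bdd (fun x => f (heis_mul x (t *: delta_mx 0 r)) + (-1) * f x) (M + M).
  by move=> x; exact: (le_trans (ler_normD _ _) (lerD (bT x) (bN x))).
have mq : m q = 0.
  have -> : q = fun x => q x by [].
  by rewrite qE (mZ _ _ _ bq1) (mD _ _ _ _ bT bN) (mT _ _ _ fM) (mZ _ _ _ fM) mulN1r subrr mulr0.
have bD : bdd (fun x => Yr r f x + (-1) * q x) e.
  by move=> x; rewrite mulN1r distrC.
have := mB _ _ bD.
have bq : bdd q (e + N).
  move=> x; rewrite -[q x](subrK (Yr r f x)).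
  exact: (le_trans (ler_normD _ _) (lerD (near x) (YN x))).
have bNq : bdd (fun x => (-1) * q x) (e + N) by move=> x; rewrite mulN1r normrN.
by rewrite (mD _ _ _ _ YN bNq) (mZ _ _ _ bq) mq mulr0 addr0.
Qed.

(** If $f(x_0)>0$, finitely many right translates of $f$ have a sum bounded below by a positive
    constant on the compact fundamental set, hence everywhere by periodicity. That sum has positive
    mean, whereas each translate has mean $m(f)=0$. *)
Lemma mean_eq0 f : continuous f -> lattice_periodic f -> (forall x, 0 <= f x) -> m f = 0 ->
  forall x, f x = 0.
Proof.
move=> cf pf f0 mf x0; have [mD mZ mB mge mT] := hm.
have [M fM] := periodic_bounded cf pf.
apply/eqP/negPn/negP => nz; have c0 : 0 < f x0 by rewrite lt_neqAle eq_sym nz f0.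
have [_ _ _ _ [K cK HK]] := hGam.
(* Right multiplication by $y^{-1}x_0$ carries $y$ to $x_0$, so [U y] is a neighbourhood of $y$. *)
pose U y : set G := [set x | f x0 / 2 < f (heis_mul x (heis_div y x0))].
have oU y : open (U y).
  apply: (@open_comp _ _ (fun x => f (heis_mul x (heis_div y x0))) [set r | f x0 / 2 < r]).
    move=> x _; apply: continuous_comp; [exact: heis_mulr_continuous | exact: cf].
  exact: open_gt.
have KU : K `<=` cover setT U.
  move=> y Ky; exists y => //; rewrite /U/= heis_mul_div.
  by rewrite ltr_pdivrMr// ltr_pMr// ltr1n.
move: cK; rewrite compact_cover => /(_ _ setT U (fun y _ => oU y) KU)[D _ KD].
pose F x := \sum_(y <- finmap.enum_fset D) f (heis_mul x (heis_div y x0)).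
have FK x : f x0 / 2 <= F x.
  have [g [k [Gg Kk ->]]] := HK x; have [y yD Uy] := KD _ Kk.
  rewrite /F (eq_bigr (fun y => f (heis_mul k (heis_div y x0)))); last first.
    by move=> z _; rewrite -heis_mulA pf.
  rewrite (big_rem y)//=; apply: le_trans (ltW Uy) _; rewrite lerDl.
  by apply: sumr_ge0.
have [N FN mF] : exists2 N, bdd F N & m F = 0.
  rewrite /F; elim: (finmap.enum_fset D) => [|y s [N sN ms]].
    exists 0 => [x|]; first by rewrite big_nil normr0.
    have := mZ 0 f M fM; rewrite mul0r => E; rewrite -[RHS]E.
    by congr m; apply/funext => x; rewrite big_nil mul0r.
  exists (M + N) => [x|].
    by rewrite big_cons; exact: (le_trans (ler_normD _ _) (lerD (fM _) (sN x))).
  have bT : bdd (fun x => f (heis_mul x (heis_div y x0))) M by move=> x.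
  have -> : (fun x => \sum_(y0 <- y :: s) f (heis_mul x (heis_div y0 x0))) =
    (fun x => f (heis_mul x (heis_div y x0)) + \sum_(y0 <- s) f (heis_mul x (heis_div y0 x0))).
    by apply/funext => x; rewrite big_cons.
  by rewrite (mD _ _ _ _ bT sN) (mT _ _ _ fM) mf ms addr0.
have := mge F N (f x0 / 2) FN FK; rewrite mF leNgt divr_gt0//.
Qed.

End Quotient.
End HeisenbergMean.

(** * Invariant derivations of complex-valued functions *)

Section ComplexFields.
Context {R : realType}.
Local Notation C := R[i].
Local Notation G := 'rV[R]_6.
Implicit Types (x g : G) (r : 'I_6) (f : G -> C).

Definition csm f := csmooth_on setT f.

Lemma csm_cst (c : C) : csm (fun=> c).
Proof. by split; apply: smooth_cst. Qed.

Lemma csmD f f' : csm f -> csm f' -> csm (fun x => f x + f' x).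
Proof.
move=> [fr fi] [gr gi]; split.
  have := smoothD fr gr; congr smooth; apply/funext => x.
  by case: (f x) (f' x) => ? ? [].
have := smoothD fi gi; congr smooth; apply/funext => x.
by case: (f x) (f' x) => ? ? [].
Qed.

Lemma csmM f f' : csm f -> csm f' -> csm (fun x => f x * f' x).
Proof.
move=> [fr fi] [gr gi]; split.
  have := smoothB (smoothM fr gr) (smoothM fi gi); congr smooth; apply/funext => x.
  by case: (f x) (f' x) => ? ? [].
have := smoothD (smoothM fr gi) (smoothM fi gr); congr smooth; apply/funext => x.
by case: (f x) (f' x) => ? ? [].
Qed.

Lemma csm_conj f : csm f -> csm (fun x => (f x)^*).
Proof.
move=> [fr fi]; split.
  by move: fr; congr smooth; apply/funext => x; case: (f x).
have := smoothN fi; congr smooth; apply/funext => x; by case: (f x).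
Qed.

Lemma csm_sum (I : Type) (l : seq I) (F : I -> G -> C) :
  (forall a, csm (F a)) -> csm (fun x => \sum_(a <- l) F a x).
Proof.
move=> sF; elim: l => [|a l IH].
  by have := csm_cst 0; congr csm; apply/funext => x; rewrite big_nil.
by have := csmD (sF a) IH; congr csm; apply/funext => x; rewrite big_cons.
Qed.

Definition Yc r f x : C := Yr r (fun y => complex.Re (f y)) x +i* Yr r (fun y => complex.Im (f y)) x.

Lemma csm_Yc r f : csm f -> csm (Yc r f).
Proof. by move=> [fr fi]; exact: (conj (smooth_Yr r fr) (smooth_Yr r fi)). Qed.

Lemma YcD r f f' x : csm f -> csm f' ->
  Yc r (fun y => f y + f' y) x = Yc r f x + Yc r f' x.
Proof.
move=> [fr fi] [gr gi]; apply/eqP; rewrite eq_complex /=; apply/andP; split; apply/eqP.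
  rewrite -(YrD r x fr gr); congr Yr; apply/funext => y.
  by case: (f y) (f' y) => ? ? [].
rewrite -(YrD r x fi gi); congr Yr; apply/funext => y.
by case: (f y) (f' y) => ? ? [].
Qed.

Lemma YcM r f f' x : csm f -> csm f' ->
  Yc r (fun y => f y * f' y) x = Yc r f x * f' x + f x * Yc r f' x.
Proof.
move=> [fr fi] [gr gi]; rewrite /Yc.
have -> : (fun y => complex.Re (f y * f' y)) =
   (fun y => complex.Re (f y) * complex.Re (f' y) + (-1) * (complex.Im (f y) * complex.Im (f' y))).
  by apply/funext => y; case: (f y) (f' y) => ? ? [? ?] /=; rewrite mulN1r.
have -> : (fun y => complex.Im (f y * f' y)) =
   (fun y => complex.Re (f y) * complex.Im (f' y) + complex.Im (f y) * complex.Re (f' y)).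
  by apply/funext => y; case: (f y) (f' y) => ? ? [].
rewrite (YrD r x (smoothM fr gr) (smoothM (smooth_cst (-1)) (smoothM fi gi))).
rewrite (YrZ r (-1) x (smoothM fi gi)) (YrM r x fr gr) (YrM r x fi gi).
rewrite (YrD r x (smoothM fr gi) (smoothM fi gr)) (YrM r x fr gi) (YrM r x fi gr).
set a := Yr r _ x; set b := Yr r _ x; set c := Yr r _ x; set d := Yr r _ x.
move: a b c d => a b c d; case: (f x) (f' x) => p q [u v] /=.
by apply/eqP; rewrite eq_complex /=; apply/andP; split; apply/eqP; ring.
Qed.

Lemma Yc_cst r (c : C) x : Yc r (fun=> c) x = 0.
Proof. by rewrite /Yc !Yr_cst. Qed.

Lemma Yc_sum r (I : Type) (l : seq I) (F : I -> G -> C) x :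
  (forall a, csm (F a)) ->
  Yc r (fun y => \sum_(a <- l) F a y) x = \sum_(a <- l) Yc r (F a) x.
Proof.
move=> sF; elim: l => [|a l IH].
  rewrite big_nil -[RHS](Yc_cst r 0 x); congr (Yc _ _ _).
  by apply/funext => y; rewrite big_nil.
rewrite big_cons -IH -(YcD r x (sF a) (csm_sum l sF)).
by congr (Yc _ _ _); apply/funext => y; rewrite big_cons.
Qed.

Lemma Yc_conj r f x : csm f -> Yc r (fun y => (f y)^*) x = (Yc r f x)^*.
Proof.
move=> [fr fi]; rewrite /Yc.
have -> : (fun y => complex.Re ((f y)^*)) = (fun y => complex.Re (f y)).
  by apply/funext => y; case: (f y).
have -> : (fun y => complex.Im ((f y)^*)) = (fun y => (-1) * complex.Im (f y)).
  by apply/funext => y; rewrite mulN1r; case: (f y).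
by rewrite (YrZ r (-1) x fi) mulN1r.
Qed.

Lemma Yc_comm_central r s f x : csm f -> s = o4 \/ s = o5 ->
  Yc r (Yc s f) x = Yc s (Yc r f) x.
Proof.
by move=> [fr fi] s45; rewrite /Yc /= (Yr_comm_central r x fr s45) (Yr_comm_central r x fi s45).
Qed.

Lemma Yc_comm r s f x : csm f -> (forall y, Yc o4 f y = 0) -> (forall y, Yc o5 f y = 0) ->
  Yc r (Yc s f) x = Yc s (Yc r f) x.
Proof.
move=> [fr fi] f4 f5.
have f4r y : Yr o4 (fun z => complex.Re (f z)) y = 0 by have := congr1 (@complex.Re R) (f4 y).
have f5r y : Yr o5 (fun z => complex.Re (f z)) y = 0 by have := congr1 (@complex.Re R) (f5 y).
have f4i y : Yr o4 (fun z => complex.Im (f z)) y = 0 by have := congr1 (@complex.Im R) (f4 y).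
have f5i y : Yr o5 (fun z => complex.Im (f z)) y = 0 by have := congr1 (@complex.Im R) (f5 y).
have er := Yr_comm r s x fr f4r f5r; have ei := Yr_comm r s x fi f4i f5i.
exact: (congr2 (@Complex R) er ei).
Qed.

End ComplexFields.

(** * The ring of smooth lattice-periodic functions and its frame derivations *)

Section PeriodicFunctions.
Context {R : realType} (Gam : set 'rV[R]_6).
Local Notation C := R[i].
Local Notation G := 'rV[R]_6.

(** These functions form the commutative ring to which the abstract double complex is specialized;
    they are the smooth functions on the quotient. *)
Definition gsm_pred : {pred (G -> C)} := fun f => `[< csm f /\ lattice_periodic Gam f >].

Lemma gsm_subring_closed : subring_closed gsm_pred.
Proof.
split=> [|f f' /asboolP[sf pf] /asboolP[sg pg]|f f' /asboolP[sf pf] /asboolP[sg pg]]; apply/asboolP; split.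
- exact: csm_cst.
- by [].
- have := csmD sf (csmM (csm_cst (-1)) sg); congr csm; apply/funext => x.
  by rewrite mulN1r.
- by move=> g Gg x; rewrite !fctE pf// pg.
- exact: (csmM sf sg).
- by move=> g Gg x; rewrite !fctE pf// pg.
Qed.

HB.instance Definition _ := GRing.isSubringClosed.Build (G -> C) gsm_pred gsm_subring_closed.

Record gsm := Gsm { gval : G -> C; _ : gval \in gsm_pred }.
HB.instance Definition _ := [isSub for gval].
HB.instance Definition _ := [Choice of gsm by <:].
HB.instance Definition _ := GRing.SubChoice_isSubComPzRing.Build (G -> C) gsm_pred gsm gsm_subring_closed.


Implicit Types (f g : gsm) (c : C) (r s : 'I_6).

Lemma gsmP f : csm (gval f) /\ lattice_periodic Gam (gval f).
Proof. by case: f => f /= /asboolP. Qed.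

Lemma gsm_ext f g : (forall x, gval f x = gval g x) -> f = g.
Proof. by move=> fg; apply/val_inj/funext. Qed.

Lemma gvalD f g x : gval (f + g) x = gval f x + gval g x. Proof. by []. Qed.
Lemma gvalN f x : gval (- f) x = - gval f x. Proof. by []. Qed.
Lemma gvalM f g x : gval (f * g) x = gval f x * gval g x. Proof. by []. Qed.
Lemma gval0 x : gval 0 x = 0. Proof. by []. Qed.
Lemma gval_sum (I : Type) (l : seq I) (P : pred I) (F : I -> gsm) x :
  gval (\sum_(a <- l | P a) F a) x = \sum_(a <- l | P a) gval (F a) x.
Proof. by elim/big_rec2: _ => // a y y' _ <-. Qed.

Lemma gsm_cst_subproof c : (fun=> c) \in gsm_pred.
Proof. by apply/asboolP; split; [exact: csm_cst | ]. Qed.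
Definition gcst c := Gsm (gsm_cst_subproof c).

Lemma gcst_is_zmod_morphism : zmod_morphism gcst.
Proof. by move=> c d; apply: gsm_ext. Qed.
HB.instance Definition _ := GRing.isZmodMorphism.Build C gsm gcst gcst_is_zmod_morphism.
Lemma gcst_is_monoid_morphism : monoid_morphism gcst.
Proof. by split=> [|c d]; apply: gsm_ext. Qed.
HB.instance Definition _ := GRing.isMonoidMorphism.Build C gsm gcst gcst_is_monoid_morphism.

Lemma gconj_subproof f : (fun x => (gval f x)^*) \in gsm_pred.
Proof.
have [sf pf] := gsmP f; apply/asboolP; split; first exact: csm_conj.
by move=> g Gg x; rewrite pf.
Qed.
Definition gconj f := Gsm (gconj_subproof f).

Lemma gY_subproof r f : Yc r (gval f) \in gsm_pred.
Proof.
have [sf pf] := gsmP f; apply/asboolP; split; first exact: csm_Yc.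
move=> g Gg x; have [fr fi] := sf; rewrite /Yc.
have pr y : complex.Re (gval f (heis_mul g y)) = complex.Re (gval f y) by rewrite pf.
have pi y : complex.Im (gval f (heis_mul g y)) = complex.Im (gval f y) by rewrite pf.
by rewrite (Yr_invariant r fr pr) (Yr_invariant r fi pi).
Qed.
Definition gY r f := Gsm (gY_subproof r f).

Lemma gYD r f g : gY r (f + g) = gY r f + gY r g.
Proof. by apply: gsm_ext => x; apply: YcD (gsmP f).1 (gsmP g).1. Qed.

Lemma gYM r f g : gY r (f * g) = gY r f * g + f * gY r g.
Proof. by apply: gsm_ext => x; apply: YcM (gsmP f).1 (gsmP g).1. Qed.

Lemma gY_cst r c : gY r (gcst c) = 0.
Proof. by apply: gsm_ext => x; apply: Yc_cst. Qed.

Lemma gYZ r c f : gY r (gcst c * f) = gcst c * gY r f.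
Proof. by rewrite gYM gY_cst mul0r add0r. Qed.

Lemma gYN r f : gY r (- f) = - gY r f.
Proof.
have E h : - h = gcst (- 1) * h by apply: gsm_ext => x; rewrite gvalM gvalN mulN1r.
by rewrite (E f) gYZ -E.
Qed.

Lemma gY_sum r (I : Type) (l : seq I) (F : I -> gsm) :
  gY r (\sum_(a <- l) F a) = \sum_(a <- l) gY r (F a).
Proof.
elim: l => [|a l IH]; last by rewrite !big_cons gYD IH.
by rewrite !big_nil -{1}(raddf0 gcst) gY_cst.
Qed.

Lemma gYC r s f : s = o4 \/ s = o5 -> gY r (gY s f) = gY s (gY r f).
Proof. by move=> s45; apply: gsm_ext => x; apply: Yc_comm_central (gsmP f).1 s45. Qed.

Lemma gY_comm r s f : gY o4 f = 0 -> gY o5 f = 0 -> gY r (gY s f) = gY s (gY r f).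
Proof.
move=> f4 f5; apply: gsm_ext => x; apply: Yc_comm (gsmP f).1 _ _ => y.
  exact: (congr1 (fun h => gval h y) f4).
exact: (congr1 (fun h => gval h y) f5).
Qed.

Lemma gY_conj r f : gconj (gY r f) = gY r (gconj f).
Proof. by apply: gsm_ext => x; rewrite /= (Yc_conj r x (gsmP f).1). Qed.

Lemma gconjB f g : gconj (f - g) = gconj f - gconj g.
Proof. apply: gsm_ext => x; exact: (rmorphB (@conjc R) (gval f x) (gval g x)). Qed.
Lemma gconjM f g : gconj (f * g) = gconj f * gconj g.
Proof. apply: gsm_ext => x; exact: (rmorphM (@conjc R) (gval f x) (gval g x)). Qed.
Lemma gconjK : involutive gconj.
Proof. by move=> f; apply: gsm_ext => x; rewrite /= conjcK. Qed.
Lemma gconj_cst c : gconj (gcst c) = gcst c^*.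
Proof. exact: gsm_ext. Qed.
HB.instance Definition _ := GRing.isZmodMorphism.Build gsm gsm gconj gconjB.

Section Fields.
Context (Q : 'M[C]_6).
(** Column $j$ of $Q$ expresses the complex frame field $X_j$ through the real left-invariant
    fields. *)
Definition gX (j : 'I_6) f : gsm := \sum_r gcst (Q r j) * gY r f.

Lemma gXB j : zmod_morphism (gX j).
Proof.
move=> f g; rewrite /gX -sumrB; apply: eq_bigr => r _.
by rewrite gYD gYN mulrBr.
Qed.

Lemma gXM j f g : gX j (f * g) = gX j f * g + f * gX j g.
Proof.
rewrite /gX mulr_suml mulr_sumr -big_split; apply: eq_bigr => r _.
by rewrite gYM mulrDr mulrA (mulrCA f).
Qed.

Lemma gX_cst j c : gX j (gcst c) = 0.
Proof. by rewrite /gX big1// => r _; rewrite gY_cst mulr0. Qed.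

Lemma gX_gX i j f : gX i (gX j f) = \sum_r \sum_s gcst (Q r i) * gcst (Q s j) * gY r (gY s f).
Proof.
rewrite {1}/gX; apply: eq_bigr => r _; rewrite gY_sum mulr_sumr; apply: eq_bigr => s _.
by rewrite gYZ mulrA.
Qed.

Lemma gX_comm i j f : (forall r s, gcst (Q r i * Q s j) * gY r (gY s f) = gcst (Q r i * Q s j) * gY s (gY r f)) -> gX i (gX j f) = gX j (gX i f).
Proof.
move=> C; rewrite !gX_gX exchange_big/=; apply: eq_bigr => s _; apply: eq_bigr => r _.
by rewrite -rmorphM C (rmorphM gcst) (mulrC (gcst _) (gcst _)).
Qed.

Context (Q_central : forall r, Q r o2 = 2^-1 * ((r == o4)%:R - 'i * (r == o5)%:R)).
Context (Q_bar : forall r j, Q r (bar6 j) = (Q r j)^*).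

Lemma gX_conj j f : gconj (gX j f) = gX (bar6 j) (gconj f).
Proof.
rewrite /gX (raddf_sum gconj)/=; apply: eq_bigr => r _.
by rewrite gconjM gY_conj gconj_cst Q_bar.
Qed.

Lemma Q_central0 r j : j = o2 \/ j = o5 -> r != o4 -> r != o5 -> Q r j = 0.
Proof.
have [[_ _ b2] _] := bar6E.
move=> j25 /negbTE r4 /negbTE r5.
have q2 : Q r o2 = 0 by rewrite Q_central r4 r5 mulr0 subrr mulr0.
by case: j25 => ->//; rewrite -b2 Q_bar q2 conjc0.
Qed.

Lemma gXC j i f : j = o2 \/ j = o5 -> gX j (gX i f) = gX i (gX j f).
Proof.
move=> j25; apply: gX_comm => r s.
have [r4|r4] := eqVneq r o4; first by rewrite r4 (gYC s); auto.
have [r5|r5] := eqVneq r o5; first by rewrite r5 (gYC s); auto.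
by rewrite (Q_central0 j25 r4 r5) mul0r (raddf0 gcst) !mul0r.
Qed.

(** The real central fields are recovered as $Y_4=X_2+X_5$ and $iY_5=X_5-X_2$, so $f$ is killed by
    the centre, on which all brackets depend. *)
Lemma gX_comm_central i j f : gX o2 f = 0 -> gX o5 f = 0 -> gX i (gX j f) = gX j (gX i f).
Proof.
have [[_ _ b2] _] := bar6E.
have e p : p = o2 \/ p = o5 ->
    gX p f = gcst (Q o4 p) * gY o4 f + gcst (Q o5 p) * gY o5 f.
  move=> j25; rewrite /gX big_ord6/= (Q_central0 j25 (r := o0))// (Q_central0 j25 (r := o1))//.
  rewrite (Q_central0 j25 (r := o2))// (Q_central0 j25 (r := o3))//.
  by rewrite (raddf0 gcst) !mul0r !add0r.
have ci : ('i : C)^* = - 'i.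
  by apply/eqP; rewrite eq_complex/= oppr0 !eqxx.
have c2 : (2^-1 : C)^* = 2^-1 by rewrite conjc_inv conjc_nat.
have q42 : Q o4 o2 = 2^-1 by rewrite Q_central mulr0 subr0 mulr1.
have q52 : Q o5 o2 = - (2^-1 * 'i) by rewrite Q_central mulr1 sub0r mulrN.
have qb r : Q r o5 = (Q r o2)^* by rewrite -Q_bar b2.
have q45 : Q o4 o5 = 2^-1 by rewrite qb q42 c2.
have q55 : Q o5 o5 = 2^-1 * 'i.
  have cN (z : C) : (- z)^* = - z^* := rmorphN (@conjc R) z.
  have cM (y z : C) : (y * z)^* = y^* * z^* := rmorphM (@conjc R) y z.
  rewrite qb q52; apply: etrans (cN (2^-1 * 'i)) _.
  apply: etrans (congr1 -%R (cM 2^-1 'i)) _.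
  apply: etrans (congr1 -%R (congr2 *%R c2 ci)) _; by rewrite mulrN opprK.
have gN z : gcst (- z) = - gcst z := raddfN gcst z.
have gM y z : gcst (y * z) = gcst y * gcst z := rmorphM gcst y z.
have e2 : gX o2 f = gcst 2^-1 * (gY o4 f - gcst 'i * gY o5 f).
  rewrite (e o2 (or_introl erefl)) q42 q52 gN gM.
  by rewrite mulNr -mulrA -mulrBr.
have e5 : gX o5 f = gcst 2^-1 * (gY o4 f + gcst 'i * gY o5 f).
  rewrite (e o5 (or_intror erefl)) q45 q55 gM.
  by rewrite -mulrA -mulrDr.
move=> f2 f5.
have splitr1 : gcst 2^-1 + gcst 2^-1 = 1.
  apply: gsm_ext => x; rewrite gvalD /=; have := splitr (1 : C); by rewrite mul1r.
have f4' : gY o4 f = gX o2 f + gX o5 f.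
  rewrite e2 e5 -mulrDr addrACA addNr addr0 mulrDr -mulrDl.
  by rewrite splitr1 mul1r.
have f5' : gcst 'i * gY o5 f = gX o5 f - gX o2 f.
  rewrite e2 e5 -mulrBr opprB addrCA addrAC subrr add0r mulrDr -mulrDl.
  by rewrite splitr1 mul1r.
apply: gX_comm => r s; congr (_ * _); apply: gY_comm; first by rewrite f4' f2 f5 addr0.
have i1 : gcst ('i^-1) * gcst 'i = 1 by rewrite -gM mulVf ?neq0Ci ?(rmorph1 gcst).
by rewrite -[LHS]mul1r -i1 -mulrA f5' f2 f5 subrr mulr0.
Qed.
End Fields.

End PeriodicFunctions.

(** * Solutions of the harmonic system on the quotient are constant *)

Section HarmonicCoefficients.
Context {R : realType} (Gam : set 'rV[R]_6) (hGam : heis_lattice Gam).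
Local Notation C := R[i].
Local Notation G := 'rV[R]_6.
Local Notation A := (gsm Gam).
Implicit Types (f g : A) (c : C) (r s : 'I_6).

Lemma gsm_smooth_re f : smooth (fun x => complex.Re (gval f x)).
Proof. exact: (gsmP f).1.1. Qed.

Lemma gsm_periodic_re f : lattice_periodic Gam (fun x => complex.Re (gval f x)).
Proof. by have [_ pf] := gsmP f; move=> g Gg x; rewrite pf. Qed.

Section Mean.
Context (m : (G -> R) -> R) (hm : heis_mean_spec m).

(** Only the real part is averaged: the abstract argument asks for an additive map that kills
    derivatives and is definite on squared norms, and complex linearity is not part of it. *)
Definition gmean f := m (fun x => complex.Re (gval f x)).

Lemma gmean_bdd f : exists M, bdd (fun x => complex.Re (gval f x)) M.
Proof.
exact: (periodic_bounded hGam (smooth_continuous (gsm_smooth_re f)) (gsm_periodic_re f)).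
Qed.

Lemma gmeanB : zmod_morphism gmean.
Proof.
have [mD mZ _ _ _] := hm.
move=> f g; rewrite /gmean; have [M fM] := gmean_bdd f; have [N gN] := gmean_bdd g.
have bN : bdd (fun x => (-1) * complex.Re (gval g x)) N by move=> x; rewrite mulN1r normrN.
rewrite -[- m _]mulN1r -(mZ _ _ _ gN) -(mD _ _ _ _ fM bN); congr m; apply/funext => x.
by rewrite mulN1r gvalD gvalN; case: (gval f x) (gval g x) => ? ? [].
Qed.
HB.instance Definition _ := GRing.isZmodMorphism.Build A R gmean gmeanB.

Lemma gmean_gY r f : gmean (gY r f) = 0.
Proof. exact: (mean_Yr hGam hm r (gsm_smooth_re f) (gsm_periodic_re f)). Qed.

Lemma gmean_gX Q j f : gmean (gX Q j f) = 0.
Proof.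
rewrite /gX (raddf_sum gmean)/= big1 => [|r _]; first by [].
by have := gmean_gY r (gcst Gam (Q r j) * f); rewrite gYZ.
Qed.

Lemma gmean_eq0 f : (forall x, 0 <= complex.Re (gval f x)) -> gmean f = 0 ->
  forall x, complex.Re (gval f x) = 0.
Proof.
exact: (mean_eq0 hGam hm (smooth_continuous (gsm_smooth_re f)) (gsm_periodic_re f)).
Qed.

Lemma Re_mulC_ge0 (c : C) : 0 <= complex.Re (c * c^*).
Proof. by case: c => a b /=; rewrite mulrN opprK -!expr2 addr_ge0 ?sqr_ge0. Qed.

Lemma Re_mulC_eq0 (c : C) : complex.Re (c * c^*) = 0 -> c = 0.
Proof.
case: c => a b /= /eqP; rewrite mulrN opprK -!expr2 paddr_eq0 ?sqr_ge0// !sqrf_eq0.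
by case/andP => /eqP -> /eqP ->.
Qed.

Lemma gmean_wpos (w : {set 'I_6} -> R) (u : {ffun {set 'I_6} -> A}) : (forall S, 0 < w S) ->
  gmean (\sum_(S : {set 'I_6}) gcst Gam (w S)%:C * (u S * gconj (u S))) = 0 -> u = 0.
Proof.
move=> w0 um.
have E x : complex.Re (gval (\sum_(S : {set 'I_6}) gcst Gam (w S)%:C * (u S * gconj (u S))) x) =
    \sum_(S : {set 'I_6}) w S * complex.Re (gval (u S) x * (gval (u S) x)^*).
  rewrite gval_sum (raddf_sum (@complex.Re R)); apply: eq_bigr => S _.
  have cR (a : R) (z : C) : complex.Re (a%:C * z) = a * complex.Re z.
    by case: z => p q /=; rewrite mul0r subr0.
  exact: cR.
have p0 x S : 0 <= w S * complex.Re (gval (u S) x * (gval (u S) x)^*).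
  exact: mulr_ge0 (ltW (w0 S)) (Re_mulC_ge0 _).
apply/ffunP => S; rewrite ffunE; apply: gsm_ext => x; rewrite gval0.
have : complex.Re (gval (\sum_(S : {set 'I_6}) gcst Gam (w S)%:C * (u S * gconj (u S))) x) = 0.
  by apply: gmean_eq0 => // y; rewrite E sumr_ge0.
rewrite E => /eqP; rewrite psumr_eq0 => [/allP/(_ S (mem_index_enum S))/=|T _]; last exact: p0.
by rewrite mulf_eq0 (gt_eqF (w0 S))/= => /eqP/Re_mulC_eq0.
Qed.

Lemma gmean_pos f : gmean (f * gconj f) = 0 -> f = 0.
Proof.
move=> fm; apply: gsm_ext => x; apply: Re_mulC_eq0.
by apply: (gmean_eq0 (f := f * gconj f)) => // y; apply: Re_mulC_ge0.
Qed.
End Mean.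

Context (Q B : 'M[C]_6) (k : R) (al : C) (w : {set 'I_6} -> R).
Context (Q_central : forall r, Q r o2 = 2^-1 * ((r == o4)%:R - 'i * (r == o5)%:R)).
Context (Q_bar : forall r j, Q r (bar6 j) = (Q r j)^*).
Context (QB : Q *m B = 1%:M).
Context (w_gt0 : forall S, 0 < w S).

Local Notation X := (@gX R Gam Q).
Local Notation gk := (gcst Gam k%:C).

Definition harmonic_system (u : {ffun {set 'I_6} -> A}) :=
  harmonic_form X gk (gcst Gam al) (gcst Gam al^*) (fun S => gcst Gam (w S)%:C) u.

Lemma harmonic_gY u : harmonic_system u -> forall S r, gY r (u S) = 0.
Proof.
move=> hu; have [m hm] := @heis_mean_exists R.
have cR (c : R) : gconj (gcst Gam c%:C) = gcst Gam c%:C.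
  by apply: gsm_ext => x /=; rewrite oppr0.
have X0 : forall i, Xv X i u = 0.
  apply: (@harmonic_invariant _ _ X (@gconj R Gam) (gmean m) gk (gcst Gam al) (gcst Gam al^*) (fun S => gcst Gam (w S)%:C)) => //.
  - exact: gXB.
  - exact: gXM.
  - by move=> i f; apply: gXC => //; left.
  - by move=> i f; apply: gXC => //; right.
  - by move=> i j f; apply: gX_comm_central.
  - exact: gconjB.
  - exact: gconjM.
  - by apply: gsm_ext => x /=; rewrite oppr0.
  - exact: gconjK.
  - by move=> i f; apply: gX_conj.
  - exact: gmeanB.
  - by move=> i f; apply: gmean_gX.
  - by move=> f; apply: gmean_pos.
  - by move=> v; apply: gmean_wpos.
  - by move=> i; apply: gX_cst.
  - by move=> i; apply: gX_cst.
  - by move=> i; apply: gX_cst.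
  - by move=> i S; apply: gX_cst.
  - exact: gconj_cst.
move=> S r.
have XS j : X j (u S) = 0 by have := congr1 (fun v : {ffun {set 'I_6} -> A} => v S) (X0 j); rewrite !ffunE.
(* The inverse matrix writes each real field as a combination of the frame fields, all of which kill
   the coefficient. *)
transitivity (\sum_j gcst Gam (B j r) * X j (u S)); last first.
  by rewrite big1// => j _; rewrite XS mulr0.
have gM y z : gcst Gam (y * z) = gcst Gam y * gcst Gam z := rmorphM (@gcst R Gam) y z.
rewrite /gX; under eq_bigr => j _ do rewrite mulr_sumr.
rewrite exchange_big/=.
have QBE s : \sum_j gcst Gam (B j r) * (gcst Gam (Q s j) * gY s (u S)) = gcst Gam ((s == r)%:R) * gY s (u S).
  have -> : (s == r)%:R = \sum_j B j r * Q s j.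
    have := congr1 (fun M : 'M[C]_6 => M s r) QB; rewrite !mxE => <-.
    by apply: eq_bigr => j _; rewrite mulrC.
  rewrite (raddf_sum (@gcst R Gam)) mulr_suml; apply: eq_bigr => j _.
  by rewrite mulrA -gM.
under eq_bigr => s _ do rewrite QBE.
rewrite (bigD1 r)//= eqxx big1 ?addr0 => [|s /negbTE ->].
  by rewrite (rmorph1 (@gcst R Gam)) mul1r.
by rewrite (raddf0 (@gcst R Gam)) mul0r.
Qed.

(** The central fields are the partial derivatives in coordinates 4 and 5. The other fields differ
    from partial derivatives only by combinations of these two, so all partial derivatives
    vanish. *)
Lemma smooth_Yr_const (f : G -> R) : smooth f -> (forall r x, Yr r f x = 0) -> forall x, f x = f 0.
Proof.
move=> sf Yf.
have p45 s x : s = o4 \/ s = o5 -> partial s f x = 0.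
  by move=> s45; rewrite -(Yr_central f x s45) Yf.
have pf i x : partial i f x = 0.
  have yvE j : yv i x 0 j = (j == i)%:R + \sum_l x 0 l * beta i l j.
    by rewrite /yv !mxE eqxx.
  have := Yf i x; rewrite /Yr (bigD1 i)//= big1 => [|j ji].
    rewrite addr0 yvE eqxx big1 ?addr0 ?mul1r// => l _.
    have [i4|i4] := eqVneq i o4; first by rewrite (beta_central (or_introl i4)) mxE mulr0.
    have [i5|i5] := eqVneq i o5; first by rewrite (beta_central (or_intror i5)) mxE mulr0.
    by rewrite beta_col ?mulr0.
  have [j4|j4] := eqVneq j o4; first by rewrite (p45 _ _ (or_introl j4)) mulr0.
  have [j5|j5] := eqVneq j o5; first by rewrite (p45 _ _ (or_intror j5)) mulr0.
  rewrite yvE (negbTE ji) add0r big1 ?mul0r// => l _.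
  by rewrite beta_col ?mulr0.
move=> x; have D y : is_derive y x f 0.
  have := smooth_dir x sf y; rewrite big1// => i _; by rewrite pf mulr0.
have [|s _ E] := @MVT_line _ _ f x 0 1.
  by move=> y; apply: ex_derive; apply: (D y).
by have := E; rewrite scale1r add0r (@derive_val _ _ _ _ _ _ _ (D _)) mulr0 => /eqP; rewrite subr_eq0 => /eqP.
Qed.

Lemma harmonic_const u : harmonic_system u -> forall S x, gval (u S) x = gval (u S) 0.
Proof.
move=> hu S x; have [[sr si] _] := gsmP (u S).
have Y0 r y : Yc r (gval (u S)) y = 0 := congr1 (fun h => gval h y) (harmonic_gY hu S r).
have Er := smooth_Yr_const sr (fun r y => congr1 (@complex.Re R) (Y0 r y)) x.
have Ei := smooth_Yr_const si (fun r y => congr1 (@complex.Im R) (Y0 r y)) x.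
by apply/eqP; rewrite eq_complex Er Ei !eqxx.
Qed.

End HarmonicCoefficients.

(** * The exterior derivative in a moving coframe *)

Section FrameDerivative.
Context {R : realType}.
Local Notation C := R[i].
Local Notation G := 'rV[R]_6.
Implicit Types (x y : G) (i j r s l : 'I_6) (f g : G -> C) (a u v : dform R 5) (t : G -> 'rV[C]_6).

(* Row r is the covector dual to the vector field yv r. *)
Definition coframe x : 'M[R]_6 := \matrix_(r, i) ((r == i)%:R - (x *m beta i) 0 r).

Lemma coframe_yv x i j : \sum_r coframe x r i * yv r x 0 j = (i == j)%:R.
Proof.
pose N i j := (x *m beta i) 0 j.
have E r : coframe x r i * yv r x 0 j =
    (r == i)%:R * ((j == r)%:R + N r j) - N i r * (j == r)%:R - N i r * N r j.
  have -> : yv r x 0 j = (j == r)%:R + N r j.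
    by rewrite /yv [LHS]mxE; congr (_ + _); rewrite mxE eqxx.
  have -> : coframe x r i = (r == i)%:R - N i r by rewrite mxE.
  ring.
under eq_bigr => r _ do rewrite E.
rewrite !sumrB (bigD1 i)//= eqxx mul1r big1 => [|r /negbTE ->]; last by rewrite mul0r.
rewrite (bigD1 j)//= eqxx mulr1 big1 => [|r /negbTE rj]; last by rewrite eq_sym rj mulr0.
rewrite !addr0 addrK big1 ?subr0 1?eq_sym// => r _.
rewrite /N mxE mulr_suml big1// => l _; rewrite [(x *m beta r) 0 j]mxE mulr_sumr big1// => p _.
have := congr1 (fun M : 'M[R]_6 => M p j) (beta_out i l r); rewrite [LHS]mxE [RHS]mxE => e.
by rewrite -mulrA (mulrCA (beta i l r)) e !mulr0.
Qed.

Lemma cpartialE i f x : cpartial i f x = \sum_r (coframe x r i)%:C * Yc r f x.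
Proof.
have P (g : G -> R) : partial i g x = \sum_r coframe x r i * Yr r g x.
  transitivity (\sum_j (i == j)%:R * partial j g x).
    rewrite (bigD1 i)//= eqxx mul1r big1 ?addr0// => j; rewrite eq_sym => /negbTE ->.
    by rewrite mul0r.
  under [RHS]eq_bigr => r _ do rewrite /Yr mulr_sumr.
  rewrite exchange_big/=; apply: eq_bigr => j _; rewrite -(coframe_yv x) mulr_suml.
  by apply: eq_bigr => r _; rewrite mulrA.
have S (F F' : 'I_6 -> R) : \sum_r (F r +i* F' r) = (\sum_r F r) +i* (\sum_r F' r).
  by rewrite !big_ord6.
rewrite /cpartial !P -S; apply: eq_bigr => r _.
by apply/eqP; rewrite eq_complex /= !mul0r subr0 addr0 !eqxx.
Qed.

Lemma cpartialM i f g x : csm f -> csm g ->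
  cpartial i (fun y => f y * g y) x = cpartial i f x * g x + f x * cpartial i g x.
Proof.
move=> sf sg; rewrite !cpartialE mulr_suml mulr_sumr -big_split; apply: eq_bigr => r _.
by rewrite (YcM r x sf sg) mulrDr mulrA (mulrCA (f x)).
Qed.

Lemma cpartial_cst i (c : C) x : cpartial i (fun=> c) x = 0.
Proof. by rewrite cpartialE big1// => r _; rewrite Yc_cst mulr0. Qed.

Lemma cpartialZ i (c : C) f x : csm f -> cpartial i (fun y => c * f y) x = c * cpartial i f x.
Proof. by move=> sf; rewrite (cpartialM i x (csm_cst c) sf) cpartial_cst mul0r add0r. Qed.

Lemma cpartial_sum i (I : Type) (s : seq I) (F : I -> G -> C) x :
  (forall b, csm (F b)) ->
  cpartial i (fun y => \sum_(b <- s) F b y) x = \sum_(b <- s) cpartial i (F b) x.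
Proof.
move=> sF; rewrite cpartialE; under [RHS]eq_bigr => b _ do rewrite cpartialE.
rewrite exchange_big/=; apply: eq_bigr => r _.
by rewrite (Yc_sum r s x sF) mulr_sumr.
Qed.

Definition dpart i a x : ext R 6 := [ffun S : {set 'I_6} => cpartial i (fun y => a y S) x].

Lemma dpartE i a x S : dpart i a x S = cpartial i (fun y => a y S) x.
Proof. by rewrite ffunE. Qed.

Lemma ext_dE a x : ext_d a x = \sum_i eps i (dpart i a x).
Proof. by apply: eq_bigr => i _; rewrite wedge_ebasis1. Qed.

Definition grow f x : 'rV[C]_6 := \row_i cpartial i f x.
Definition drow i t x : 'rV[C]_6 := \row_j cpartial i (fun y => t y 0 j) x.

Definition fsm a := forall S, csm (fun x => a x S).
Definition tsm t := forall j, csm (fun x => t x 0 j).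

Lemma eps_coef j (w : ext R 6) S : eps j w S = (if j \in S then sg j (S :\ j)%SET else 0) * w (S :\ j)%SET.
Proof. by rewrite ffunE; case: ifP; rewrite ?mul0r. Qed.

Lemma cov_coef (t : 'rV[C]_6) (w : ext R 6) S : cov t w S =
  \sum_j t 0 j * ((if j \in S then sg j (S :\ j)%SET else 0) * w (S :\ j)%SET).
Proof. by rewrite covE sum_ffunE; apply: eq_bigr => j _; rewrite ffunE eps_coef. Qed.

Lemma fsm_cov t u : tsm t -> fsm u -> fsm (fun y => cov (t y) (u y)).
Proof.
move=> st su S; have := csm_sum (index_enum 'I_6) (fun j => csmM (st j)
  (csmM (csm_cst (if j \in S then sg j (S :\ j)%SET else 0)) (su (S :\ j)%SET))).
by congr csm; apply/funext => y; rewrite cov_coef.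
Qed.

Lemma dpart_cov i t u x : tsm t -> fsm u ->
  dpart i (fun y => cov (t y) (u y)) x = cov (drow i t x) (u x) + cov (t x) (dpart i u x).
Proof.
move=> st su; apply/ffunP => S; rewrite !ffunE !cov_coef -big_split/=.
have -> : (fun y => cov (t y) (u y) S) = fun y => \sum_j t y 0 j *
    ((if j \in S then sg j (S :\ j)%SET else 0) * u y (S :\ j)%SET).
  by apply/funext => y; rewrite cov_coef.
have sZ j := csmM (csm_cst (if j \in S then sg j (S :\ j)%SET else 0)) (su (S :\ j)%SET).
rewrite (cpartial_sum i _ x (fun j => csmM (st j) (sZ j))); apply: eq_bigr => j _.
by rewrite (cpartialM i x (st j) (sZ j)) (cpartialZ i _ x (su _)) !mxE !ffunE.
Qed.

Lemma ext_d_cov t u x : tsm t -> fsm u ->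
  ext_d (fun y => cov (t y) (u y)) x =
  wedge (ext_d (fun y => covector (t y)) x) (u x) - cov (t x) (ext_d u x).
Proof.
move=> st su; rewrite !ext_dE wedge_suml.
have -> : (fun y => covector (t y)) = fun y => cov (t y) (ebasis R finset.set0).
  by apply/funext => y; rewrite covectorE.
have s1 : fsm (fun=> ebasis R finset.set0) by move=> S; exact: csm_cst.
rewrite (raddf_sum (cov (t x)))/= -sumrB; apply: eq_bigr => i _.
rewrite (dpart_cov i x st su) (dpart_cov i x st s1) (raddfD (eps i))/=.
rewrite cov_eps opprK; congr (_ + _).
have -> : dpart i (fun=> ebasis R finset.set0) x = 0.
  by apply/ffunP => S; rewrite !ffunE cpartial_cst.
by rewrite covr0 addr0 eps_wedge cov_wedge wedge1l.
Qed.

Lemma fsm_esc f u : csm f -> fsm u -> fsm (fun y => esc (f y) (u y)).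
Proof.
move=> sf su S; have := csmM sf (su S).
by congr csm; apply/funext => y; rewrite ffunE.
Qed.

Lemma ext_d_esc f u x : csm f -> fsm u ->
  ext_d (fun y => esc (f y) (u y)) x = cov (grow f x) (u x) + esc (f x) (ext_d u x).
Proof.
move=> sf su; rewrite !ext_dE covE esc_sum -big_split; apply: eq_bigr => i _ /=.
rewrite -!eps_esc -(raddfD (eps i))/=; congr (eps i _); apply/ffunP => S.
have -> : dpart i (fun y => esc (f y) (u y)) x S = cpartial i (fun y => f y * u y S) x.
  rewrite dpartE; apply: (congr1 (fun h => cpartial i h x)); apply/funext => y.
  by rewrite ffunE.
rewrite (cpartialM i x sf (su S)) [RHS]ffunE; congr (_ + _); rewrite [RHS]ffunE.
  by rewrite mxE.
by rewrite [dpart _ _ _ _]ffunE.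
Qed.

Lemma ext_d_sum (I : Type) (s : seq I) (F : I -> dform R 5) x : (forall b, fsm (F b)) ->
  ext_d (fun y => \sum_(b <- s) F b y) x = \sum_(b <- s) ext_d (F b) x.
Proof.
move=> sF; rewrite ext_dE; under [RHS]eq_bigr => b _ do rewrite ext_dE.
rewrite exchange_big/=; apply: eq_bigr => i _.
rewrite -(raddf_sum (eps i))/=; congr (eps i _); apply/ffunP => S; rewrite sum_ffunE ffunE.
under [RHS]eq_bigr => b _ do rewrite ffunE.
apply: etrans (cpartial_sum i s x (fun b => sF b S)); apply: (congr1 (fun h => cpartial i h x)).
by apply/funext => y; rewrite sum_ffunE.
Qed.

Section Frame.
Context (B : G -> 'M[C]_6) (W : 'I_6 -> ext R 6 -> ext R 6) (D : 'I_6 -> (G -> C) -> G -> C).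
Context (sB : forall r j, csm (fun x => B x r j)).
Context (W_zmod : forall r, zmod_morphism (W r)).
Context (W_eps : forall r i (w : ext R 6), W r (eps i w) = eps i (W r w)).
Context (W_esc : forall r c (w : ext R 6), W r (esc c w) = esc c (W r w)).
Context (dB : forall r x (w : ext R 6),
  wedge (ext_d (fun y => covector (row r (B y))) x) (ext_map (B x) w) = ext_map (B x) (W r w)).
Context (DB : forall f x, grow f x = \sum_j D j f x *: row j (B x)).

HB.instance Definition _ r := GRing.isZmodMorphism.Build _ _ (W r) (W_zmod r).

(** [W r] is multiplication by $de_r$ read in the coframe. Replacing one factor $e_r$ by $de_r$ is
    contraction followed by this multiplication, so the sum is the exterior derivative on forms with
    constant coefficients. *)
Definition torsion (u : ext R 6) := \sum_r W r (iot r u).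

Lemma torsion_zmod : zmod_morphism torsion.
Proof.
move=> u v; rewrite /torsion -sumrB; apply: eq_bigr => r _.
by rewrite (raddfB (iot r)) (raddfB (W r)).
Qed.
HB.instance Definition _ := GRing.isZmodMorphism.Build _ _ torsion torsion_zmod.

Lemma torsion_esc c (u : ext R 6) : torsion (esc c u) = esc c (torsion u).
Proof. by rewrite /torsion esc_sum; apply: eq_bigr => r _; rewrite iot_esc W_esc. Qed.

Lemma torsion_eps i (u : ext R 6) : torsion (eps i u) = W i u - eps i (torsion u).
Proof.
rewrite /torsion (raddf_sum (eps i))/= (bigD1 i)//= [in RHS](bigD1 i)//= iot_eps_eq.
rewrite (raddfB (W i))/= W_eps -addrA opprD; congr (_ + (_ + _)).
rewrite -sumrN; apply: eq_bigr => r ri; rewrite iot_eps// (raddfN (W r))/=.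
by rewrite W_eps.
Qed.

Lemma tsm_row r : tsm (fun y => row r (B y)).
Proof. by move=> j; have := sB r j; congr csm; apply/funext => y; rewrite mxE. Qed.

Lemma fsm_frame_ebasis S : fsm (fun y => ext_map (B y) (ebasis R S)).
Proof.
elim/ord_set_ind: S => [T|i S iS IH T].
  by have := csm_cst (ebasis R finset.set0 T); congr csm; apply/funext => y; rewrite ext_map1.
have := fsm_cov (tsm_row i) IH T; congr csm; apply/funext => y.
by rewrite -(@eps_ebasis_min R _ _ _ iS) ext_map_eps.
Qed.

Lemma ext_d_frame_ebasis S x :
  ext_d (fun y => ext_map (B y) (ebasis R S)) x = ext_map (B x) (torsion (ebasis R S)).
Proof.
elim/ord_set_ind: S => [|i S iS IH].
  rewrite /torsion big1 => [|r _]; last by rewrite iot_ebasis0 (raddf0 (W r)).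
  rewrite (raddf0 (ext_map (B x))) ext_dE big1// => i _.
  have -> : dpart i (fun y => ext_map (B y) (ebasis R finset.set0)) x = 0.
    apply/ffunP => S; rewrite !ffunE -[RHS](cpartial_cst i (ebasis R finset.set0 S) x); apply: (congr1 (fun h => cpartial i h x)).
    by apply/funext => y; rewrite ext_map1.
  exact: (raddf0 (eps i)).
have -> : (fun y => ext_map (B y) (ebasis R (i |: S)%SET)) =
    fun y => cov (row i (B y)) (ext_map (B y) (ebasis R S)).
  by apply/funext => y; rewrite -(@eps_ebasis_min R _ _ _ iS) ext_map_eps.
rewrite (ext_d_cov x (tsm_row i) (fsm_frame_ebasis S)) dB IH.
by rewrite -(@eps_ebasis_min R _ _ _ iS) torsion_eps (raddfB (ext_map (B x)))/= ext_map_eps.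
Qed.

Lemma frame_sum v y : ext_map (B y) (v y) = \sum_(S : {set 'I_6}) esc (v y S) (ext_map (B y) (ebasis R S)).
Proof.
rewrite {1}[v y]ebasis_sum (raddf_sum (ext_map (B y)))/=.
by apply: eq_bigr => S _; rewrite ext_map_esc.
Qed.

Lemma fsm_frame v : fsm v -> fsm (fun y => ext_map (B y) (v y)).
Proof.
move=> sv S; have := csm_sum (index_enum {set 'I_6}) (fun T => fsm_esc (sv T) (fsm_frame_ebasis T) S).
by congr csm; apply/funext => y; rewrite frame_sum sum_ffunE.
Qed.

Lemma ext_d_frame v x : fsm v ->
  ext_d (fun y => ext_map (B y) (v y)) x =
  ext_map (B x) (\sum_j eps j [ffun S : {set 'I_6} => D j (fun y => v y S) x] + torsion (v x)).
Proof.
move=> sv.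
have -> : (fun y => ext_map (B y) (v y)) =
    fun y => \sum_(S : {set 'I_6}) esc (v y S) (ext_map (B y) (ebasis R S)).
  by apply/funext => y; rewrite frame_sum.
rewrite (ext_d_sum _ x (fun S => fsm_esc (sv S) (fsm_frame_ebasis S))).
under eq_bigr => S _ do rewrite (ext_d_esc x (sv S) (fsm_frame_ebasis S)) ext_d_frame_ebasis.
rewrite big_split/= (raddfD (ext_map (B x)))/=; congr (_ + _); last first.
  rewrite {2}[v x]ebasis_sum (raddf_sum torsion) (raddf_sum (ext_map (B x)))/=.
  by apply: eq_bigr => S _; rewrite torsion_esc ext_map_esc.
rewrite (raddf_sum (ext_map (B x)))/=.
under eq_bigr => S _ do rewrite DB.
have covS (I : finType) (c : I -> C) (F : I -> 'rV[C]_6) w :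
    cov (\sum_b c b *: F b) w = \sum_b esc (c b) (cov (F b) w).
  rewrite covE; under [RHS]eq_bigr => b _ do rewrite covE esc_sum.
  rewrite exchange_big/=; apply: eq_bigr => j _; apply/ffunP => S.
  rewrite !ffunE sum_ffunE summxE mulr_suml; apply: eq_bigr => b _.
  by rewrite !ffunE mxE mulrA.
under eq_bigr => S _ do rewrite covS.
rewrite exchange_big/=; apply: eq_bigr => j _; rewrite ext_map_eps.
have -> : [ffun S : {set 'I_6} => D j (fun y => v y S) x] = \sum_S esc (D j (fun y => v y S) x) (ebasis R S) :> ext R 6.
  by rewrite {1}[LHS]ebasis_sum; apply: eq_bigr => S _; rewrite ffunE.
rewrite (raddf_sum (ext_map (B x)))/= (raddf_sum (cov (row j (B x))))/=.
by apply: eq_bigr => S _; rewrite ext_map_esc cov_esc.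
Qed.
End Frame.
End FrameDerivative.

(** * The invariant coframes of the deformed Iwasawa manifolds *)

Section IwasawaFrame.
Context {R : realType}.
Local Notation C := R[i].
Local Notation G := 'rV[R]_6.
Local Notation cj := (@conjc R).

Definition mx6 (K : pzRingType) (l : seq (seq K)) : 'M[K]_6 :=
  \matrix_(i, j) (nth [::] l i)`_j.

Lemma mx6E (K : pzRingType) (l : seq (seq K)) i j : mx6 l i j = (nth [::] l i)`_j.
Proof. exact: mxE. Qed.

Lemma matrix6P (K : pzRingType) (M N : 'M[K]_6) :
  (forall i j, M i j = N i j) -> M = N.
Proof. by move=> MN; apply/matrixP. Qed.

Lemma mul6E (K : pzRingType) (l : seq (seq K)) (N : 'M[K]_6) i j :
  (mx6 l *m N) i j = (nth [::] l i)`_0 * N o0 j + ((nth [::] l i)`_1 * N o1 j +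
    ((nth [::] l i)`_2 * N o2 j + ((nth [::] l i)`_3 * N o3 j +
    ((nth [::] l i)`_4 * N o4 j + (nth [::] l i)`_5 * N o5 j)))).
Proof. by rewrite mxE big_ord6 !mx6E. Qed.

Lemma conjcM (x y : C) : (cj (x * y)) = cj x * cj y. Proof. exact: (rmorphM (@conjc R)). Qed.
Lemma conjcD (x y : C) : (cj (x + y)) = cj x + cj y. Proof. exact: (rmorphD (@conjc R)). Qed.
Lemma conjcN (x : C) : (cj (- x)) = - cj x. Proof. exact: (rmorphN (@conjc R)). Qed.
Lemma conjci : (cj ('i : C)) = - 'i.
Proof. by apply/eqP; rewrite eq_complex/= oppr0 !eqxx. Qed.
Lemma conjc_half : (cj (2^-1 : C)) = 2^-1. Proof. by rewrite conjc_inv conjc_nat. Qed.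
Lemma mulii : ('i : C) * 'i = - 1. Proof. by rewrite -expr2 sqr_i. Qed.

Section Coefficients.
Context (a c d1 d2 : C).
Definition dsc : C := 1 - a * cj a.
Local Notation I := ('i : C).
Local Notation h := (2^-1 : C).
Local Notation n := (dsc^-1).
Local Notation e := (d1 - d2 * c).

(** With $\theta=dz_2-z_0\,dz_1$, whose real and imaginary parts are the last two rows of [coframe],
    the rows stand for $e_0=dz_0+a\,d\bar z_0$, $e_1=c\,e_0+dz_1$, $e_2=d_1e_0+d_2\,dz_1+\theta$ and
    their conjugates. The parameter $a$ is that of the deformation; $c$, $d_1$, $d_2$ are chosen
    later to make the metric diagonal. *)
Definition frame_mx : 'M[C]_6 := mx6
  [:: [:: 1 + a; I - I * a; 0; 0; 0; 0];
      [:: c * (1 + a); c * (I - I * a); 1; I; 0; 0];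
      [:: d1 * (1 + a); d1 * (I - I * a); d2; d2 * I; 1; I];
      [:: 1 + cj a; - I + I * cj a; 0; 0; 0; 0];
      [:: cj c * (1 + cj a); cj c * (- I + I * cj a); 1; - I; 0; 0];
      [:: cj d1 * (1 + cj a); cj d1 * (- I + I * cj a); cj d2; - (cj d2 * I); 1; - I]].

(** The inverse of [frame_mx]: column $j$ gives the field dual to $e_j$ in terms of the real
    left-invariant fields. *)
Definition vector_mx : 'M[C]_6 := mx6
  [:: [:: h * n * (1 - cj a); 0; 0; h * n * (1 - a); 0; 0];
      [:: - (I * h * n * (1 + cj a)); 0; 0; I * h * n * (1 + a); 0; 0];
      [:: - (h * c); h; 0; - (h * cj c); h; 0];
      [:: I * h * c; - (I * h); 0; - (I * h * cj c); I * h; 0];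
      [:: - (h * e); - (h * d2); h; - (h * (cj d1 - cj d2 * cj c)); - (h * cj d2); h];
      [:: I * h * e; I * h * d2; - (I * h); - (I * h * (cj d1 - cj d2 * cj c)); - (I * h * cj d2); I * h]].

Lemma vector_central r : vector_mx r o2 = 2^-1 * ((r == o4)%:R - 'i * (r == o5)%:R).
Proof. by elim/ord6P: r; rewrite mx6E /= ?mulr0 ?mulr1 ?subr0 ?sub0r ?mulr1 ?mulr0// mulrN mulrC. Qed.

Lemma dsc_conj : cj dsc = dsc.
Proof. by rewrite /dsc conjcD conjcN conjcM conjcK conjc1 mulrC. Qed.

Lemma vector_bar r j : vector_mx r (bar6 j) = (cj (vector_mx r j)).
Proof.
have nc : (cj (dsc^-1)) = dsc^-1 by rewrite conjc_inv dsc_conj.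
have [[b0 b1 b2] [b3 b4 b5]] := bar6E.
have c0 : cj 0 = 0 := conjc0 _.
have cK x : cj (cj x) = x := conjcK x.
rewrite !mx6E; move: nc cK c0 conjcM conjcD conjcN (conjci : cj I = - I) (conjc_half : cj h = h).
move: (dsc^-1) (2^-1 : C) I cj => n h I cc nc cK c0 cM cD cN ci ch.
have c1 : cc 1 = 1 by have := cM (cc 1) 1; rewrite mulr1 cK mul1r => <-.
elim/ord6P: r; elim/ord6P: j; rewrite ?(b0, b1, b2, b3, b4, b5) /=;
  rewrite ?(cM, cN, cD, nc, ch, ci, c0, c1, cK); ring.
Qed.

Context (a_lt1 : `|a| < 1).

Lemma dsc_neq0 : dsc != 0.
Proof. by rewrite /dsc -sqr_normc subr_eq0 eq_sym lt_eqF// expr_lt1. Qed.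

Lemma vector_frame : vector_mx *m frame_mx = 1%:M.
Proof.
have n0 := dsc_neq0.
have hE : 2 * h = 1 by rewrite mulfV// pnatr_eq0.
(* The entries are polynomials in $n$, $h$, $i$ and the parameters, subject to $n|a|^2=n-1$, $2h=1$
   and $i^2=-1$. *)
have nE : n * (a * cj a) = n - 1.
  by have := mulVf n0; move: (n) => m; rewrite /dsc mulrBr mulr1 => <-; ring.
have iE : I * I = - 1 := mulii.
have n1 : n - n * (a * cj a) = 1 by rewrite nE opprB addrC subrK.
apply: matrix6P; elim/ord6P; elim/ord6P; rewrite mul6E !mx6E mxE /=; move: nE n1 iE hE;
  move: n h I => n h I nE n1 iE hE.
all: try (by ring: nE hE).
all: try (transitivity (- (I * I) * (2 * h)); [ring | rewrite iE hE; ring]).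
all: try (transitivity (- (I * I) * (2 * h) * (n - n * (a * cj a))); [ring | rewrite iE hE n1; ring]).
Qed.

(* The complex structure on C^3 for which z_0 + a conj(z_0), z_1 and z_2 are
   holomorphic. *)
Definition fibre_mx : 'M[R]_6 :=
  let p := complex.Re a in let q := complex.Im a in let m := (1 - p ^+ 2 - q ^+ 2)^-1 in
  mx6 [:: [:: - (2 * q * m); - (((1 - p) ^+ 2 + q ^+ 2) * m); 0; 0; 0; 0];
          [:: ((1 + p) ^+ 2 + q ^+ 2) * m; 2 * q * m; 0; 0; 0; 0];
          [:: 0; 0; 0; -1; 0; 0];
          [:: 0; 0; 1; 0; 0; 0];
          [:: 0; 0; 0; 0; 0; -1];
          [:: 0; 0; 0; 0; 1; 0]].

Definition heis_frame (x : G) : 'M[C]_6 := frame_mx *m cplx_mx (coframe x).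

Lemma coframeE (x : G) : coframe x = mx6
  [:: [:: 1; 0; 0; 0; 0; 0]; [:: 0; 1; 0; 0; 0; 0];
      [:: 0; 0; 1; 0; 0; 0]; [:: 0; 0; 0; 1; 0; 0];
      [:: 0; 0; - x 0 o0; x 0 o1; 1; 0]; [:: 0; 0; - x 0 o1; - x 0 o0; 0; 1]].
Proof.
apply: matrix6P => r i; rewrite mx6E mxE mxE big_ord6.
by elim/ord6P: r; elim/ord6P: i; rewrite /= !mxE /= ?mulr0n ?mulr1n; ring.
Qed.

(** The constant matrix therefore represents the same structure in the left-invariant coframe. This
    makes the structure left invariant and the coframe compatible with it at every point. *)
Lemma coframe_fibre (x : G) : coframe x *m fibre_mx = fibre_mx *m coframe x.
Proof.
apply: matrix6P => r i; rewrite coframeE {1}/mx6 /fibre_mx !mul6E !mx6E.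
by elim/ord6P: r; elim/ord6P: i; rewrite /=; ring.
Qed.

Definition hol_sign (r : 'I_6) : C := if (r < 3)%N then I else - I.

Lemma det_re_neq0 : 1 - complex.Re a ^+ 2 - complex.Im a ^+ 2 != 0.
Proof.
have := dsc_neq0; rewrite /dsc; apply: contraNneq => E.
case: a E => p q /= E; rewrite eq_complex /=; apply/andP; split; apply/eqP.
  by rewrite -[RHS]E; ring.
by ring.
Qed.

Lemma frame_fibre : frame_mx *m cplx_mx fibre_mx = diag_mx (\row_r hol_sign r) *m frame_mx.
Proof.
have m0 := det_re_neq0.
have [p pE] : exists p : C, p = (complex.Re a)%:C by exists (complex.Re a)%:C.
have [q qE] : exists q : C, q = (complex.Im a)%:C by exists (complex.Im a)%:C.
pose mr := (1 - complex.Re a ^+ 2 - complex.Im a ^+ 2)^-1.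
have [m mE] : exists m : C, m = mr%:C by exists mr%:C.
have fE : cplx_mx fibre_mx = mx6
  [:: [:: - (2 * q * m); - (((1 - p) ^+ 2 + q ^+ 2) * m); 0; 0; 0; 0];
      [:: ((1 + p) ^+ 2 + q ^+ 2) * m; 2 * q * m; 0; 0; 0; 0];
      [:: 0; 0; 0; -1; 0; 0];
      [:: 0; 0; 1; 0; 0; 0];
      [:: 0; 0; 0; 0; 0; -1];
      [:: 0; 0; 0; 0; 1; 0]].
  apply: matrix6P => k l; rewrite mxE !mx6E pE qE mE -/mr.
  elim/ord6P: k; elim/ord6P: l; rewrite /= ?(rmorphN (real_complex R)) ?(rmorph1 (real_complex R)) //=;
  by rewrite ?(rmorphM (real_complex R), rmorphD (real_complex R), rmorphXn (real_complex R), rmorphN (real_complex R), rmorph1 (real_complex R), rmorph_nat (real_complex R)).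
have aE : a = p + I * q.
  by rewrite pE qE; case: (a) => u v; apply/eqP; rewrite eq_complex /=; apply/andP; split; apply/eqP; ring.
have caE : cj a = p - I * q.
  by rewrite pE qE; case: (a) => u v; apply/eqP; rewrite eq_complex /=; apply/andP; split; apply/eqP; ring.
have mpE : m * (p * p) = m - m * (q * q) - 1.
  rewrite pE qE mE -!rmorphM/= -(rmorph1 (real_complex R)) -!rmorphB/=; congr (_%:C).
  by rewrite -(mulVf m0) -/mr; ring.
have iE : I * I = - 1 := mulii.
apply: matrix6P => r i.
have dE (M : 'M[C]_6) : (diag_mx (\row_r hol_sign r) *m M) r i = hol_sign r * M r i.
  by rewrite mul_diag_mx !mxE.
rewrite dE fE mul6E !mx6E caE aE /hol_sign.
move: iE; move: I (cj c) (cj d1) (cj d2) => I' cb d1b d2b iE {dE fE aE caE mE m0 pE qE mr}.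
elim/ord6P: r; elim/ord6P: i; rewrite /=; by ring: mpE iE.
Qed.

Lemma heis_frame_fibre x r :
  row r (heis_frame x) *m cplx_mx fibre_mx = hol_sign r *: row r (heis_frame x).
Proof.
rewrite -row_mul /heis_frame -mulmxA -map_mxM coframe_fibre map_mxM mulmxA frame_fibre.
rewrite -mulmxA; move: (_ *m cplx_mx _) => X; apply/rowP => j.
by rewrite mul_diag_mx !mxE.
Qed.

Lemma coframe_heis_mul (g x : G) :
  coframe (heis_mul g x) *m jacobian_mx (heis_mul g) x = coframe x.
Proof.
have -> : jacobian_mx (heis_mul g) x = \matrix_(i, j) ((i == j)%:R + (g *m beta j) 0 i).
  apply/matrixP => i j; rewrite [LHS]mxE [RHS]mxE.
  have E (y : G) : heis_mul g y 0 i = g 0 i + (y 0 i + \sum_r (g *m beta r) 0 i * y 0 r).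
    rewrite heis_mulE [LHS]mxE [X in X + _]mxE -addrA; congr (_ + (_ + _)).
    by rewrite summxE; apply: eq_bigr => r _; rewrite mxE mulrC.
  have -> : (fun y => heis_mul g y 0 i) = fun y => g 0 i + (y 0 i + \sum_r (g *m beta r) 0 i * y 0 r).
    exact/funext.
  have sS : smooth (fun y : G => \sum_r (g *m beta r) 0 i * y 0 r).
    by apply: smooth_sum => r; apply: smoothM; [apply: smooth_cst | apply: smooth_coord].
  rewrite (partialD j x (smooth_cst (g 0 i)) (smoothD (smooth_coord i) sS)).
  rewrite (partialD j x (smooth_coord i) sS) partial_cst add0r partial_coord; congr (_ + _).
  rewrite (partial_sum j _ x (fun r => smoothM (smooth_cst ((g *m beta r) 0 i)) (smooth_coord r))).
  rewrite (bigD1 j)//= (partialZ j _ x (smooth_coord j)) partial_coord eqxx mulr1.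
  rewrite big1 ?addr0// => r rj; rewrite (partialZ j _ x (smooth_coord r)) partial_coord.
  by rewrite (negbTE rj) mulr0.
have NE i r : (heis_mul g x *m beta i) 0 r = (g *m beta i) 0 r + (x *m beta i) 0 r.
  rewrite heis_mulE !mulmxDl; set Z := \sum_r _.
  have -> : Z *m beta i = 0.
    rewrite mulmx_suml big1// => s _; by rewrite -scalemxAl -mulmxA beta_beta mulmx0 scaler0.
  by rewrite addr0 mxE.
apply/matrixP => r j; rewrite [LHS]mxE.
transitivity (\sum_i ((r == i)%:R * ((i == j)%:R + (g *m beta j) 0 i) -
    ((g *m beta i) 0 r + (x *m beta i) 0 r) * (i == j)%:R)).
  apply: eq_bigr => i _; rewrite [coframe _ _ _]mxE NE [X in _ * X]mxE.
  have e1 : (g *m beta j) 0 i *: beta i = 0 :> 'M[R]_6.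
    rewrite mxE scaler_suml big1// => p _; by rewrite -scalerA beta_out scaler0.
  have e0 (h : G) : (h *m beta i) 0 r * (g *m beta j) 0 i = 0.
    have <- : ((g *m beta j) 0 i *: (h *m beta i)) 0 r = (h *m beta i) 0 r * (g *m beta j) 0 i.
      by rewrite [LHS]mxE mulrC.
    by rewrite scalemxAr e1 mulmx0 mxE.
  by rewrite mulrBl mulrDr [X in _ - X]mulrDr !mulrDl e0 e0 !addr0.
rewrite sumrB (bigD1 r)//= eqxx mul1r big1 => [|i ir]; last by rewrite eq_sym (negbTE ir) mul0r.
rewrite (bigD1 j)//= eqxx mulr1 big1 => [|i ij]; last by rewrite (negbTE ij) mulr0.
by rewrite !addr0 [RHS]mxE opprD addrA addrK.
Qed.

Lemma heis_frame_mul (g x : G) :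
  heis_frame (heis_mul g x) *m cplx_mx (jacobian_mx (heis_mul g) x) = heis_frame x.
Proof. by rewrite /heis_frame -mulmxA -map_mxM coframe_heis_mul. Qed.

Definition frame_inv (x : G) : 'M[C]_6 := (cplx_mx (\matrix_(r, j) yv r x 0 j))^T *m vector_mx.

Lemma frame_invK x : frame_inv x *m heis_frame x = 1%:M.
Proof.
have E : coframe x *m (\matrix_(r, j) yv r x 0 j)^T = 1%:M.
  apply/mulmx1C/matrixP => j i; rewrite [LHS]mxE [RHS]mxE eq_sym -(coframe_yv x).
  by apply: eq_bigr => r _; rewrite mxE [X in X * _]mxE mulrC.
rewrite /frame_inv /heis_frame -mulmxA (mulmxA vector_mx) vector_frame mul1mx.
by rewrite map_trmx -map_mxM (mulmx1C E) map_mx1.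
Qed.

Lemma heis_frame_unit x : heis_frame x \in unitmx.
Proof. by have [] := mulmx1_unit (frame_invK x). Qed.

Lemma smooth_ext (f f' : G -> R) : smooth f -> f =1 f' -> smooth f'.
Proof. by move=> sf /funext <-. Qed.

Lemma csm_real (f : G -> R) : smooth f -> csm (fun x => (f x)%:C).
Proof. move=> sf; split; [exact: sf | exact: smooth_cst]. Qed.

Lemma smooth_coframe s j : smooth (fun x : G => coframe x s j).
Proof.
apply: (smooth_ext (smoothB (smooth_cst ((s == j)%:R)) (smooth_sum (index_enum 'I_6)
  (fun l => smoothM (smooth_coord l) (smooth_cst (beta j l s)))))) => x.
by rewrite [RHS]mxE [X in _ = _ - X]mxE.
Qed.

Lemma csm_heis_frame r j : csm (fun x => heis_frame x r j).
Proof.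
have s1 s := csm_real (smooth_coframe s j).
have := csm_sum (index_enum 'I_6) (fun s => csmM (csm_cst (frame_mx r s)) (s1 s)).
by congr csm; apply/funext => x; rewrite [RHS]mxE; apply: eq_bigr => s _; rewrite [X in _ = _ * X]mxE.
Qed.

Lemma csm_frame_inv r j : csm (fun x => frame_inv x r j).
Proof.
have s1 s := csm_real (smooth_yv s r).
have := csm_sum (index_enum 'I_6) (fun s => csmM (s1 s) (csm_cst (vector_mx s j))).
congr csm; apply/funext => x; rewrite [RHS]mxE; apply: eq_bigr => s _; congr (_ * _).
by rewrite [RHS]mxE [RHS]mxE [X in _ = X%:C]mxE.
Qed.

Lemma grow_frame f x :
  grow f x = \sum_j (\sum_r vector_mx r j * Yc r f x) *: row j (heis_frame x).
Proof.
apply/rowP => i; rewrite [LHS]mxE cpartialE summxE.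
transitivity (\sum_r Yc r f x * (vector_mx *m heis_frame x) r i).
  rewrite /heis_frame mulmxA vector_frame mul1mx; apply: eq_bigr => r _.
  by rewrite [cplx_mx _ _ _]mxE mulrC.
under eq_bigr => r _ do rewrite [(_ *m heis_frame x) _ _]mxE mulr_sumr.
rewrite exchange_big; apply: eq_bigr => j _; rewrite [RHS]mxE mulr_suml.
apply: eq_bigr => r _; rewrite [X in _ = _ * X]mxE; ring.
Qed.

Context (ac0 : a * c = 0).

(** Multiplication by $de_r$. Only $\theta$ contributes to $de_2=-dz_0\wedge dz_1$, and
    $(1-|a|^2)\,dz_0=e_0-a\,e_3$. Replacing $dz_1$ by $e_1$ changes the product by a multiple of
    $ac\,e_3\wedge e_0$, which is zero under [ac0]. *)
Definition d_frame (r : 'I_6) (w : ext R 6) : ext R 6 :=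
  if r == o2 then esc (- n) (eps o0 (eps o1 w)) + esc (n * a) (eps o3 (eps o1 w)) else
  if r == o5 then esc (- n) (eps o3 (eps o4 w)) + esc (n * cj a) (eps o0 (eps o4 w)) else 0.

Lemma covZ (s : C) (t : 'rV[C]_6) (w : ext R 6) : cov (s *: t) w = esc s (cov t w).
Proof. by rewrite !covE esc_sum; apply: eq_bigr => i _; rewrite mxE escA. Qed.

Lemma covDl (s t : 'rV[C]_6) (w : ext R 6) : cov (s + t) w = cov s w + cov t w.
Proof. by rewrite !covE -big_split; apply: eq_bigr => i _; rewrite mxE escDl. Qed.

Lemma drow_frame i r x : drow i (fun y => row r (heis_frame y)) x =
  \row_j - (\sum_s frame_mx r s * (beta j i s)%:C).
Proof.
apply/rowP => j; rewrite [LHS]mxE [RHS]mxE.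
have sb s : smooth (fun y : G => (y *m beta j) 0 s).
  apply: (smooth_ext (smooth_sum (index_enum 'I_6)
    (fun l => smoothM (smooth_coord l) (smooth_cst (beta j l s))))) => y; by rewrite [RHS]mxE.
have pb s : partial i (fun y : G => (y *m beta j) 0 s) x = beta j i s.
  have -> : (fun y : G => (y *m beta j) 0 s) = fun y => \sum_l beta j l s * y 0 l.
    by apply/funext => y; rewrite mxE; apply: eq_bigr => l _; rewrite mulrC.
  rewrite (partial_sum i _ x (fun l => smoothM (smooth_cst (beta j l s)) (smooth_coord l))).
  rewrite (bigD1 i)//= (partialZ i _ x (smooth_coord i)) partial_coord eqxx mulr1.
  by rewrite big1 ?addr0// => l li; rewrite (partialZ i _ x (smooth_coord l)) partial_coord (negbTE li) mulr0.
have cE s : cpartial i (fun y => (coframe y s j)%:C) x = - (beta j i s)%:C.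
  rewrite /cpartial /= partial_cst.
  have -> : (fun y : G => coframe y s j) = (fun y : G => (s == j)%:R + (-1) * (y *m beta j) 0 s) :> (G -> R).
    by apply/funext => y; rewrite mxE mulN1r.
  rewrite (partialD i x (smooth_cst _) (smoothM (smooth_cst (-1)) (sb s))) partial_cst add0r.
  rewrite (partialZ i _ x (sb s)) pb mulN1r.
  by apply/eqP; rewrite eq_complex /= oppr0 !eqxx.
have -> : (fun y => row r (heis_frame y) 0 j) = fun y => \sum_s frame_mx r s * (coframe y s j)%:C.
  apply/funext => y; rewrite mxE mxE; apply: eq_bigr => s _; congr (_ * _); exact: mxE.
have s1 s := csm_real (smooth_coframe s j).
rewrite (cpartial_sum i _ x (fun s => csmM (csm_cst (frame_mx r s)) (s1 s))) -sumrN.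
by apply: eq_bigr => s _; rewrite (cpartialZ i _ x (s1 s)) cE mulrN.
Qed.

Let z1 : 'rV[C]_6 := \row_j [:: 1; I; 0; 0; 0; 0]`_j.
Let z2 : 'rV[C]_6 := \row_j [:: 0; 0; 1; I; 0; 0]`_j.
Let z1b : 'rV[C]_6 := \row_j [:: 1; - I; 0; 0; 0; 0]`_j.
Let z2b : 'rV[C]_6 := \row_j [:: 0; 0; 1; - I; 0; 0]`_j.

Lemma heis_frame_base r x : frame_mx r o4 = 0 -> frame_mx r o5 = 0 ->
  row r (heis_frame x) = row r frame_mx.
Proof.
move=> r4 r5; apply/rowP => j; rewrite [LHS]mxE [LHS]mxE [RHS]mxE.
transitivity (\sum_s frame_mx r s * (s == j)%:R); last first.
  by rewrite (bigD1 j)//= eqxx mulr1 big1 ?addr0// => s /negbTE ->; rewrite mulr0.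
apply: eq_bigr => s _; rewrite [cplx_mx _ _ _]mxE.
have [->|s4] := eqVneq s o4; first by rewrite r4 !mul0r.
have [->|s5] := eqVneq s o5; first by rewrite r5 !mul0r.
congr (_ * _); rewrite mxE [X in _ - X](_ : _ = 0) ?subr0 ?(rmorph_nat (real_complex R))//.
by rewrite mxE big1// => l _; rewrite beta_col ?mulr0.
Qed.

Lemma base_rows x :
  [/\ row o0 (heis_frame x) = z1 + a *: z1b, row o1 (heis_frame x) = c *: row o0 (heis_frame x) + z2,
      row o3 (heis_frame x) = z1b + cj a *: z1 & row o4 (heis_frame x) = cj c *: row o3 (heis_frame x) + z2b].
Proof.
rewrite !heis_frame_base ?mx6E//; split; apply/rowP; elim/ord6P; rewrite !mxE /=; ring.
Qed.

Lemma torsion_row r i : \row_j - (\sum_s frame_mx r s * (beta j i s)%:C) =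
  if r == o2 then - z1 0 i *: z2 else if r == o5 then - z1b 0 i *: z2b else 0.
Proof.
have bC (x y z w : bool) : ((x%:R + y%:R + z%:R - w%:R : R)%:C) = x%:R + y%:R + z%:R - w%:R :> C.
  by rewrite (rmorphB (real_complex R)) !(rmorphD (real_complex R)) !(rmorph_nat (real_complex R)).
have iE : I * I = - 1 := mulii.
apply/rowP => j; rewrite [LHS]mxE big_ord6.
have bE s : (beta j i s)%:C = (((j == o2) && (i == o0) && (s == o4))%:R + ((j == o2) && (i == o1) && (s == o5))%:R +
   ((j == o3) && (i == o0) && (s == o5))%:R - ((j == o3) && (i == o1) && (s == o4))%:R) :> C.
  by rewrite [beta _ _ _]mxE bC.
rewrite !bE /= !andbF /= !andbT !mx6E.
move: iE; rewrite /z1 /z2 /z1b /z2b; move: I => I' iE {bC bE}.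
elim/ord6P: r; elim/ord6P: j; elim/ord6P: i; rewrite /= !mxE /=; by ring: iE.
Qed.

Lemma frame_torsion r x (w : ext R 6) :
  wedge (ext_d (fun y => covector (row r (heis_frame y))) x) (ext_map (heis_frame x) w) =
  ext_map (heis_frame x) (d_frame r w).
Proof.
have -> : wedge (ext_d (fun y => covector (row r (heis_frame y))) x) (ext_map (heis_frame x) w) =
   \sum_i eps i (cov (\row_j - (\sum_s frame_mx r s * (beta j i s)%:C)) (ext_map (heis_frame x) w)).
  rewrite ext_dE wedge_suml; apply: eq_bigr => i _; rewrite eps_wedge; congr (eps i _).
  have -> : (fun y => covector (row r (heis_frame y))) =
      fun y => cov (row r (heis_frame y)) (ebasis R finset.set0).
    by apply/funext => y; rewrite covectorE.
  have st : tsm (fun y => row r (heis_frame y)).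
    by move=> j; have := csm_heis_frame r j; congr csm; apply/funext => y; rewrite [RHS]mxE.
  have s1 : fsm (fun=> ebasis R finset.set0) by move=> S; exact: csm_cst.
  rewrite (dpart_cov i x st s1) drow_frame.
  have -> : dpart i (fun=> ebasis R finset.set0) x = 0.
    by apply/ffunP => S; rewrite !ffunE cpartial_cst.
  by rewrite covr0 addr0 cov_wedge wedge1l.
have [X0 XE] : exists X0, X0 = ext_map (heis_frame x) w by exists (ext_map (heis_frame x) w).
rewrite -XE.
have S (s t : 'rV[C]_6) : \sum_i eps i (cov (- s 0 i *: t) X0) = - cov s (cov t X0).
  rewrite (covE s) -sumrN; apply: eq_bigr => i _.
  by rewrite covZ eps_esc escN.
have [r0 r1 r3 r4] := base_rows x.
have ndsc : n * (a * cj a) = n - 1.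
  by have := mulVf dsc_neq0; move: (n) => m; rewrite /dsc mulrBr mulr1 => <-; ring.
(* The inversion of $e_0=dz_0+a\,d\bar z_0$ and its conjugate for $dz_0$, as an identity of
   operators. *)
have elim_z s t b bb (u : ext R 6) : n * (b * bb) = n - 1 ->
    esc (- n) (cov (s + b *: t) u) + esc (n * b) (cov (t + bb *: s) u) = - cov s u.
  move=> nb; rewrite !covDl !covZ; move: (cov s u) (cov t u) => p q; apply/ffunP => S'; rewrite !ffunE.
  by move: nb; move: n (p S') (q S') => m p' q' nb; ring: nb.
(* The part of $e_1$ along $e_0$ drops out of the product, by $ac=0$. *)
have elim_c s t y b b' : b * b' = 0 -> cov s (cov (b' *: (s + b *: t) + y) X0) = cov s (cov y X0).
  move=> bb; rewrite covDl covZ covDl covZ !(raddfD (cov s))/= !cov_esc !(raddfD (cov s))/= cov_cov0 add0r.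
  by rewrite !cov_esc escA (mulrC b') bb esc0 add0r.
under eq_bigr => i _ do rewrite torsion_row.
rewrite /d_frame; have [_|_] := eqVneq r o2; last have [_|_] := eqVneq r o5.
- rewrite S (raddfD (ext_map _))/= !ext_map_esc !ext_map_eps -XE r1 r0 r3.
  by rewrite elim_z// elim_c.
- rewrite S (raddfD (ext_map _))/= !ext_map_esc !ext_map_eps -XE r4 r3 r0.
  have cac : cj a * cj c = 0 by rewrite -conjcM ac0 conjc0.
  by rewrite elim_z ?elim_c// [cj a * a]mulrC.
- rewrite big1 ?(raddf0 (ext_map _))// => i _; rewrite -(scale0r (0 : 'rV[C]_6)) covZ esc0.
  exact: (raddf0 (eps i)).
Qed.
End Coefficients.
End IwasawaFrame.

(** * Bidegree in the coframe *)

Definition hol6 : {set 'I_6} := [set i : 'I_6 | (i < 3)%N]%SET.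

Section Bidegree.
Context {K : comPzRingType}.
Local Notation V := {ffun {set 'I_6} -> K}.
Implicit Types (u v : V) (i j l : 'I_6) (P : nat -> nat -> bool) (S : {set 'I_6}).

(** The numbers of (1,0)- and (0,1)-factors are constrained by a predicate rather than fixed, so
    that the constraint can be transported through each creation or annihilation operator
    separately. *)
Definition bideg P u := forall S, ~~ P #|(S :&: hol6)%SET| #|(S :\: hol6)%SET| -> u S = 0.

Definition typg (p q : nat) u : V := [ffun S : {set 'I_6} =>
  if (#|(S :&: hol6)%SET| == p) && (#|(S :\: hol6)%SET| == q) then u S else 0].

Local Notation at_ p q := (fun p' q' : nat => (p' == p) && (q' == q)).

Lemma bidegW P P' u : (forall p q, P p q -> P' p q) -> bideg P u -> bideg P' u.
Proof. by move=> PP uP S nP; apply: uP; apply: contra nP; apply: PP. Qed.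

Lemma bidegD P u v : bideg P u -> bideg P v -> bideg P (u + v).
Proof. by move=> uP vP S nP; rewrite ffunE uP// vP// addr0. Qed.

Lemma bideg_esc P c u : bideg P u -> bideg P (esc c u).
Proof. by move=> uP S nP; rewrite ffunE uP// mulr0. Qed.

Lemma hol6E i : (i \in hol6) = (i < 3)%N. Proof. by rewrite finset.inE. Qed.

Lemma card_bidegU i S : i \notin S ->
  #|((i |: S) :&: hol6)%SET| = ((i < 3) + #|(S :&: hol6)%SET|)%N /\
  #|((i |: S) :\: hol6)%SET| = ((3 <= i) + #|(S :\: hol6)%SET|)%N.
Proof.
move=> iS; have [i3|i3] := ltnP i 3.
  have ih : i \in hol6 by rewrite hol6E.
  have -> : ((i |: S) :&: hol6 = i |: (S :&: hol6))%SET.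
    by apply/setP => x; rewrite !finset.inE; case: eqP => //= ->; rewrite i3.
  have -> : ((i |: S) :\: hol6 = S :\: hol6)%SET.
    by apply/setP => x; rewrite !finset.inE; case: eqP => //= ->; rewrite i3 (negbTE iS).
  by rewrite finset.cardsU1 !finset.inE (negbTE iS).
have -> : ((i |: S) :&: hol6 = (S :&: hol6))%SET.
  by apply/setP => x; rewrite !finset.inE; case: eqP => //= ->; rewrite ltnNge i3 (negbTE iS).
have -> : ((i |: S) :\: hol6 = i |: (S :\: hol6))%SET.
  by apply/setP => x; rewrite !finset.inE; case: eqP => //= ->; rewrite ltnNge i3.
by rewrite finset.cardsU1 !finset.inE (negbTE iS) andbF.
Qed.

Lemma bideg_eps P i u : bideg P u ->
  bideg (fun p q => if (i < 3)%N then (0 < p)%N && P p.-1 q else (0 < q)%N && P p q.-1) (eps i u).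
Proof.
move=> uP S nP; rewrite ffunE; case: ifP => // iS; rewrite uP ?mulr0//.
move: nP; have [] := @card_bidegU i (S :\ i)%SET; first by rewrite finset.setD11.
rewrite (finset.setD1K iS) => -> ->; by have [i3|i3] := ltnP i 3; rewrite ?add1n ?add0n.
Qed.

Lemma bideg_iot P i u : bideg P u ->
  bideg (fun p q => if (i < 3)%N then P p.+1 q else P p q.+1) (iot i u).
Proof.
move=> uP S nP; rewrite ffunE; case: ifPn => // iS; rewrite uP ?mulr0//.
move: nP; have [-> ->] := card_bidegU iS.
by have [i3|i3] := ltnP i 3; rewrite ?add1n ?add0n.
Qed.

Lemma typg_bideg p q u : bideg (at_ p q) (typg p q u).
Proof. by move=> S /negbTE h; rewrite ffunE h. Qed.

Lemma bideg_typg p q u : bideg (at_ p q) u -> typg p q u = u.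
Proof. by move=> uP; apply/ffunP => S; rewrite ffunE; case: ifPn => // h; rewrite uP. Qed.

Lemma bideg_typg0 p q p' q' u : bideg (at_ p q) u -> ~~ ((p' == p) && (q' == q)) ->
  typg p' q' u = 0.
Proof.
move=> uP h; apply/ffunP => S; rewrite !ffunE; case: ifP => // /andP[/eqP e1 /eqP e2].
by rewrite uP// e1 e2.
Qed.

Lemma sum_typg u : \sum_(p < 7) \sum_(q < 7) typg p q u = u.
Proof.
apply/ffunP => S; rewrite sum_ffunE.
have h1 : (#|(S :&: hol6)%SET| < 7)%N.
  by rewrite ltnS; apply: leq_trans (max_card _) _; rewrite card_ord.
have h2 : (#|(S :\: hol6)%SET| < 7)%N.
  by rewrite ltnS; apply: leq_trans (max_card _) _; rewrite card_ord.
rewrite (bigD1 (Ordinal h1))//= [X in _ + X]big1 => [|p p1]; last first.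
  rewrite sum_ffunE big1// => q _; rewrite ffunE; case: eqP => //= e.
  by case/eqP: p1; apply/val_inj.
rewrite addr0 sum_ffunE (bigD1 (Ordinal h2))//= [X in _ + X]big1 => [|q q1]; last first.
  rewrite ffunE; case: (_ =P _) => //= _; case: eqP => //= e.
  by case/eqP: q1; apply/val_inj.
by rewrite addr0 ffunE !eqxx.
Qed.

Lemma typgD p q u v : typg p q (u + v) = typg p q u + typg p q v.
Proof. by apply/ffunP => S; rewrite !ffunE; case: ifP; rewrite ?addr0. Qed.

Context (X : 'I_6 -> K -> K) (k al alc : K).
Context (XB : forall i, zmod_morphism (X i)).

Lemma bideg_Xv P i u : bideg P u -> bideg P (Xv X i u).
Proof.
by move=> uP S nP; rewrite ffunE uP//; have := XB i 0 0; rewrite !subrr.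
Qed.

Lemma bideg_dl p q u : bideg (at_ p q) u -> bideg (at_ p.+1 q) (dl X k alc u).
Proof.
have fo i : (i < 3)%N -> bideg (at_ p q) u -> bideg (at_ p.+1 q) (first_order X i u).
  move=> i3 uP; rewrite /first_order. apply: (bidegW _ (@bideg_eps _ i _ (@bideg_Xv _ i _ uP))) => p' q'; rewrite i3.
  by case: p'.
move=> uP; rewrite /dl; apply: bidegD; first by do 2?apply: bidegD; apply: fo.
apply: bidegD; apply: bideg_esc.
  apply: (bidegW _ (@bideg_eps _ o0 _ (@bideg_eps _ o1 _ (@bideg_iot _ o2 _ uP)))) => p' q' /=.
  by case: p' => [|[|p']].
apply: (bidegW _ (@bideg_eps _ o0 _ (@bideg_eps _ o4 _ (@bideg_iot _ o5 _ uP)))) => p' q' /=.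
by case: p' => [|p']; case: q'.
Qed.

Lemma bideg_db p q u : bideg (at_ p q) u -> bideg (at_ p q.+1) (db X k al u).
Proof.
have fo i : (3 <= i)%N -> bideg (at_ p q) u -> bideg (at_ p q.+1) (first_order X i u).
  move=> i3 uP; rewrite /first_order; apply: (bidegW _ (@bideg_eps _ i _ (@bideg_Xv _ i _ uP))) => p' q'; rewrite ltnNge i3/=.
  by case: q'.
move=> uP; rewrite /db; apply: bidegD; first by do 2?apply: bidegD; apply: fo.
apply: bidegD; apply: bideg_esc.
  apply: (bidegW _ (@bideg_eps _ o3 _ (@bideg_eps _ o4 _ (@bideg_iot _ o5 _ uP)))) => p' q' /=.
  by case: q' => [|[|q']].
apply: (bidegW _ (@bideg_eps _ o3 _ (@bideg_eps _ o1 _ (@bideg_iot _ o2 _ uP)))) => p' q' /=.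
by case: p' => [|p']; case: q'.
Qed.

(** [dl] and [db] raise different degrees by one, so type projection separates them in $d$. *)
Lemma typg_dl p q u : typg p.+1 q (dl X k alc (typg p q u) + db X k al (typg p q u)) =
  dl X k alc (typg p q u).
Proof.
rewrite typgD (bideg_typg (bideg_dl (@typg_bideg p q u))).
rewrite (bideg_typg0 (bideg_db (@typg_bideg p q u))) ?addr0//.
by rewrite gtn_eqF.
Qed.

Lemma typg_db p q u : typg p q.+1 (dl X k alc (typg p q u) + db X k al (typg p q u)) =
  db X k al (typg p q u).
Proof.
rewrite typgD (bideg_typg (bideg_db (@typg_bideg p q u))).
by rewrite (bideg_typg0 (bideg_dl (@typg_bideg p q u))) ?add0r// ltn_eqF.
Qed.

Lemma closed_split p q u : bideg (at_ p q) u -> dl X k alc u + db X k al u = 0 ->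
  dl X k alc u = 0 /\ db X k al u = 0.
Proof.
move=> uP D0; have uE := bideg_typg uP; split.
  by rewrite -uE -typg_dl uE D0; apply/ffunP => S; rewrite !ffunE; case: ifP.
by rewrite -uE -typg_db uE D0; apply/ffunP => S; rewrite !ffunE; case: ifP.
Qed.
End Bidegree.

(** * Lattice-invariant forms as vectors of periodic functions *)

Section FrameForms.
Context {R : realType} (Gam : set 'rV[R]_6).
Local Notation C := R[i].
Local Notation G := 'rV[R]_6.
Local Notation A := (gsm Gam).
Local Notation V := {ffun {set 'I_6} -> A}.
Local Notation cj := (@conjc R).
Context (a c d1 d2 : C).
Context (a_lt1 : `|a| < 1).
Context (ac0 : a * c = 0).
Implicit Types (u v : V) (x g : G).

Local Notation Q := (vector_mx a c d1 d2).
Local Notation B := (heis_frame a c d1 d2).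
Local Notation X := (@gX R Gam Q).

(** The coefficient $k=-1/(1-|a|^2)$ of the abstract complex, given as a real number because $k$ has
    to be its own conjugate. *)
Definition torsion_coef : R := - (1 - complex.Re a ^+ 2 - complex.Im a ^+ 2)^-1.
Local Notation gk := (gcst Gam torsion_coef%:C).
Local Notation DL := (dl X gk (gcst Gam (cj a))).
Local Notation DB := (db X gk (gcst Gam a)).

Lemma torsion_coefE : torsion_coef%:C = - (dsc a)^-1.
Proof.
have -> : dsc a = (1 - complex.Re a ^+ 2 - complex.Im a ^+ 2)%:C.
  rewrite /dsc; case: (a) => p q /=; apply/eqP; rewrite eq_complex /=.
  by apply/andP; split; apply/eqP; ring.
by rewrite /torsion_coef (rmorphN (real_complex R)) (fmorphV (real_complex R)).
Qed.

(** [gev] evaluates the coefficients at a point, and [fform] reads them in the moving coframe. By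
    [fform_inj] and [fform_surj] the latter identifies the abstract module with the smooth forms on
    the quotient. *)
Definition gev u x : ext R 6 := [ffun S : {set 'I_6} => gval (u S) x].
Definition fform u : dform R 5 := fun x => ext_map (B x) (gev u x).

Lemma gevD u v x : gev (u + v) x = gev u x + gev v x.
Proof. by apply/ffunP => S; rewrite !ffunE. Qed.

Lemma gval_sg (i : 'I_6) (S : {set 'I_6}) x : gval (sg i S : A) x = sg i S.
Proof.
rewrite /sg; elim: (index_enum _) => [|b s IH]; first by rewrite !big_nil.
rewrite !big_cons; case: ifP => // _; rewrite gvalM IH; congr (_ * _).
by rewrite /flip; case: ifP.
Qed.

Lemma gev_eps i u x : gev (eps i u) x = eps i (gev u x).
Proof. by apply/ffunP => S; rewrite !ffunE; case: ifP => _ //; rewrite gvalM gval_sg. Qed.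

Lemma gev_iot i u x : gev (iot i u) x = iot i (gev u x).
Proof. by apply/ffunP => S; rewrite !ffunE; case: ifP => _ //; rewrite gvalM gval_sg. Qed.

Lemma gev_esc (s : C) u x : gev (esc (gcst Gam s) u) x = esc s (gev u x).
Proof. by apply/ffunP => S; rewrite !ffunE. Qed.

Lemma fsm_gev u : fsm (gev u).
Proof.
move=> S; have [sf _] := gsmP (u S).
by move: sf; congr csm; apply/funext => x; rewrite ffunE.
Qed.

Lemma fform_inj u v : (forall x, fform u x = fform v x) -> u = v.
Proof.
move=> uv; apply/ffunP => S; apply: gsm_ext => x.
have := congr1 (ext_map (invmx (B x))) (uv x).
rewrite /fform !(ext_mapKV _ (heis_frame_unit c d1 d2 a_lt1 x)) => /(congr1 (fun w : ext R 6 => w S)).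
by rewrite !ffunE.
Qed.

Lemma fform0 x : fform 0 x = 0.
Proof.
rewrite /fform (_ : gev 0 x = 0) ?(raddf0 (ext_map (B x)))//.
by apply/ffunP => S; rewrite !ffunE.
Qed.

Lemma fform_eq0 u : (forall x, fform u x = 0) -> u = 0.
Proof. by move=> u0; apply: fform_inj => x; rewrite u0 fform0. Qed.

Lemma fformD u v x : fform (u + v) x = fform u x + fform v x.
Proof. by rewrite /fform gevD (raddfD (ext_map (B x))). Qed.

Lemma fform_sum (I : Type) (s : seq I) (F : I -> V) x :
  fform (\sum_(b <- s) F b) x = \sum_(b <- s) fform (F b) x.
Proof.
elim: s => [|b s IH]; first by rewrite !big_nil fform0.
by rewrite !big_cons fformD IH.
Qed.

Lemma d_frame_zmod r : zmod_morphism (@d_frame R a r).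
Proof.
move=> v w; rewrite /d_frame; case: eqP => _; last case: eqP => _; last by rewrite subr0.
  by rewrite !(raddfB (eps _)) !(raddfB (esc _))/= addrACA -opprD.
by rewrite !(raddfB (eps _)) !(raddfB (esc _))/= addrACA -opprD.
Qed.

Lemma d_frame_eps r i (w : ext R 6) : d_frame a r (eps i w) = eps i (d_frame a r w).
Proof.
have E p q s : esc s (eps p (eps q (eps i w))) = eps i (esc s (eps p (eps q w))).
  by rewrite (eps_eps q) (raddfN (eps p))/= (eps_eps p) opprK eps_esc.
rewrite /d_frame; case: eqP => _; last case: eqP => _; last by rewrite (raddf0 (eps i)).
  by rewrite !E -(raddfD (eps i)).
by rewrite !E -(raddfD (eps i)).
Qed.

Lemma d_frame_esc r s (w : ext R 6) : d_frame a r (esc s w) = esc s (d_frame a r w).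
Proof.
rewrite /d_frame; case: eqP => _; last case: eqP => _; last by rewrite (raddf0 (esc s)).
  by rewrite (raddfD (esc s))/= !eps_esc !escA !(mulrC s).
by rewrite (raddfD (esc s))/= !eps_esc !escA !(mulrC s).
Qed.

Lemma gev_cubic (s : C) i j l u x :
  gev (cubic (gcst Gam s) i j l u) x = esc s (eps i (eps j (iot l (gev u x)))).
Proof. by rewrite /cubic gev_esc !gev_eps gev_iot. Qed.

Lemma torsion_gcst s : - (gk * gcst Gam s) = gcst Gam ((dsc a)^-1 * s).
Proof.
apply: gsm_ext => y; rewrite gvalN gvalM /= -/(torsion_coef%:C); have := torsion_coefE.
by move: (torsion_coef%:C) => z ->; rewrite mulNr opprK.
Qed.

Lemma gev_add5 (f0 f1 f2 f3 f4 : V) x : gev (f0 + f1 + f2 + (f3 + f4)) x =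
  gev f0 x + gev f1 x + gev f2 x + (gev f3 x + gev f4 x).
Proof. by rewrite !gevD. Qed.

Lemma gev_dl u x : gev (DL u) x =
  gev (first_order X o0 u) x + gev (first_order X o1 u) x + gev (first_order X o2 u) x +
  (esc (- (dsc a)^-1) (eps o0 (eps o1 (iot o2 (gev u x)))) +
   esc ((dsc a)^-1 * cj a) (eps o0 (eps o4 (iot o5 (gev u x))))).
Proof.
rewrite -torsion_coefE /dl torsion_gcst; apply: etrans (gev_add5 _ _ _ _ _ _) _; congr (_ + _).
exact: (congr2 +%R (gev_cubic _ o0 o1 o2 _ _) (gev_cubic _ o0 o4 o5 _ _)).
Qed.

Lemma gev_db u x : gev (DB u) x =
  gev (first_order X o3 u) x + gev (first_order X o4 u) x + gev (first_order X o5 u) x +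
  (esc (- (dsc a)^-1) (eps o3 (eps o4 (iot o5 (gev u x)))) +
   esc ((dsc a)^-1 * a) (eps o3 (eps o1 (iot o2 (gev u x))))).
Proof.
rewrite -torsion_coefE /db torsion_gcst; apply: etrans (gev_add5 _ _ _ _ _ _) _; congr (_ + _).
exact: (congr2 +%R (gev_cubic _ o3 o4 o5 _ _) (gev_cubic _ o3 o1 o2 _ _)).
Qed.

Lemma ext_d_heis (v : dform R 5) x : fsm v -> ext_d (fun y => ext_map (B y) (v y)) x =
  ext_map (B x) (\sum_j eps j [ffun S : {set 'I_6} => \sum_r Q r j * Yc r (fun y => v y S) x] +
                 torsion (d_frame a) (v x)).
Proof.
move=> sv; exact: (@ext_d_frame R B (d_frame a) (fun j f x => \sum_r Q r j * Yc r f x)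
  (csm_heis_frame a c d1 d2) d_frame_zmod d_frame_eps d_frame_esc (@frame_torsion R a c d1 d2 a_lt1 ac0)
  (fun f x => @grow_frame R a c d1 d2 a_lt1 f x) v x sv).
Qed.

Lemma ext_d_const (w : ext R 6) x :
  ext_d (fun y => ext_map (B y) w) x = ext_map (B x) (torsion (d_frame a) w).
Proof.
rewrite (@ext_d_heis (fun=> w) x); last by move=> S; exact: csm_cst.
congr (ext_map _ _); rewrite big1 ?add0r// => j _.
have -> : [ffun S : {set 'I_6} => \sum_r Q r j * Yc r (fun=> w S) x] = 0 :> ext R 6.
  by apply/ffunP => S; rewrite !ffunE big1// => r _; rewrite Yc_cst mulr0.
exact: (raddf0 (eps j)).
Qed.

Lemma ext_d_fform u x : ext_d (fform u) x = fform (DL u + DB u) x.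
Proof.
apply: etrans (ext_d_heis x (fsm_gev u)) _.
rewrite /fform; congr (ext_map _ _).
have fo j : eps j [ffun S : {set 'I_6} => \sum_r Q r j * Yc r (fun y => gev u y S) x] =
    gev (first_order X j u) x.
  rewrite /first_order gev_eps; congr (eps j _); apply/ffunP => S; rewrite !ffunE gval_sum.
  apply: eq_bigr => r _; rewrite gvalM; apply: (congr1 (fun h => Q r j * Yc r h x)).
  by apply/funext => y; rewrite ffunE.
under eq_bigr => j _ do rewrite fo.
have tE (w : ext R 6) : torsion (d_frame a) w =
    (esc (- (dsc a)^-1) (eps o0 (eps o1 (iot o2 w))) + esc ((dsc a)^-1 * a) (eps o3 (eps o1 (iot o2 w)))) +
    (esc (- (dsc a)^-1) (eps o3 (eps o4 (iot o5 w))) + esc ((dsc a)^-1 * cj a) (eps o0 (eps o4 (iot o5 w)))).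
  by rewrite /torsion big_ord6 /d_frame /= !add0r.
(* The torsion comes grouped by $de_2$ and $de_5$ and is regrouped by type, as in [dl] and [db]. *)
have key (f : 'I_6 -> ext R 6) (w1 w2 w3 w4 : ext R 6) : \sum_j f j + ((w1 + w2) + (w3 + w4)) =
    (f o0 + f o1 + f o2 + (w1 + w4)) + (f o3 + f o4 + f o5 + (w3 + w2)).
  by rewrite big_ord6; apply/ffunP => S; rewrite !ffunE; ring.
apply: etrans (congr1 (fun z => \sum_j gev (first_order X j u) x + z) (tE _)) _.
apply: etrans (key (fun j => gev (first_order X j u) x) _ _ _ _) _.
exact: (esym (etrans (gevD (DL u) (DB u) x) (congr2 +%R (gev_dl u x) (gev_db u x)))).
Qed.

Lemma type_proj_fform p q u x : type_proj (fibre_mx a) p q (fform u x) = fform (typg p q u) x.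
Proof.
have half2 (z : C) : 2^-1 * (z + z) = z by field.
have ii (z : C) : 'i * ('i%C * z) = - z.
  by case: z => p' q'; apply/eqP; rewrite eq_complex /=; apply/andP; split; apply/eqP; ring.
have iN (z : C) : 'i * (- 'i%C * z) = z.
  by case: z => p' q'; apply/eqP; rewrite eq_complex /=; apply/andP; split; apply/eqP; ring.
have halfE (z : C) : 2^-1 * (z - 'i * ('i%C * z)) = z by rewrite ii opprK half2.
have halfE' (z : C) : 2^-1 * (z - 'i * (- 'i%C * z)) = 0 by rewrite iN subrr mulr0.
have halfE2 (z : C) : 2^-1 * (z + 'i * ('i%C * z)) = 0 by rewrite ii subrr mulr0.
have halfE2' (z : C) : 2^-1 * (z + 'i * (- 'i%C * z)) = z by rewrite iN half2.
rewrite /fform (@type_proj_frame _ _ _ (B x) hol6).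
- by congr (ext_map _ _); apply/ffunP => S; rewrite !ffunE; case: ifP.
- move=> i; move: (heis_frame_fibre c d1 d2 a_lt1 x i); move: (row i (B x)) => t tE.
  rewrite /proj10 -scalemxAr mulmxBr mulmx1 -scalemxAr tE hol6E /hol_sign.
  by case: ifP => _; apply/rowP => j; rewrite !mxE (halfE, halfE').
- move=> i; move: (heis_frame_fibre c d1 d2 a_lt1 x i); move: (row i (B x)) => t tE.
  rewrite /proj01 -scalemxAr mulmxDr mulmx1 -scalemxAr tE hol6E /hol_sign.
  by case: ifP => _; apply/rowP => j; rewrite !mxE (halfE2, halfE2').
Qed.

Local Notation J := ((fun _ => fibre_mx a) : acs R 5).

Lemma fform_of_type p q u : of_type J p q (fform u) <-> typg p q u = u.
Proof.
split=> [uT|uT x]; last by rewrite type_proj_fform uT.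
by apply: fform_inj => x; rewrite -type_proj_fform uT.
Qed.

Lemma zmod_morphism_sum (U W : zmodType) (f : U -> W) (I : Type) (s : seq I) (F : I -> U) :
  zmod_morphism f -> f (\sum_(b <- s) F b) = \sum_(b <- s) f (F b).
Proof.
move=> fB; have f0 : f 0 = 0 by have := fB 0 0; rewrite !subrr.
elim: s => [|b s IH]; first by rewrite !big_nil.
rewrite !big_cons -IH -[\sum_(b0 <- s) F b0 in LHS]opprK fB.
by rewrite -[- \sum_(_ <- _) _]sub0r fB f0 sub0r opprK.
Qed.

Lemma del_fform u x : del J (fform u) x = fform (DL u) x.
Proof.
transitivity (\sum_(p < 7) \sum_(q < 7) fform (DL (typg p q u)) x).
  apply: eq_bigr => p _; apply: eq_bigr => q _.
  have -> : (fun y => type_proj (fibre_mx a) p q (fform u y)) = fform (typg p q u).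
    by apply/funext => y; rewrite type_proj_fform.
  by rewrite ext_d_fform type_proj_fform typg_dl//; exact: gXB.
rewrite -[in RHS](sum_typg u) (zmod_morphism_sum _ _ (dl_is_additive _ _ (gXB Q))) fform_sum.
by apply: eq_bigr => p _; rewrite (zmod_morphism_sum _ _ (dl_is_additive _ _ (gXB Q))) fform_sum.
Qed.

Lemma delbar_fform u x : delbar J (fform u) x = fform (DB u) x.
Proof.
transitivity (\sum_(p < 7) \sum_(q < 7) fform (DB (typg p q u)) x).
  apply: eq_bigr => p _; apply: eq_bigr => q _.
  have -> : (fun y => type_proj (fibre_mx a) p q (fform u y)) = fform (typg p q u).
    by apply/funext => y; rewrite type_proj_fform.
  by rewrite ext_d_fform type_proj_fform typg_db//; exact: gXB.
rewrite -[in RHS](sum_typg u) (zmod_morphism_sum _ _ (db_is_additive _ _ (gXB Q))) fform_sum.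
by apply: eq_bigr => p _; rewrite (zmod_morphism_sum _ _ (db_is_additive _ _ (gXB Q))) fform_sum.
Qed.

Lemma fform_smooth u : smooth_form (fform u).
Proof. exact: (fsm_frame (csm_heis_frame a c d1 d2) (fsm_gev u)). Qed.

Lemma fform_invariant u : invariant_form Gam (fform u).
Proof.
move=> g Gg; apply/funext => x; rewrite /pullback /fform ext_map_comp heis_frame_mul.
congr (ext_map _ _); apply/ffunP => S; rewrite !ffunE.
by have [_ pu] := gsmP (u S); rewrite pu.
Qed.

Lemma fform_surj (al : dform R 5) : smooth_form al -> invariant_form Gam al ->
  exists u, al = fform u.
Proof.
move=> sal ial.
have [v [sv vK]] : exists v : dform R 5, fsm v /\ forall x, ext_map (B x) (v x) = al x.
  exists (fun x => ext_map (frame_inv a c d1 d2 x) (al x)); split.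
    exact: (fsm_frame (csm_frame_inv a c d1 d2) sal).
  by move=> x; rewrite ext_map_comp frame_invK// ext_map_id.
have pv S : lattice_periodic Gam (fun x => v x S).
  move=> g Gg x; suff -> : v (heis_mul g x) = v x by [].
  have E : ext_map (B x) (v (heis_mul g x)) = ext_map (B x) (v x).
    have := congr1 (fun b : dform R 5 => b x) (ial g Gg).
    by rewrite vK /pullback -vK ext_map_comp heis_frame_mul.
  have U := heis_frame_unit c d1 d2 a_lt1 x.
  by rewrite -(ext_mapKV (v (heis_mul g x)) U) E (ext_mapKV (v x) U).
have gv S : (fun x => v x S) \in gsm_pred Gam.
  by apply/asboolP; split; [exact: sv | exact: pv].
exists [ffun S => Gsm (gv S)]; apply/funext => x; rewrite -vK /fform; congr (ext_map _ _).
by apply/ffunP => S; rewrite !ffunE.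
Qed.

End FrameForms.

(** * From vanishing of operator words to vanishing of coefficients *)

Section Vanishing.
Context {K : comPzRingType} {n : nat}.
Local Notation V := {ffun {set 'I_n} -> K}.
Implicit Types (u : V) (i j : 'I_n) (S : {set 'I_n}) (P : {set 'I_n} -> Prop).

Lemma sg_mulK i S (z : K) : sg i S * z = 0 -> z = 0.
Proof. by move=> z0; rewrite -[z]mul1r -(sg_sq i S) -mulrA z0 mulr0. Qed.

Lemma eps_vanish P i u : (forall S, P S -> eps i u S = 0) <->
  (forall S, i \notin S -> P (i |: S)%SET -> u S = 0).
Proof.
split=> H S.
  move=> iS PS; have := H _ PS; rewrite ffunE finset.setU11 (finset.setU1K iS).
  exact: sg_mulK.
move=> PS; rewrite ffunE; case: ifP => // iS; rewrite H ?mulr0 ?finset.setD11//.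
by rewrite (finset.setD1K iS).
Qed.

Lemma iot_vanish P i u : (forall S, P S -> iot i u S = 0) <->
  (forall S, i \in S -> P (S :\ i)%SET -> u S = 0).
Proof.
split=> H S.
  move=> iS PS; have := H _ PS; rewrite ffunE finset.setD11 (finset.setD1K iS).
  exact: sg_mulK.
move=> PS; rewrite ffunE; case: ifPn => // iS; rewrite H ?mulr0 ?finset.setU11//.
by rewrite (finset.setU1K iS).
Qed.

Lemma ext_vanish u : u = 0 <-> (forall S, True -> u S = 0).
Proof. by split=> [-> S _|H]; [rewrite ffunE | apply/ffunP => S; rewrite ffunE H]. Qed.

Lemma iot_epsE i j u : iot i (eps j u) = esc (i == j)%:R u - eps j (iot i u).
Proof.
have [->|ij] := eqVneq i j; first by rewrite iot_eps_eq esc1.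
by rewrite iot_eps// esc0 sub0r.
Qed.

Lemma eps_insert i u S : i \notin S -> eps i u (i |: S)%SET = sg i S * u S.
Proof. by move=> iS; rewrite ffunE finset.setU11 (finset.setU1K iS). Qed.
End Vanishing.

(** * Diagonal fundamental forms: metric, volume and star *)

Section FundamentalForm.
Context {R : realType}.
Local Notation C := R[i].
Local Notation E := (ext R 6).
Local Notation one6 := (ebasis R (finset.set0 : {set 'I_6})).
Local Notation cj := (@conjc R).
Implicit Types (u v : E) (t : C).

Lemma wedge_r1 u : wedge u one6 = u.
Proof.
move: u; apply: ext_ind => [u w Eu Ew|s u Eu||j u Eu].
- by rewrite wedgeDl Eu Ew.
- by rewrite wedge_escl Eu.
- by rewrite wedge1l.
- by rewrite eps_wedge Eu.
Qed.

Lemma wedge_two u i j : wedge u (eps i (eps j one6)) = eps i (eps j u).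
Proof.
by rewrite wedge_eps wedge_eps wedge_r1 par_eps par_par (raddfN (eps j))/= eps_eps opprK.
Qed.

Definition lefschetz t0 t1 t2 u : E :=
  esc t0 (eps o0 (eps o3 u)) + esc t1 (eps o1 (eps o4 u)) + esc t2 (eps o2 (eps o5 u)).

Definition phi t0 t1 t2 : E := lefschetz t0 t1 t2 one6.

Lemma wedge_phil t0 t1 t2 u : wedge (phi t0 t1 t2) u = lefschetz t0 t1 t2 u.
Proof. by rewrite /phi /lefschetz !wedgeDl !wedge_escl !eps_wedge !wedge1l. Qed.

Lemma wedge_phir t0 t1 t2 u : wedge u (phi t0 t1 t2) = lefschetz t0 t1 t2 u.
Proof. by rewrite /phi /lefschetz !(raddfD (wedge u))/= !wedge_escr !wedge_two. Qed.

(** Three commuting operators of square zero: in the cube of their sum only the $3!$ arrangements of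
    the product of all three survive. *)
Lemma cube_commuting (f g h : E -> E) t0 t1 t2 :
  (forall u v, f (u + v) = f u + f v) -> (forall u v, g (u + v) = g u + g v) ->
  (forall u v, h (u + v) = h u + h v) -> (forall s u, f (esc s u) = esc s (f u)) ->
  (forall s u, g (esc s u) = esc s (g u)) -> (forall s u, h (esc s u) = esc s (h u)) ->
  (forall u, f (f u) = 0) -> (forall u, g (g u) = 0) -> (forall u, h (h u) = 0) ->
  (forall u, g (f u) = f (g u)) -> (forall u, h (f u) = f (h u)) -> (forall u, h (g u) = g (h u)) ->
  let L u := esc t0 (f u) + esc t1 (g u) + esc t2 (h u) in
  forall u, L (L (L u)) = esc (6%:R * t0 * t1 * t2) (f (g (h u))).
Proof.
move=> fD gD hD fZ gZ hZ ff gg hh gf hf hg L u.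
have f0 : f 0 = 0 by rewrite -(ff u) ff.
have g0 : g 0 = 0 by rewrite -(gg u) gg.
have h0 : h 0 = 0 by rewrite -(hh u) hh.
have L2 w : L (L w) = esc (2%:R * t0 * t1) (f (g w)) + esc (2%:R * t0 * t2) (f (h w)) +
    esc (2%:R * t1 * t2) (g (h w)).
  rewrite /L !(fD, gD, hD) !(fZ, gZ, hZ) !(gf, hf, hg, ff, gg, hh).
  by move: (f (g w)) (f (h w)) (g (h w)) => x y z; apply/ffunP => S; rewrite !ffunE; ring.
rewrite L2 /L !(fD, gD, hD) !(fZ, gZ, hZ) !(gf, hf, hg, ff, gg, hh, f0, g0, h0).
by move: (f (g (h u))) => x; apply/ffunP => S; rewrite !ffunE; ring.
Qed.

Lemma phi_cube t0 t1 t2 : lefschetz t0 t1 t2 (lefschetz t0 t1 t2 (lefschetz t0 t1 t2 one6)) =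
  esc (6%:R * t0 * t1 * t2) (eps o0 (eps o3 (eps o1 (eps o4 (eps o2 (eps o5 one6)))))).
Proof.
have ND i j u v : eps i (eps j (u + v)) = eps i (eps j u) + eps i (eps j v) :> E.
  by rewrite (raddfD (eps j))/= (raddfD (eps i)).
have NE i j s u : eps i (eps j (esc s u)) = esc s (eps i (eps j u)) :> E by rewrite !eps_esc.
have nn p (w : E) : eps p (- w) = - eps p w := raddfN (eps p) w.
have N0 i j u : eps i (eps j (eps i (eps j u))) = 0 :> E.
  by rewrite (eps_eps j) nn eps_eps0 oppr0.
have NC i j k l u : eps i (eps j (eps k (eps l u))) = eps k (eps l (eps i (eps j u))) :> E.
  by rewrite (eps_eps j k) nn (eps_eps i k) opprK (eps_eps j l) !nn (eps_eps i l) nn opprK.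
exact: (@cube_commuting (fun u => eps o0 (eps o3 u)) (fun u => eps o1 (eps o4 u))
  (fun u => eps o2 (eps o5 u)) t0 t1 t2 (ND _ _) (ND _ _) (ND _ _) (NE _ _) (NE _ _) (NE _ _)
  (N0 _ _) (N0 _ _) (N0 _ _) (NC _ _ _ _) (NC _ _ _ _) (NC _ _ _ _) one6).
Qed.

Lemma phi_top_neq0 t0 t1 t2 : t0 != 0 -> t1 != 0 -> t2 != 0 ->
  lefschetz t0 t1 t2 (lefschetz t0 t1 t2 (lefschetz t0 t1 t2 one6)) finset.setT != 0.
Proof.
move=> h0 h1 h2; rewrite phi_cube.
have -> : finset.setT = (o0 |: (o3 |: (o1 |: (o4 |: (o2 |: (o5 |: finset.set0))))))%SET.
  by apply/setP; elim/ord6P; rewrite !finset.inE.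
have sg_neq0 i (S : {set 'I_6}) : sg i S != 0 :> C.
  by apply/eqP => s0; have := @sg_sq C 6 i S; rewrite s0 mul0r => /esym/eqP; rewrite oner_eq0.
rewrite ffunE !eps_insert ?finset.inE// ffunE eqxx mulr1.
by rewrite !mulf_neq0 ?sg_neq0// pnatr_eq0.
Qed.

Lemma two_form_phi t0 t1 t2 : two_form_mx (phi t0 t1 t2) = mx6
  [:: [:: 0; 0; 0; t0; 0; 0]; [:: 0; 0; 0; 0; t1; 0]; [:: 0; 0; 0; 0; 0; t2];
      [:: - t0; 0; 0; 0; 0; 0]; [:: 0; - t1; 0; 0; 0; 0]; [:: 0; 0; - t2; 0; 0; 0]].
Proof.
have two p q i j : iot j (iot i (eps p (eps q one6))) finset.set0 =
    (i == p)%:R * (j == q)%:R - (j == p)%:R * (i == q)%:R :> C.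
  rewrite !iot_epsE (raddfB (iot j))/= iot_ebasis0 (raddf0 (eps q)) subr0 iot_esc !iot_epsE.
  rewrite iot_ebasis0 (raddf0 (eps q)) subr0 iot_esc iot_ebasis0 (raddf0 (esc _)) (raddf0 (eps p)) subr0.
  by rewrite !ffunE eqxx !mulr1.
have tw t p q i j : iot j (iot i (esc t (eps p (eps q one6)))) finset.set0 =
    t * ((i == p)%:R * (j == q)%:R - (j == p)%:R * (i == q)%:R).
  by rewrite !iot_esc ffunE two.
have addE (u v : E) : (u + v) finset.set0 = u finset.set0 + v finset.set0 by rewrite ffunE.
apply: matrix6P => i j; rewrite two_form_mxE mx6E /phi /lefschetz.
rewrite (raddfD (iot i))/= (raddfD (iot i))/= (raddfD (iot j))/= (raddfD (iot j))/=.
apply: etrans (etrans (addE _ _) (congr2 +%R (etrans (addE _ _)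
  (congr2 +%R (tw _ _ _ _ _) (tw _ _ _ _ _))) (tw _ _ _ _ _))) _.
by elim/ord6P: i; elim/ord6P: j; rewrite /= ?mulr0n ?mulr1n; ring.
Qed.

Section Metric.
Context (a c d1 d2 : C) (h0 h1 h2 : R).
Context (a_lt1 : `|a| < 1).
Context (h0_gt0 : 0 < h0) (h1_gt0 : 0 < h1) (h2_gt0 : 0 < h2).
Local Notation B := (heis_frame a c d1 d2).
Local Notation I := ('i%C : C).
Definition phih : E := phi (I * h0%:C) (I * h1%:C) (I * h2%:C).

Definition hseq (i : 'I_6) : R := [:: h0; h1; h2; h0; h1; h2]`_i.

Lemma hseq_gt0 i : 0 < hseq i.
Proof. by elim/ord6P: i. Qed.

(** The complex bilinear extension of the metric pairs each $e_i$ with its conjugate and with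
    nothing else, so the Gram matrix has two off-diagonal diagonal blocks. *)
Definition gram_mx : 'M[C]_6 := mx6
  [:: [:: 0; 0; 0; h0%:C; 0; 0]; [:: 0; 0; 0; 0; h1%:C; 0]; [:: 0; 0; 0; 0; 0; h2%:C];
      [:: h0%:C; 0; 0; 0; 0; 0]; [:: 0; h1%:C; 0; 0; 0; 0]; [:: 0; 0; h2%:C; 0; 0; 0]].

Definition gram_inv : 'M[C]_6 := mx6
  [:: [:: 0; 0; 0; h0%:C^-1; 0; 0]; [:: 0; 0; 0; 0; h1%:C^-1; 0]; [:: 0; 0; 0; 0; 0; h2%:C^-1];
      [:: h0%:C^-1; 0; 0; 0; 0; 0]; [:: 0; h1%:C^-1; 0; 0; 0; 0]; [:: 0; 0; h2%:C^-1; 0; 0; 0]].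

Lemma gram_invK : gram_mx *m gram_inv = 1%:M.
Proof.
have n0 : h0%:C != 0 by rewrite (fmorph_eq0 (real_complex R)) gt_eqF.
have n1 : h1%:C != 0 by rewrite (fmorph_eq0 (real_complex R)) gt_eqF.
have n2 : h2%:C != 0 by rewrite (fmorph_eq0 (real_complex R)) gt_eqF.
have e0 := mulfV n0; have e1 := mulfV n1; have e2 := mulfV n2.
apply: matrix6P => i j; rewrite mul6E !mx6E [RHS]mxE.
move: e0 e1 e2; move: (h0%:C) (h1%:C) (h2%:C) => x y z.
move: (x^-1) (y^-1) (z^-1) => x' y' z' e0 e1 e2.
by elim/ord6P: i; elim/ord6P: j; rewrite /= ?mulr0n ?mulr1n; ring: e0 e1 e2.
Qed.

Lemma metric_frame x : metric_mx (fibre_mx a) (ext_map (B x) phih) = (B x)^T *m gram_mx *m B x.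
Proof.
rewrite /metric_mx two_form_mx_ext_map -mulmxA.
have -> : B x *m cplx_mx (fibre_mx a) = diag_mx (\row_r hol_sign r) *m B x.
  apply/row_matrixP => r; rewrite row_mul heis_frame_fibre//.
  by apply/rowP => j; rewrite mul_diag_mx !mxE.
have dE k l : diag_mx (\row_r hol_sign r) k l = hol_sign k * (k == l)%:R :> C.
  by rewrite !mxE mulr_natr.
suff TL : two_form_mx phih *m diag_mx (\row_r hol_sign r) = gram_mx.
  by rewrite mulmxA -(mulmxA (B x)^T _ (diag_mx _)) TL.
rewrite two_form_phi; apply: matrix6P => i j; rewrite [LHS]mxE big_ord6 /= !dE !mx6E /hol_sign.
have iE : I * I = - 1 := @mulii R.
have -> : ('i : C) = I by []. 
move: iE; move: I (h0%:C) (h1%:C) (h2%:C) => I' x0 x1 x2 iE {dE}.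
by elim/ord6P: i; elim/ord6P: j; rewrite /= ?mulr0n ?mulr1n; ring: iE.
Qed.

Definition hweight (S : {set 'I_6}) : R := \prod_(i in S) (hseq i)^-1.

Lemma hweight_gt0 S : 0 < hweight S.
Proof. by apply: prodr_gt0 => i _; rewrite invr_gt0 hseq_gt0. Qed.

(** Row $i$ of the inverse is the conjugate generator divided by the weight of $i$. The induced
    algebra morphism is thus a rescaling followed by the conjugation of indices, the form used in
    [harmonic_form]. *)
Lemma ext_map_gram u : ext_map gram_inv u =
  swap bar6 [ffun S : {set 'I_6} => (hweight S)%:C * u S].
Proof.
pose wg u : E := [ffun S : {set 'I_6} => (hweight S)%:C * u S].
rewrite -/(wg u).
have wgD v w : wg (v + w) = wg v + wg w by apply/ffunP => S; rewrite !ffunE mulrDr.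
have wgZ s v : wg (esc s v) = esc s (wg v) by apply/ffunP => S; rewrite !ffunE mulrCA.
have rowE i : row i gram_inv = (hseq i)%:C^-1 *: delta_mx 0 (bar6 i).
  have [[b0 b1 b2] [b3 b4 b5]] := bar6E.
  apply/rowP => j; rewrite [LHS]mxE [RHS]mxE [delta_mx _ _ _ _]mxE mx6E.
  elim/ord6P: i; rewrite ?(b0, b1, b2, b3, b4, b5); elim/ord6P: j;
    by rewrite /= ?mulr1 ?mulr0.
move: u; apply: ext_ind => [v w Ev Ew|s v Ev||i v Ev].
- by rewrite (raddfD (ext_map _))/= Ev Ew wgD (raddfD (swap bar6)).
- by rewrite ext_map_esc Ev wgZ swap_esc.
- rewrite ext_map1; apply/ffunP => S; rewrite !ffunE.
  have [->|S0] := eqVneq S finset.set0.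
    by rewrite imset0 swap_sign0 eqxx /hweight big_set0 !mul1r.
  rewrite (_ : (bar6 @: S == finset.set0)%SET = false) ?mulr0//.
  by apply/negbTE; rewrite imset_eq0.
- rewrite ext_map_eps Ev rowE covZ cov_delta -(swap_eps bar6K) -swap_esc; congr (swap _ _).
  apply/ffunP => S; rewrite !ffunE; case: ifP => iS; last by rewrite !mulr0.
  rewrite -[in hweight S](finset.setD1K iS) /hweight big_setU1 ?finset.setD11//= .
  rewrite (rmorphM (real_complex R))/= (fmorphV (real_complex R))/=; ring.
Qed.

(** The volume is $F^3/3!$ with constant coefficients in the coframe, so the top coefficient of the
    coframe enters as a factor and cancels. *)
Lemma volume_frame : exists2 kap : C, kap != 0 & forall x,
  volume (ext_map (B x) phih) finset.setT * (top_coef (B x))^-1 = kap.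
Proof.
exists (6%:R^-1 * lefschetz (I * h0%:C) (I * h1%:C) (I * h2%:C)
  (lefschetz (I * h0%:C) (I * h1%:C) (I * h2%:C) (lefschetz (I * h0%:C) (I * h1%:C) (I * h2%:C) one6)) finset.setT).
  have iN : I != 0 by rewrite eq_complex /= negb_and oner_neq0 orbT.
  have hN (h : R) : 0 < h -> I * h%:C != 0.
    by move=> hp; rewrite mulf_neq0// (fmorph_eq0 (real_complex R)) gt_eqF.
  rewrite mulf_neq0 ?invr_eq0 ?pnatr_eq0//.
  by apply: phi_top_neq0; apply: hN.
move=> x; rewrite /volume escaleE ffunE /=.
rewrite -[one6 in LHS](ext_map1 (B x)) -!ext_map_wedge !wedge_phil ext_map_top.
have := top_coef_neq0 (heis_frame_unit c d1 d2 a_lt1 x).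
by move: (top_coef _) => z z0; rewrite -mulrA; congr (_ * _); rewrite mulrC mulKf.
Qed.

Lemma star_frame : exists2 kap : C, kap != 0 & forall x u,
  hodge (fibre_mx a) (ext_map (B x) phih) (ext_map (B x) u) =
  esc kap (ext_map (B x) (star0 (swap bar6 [ffun S : {set 'I_6} => (hweight S)%:C * u S]))).
Proof.
have [kap k0 kE] := volume_frame; exists kap => // x u.
have [uG _] := mulmx1_unit gram_invK.
rewrite (hodge_frame _ (heis_frame_unit c d1 d2 a_lt1 x) uG (metric_frame x)) kE.
suff -> : invmx gram_mx = gram_inv by rewrite ext_map_gram.
by rewrite -[gram_inv]mul1mx -(mulVmx uG) -mulmxA gram_invK mulmx1.
Qed.
End Metric.
End FundamentalForm.

(** * Supports of forms of bidegree (2,2) and (3,3) *)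

Section BidegreeTwo.
Context {K : comPzRingType}.
Implicit Types (u : {ffun {set 'I_6} -> K}) (S X : {set 'I_6}).

Lemma card_hol6 : #|hol6| = 3.
Proof.
have -> : hol6 = (o0 |: (o1 |: [set o2]))%SET by apply/setP; elim/ord6P; rewrite !finset.inE.
by rewrite !finset.cardsU1 finset.cards1 !finset.inE.
Qed.

Lemma bideg22_supp u X p q : bideg (fun p' q' => (p' == 2) && (q' == 2)) u ->
  p \notin X -> q \notin X -> p != q -> X != (~: [set p; q])%SET -> u X = 0.
Proof.
move=> uT pX qX pq XN; apply: uT; apply: contra XN => /andP[/eqP e1 /eqP e2].
have cX : #|X| = 4 by rewrite -(cardsID hol6 X) e1 e2.
rewrite eqEcard; apply/andP; split.
  apply/fintype.subsetP => x xX; rewrite !finset.inE negb_or; apply/andP; split.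
    by apply: contraNneq pX => <-.
  by apply: contraNneq qX => <-.
have := finset.cardsC [set p; q]%SET; rewrite finset.cards2 pq card_ord cX => e.
by rewrite -(leq_add2l 2) e.
Qed.

Lemma bideg33_eq0 u : bideg (fun p' q' => (p' == 3) && (q' == 3)) u -> u finset.setT = 0 -> u = 0.
Proof.
move=> uT u0; apply/ffunP => S; rewrite [RHS]ffunE; have [->//|SN] := eqVneq S finset.setT.
apply: uT; apply: contra SN => /andP[/eqP e1 /eqP e2].
by rewrite eqEcard finset.subsetT /= finset.cardsT card_ord -(cardsID hol6 S) e1 e2.
Qed.
End BidegreeTwo.

(** * Completing the square for a positive Hermitian form in three variables *)

Section CompleteSquare.
Context {R : realType}.
Local Notation C := R[i].
Local Notation cj := (@conjc R).

Lemma complex_gt0 (z : C) : 0 < z -> exists2 r : R, 0 < r & z = r%:C.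
Proof.
case: z => p q; rewrite ltcE /= => /andP[/eqP q0 p0]; exists p => //.
by rewrite q0.
Qed.

(** Being positive in [R[i]] includes being real. The values at $(1,0)$, $(0,1)$, $(1,1)$ and
    $(1,i)$ then determine how the two mixed coefficients are related. *)
Lemma pos_hermitian (A B D F : C) :
  (forall x y, x != 0 \/ y != 0 ->
    0 < A * (x * cj x) + B * (x * cj y) + D * (y * cj x) + F * (y * cj y)) ->
  D = cj B.
Proof.
move=> H.
have h1 := H 1 0 (or_introl (oner_neq0 _)).
have h2 := H 0 1 (or_intror (oner_neq0 _)).
have h3 := H 1 1 (or_introl (oner_neq0 _)).
have h4 := H 1 'i%C (or_introl (oner_neq0 _)).
move: h1 h2 h3 h4; case: A B D F {H} => [a a'] [b b'] [d d'] [f f'].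
rewrite !ltcE /= => /andP[/eqP e1 _] /andP[/eqP e2 _] /andP[/eqP e3 _] /andP[/eqP e4 _].
by apply/eqP; rewrite eq_complex /=; apply/andP; split; apply/eqP; lra.
Qed.

(** The form is written as $h_0|x|^2+h_1|cx+y|^2+h_2|d_1x+d_2y+z|^2$, starting from the last
    variable. Each weight is positive because it is the value of the form at a vector that
    annihilates the other squares. *)
Lemma complete_square (H00 H01 H02 H10 H11 H12 H20 H21 H22 : C) :
  (forall x y z, [\/ x != 0, y != 0 | z != 0] ->
    0 < H00 * (x * cj x) + H01 * (x * cj y) + H02 * (x * cj z) +
        (H10 * (y * cj x) + H11 * (y * cj y) + H12 * (y * cj z)) +
        (H20 * (z * cj x) + H21 * (z * cj y) + H22 * (z * cj z))) ->
  exists h : R * R * R, exists cd : C * C * C,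
    let: (h0, h1, h2) := h in let: (c, d1, d2) := cd in
    [/\ 0 < h0, 0 < h1 & 0 < h2] /\
    [/\ [/\ H00 = h0%:C + h1%:C * (c * cj c) + h2%:C * (d1 * cj d1),
            H01 = h1%:C * c + h2%:C * (d1 * cj d2) & H02 = h2%:C * d1],
        [/\ H10 = h1%:C * cj c + h2%:C * (d2 * cj d1),
            H11 = h1%:C + h2%:C * (d2 * cj d2) & H12 = h2%:C * d2] &
        [/\ H20 = h2%:C * cj d1, H21 = h2%:C * cj d2 & H22 = h2%:C]].
Proof.
move=> H.
have c0 : cj 0 = 0 := conjc0 _.
have c1 : cj 1 = 1 := conjc1 _.
have e10 : H10 = cj H01.
  apply: (@pos_hermitian H00 H01 H10 H11) => x y xy.
  have h : [\/ (x : C) != 0, (y : C) != 0 | (0 : C) != 0].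
    by case: xy => h; [constructor 1 | constructor 2].
  have E := H _ _ _ h; rewrite c0 in E; apply: (etrans _ E); congr (0 < _); ring.
have e20 : H20 = cj H02.
  apply: (@pos_hermitian H00 H02 H20 H22) => x z xz.
  have h : [\/ (x : C) != 0, (0 : C) != 0 | (z : C) != 0].
    by case: xz => h; [constructor 1 | constructor 3].
  have E := H _ _ _ h; rewrite c0 in E; apply: (etrans _ E); congr (0 < _); ring.
have e21 : H21 = cj H12.
  apply: (@pos_hermitian H11 H12 H21 H22) => y z yz.
  have h : [\/ (0 : C) != 0, (y : C) != 0 | (z : C) != 0].
    by case: yz => h; [constructor 2 | constructor 3].
  have E := H _ _ _ h; rewrite c0 in E; apply: (etrans _ E); congr (0 < _); ring.
have cR (r : R) : cj r%:C = r%:C by apply/eqP; rewrite eq_complex /= oppr0 !eqxx.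
have cM (x y : C) : cj (x * y) = cj x * cj y := conjcM x y.
have cV (x : C) : cj (x^-1) = (cj x)^-1 := conjc_inv x.
have cN (x : C) : cj (- x) = - cj x := conjcN x.
have cD (x y : C) : cj (x + y) = cj x + cj y := conjcD x y.
have [h2 h2p e22] : exists2 r : R, 0 < r & H22 = r%:C.
  apply: complex_gt0; have := H 0 0 1 (Or33 _ _ (oner_neq0 _)).
  by rewrite c0 c1 !mulr0 !mul0r !mulr0 !mulr1 !addr0 !add0r.
have n2 : h2%:C != 0 by rewrite (fmorph_eq0 (real_complex R)) gt_eqF.
have [d1 e02] : exists d1 : C, H02 = h2%:C * d1 by exists (H02 / h2%:C); rewrite [RHS]mulrC divfK.
have [d2 e12] : exists d2 : C, H12 = h2%:C * d2 by exists (H12 / h2%:C); rewrite [RHS]mulrC divfK.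
have f20 : H20 = h2%:C * cj d1 by rewrite e20 e02 cM cR.
have f21 : H21 = h2%:C * cj d2 by rewrite e21 e12 cM cR.
have [h1 h1p e11] : exists2 r : R, 0 < r & H11 - h2%:C * (d2 * cj d2) = r%:C.
  (* At $(0,1,-d_2)$ the squares with weights $h_0$ and $h_2$ vanish. *)
  apply: complex_gt0; have E := H 0 1 (- d2) (Or32 _ _ (oner_neq0 _)).
  rewrite f20 f21 e22 e02 e12 c0 c1 cN in E.
  apply: (etrans _ E); congr (0 < _); ring.
have n1 : h1%:C != 0 by rewrite (fmorph_eq0 (real_complex R)) gt_eqF.
have [c e01] : exists c : C, H01 - h2%:C * (d1 * cj d2) = h1%:C * c.
  by exists ((H01 - h2%:C * (d1 * cj d2)) / h1%:C); rewrite [RHS]mulrC divfK.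
have g01 : H01 = h1%:C * c + h2%:C * (d1 * cj d2) by rewrite -e01 subrK.
have cK (x : C) : cj (cj x) = x := conjcK x.
have g10 : H10 = h1%:C * cj c + h2%:C * (d2 * cj d1).
  rewrite e10 g01 cD (cM h1%:C) (cM h2%:C) (cM d1) !cR cK; congr (_ + _ * _); exact: mulrC.
have g11 : H11 = h1%:C + h2%:C * (d2 * cj d2) by rewrite -e11 subrK.
have [h0 h0p e00] : exists2 r : R, 0 < r & H00 - h1%:C * (c * cj c) - h2%:C * (d1 * cj d1) = r%:C.
  (* At this vector the squares with weights $h_1$ and $h_2$ vanish. *)
  apply: complex_gt0; have E := H 1 (- c) (- (d1 - d2 * c)) (Or31 _ _ (oner_neq0 _)).
  rewrite f20 f21 e22 e02 e12 g01 g10 g11 c1 !(cN, cD, cM) in E.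
  apply: (etrans _ E); congr (0 < _); ring.
exists (h0, h1, h2), (c, d1, d2); split=> //; split; split=> //.
by rewrite -e00; ring.
Qed.
End CompleteSquare.

(** * Invariant (1,1)-forms and triangular changes of coframe *)

Section AdaptedFrame.
Context {R : realType}.
Local Notation C := R[i].
Local Notation G := 'rV[R]_6.
Local Notation E := (ext R 6).
Local Notation one6 := (ebasis R (finset.set0 : {set 'I_6})).
Local Notation cj := (@conjc R).
Local Notation I := ('i%C : C).

Lemma two_cov (s t : 'rV[C]_6) i j : iot j (iot i (cov s (cov t one6))) finset.set0 =
  s 0 i * t 0 j - s 0 j * t 0 i.
Proof.
rewrite !iot_cov (raddfB (iot j))/= iot_ebasis0 covr0 subr0 iot_esc !iot_cov iot_ebasis0 covr0 subr0.
rewrite iot_esc iot_ebasis0 (raddf0 (esc _)) covr0 subr0.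
have one0 : one6 finset.set0 = 1 by rewrite ffunE eqxx.
have subE (u v : E) : (u - v) finset.set0 = u finset.set0 - v finset.set0 by rewrite !ffunE.
have escE z (u : E) : esc z u finset.set0 = z * u finset.set0 by rewrite ffunE.
by rewrite subE !escE one0 !mulr1.
Qed.

Lemma form11_ext (u v : E) : bideg (fun p q => (p == 1) && (q == 1)) u ->
  bideg (fun p q => (p == 1) && (q == 1)) v ->
  (forall j l : 'I_6, (j < 3)%N -> (3 <= l)%N ->
    iot l (iot j u) finset.set0 = iot l (iot j v) finset.set0) -> u = v.
Proof.
move=> uT vT uv; apply/ffunP => S.
have [/andP[c1 c2]|nS] := boolP ((#|(S :&: hol6)%SET| == 1) && (#|(S :\: hol6)%SET| == 1)); last first.
  by rewrite uT ?vT.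
have /cards1P[j jE] := c1; have /cards1P[l lE] := c2.
have jh : (j \in S) && (j < 3)%N.
  by have := finset.set11 j; rewrite -jE finset.inE hol6E.
have lh : (l \in S) && (3 <= l)%N.
  by have := finset.set11 l; rewrite -lE finset.inE hol6E -leqNgt andbC.
have SE : S = [set j; l]%SET.
  by rewrite -(finset.setID S hol6) jE lE.
have [/andP[_ j3] /andP[_ l3]] := (jh, lh).
have jl : (j < l)%N by apply: leq_trans l3.
have co (w : E) : w [set j; l]%SET = iot l (iot j w) finset.set0.
  by rewrite -two_form_mxE mxE jl.
by rewrite SE !co uv.
Qed.

Lemma bideg_cov_hol P (t : 'rV[C]_6) (w : E) : (forall i : 'I_6, (3 <= i)%N -> t 0 i = 0) ->
  bideg P w -> bideg (fun p q => (0 < p)%N && P p.-1 q) (cov t w).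
Proof.
move=> t0 wP S nS; rewrite covE sum_ffunE big1// => i _; rewrite ffunE.
have [i3|i3] := ltnP i 3; last by rewrite t0// mul0r.
by rewrite (@bideg_eps _ P i w wP) ?mulr0// i3.
Qed.

Lemma bideg_cov_anti P (t : 'rV[C]_6) (w : E) : (forall i : 'I_6, (i < 3)%N -> t 0 i = 0) ->
  bideg P w -> bideg (fun p q => (0 < q)%N && P p q.-1) (cov t w).
Proof.
move=> t0 wP S nS; rewrite covE sum_ffunE big1// => i _; rewrite ffunE.
have [i3|i3] := ltnP i 3; first by rewrite t0// mul0r.
by rewrite (@bideg_eps _ P i w wP) ?mulr0// ltnNge i3.
Qed.

Lemma bideg_one : bideg (fun p q => (p == 0) && (q == 0)) one6.
Proof.
move=> S nS; rewrite ffunE; have [S0|//] := eqVneq S finset.set0.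
by case/negP: nS; rewrite S0 finset.set0I finset.set0D finset.cards0.
Qed.

Lemma bideg_cov_cov (s t : 'rV[C]_6) : (forall i : 'I_6, (3 <= i)%N -> s 0 i = 0) ->
  (forall i : 'I_6, (i < 3)%N -> t 0 i = 0) ->
  bideg (fun p q => (p == 1) && (q == 1)) (cov s (cov t one6)).
Proof.
move=> s0 t0; apply: (bidegW _ (bideg_cov_hol s0 (bideg_cov_anti t0 bideg_one))) => p q /=.
by case: p q => [|p] [|q].
Qed.

Definition change_mx (c d1 d2 : C) : 'M[C]_6 := mx6
  [:: [:: 1; 0; 0; 0; 0; 0]; [:: c; 1; 0; 0; 0; 0]; [:: d1; d2; 1; 0; 0; 0];
      [:: 0; 0; 0; 1; 0; 0]; [:: 0; 0; 0; cj c; 1; 0]; [:: 0; 0; 0; cj d1; cj d2; 1]].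

Lemma frame_change a c d1 d2 x :
  heis_frame a c d1 d2 x = change_mx c d1 d2 *m heis_frame a 0 0 0 x.
Proof.
rewrite /heis_frame mulmxA; congr (_ *m _); apply: matrix6P => i j; rewrite mul6E !mx6E.
have := conjc0 R; move: cj => cc c0.
elim/ord6P: i; elim/ord6P: j; rewrite /= ?c0; ring.
Qed.

(** This separates $c$, which would alter the structure equations, from $d_1$ and $d_2$, which do
    not. *)
Lemma change_split c d1 d2 : change_mx c d1 d2 = change_mx c 0 0 *m change_mx 0 d1 d2.
Proof.
apply: matrix6P => i j; rewrite mul6E !mx6E.
have := conjc0 R; move: cj => cc c0.
elim/ord6P: i; elim/ord6P: j; rewrite /= ?c0; ring.
Qed.

Lemma change_phi c d1 d2 t0 t1 t2 : ext_map (change_mx c d1 d2) (phi t0 t1 t2) =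
  esc t0 (cov (row o0 (change_mx c d1 d2)) (cov (row o3 (change_mx c d1 d2)) one6)) +
  esc t1 (cov (row o1 (change_mx c d1 d2)) (cov (row o4 (change_mx c d1 d2)) one6)) +
  esc t2 (cov (row o2 (change_mx c d1 d2)) (cov (row o5 (change_mx c d1 d2)) one6)).
Proof.
rewrite /phi /lefschetz (raddfD (ext_map _))/= (raddfD (ext_map _))/= !ext_map_esc !ext_map_eps.
by rewrite ext_map1.
Qed.

Lemma change_row_hol c d1 d2 (k i : 'I_6) : (k < 3)%N -> (3 <= i)%N -> (row k (change_mx c d1 d2)) 0 i = 0.
Proof. by rewrite mxE mx6E; elim/ord6P: k; elim/ord6P: i. Qed.

Lemma change_row_anti c d1 d2 (k i : 'I_6) : (3 <= k)%N -> (i < 3)%N -> (row k (change_mx c d1 d2)) 0 i = 0.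
Proof. by rewrite mxE mx6E; elim/ord6P: k; elim/ord6P: i. Qed.

(** Full left invariance is periodicity for the whole group, which acts transitively, so the
    coefficients are constant. *)
Lemma invariant_const (a : C) (F : dform R 5) : `|a| < 1 -> smooth_form F ->
  invariant_form setT F -> exists f : E, F = fun x => ext_map (heis_frame a 0 0 0 x) f.
Proof.
move=> a1 sF iF; have [u uE] := @fform_surj R setT a 0 0 0 a1 F sF iF.
exists (gev u 0); rewrite uE; apply/funext => x; rewrite /fform; congr (ext_map _ _).
apply/ffunP => S; rewrite !ffunE; have [_ pu] := gsmP (u S).
have <- : gval (u S) (heis_mul x 0) = gval (u S) 0 by exact: pu.
congr (gval _ _); rewrite heis_mulE addr0 big1 ?addr0// => r _.
by rewrite mxE scale0r.
Qed.

Lemma frame_real_vector (a w0 w1 w2 : C) x : `|a| < 1 -> exists v : 'cV[R]_6,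
  heis_frame a 0 0 0 x *m cplx_mx v = \col_i [:: w0; w1; w2; cj w0; cj w1; cj w2]`_i.
Proof.
move=> a1; pose w : 'cV[C]_6 := \col_i [:: w0; w1; w2; cj w0; cj w1; cj w2]`_i.
have [[b0 b1 b2] [b3 b4 b5]] := bar6E.
have U := heis_frame_unit 0 0 0 a1 x.
have wb i : w (bar6 i) 0 = cj (w i 0).
  rewrite !mxE; elim/ord6P: i; rewrite ?(b0, b1, b2, b3, b4, b5) /=; rewrite ?conjcK//.
have Qb r j : frame_inv a 0 0 0 x r (bar6 j) = cj (frame_inv a 0 0 0 x r j).
  rewrite [LHS]mxE [in RHS]mxE (rmorph_sum (@conjc R)); apply: eq_bigr => s _.
  rewrite vector_bar (rmorphM (@conjc R))/=; congr (_ * _).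
  by rewrite [_^T _ _]mxE [cplx_mx _ _ _]mxE; apply/eqP; rewrite eq_complex /= oppr0 !eqxx.
pose z := frame_inv a 0 0 0 x *m w.
have zR r : z r 0 = (complex.Re (z r 0))%:C.
  have E : z r 0 = cj (z r 0).
    rewrite [LHS]mxE [in RHS]mxE (rmorph_sum (@conjc R)).
    rewrite (reindex_inj (inv_inj bar6K)) /=; apply: eq_bigr => j _.
    by rewrite Qb wb (rmorphM (@conjc R)).
  move: E; case: (z r 0) => p q /= /eqP; rewrite eq_complex /= => /andP[_ /eqP e].
  by apply/eqP; rewrite eq_complex /= eqxx /=; apply/eqP; lra.
exists (\col_r complex.Re (z r 0)).
have -> : cplx_mx (\col_r complex.Re (z r 0)) = z.
  by apply/matrixP => r s; rewrite mxE mxE (ord1 s) -zR.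
by rewrite /z mulmxA (mulmx1C (frame_invK 0 0 0 a1 x)) mul1mx.
Qed.
End AdaptedFrame.

(** * Balancedness read in the coframe *)

Section ExteriorOperators.
Context (K : comPzRingType) (V : zmodType) (sc : K -> V -> V) (e : 'I_6 -> V -> V).

Definition exterior_operators : Prop :=
  [/\ forall s t u, sc s (sc t u) = sc (s * t) u, forall s, sc s 0 = 0,
      forall i u v, e i (u + v) = e i u + e i v & forall i u, e i (- u) = - e i u] /\
  [/\ forall i, e i 0 = 0, forall i s u, e i (sc s u) = sc s (e i u),
      forall i j u, e i (e j u) = - e j (e i u) & forall i u, e i (e i u) = 0].

Context (ops : exterior_operators).

Lemma operator_kill : [/\ forall i j u, e i (e j (e i u)) = 0,
  forall i j k u, e i (e j (e k (e i u))) = 0 &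
  forall i j k l u, e i (e j (e k (e l (e i u)))) = 0].
Proof.
have [[scA sc0 eD eN] [e0 eZ ec ee]] := ops.
have k2 i j u : e i (e j (e i u)) = 0 by rewrite (ec j) eN ee oppr0.
have k3 i j k u : e i (e j (e k (e i u))) = 0 by rewrite (ec k i) !eN k2 oppr0.
by split=> // i j k l u; rewrite (ec l i) !eN k3 oppr0.
Qed.

(** Every term of [w] repeats a factor $e_0$ or $e_1$ of the first product, and only $e_0\wedge e_4$
    is free of the factors $e_3$ and $e_1$ of the second. *)
Lemma mixed_term A B D t p q u :
  let w := sc A (e o0 (e o3 u)) + sc B (e o0 (e o4 u)) + sc D (e o1 (e o3 u)) + sc t (e o1 (e o4 u)) in
  e o2 (sc p (e o0 (e o1 (e o5 w))) + sc q (e o3 (e o1 (e o5 w)))) =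
  sc (q * B) (e o2 (e o3 (e o1 (e o5 (e o0 (e o4 u)))))).
Proof.
have [[scA sc0 eD eN] [e0 eZ ec ee]] := ops; have [k2 k3 k4] := operator_kill.
by rewrite /= !(eD, eZ) !(k2, k3, k4) !(e0, sc0, add0r, addr0) scA.
Qed.

(** Here $T$ behaves as $d$. Each monomial of $de_2$ and $de_5$ shares a factor with $e_0\wedge e_3$
    and with $e_1\wedge e_4$, so every term of the differential of the square repeats a factor. *)
Lemma diagonal_square_closed (T : V -> V) (m k l x y z : K) (u : V) :
  zmod_morphism T -> (forall s v, T (sc s v) = sc s (T v)) -> T u = 0 ->
  (forall i v, i != o2 -> i != o5 -> T (e i v) = - e i (T v)) ->
  (forall v, T (e o2 v) = sc m (e o0 (e o1 v)) + sc k (e o3 (e o1 v)) - e o2 (T v)) ->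
  (forall v, T (e o5 v) = sc m (e o3 (e o4 v)) + sc l (e o0 (e o4 v)) - e o5 (T v)) ->
  let L v := sc x (e o0 (e o3 v)) + sc y (e o1 (e o4 v)) + sc z (e o2 (e o5 v)) in
  T (L (L u)) = 0.
Proof.
move=> TB TZ Tu Ti T2 T5 /=.
have [[scA sc0 eD eN] [e0 eZ ec ee]] := ops; have [k2 k3 k4] := operator_kill.
have T0 : T 0 = 0 by have := TB 0 0; rewrite !subrr.
have TN v : T (- v) = - T v by have := TB 0 v; rewrite T0 !sub0r.
have TD v w : T (v + w) = T v + T w by rewrite -[w in LHS]opprK TB TN opprK.
have i0 v : T (e o0 v) = - e o0 (T v) by exact: Ti.
have i1 v : T (e o1 v) = - e o1 (T v) by exact: Ti.
have i3 v : T (e o3 v) = - e o3 (T v) by exact: Ti.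
have i4 v : T (e o4 v) = - e o4 (T v) by exact: Ti.
rewrite !(eD, eZ) !(k2, k3, e0, sc0, addr0, add0r) !(TD, TZ, i0, i1, i3, i4, T2, T5, Tu, T0).
by rewrite !(eD, eZ, eN, e0, k2, k3, k4, ee, sc0, oppr0, addr0, add0r).
Qed.
End ExteriorOperators.

Section Reduction.
Context {R : realType}.
Local Notation C := R[i].
Local Notation G := 'rV[R]_6.
Local Notation E := (ext R 6).
Local Notation one6 := (ebasis R (finset.set0 : {set 'I_6})).
Local Notation cj := (@conjc R).
Local Notation I := ('i%C : C).

Definition cform (Gam : set G) (f : E) : {ffun {set 'I_6} -> gsm Gam} :=
  [ffun S : {set 'I_6} => gcst Gam (f S)].

Lemma gev_cform Gam (f : E) x : gev (cform Gam f) x = f.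
Proof. by apply/ffunP => S; rewrite !ffunE. Qed.

Lemma fform_cform Gam a c d1 d2 (f : E) x :
  fform a c d1 d2 (cform Gam f) x = ext_map (heis_frame a c d1 d2 x) f.
Proof. by rewrite /fform gev_cform. Qed.

Lemma of_type_const a c d1 d2 p q (f : E) : `|a| < 1 ->
  of_type (fun _ => fibre_mx a) p q (fun x => ext_map (heis_frame a c d1 d2 x) f) <->
  bideg (fun p' q' => (p' == p) && (q' == q)) f.
Proof.
move=> a1.
have -> : (fun x => ext_map (heis_frame a c d1 d2 x) f) = fform a c d1 d2 (cform setT f).
  by apply/funext => x; rewrite fform_cform.
apply: iff_trans (fform_of_type c d1 d2 a1 p q (cform setT f)) _; split=> [H S nS|H].
  have := @typg_bideg _ p q (cform setT f) S nS; rewrite H ffunE.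
  by move/(congr1 (fun g => gval g 0)).
by apply: bideg_typg => S nS; rewrite ffunE H// (raddf0 (gcst setT)).
Qed.

Lemma torsion_off (a : C) i (u : E) : i != o2 -> i != o5 ->
  torsion (d_frame a) (eps i u) = - eps i (torsion (d_frame a) u).
Proof.
move=> i2 i5; rewrite (torsion_eps (@d_frame_zmod R a) (@d_frame_eps R a)).
by rewrite /d_frame (negbTE i2) (negbTE i5) sub0r.
Qed.

Lemma eps_nn p (w : E) : eps p (- w) = - eps p w.
Proof. exact: (raddfN (eps p)). Qed.

Lemma eps_operators : exterior_operators (fun s (u : E) => esc s u) (fun i (u : E) => eps i u).
Proof.
split; split.
- exact: escA.
- by move=> s; exact: escr0.
- by move=> i u v; exact: (raddfD (eps i)).
- exact: eps_nn.
- by move=> i; exact: (raddf0 (eps i)).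
- by move=> i s u; exact: eps_esc.
- by move=> i j u; exact: eps_eps.
- by move=> i u; exact: eps_eps0.
Qed.

Lemma eps_kill2 i j (u : E) : eps i (eps j (eps i u)) = 0.
Proof. by rewrite (eps_eps j) eps_nn eps_eps0 oppr0. Qed.

Lemma sg_neq0 i (S : {set 'I_6}) : sg i S != 0 :> C.
Proof.
by apply/eqP => s0; have := @sg_sq C 6 i S; rewrite s0 mul0r => /esym/eqP; rewrite oner_eq0.
Qed.

Lemma quad_mulmx (A N : 'M[C]_6) (v w : 'cV[C]_6) : A *m v = w ->
  v^T *m (A^T *m N *m A) *m v = w^T *m N *m w.
Proof. by move=> <-; rewrite trmx_mul !mulmxA. Qed.

End Reduction.

Section SquareTorsion.
Context {R : realType}.
Local Notation C := R[i].
Local Notation G := 'rV[R]_6.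
Local Notation E := (ext R 6).
Local Notation one6 := (ebasis R (finset.set0 : {set 'I_6})).
Local Notation cj := (@conjc R).
Local Notation I := ('i%C : C).

(** Write [psi] as $S+t_2\,e_2\wedge e_5$. The square of $S$ is closed, being made of closed
    covectors, so the equation concerns $2t_2\,e_2\wedge e_5\wedge S$. Its $de_2$-part contains
    $a\,e_3\wedge e_1\wedge e_5\wedge S$, where only the coefficient $B$ of $e_0\wedge e_4$
    survives. *)
Lemma square_torsion (a A B D t1 t2 : C) : `|a| < 1 -> t2 != 0 ->
  let psi := esc A (eps o0 (eps o3 one6)) + esc B (eps o0 (eps o4 one6)) +
    esc D (eps o1 (eps o3 one6)) + esc t1 (eps o1 (eps o4 one6)) + esc t2 (eps o2 (eps o5 one6)) in
  torsion (d_frame a) (wedge psi psi) = 0 -> a * B = 0.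
Proof.
move=> a1 t20 psi.
have [S Sdef] : exists S : E -> E, forall u, S u = esc A (eps o0 (eps o3 u)) + esc B (eps o0 (eps o4 u)) +
    esc D (eps o1 (eps o3 u)) + esc t1 (eps o1 (eps o4 u)).
  by exists (fun u => esc A (eps o0 (eps o3 u)) + esc B (eps o0 (eps o4 u)) +
    esc D (eps o1 (eps o3 u)) + esc t1 (eps o1 (eps o4 u))).
have eeD i j (u v : E) : eps i (eps j (u + v)) = eps i (eps j u) + eps i (eps j v).
  by rewrite (raddfD (eps j))/= (raddfD (eps i)).
pose T := torsion (@d_frame R a).
have TB : zmod_morphism T := torsion_zmod (@d_frame_zmod R a).
have T0 : T 0 = 0 by have := TB 0 0; rewrite !subrr.
have TN u : T (- u) = - T u by have := TB 0 u; rewrite T0 !sub0r.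
have TD u v : T (u + v) = T u + T v by rewrite -[v in LHS]opprK TB TN opprK.
have TZ s u : T (esc s u) = esc s (T u) := torsion_esc (@d_frame_esc R a) s u.
have T1 : T one6 = 0.
  rewrite /T /torsion big1// => r _; rewrite iot_ebasis0.
  by have := @d_frame_zmod R a r 0 0; rewrite !subrr.
have TS u : T (S u) = S (T u).
  have Te i j w : i != o2 -> i != o5 -> j != o2 -> j != o5 -> T (eps i (eps j w)) = eps i (eps j (T w)).
    by move=> i2 i5 j2 j5; rewrite /T torsion_off// torsion_off// eps_nn opprK.
  by rewrite !Sdef !TD !TZ !Te.
have SD u v : S (u + v) = S u + S v.
  rewrite !Sdef !eeD.
  move: (eps o0 (eps o3 u)) (eps o0 (eps o4 u)) (eps o1 (eps o3 u)) (eps o1 (eps o4 u)).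
  move: (eps o0 (eps o3 v)) (eps o0 (eps o4 v)) (eps o1 (eps o3 v)) (eps o1 (eps o4 v)).
  by move=> y1 y2 y3 y4 x1 x2 x3 x4; apply/ffunP => X; rewrite !ffunE; ring.
have SZ s u : S (esc s u) = esc s (S u).
  rewrite !Sdef !eps_esc.
  move: (eps o0 (eps o3 u)) (eps o0 (eps o4 u)) (eps o1 (eps o3 u)) (eps o1 (eps o4 u)).
  by move=> x1 x2 x3 x4; apply/ffunP => X; rewrite !ffunE; ring.
have S0 : S 0 = 0 by have := SZ 0 0; rewrite !esc0.
have mv i j k l (u : E) : eps i (eps j (eps k (eps l u))) = eps k (eps l (eps i (eps j u))).
  by rewrite (eps_eps j k) eps_nn (eps_eps i k) opprK (eps_eps j l) !eps_nn (eps_eps i l) eps_nn opprK.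
have SN u : S (eps o2 (eps o5 u)) = eps o2 (eps o5 (S u)).
  by rewrite !Sdef !eeD !eps_esc !(mv _ _ o2 o5).
have wS u : wedge psi u = S u + esc t2 (eps o2 (eps o5 u)).
  by rewrite Sdef /psi !wedgeDl !wedge_escl !eps_wedge !wedge1l.
have psiE : psi = S one6 + esc t2 (eps o2 (eps o5 one6)) by rewrite Sdef.
have -> : wedge psi psi = S (S one6) + esc (2%:R * t2) (eps o2 (eps o5 (S one6))).
  rewrite wS psiE SD SZ SN eeD !eps_esc.
  have -> : eps o2 (eps o5 (eps o2 (eps o5 one6))) = 0 :> E by rewrite eps_kill2.
  move: (S (S one6)) (eps o2 (eps o5 (S one6))) => x1 x2.
  by apply/ffunP => X; rewrite !ffunE; ring.
rewrite -/(T _) TD TZ TS TS T1 S0 S0 add0r.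
have TE i u : T (eps i u) = d_frame a i u - eps i (T u).
  exact: (torsion_eps (@d_frame_zmod R a) (@d_frame_eps R a) i u).
rewrite (TE o2) (TE o5) TS T1 S0 (raddf0 (eps o5)) subr0.
(* Multiplication by $e_2$ removes the contribution of $de_5$, which still contains the factor
   $e_2$. *)
move=> /(congr1 (eps o2)); rewrite (raddf0 (eps o2)) eps_esc (raddfB (eps o2))/= eps_eps0 subr0.
rewrite /d_frame /=.
have mixed p q : eps o2 (esc p (eps o0 (eps o1 (eps o5 (S one6)))) + esc q (eps o3 (eps o1 (eps o5 (S one6))))) =
    esc (q * B) (eps o2 (eps o3 (eps o1 (eps o5 (eps o0 (eps o4 one6)))))).
  by rewrite Sdef; exact: (mixed_term eps_operators).
rewrite mixed escA.
move=> /(congr1 (fun w : E => w finset.setT)).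
have -> : finset.setT = (o2 |: (o3 |: (o1 |: (o5 |: (o0 |: (o4 |: finset.set0))))))%SET.
  by apply/setP; elim/ord6P; rewrite !finset.inE.
rewrite [LHS]ffunE [RHS]ffunE !eps_insert ?finset.inE// [ebasis _ _ _]ffunE eqxx mulr1.
move/eqP; rewrite !mulf_eq0 !(negbTE (sg_neq0 _ _)) !orbF (negbTE t20) pnatr_eq0 /=.
by rewrite invr_eq0 (negbTE (dsc_neq0 a1)) /= => /orP[] /eqP ->; rewrite ?mulr0 ?mul0r.
Qed.

End SquareTorsion.

(** * Diagonalization of invariant balanced metrics *)

Section HermitianFrame.
Context {R : realType}.
Local Notation C := R[i].
Local Notation G := 'rV[R]_6.
Local Notation E := (ext R 6).
Local Notation one6 := (ebasis R (finset.set0 : {set 'I_6})).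
Local Notation cj := (@conjc R).
Local Notation I := ('i%C : C).

(** In the coframe with $c=d_1=d_2=0$ the form is $i\sum H_{jk}\,e_j\wedge\bar e_k$ with $H$
    constant. Completing the square for $H$ is the same as making the form diagonal in a
    triangularly changed coframe. *)
Lemma hermitian_frame (a : C) (F : dform R 5) : `|a| < 1 ->
  hermitian_structure ((fun _ => fibre_mx a) : acs R 5) F -> invariant_form setT F ->
  exists c d1 d2 h0 h1 h2, [/\ 0 < h0, 0 < h1 & 0 < h2] /\
    forall x, F x = ext_map (heis_frame a 0 0 0 x) (ext_map (change_mx c d1 d2) (phih h0 h1 h2)).
Proof.
move=> a1 [sF tF _ pF] iF.
have [f fE] := invariant_const a1 sF iF; rewrite fE in tF pF *.
have f11 := (of_type_const 0 0 0 1 1 f a1).1 tF.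
have [m mE] : exists m : 'I_6 -> 'I_6 -> C, forall i j, m i j = iot j (iot i f) finset.set0.
  by exists (fun i j => iot j (iot i f) finset.set0).
have TE i j : two_form_mx f i j = if (i < 3)%N then (if (j < 3)%N then 0 else m i j)
    else if (j < 3)%N then - m j i else 0.
  rewrite two_form_mxE; have [i3|i3] := ltnP i 3; have [j3|j3] := ltnP j 3; rewrite ?mE//.
  - rewrite (@bideg_iot _ _ j _ (@bideg_iot _ _ i _ f11))// i3 j3.
    by rewrite finset.set0I finset.set0D finset.cards0.
  - by rewrite iot_iot ffunE.
  - rewrite (@bideg_iot _ _ j _ (@bideg_iot _ _ i _ f11))// (ltnNge i) i3 (ltnNge j) j3/=.
    by rewrite finset.set0I finset.set0D finset.cards0.
pose H i j := - I * m i j.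
have pos x y z : [\/ x != 0, y != 0 | z != 0] ->
    0 < H o0 o3 * (x * cj x) + H o0 o4 * (x * cj y) + H o0 o5 * (x * cj z) +
        (H o1 o3 * (y * cj x) + H o1 o4 * (y * cj y) + H o1 o5 * (y * cj z)) +
        (H o2 o3 * (z * cj x) + H o2 o4 * (z * cj y) + H o2 o5 * (z * cj z)).
  move=> xyz; have [v vE] := frame_real_vector x y z 0 a1.
  have [W WE] : exists W : 'cV[C]_6, W = \col_i [:: x; y; z; cj x; cj y; cj z]`_i by exists (\col_i [:: x; y; z; cj x; cj y; cj z]`_i).
  rewrite -WE in vE.
  have v0 : v != 0.
    apply/eqP => v0; move: vE; rewrite v0 (_ : cplx_mx 0 = 0 :> 'cV[C]_6) ?mulmx0 => [W0|]; last by apply/matrixP => i j; rewrite !mxE.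
    have w i : W i 0 = 0 by rewrite -W0 mxE.
    have := w o0; have := w o1; have := w o2; rewrite WE !mxE /= => z0 y0 x0.
    by case: xyz => /eqP.
  have := pF 0 v v0.
  have -> : metric_mx (fibre_mx a) (ext_map (heis_frame a 0 0 0 0) f) =
      (heis_frame a 0 0 0 0)^T *m mx6
      [:: [:: 0; 0; 0; H o0 o3; H o0 o4; H o0 o5]; [:: 0; 0; 0; H o1 o3; H o1 o4; H o1 o5];
          [:: 0; 0; 0; H o2 o3; H o2 o4; H o2 o5];
          [:: H o0 o3; H o1 o3; H o2 o3; 0; 0; 0]; [:: H o0 o4; H o1 o4; H o2 o4; 0; 0; 0];
          [:: H o0 o5; H o1 o5; H o2 o5; 0; 0; 0]] *m heis_frame a 0 0 0 0.
    rewrite /metric_mx two_form_mx_ext_map -mulmxA.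
    have -> : heis_frame a 0 0 0 0 *m cplx_mx (fibre_mx a) = diag_mx (\row_r hol_sign r) *m heis_frame a 0 0 0 0.
      apply/row_matrixP => r; rewrite row_mul heis_frame_fibre//.
      by apply/rowP => j; rewrite mul_diag_mx !mxE.
    rewrite mulmxA -(mulmxA _^T _ (diag_mx _)); congr (_ *m _ *m _).
    apply: matrix6P => i j; rewrite mx6E.
    have -> : (two_form_mx f *m diag_mx (\row_r hol_sign r)) i j = two_form_mx f i j * hol_sign j.
      by rewrite mul_mx_diag mxE; congr (_ * _); rewrite mxE.
    rewrite TE /hol_sign /H.
    by elim/ord6P: i; elim/ord6P: j; rewrite /=; ring.
  set M0 := mx6 _; have [M ME] : exists M : 'M[C]_6, M = M0 by exists M0.
  rewrite -ME (quad_mulmx _ vE).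
  have {}WE i : W i 0 = [:: x; y; z; cj x; cj y; cj z]`_i by rewrite WE mxE.
  have -> : (W^T *m M *m W) 0 0 = \sum_j (\sum_i W i 0 * M i j) * W j 0.
    rewrite mxE; apply: eq_bigr => j _; congr (_ * _); rewrite mxE.
    by apply: eq_bigr => i _; rewrite [X in X * _]mxE.
  rewrite !big_ord6 /= ?big_ord6 /= !WE ME /M0 !mx6E /=.
  (* The metric on a real vector is twice the Hermitian form on its (1,0)-part. *)
  move=> h; rewrite -(@pmulr_rgt0 _ 2) ?ltr0n//; move: h; congr (0 < _); ring.
have [[[h0 h1] h2] [[[c d1] d2] [[p0 p1 p2] [[e00 e01 e02] [e10 e11 e12] [e20 e21 e22]]]]] :=
  complete_square pos.
exists c, d1, d2, h0, h1, h2; split; [by split|move=> x; apply: (congr1 (ext_map _))].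
have mH i j : m i j = I * H i j by rewrite /H mulNr mulrN mulrA mulii mulN1r opprK.
apply: form11_ext => //.
  have cc (k k' : 'I_6) : (k < 3)%N -> (3 <= k')%N -> bideg (fun p q => (p == 1) && (q == 1))
      (cov (row k (change_mx c d1 d2)) (cov (row k' (change_mx c d1 d2)) one6)).
    by move=> k3 k3'; apply: bideg_cov_cov => i i3; [exact: change_row_hol | exact: change_row_anti].
  by rewrite change_phi; apply: bidegD; [apply: bidegD|]; apply: bideg_esc; exact: cc.
move=> j l j3 l3; rewrite -mE mH change_phi.
rewrite !(raddfD (iot j))/= !(raddfD (iot l))/= !iot_esc.
have addE (u v : E) : (u + v) finset.set0 = u finset.set0 + v finset.set0 by rewrite ffunE.
have escE s (u : E) : esc s u finset.set0 = s * u finset.set0 by rewrite ffunE.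
rewrite !addE !escE !two_cov.
have rE k i : (row k (change_mx c d1 d2)) 0 i = change_mx c d1 d2 k i by rewrite mxE.
rewrite !rE !mx6E; move: j3 l3.
elim/ord6P: j; elim/ord6P: l; rewrite // => _ _; rewrite ?(e00, e01, e02, e10, e11, e12, e20, e21, e22) /=; ring.
Qed.

End HermitianFrame.

Section AdaptedFrame.
Context {R : realType}.
Local Notation C := R[i].
Local Notation G := 'rV[R]_6.
Local Notation E := (ext R 6).
Local Notation one6 := (ebasis R (finset.set0 : {set 'I_6})).
Local Notation cj := (@conjc R).
Local Notation I := ('i%C : C).

Lemma adapted_frame (a : C) (F : dform R 5) : `|a| < 1 ->
  invariant_balanced ((fun _ => fibre_mx a) : acs R 5) F ->
  exists c d1 d2 h0 h1 h2, [/\ 0 < h0, 0 < h1 & 0 < h2] /\ a * c = 0 /\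
    forall x, F x = ext_map (heis_frame a c d1 d2 x) (phih h0 h1 h2).
Proof.
move=> a1 [hF iF bF].
have [c [d1 [d2 [h0 [h1 [h2 [[p0 p1 p2] FE]]]]]]] := hermitian_frame a1 hF iF.
exists c, d1, d2, h0, h1, h2; split; [by split|split]; last first.
  by move=> x; rewrite FE ext_map_comp (frame_change a c d1 d2).
(* The coframe absorbs $d_1$ and $d_2$ but not yet $c$: with the entry 0 in place of $c$ its
   structure equations hold unconditionally, and balancedness of the non-diagonal [psi] then yields
   $ac=0$. *)
pose psi : E := ext_map (change_mx c 0 0) (phih h0 h1 h2).
have FE' x : F x = ext_map (heis_frame a 0 d1 d2 x) psi.
  by rewrite FE /psi !ext_map_comp (frame_change a 0 d1 d2) (change_split c d1 d2) mulmxA.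
have tp : torsion (d_frame a) (wedge psi psi) = 0.
  have := bF 0; have -> : fwedge F F = fun x => ext_map (heis_frame a 0 d1 d2 x) (wedge psi psi).
    by apply/funext => x; rewrite /fwedge FE' ext_map_wedge.
  rewrite (ext_d_const d1 d2 a1 (mulr0 a)) => /(congr1 (ext_map (invmx (heis_frame a 0 d1 d2 0)))).
  by rewrite (ext_mapKV _ (heis_frame_unit 0 d1 d2 a1 0)) (raddf0 (ext_map _)).
have iN : I != 0 by rewrite eq_complex /= negb_and oner_neq0 orbT.
have hN (h : R) : 0 < h -> I * h%:C != 0.
  by move=> hp; rewrite mulf_neq0// (fmorph_eq0 (real_complex R)) gt_eqF.
have rD k : (k == o0) || (k == o2) || (k == o3) || (k == o5) -> row k (change_mx c 0 0) = delta_mx 0 k.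
  move=> kk; apply/rowP => j; rewrite [LHS]mxE mx6E [RHS]mxE; move: kk; have := conjc0 R; move: cj => cc c0.
  by elim/ord6P: k; elim/ord6P: j; rewrite /= ?c0.
have r1 (u : E) : cov (row o1 (change_mx c 0 0)) u = esc c (eps o0 u) + eps o1 u.
  rewrite covE big_ord6 /= !mxE /=; by rewrite !esc0 esc1 !addr0.
have r4 (u : E) : cov (row o4 (change_mx c 0 0)) u = esc (cj c) (eps o3 u) + eps o4 u.
  rewrite covE big_ord6 /= !mxE /=; by rewrite !esc0 esc1 !add0r !addr0.
have eD i (u v : E) : eps i (u + v) = eps i u + eps i v := raddfD (eps i) u v.
have psiE : psi = esc (I * h0%:C + I * h1%:C * (c * cj c)) (eps o0 (eps o3 one6)) +
    esc (I * h1%:C * c) (eps o0 (eps o4 one6)) + esc (I * h1%:C * cj c) (eps o1 (eps o3 one6)) +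
    esc (I * h1%:C) (eps o1 (eps o4 one6)) + esc (I * h2%:C) (eps o2 (eps o5 one6)).
  rewrite /psi /phih change_phi (rD o0 isT) (rD o2 isT) (rD o3 isT) (rD o5 isT) !cov_delta r4 r1 !eD !eps_esc.
  move: (eps o0 (eps o3 _)) (eps o0 (eps o4 _)) (eps o1 (eps o3 _)) (eps o1 (eps o4 _)) (eps o2 (eps o5 _)).
  by move=> w1 w2 w3 w4 w5; apply/ffunP => S; rewrite !ffunE; ring.
have /eqP := @square_torsion R a _ _ _ _ _ a1 (hN _ p2)
  (etrans (congr1 (fun w => torsion (d_frame a) (wedge w w)) (esym psiE)) tp).
by rewrite mulrCA mulf_eq0 (negbTE (hN _ p1)) /= => /eqP.
Qed.
End AdaptedFrame.

(** * The space of solutions as a finite linear system *)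

Section LSpace.
Context {R : realType}.
Local Notation C := R[i].
Local Notation G := 'rV[R]_6.
Local Notation E := (ext R 6).
Local Notation cj := (@conjc R).
Context (Gam : set G) (hGam : heis_lattice Gam).
Context (a c d1 d2 : C) (h0 h1 h2 : R).
Context (a_lt1 : `|a| < 1).
Context (ac0 : a * c = 0).
Context (h0_gt0 : 0 < h0) (h1_gt0 : 0 < h1) (h2_gt0 : 0 < h2).
Local Notation A := (gsm Gam).
Local Notation B := (heis_frame a c d1 d2).
Local Notation J := ((fun _ => fibre_mx a) : acs R 5).
Local Notation F := ((fun x => ext_map (B x) (phih h0 h1 h2)) : dform R 5).
Local Notation I := ('i%C : C).
Local Notation X := (@gX R Gam (vector_mx a c d1 d2)).
Local Notation gk := (gcst Gam (torsion_coef a)%:C).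
Local Notation DL := (dl X gk (gcst Gam (cj a))).
Local Notation DB := (db X gk (gcst Gam a)).
Local Notation wg := (fun S => gcst Gam (hweight h0 h1 h2 S)%:C).
Local Notation ff := (@fform R Gam a c d1 d2).

Lemma gval_prod (T : Type) (s : seq T) (P : pred T) (f : T -> A) x :
  gval (\prod_(b <- s | P b) f b) x = \prod_(b <- s | P b) gval (f b) x.
Proof. by elim/big_rec2: _ => // b y y' _ <-. Qed.

Lemma gval_flip (i j : 'I_6) x : gval (flip i j : A) x = flip i j.
Proof. by rewrite /flip; case: ifP. Qed.

Lemma gev_star (u : {ffun {set 'I_6} -> A}) x :
  gev (star0 (swap bar6 (wgt wg u))) x =
  star0 (swap bar6 [ffun S : {set 'I_6} => (hweight h0 h1 h2 S)%:C * gev u x S]).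
Proof.
have xs (S T : {set 'I_6}) : gval (xsg S T : A) x = xsg S T.
  by rewrite /xsg gval_prod; apply: eq_bigr => i _; rewrite gval_sg.
have ss (S : {set 'I_6}) : gval (swap_sign bar6 S : A) x = swap_sign bar6 S.
  rewrite /swap_sign gval_prod; apply: eq_bigr => i _; rewrite gval_prod; apply: eq_bigr => j _.
  by case: ifP => // _; rewrite /inv_sign gvalM !gval_flip.
by apply/ffunP => S; rewrite !ffunE !gvalM xs ss.
Qed.

Lemma star_fform : exists2 kap : C, kap != 0 & forall u x,
  star J F (ff u) x = ff (esc (gcst Gam kap) (star0 (swap bar6 (wgt wg u)))) x.
Proof.
have [kap k0 kE] := star_frame c d1 d2 a_lt1 h0_gt0 h1_gt0 h2_gt0.
exists kap => // u x; rewrite /star /fform kE gev_esc gev_star ext_map_esc.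
by [].
Qed.

Definition cdl (v : E) : E := esc (- (dsc a)^-1) (eps o0 (eps o1 (iot o2 v))) +
  esc ((dsc a)^-1 * cj a) (eps o0 (eps o4 (iot o5 v))).
Definition cdb (v : E) : E := esc (- (dsc a)^-1) (eps o3 (eps o4 (iot o5 v))) +
  esc ((dsc a)^-1 * a) (eps o3 (eps o1 (iot o2 v))).

Definition const_space (v : E) := [/\ bideg (fun p q => (p == 2) && (q == 2)) v,
  cdl v = 0, cdb v = 0,
  cdl (cdb (star0 (swap bar6 [ffun S : {set 'I_6} => (hweight h0 h1 h2 S)%:C * v S]))) = 0 &
  wedge v (phih h0 h1 h2) = 0].

Lemma X_sum_cst (v : E) i x : gev (first_order X i (cform Gam v)) x = 0.
Proof.
rewrite /first_order gev_eps (_ : gev (Xv X i (cform Gam v)) x = 0) ?(raddf0 (eps i))//.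
by apply/ffunP => S; rewrite !ffunE gX_cst.
Qed.

Lemma gev_dl_cst (v : E) : DL (cform Gam v) = cform Gam (cdl v).
Proof.
apply/ffunP => S; apply: gsm_ext => x.
have := congr1 (fun w : E => w S) (gev_dl a c d1 d2 (cform Gam v) x).
rewrite !X_sum_cst !gev_cform !add0r => E1.
have E2 := congr1 (fun w : E => w S) (gev_cform Gam (cdl v) x).
by move: E1 E2; rewrite [LHS]ffunE => -> ; rewrite [LHS]ffunE => ->.
Qed.

Lemma gev_db_cst (v : E) : DB (cform Gam v) = cform Gam (cdb v).
Proof.
apply/ffunP => S; apply: gsm_ext => x.
have := congr1 (fun w : E => w S) (gev_db a c d1 d2 (cform Gam v) x).
rewrite !X_sum_cst !gev_cform !add0r => E1.
have E2 := congr1 (fun w : E => w S) (gev_cform Gam (cdb v) x).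
by move: E1 E2; rewrite [LHS]ffunE => -> ; rewrite [LHS]ffunE => ->.
Qed.

Lemma cform_eq0 (v : E) : cform Gam v = 0 <-> v = 0.
Proof.
split=> [v0|->].
  by rewrite -(gev_cform Gam v 0) v0; apply/ffunP => S; rewrite !ffunE.
by apply/ffunP => S; rewrite !ffunE (raddf0 (gcst Gam)).
Qed.

Lemma star_cform (v : E) : star0 (swap bar6 (wgt wg (cform Gam v))) =
  cform Gam (star0 (swap bar6 [ffun S : {set 'I_6} => (hweight h0 h1 h2 S)%:C * v S])).
Proof.
apply/ffunP => S; apply: gsm_ext => x.
have := congr1 (fun w : E => w S) (gev_star (cform Gam v) x); rewrite gev_cform.
have := congr1 (fun w : E => w S) (gev_cform Gam (star0 (swap bar6 [ffun S : {set 'I_6} => (hweight h0 h1 h2 S)%:C * v S])) x).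
by rewrite [LHS]ffunE => <-; rewrite [LHS]ffunE.
Qed.

(** A closed form of pure type is closed for both [dl] and [db], so an element of the space solves
    the harmonic system and has constant coefficients. What remains is the same system for constant
    vectors, where only the torsion terms act. *)
Lemma L22_const (al : dform R 5) : L22 Gam J F al <->
  exists2 v, const_space v & al = fun x => ext_map (B x) v.
Proof.
have [kap k0 kE] := star_fform.
have DLZ (s : C) u : DL (esc (gcst Gam s) u) = esc (gcst Gam s) (DL u).
  by apply: dl_esc => i; rewrite ?gX_cst//; exact: gXM.
have DBZ (s : C) u : DB (esc (gcst Gam s) u) = esc (gcst Gam s) (DB u).
  by apply: db_esc => i; rewrite ?gX_cst//; exact: gXM.
have starE u : (forall x, del J (delbar J (star J F (ff u))) x = 0) <->
    DL (DB (star0 (swap bar6 (wgt wg u)))) = 0.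
  have -> : star J F (ff u) = ff (esc (gcst Gam kap) (star0 (swap bar6 (wgt wg u)))).
    by apply/funext => x; rewrite kE.
  have -> : delbar J (ff (esc (gcst Gam kap) (star0 (swap bar6 (wgt wg u))))) =
      ff (DB (esc (gcst Gam kap) (star0 (swap bar6 (wgt wg u))))).
    by apply/funext => x; rewrite delbar_fform.
  split=> [H|H x].
    have : DL (DB (esc (gcst Gam kap) (star0 (swap bar6 (wgt wg u))))) = 0.
      by apply: (fform_eq0 (c := c) (d1 := d1) (d2 := d2) a_lt1) => x; rewrite -del_fform.
    rewrite DBZ DLZ => /(congr1 (esc (gcst Gam kap^-1))).
    rewrite (raddf0 (esc _)) escA -(rmorphM (gcst Gam)) mulVf// (rmorph1 (gcst Gam)).
    by rewrite esc1.
  by rewrite del_fform// DBZ DLZ H (raddf0 (esc _)) fform0.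
split=> [[[sal ial] tal dal lal wal]|[v [v22 v1 v2 v3 v4] ->]].
  have [u uE] := fform_surj c d1 d2 a_lt1 sal ial.
  rewrite uE in tal dal lal wal *.
  have uT := (fform_of_type c d1 d2 a_lt1 2 2 u).1 tal.
  have u22 : bideg (fun p q => (p == 2) && (q == 2)) u by rewrite -uT; exact: typg_bideg.
  have dd : DL u + DB u = 0.
    by apply: (fform_eq0 (c := c) (d1 := d1) (d2 := d2) a_lt1) => x; rewrite -ext_d_fform.
  have [dl0 db0] := closed_split (gXB _) u22 dd.
  have hu : harmonic_system (vector_mx a c d1 d2) (torsion_coef a) a (hweight h0 h1 h2) u.
    by split; [exact: dl0|exact: db0|exact: (starE u).1 lal].
  have uc := harmonic_const hGam (vector_central a c d1 d2) (@vector_bar R a c d1 d2)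
    (vector_frame c d1 d2 a_lt1) (hweight_gt0 h0_gt0 h1_gt0 h2_gt0) hu.
  have uv : u = cform Gam (gev u 0).
    by apply/ffunP => S; apply: gsm_ext => x; rewrite !ffunE uc.
  have aE : ff u = fun x => ext_map (B x) (gev u 0).
    by apply/funext => x; rewrite [in LHS]uv fform_cform.
  exists (gev u 0) => //; split.
  - by move=> S nS; rewrite ffunE u22.
  - by apply/cform_eq0; rewrite -gev_dl_cst -uv.
  - by apply/cform_eq0; rewrite -gev_db_cst -uv.
  - by apply/cform_eq0; rewrite -gev_dl_cst -gev_db_cst -star_cform -uv; apply: (starE u).1.
  - have := wal 0; rewrite /fwedge aE -ext_map_wedge => /(congr1 (ext_map (invmx (B 0)))).
    by rewrite (ext_mapKV _ (heis_frame_unit c d1 d2 a_lt1 0)) (raddf0 (ext_map _)).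
have aE : (fun x => ext_map (B x) v) = ff (cform Gam v).
  by apply/funext => x; rewrite fform_cform.
split.
- by rewrite aE; split; [exact: fform_smooth | exact: fform_invariant].
- exact: (of_type_const c d1 d2 2 2 v a_lt1).2.
- move=> x; rewrite aE ext_d_fform// gev_dl_cst gev_db_cst v1 v2.
  by rewrite (cform_eq0 0).2// addr0 fform0.
- rewrite aE; apply: (starE _).2; rewrite star_cform gev_db_cst gev_dl_cst v3.
  exact: (cform_eq0 0).2.
- by move=> x; rewrite /fwedge -ext_map_wedge v4 (raddf0 (ext_map _)).
Qed.

Local Notation cS i j := (~: [set i; j])%SET.

Lemma esc_eq0 (s : C) (v : E) : esc s v = 0 <-> s = 0 \/ v = 0.
Proof.
split=> [H|[->|->]]; [|exact: esc0|exact: escr0].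
have [->|s0] := eqVneq s 0; [by left|right].
by have := congr1 (esc s^-1) H; rewrite escA mulVf// esc1 escr0.
Qed.

Lemma eps_vanish_and (P : {set 'I_6} -> Prop) i (u : E) : (forall S : {set 'I_6}, P S -> eps i u S = 0) <->
  (forall S : {set 'I_6}, (i \notin S)%SET /\ P (i |: S)%SET -> u S = 0).
Proof.
apply: iff_trans (eps_vanish P i u) _; split=> [H S []|H S iS PS]; first exact: H.
by apply: H.
Qed.

Lemma iot_vanish_and (P : {set 'I_6} -> Prop) i (u : E) : (forall S : {set 'I_6}, P S -> iot i u S = 0) <->
  (forall S : {set 'I_6}, (i \in S)%SET /\ P (S :\ i)%SET -> u S = 0).
Proof.
apply: iff_trans (iot_vanish P i u) _; split=> [H S []|H S iS PS]; first exact: H.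
by apply: H.
Qed.

Lemma eps2_iot_eq0 i j l (v : E) : i != j -> i != l -> j != l ->
  (eps i (eps j (iot l v)) = 0 <-> forall S : {set 'I_6}, l \in S -> i \notin S -> j \notin S -> v S = 0).
Proof.
move=> ij il jl; apply: iff_trans (ext_vanish _) _; apply: iff_trans (eps_vanish_and _ _ _) _.
apply: iff_trans (eps_vanish_and _ _ _) _; apply: iff_trans (iot_vanish_and _ _ _) _.
split=> H S.
  move=> lS iS jS; apply: H; split=> //; split; [|split=> //].
    by rewrite !finset.inE negb_and jS orbT.
  by rewrite !finset.inE negb_or negb_and ij iS orbT.
move=> [lS [jS [iS _]]]; apply: H => //.
  move: iS; rewrite !finset.inE negb_or negb_and negbK => /andP[_ /orP[/eqP e|//]].
  by rewrite e eqxx in il.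
move: jS; rewrite !finset.inE negb_and negbK => /orP[/eqP e|//].
by rewrite e eqxx in jl.
Qed.

(** The (2,0)-torsion term would need a monomial without $e_0$ and $e_1$, which has at most one
    factor of type (1,0). The other term reads the coefficient of the monomial without $e_0$ and
    $e_4$, with a factor proportional to $\bar a$. The next lemma is the conjugate statement. *)
Lemma cdl_eq0 (v : E) : bideg (fun p q => (p == 2) && (q == 2)) v ->
  (cdl v = 0 <-> a * v (cS o0 o4) = 0).
Proof.
move=> v22.
have -> : cdl v = esc ((dsc a)^-1 * cj a) (eps o0 (eps o4 (iot o5 v))).
  rewrite /cdl (_ : eps o0 (eps o1 (iot o2 v)) = 0) ?escr0 ?add0r//.
  apply/eps2_iot_eq0 => // S _ S0 S1; apply: v22; rewrite negb_and; apply/orP; left.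
  apply/eqP => e; have h : (#|(S :&: hol6)%SET| <= #|[set o2]%SET|)%N.
    apply: fintype.subset_leq_card; apply/fintype.subsetP; elim/ord6P;
      by rewrite !finset.inE //= ?(negbTE S0) ?(negbTE S1)//= ?andbF.
  by move: h; rewrite e finset.cards1.
apply: iff_trans (esc_eq0 _ _) _; split=> [[/eqP|/(eps2_iot_eq0 _ _ _ _).1 H]|/eqP].
- rewrite mulf_eq0 invr_eq0 (negbTE (dsc_neq0 a_lt1)) /= conjc_eq0 => /eqP ->.
  by rewrite mul0r.
- by rewrite H ?mulr0// !finset.inE.
- rewrite mulf_eq0 => /orP[/eqP a0|/eqP v0]; [left|right].
    by rewrite a0 conjc0 mulr0.
  apply/eps2_iot_eq0 => // S S5 S0 S4; have [->//|SN] := eqVneq S (cS o0 o4).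
  exact: (bideg22_supp v22 S0 S4).
Qed.

Lemma cdb_eq0 (v : E) : bideg (fun p q => (p == 2) && (q == 2)) v ->
  (cdb v = 0 <-> a * v (cS o1 o3) = 0).
Proof.
move=> v22.
have -> : cdb v = esc ((dsc a)^-1 * a) (eps o3 (eps o1 (iot o2 v))).
  rewrite /cdb (_ : eps o3 (eps o4 (iot o5 v)) = 0) ?escr0 ?add0r//.
  apply/eps2_iot_eq0 => // S _ S0 S1; apply: v22; rewrite negb_and; apply/orP; right.
  apply/eqP => e; have h : (#|(S :\: hol6)%SET| <= #|[set o5]%SET|)%N.
    apply: fintype.subset_leq_card; apply/fintype.subsetP; elim/ord6P;
      by rewrite !finset.inE //= ?(negbTE S0) ?(negbTE S1)//= ?andbF.
  by move: h; rewrite e finset.cards1.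
apply: iff_trans (esc_eq0 _ _) _; split=> [[/eqP|/(eps2_iot_eq0 _ _ _ _).1 H]|/eqP].
- rewrite mulf_eq0 invr_eq0 (negbTE (dsc_neq0 a_lt1)) /= => /eqP ->.
  by rewrite mul0r.
- by rewrite H ?mulr0// !finset.inE.
- rewrite mulf_eq0 => /orP[/eqP a0|/eqP v0]; [left|right].
    by rewrite a0 mulr0.
  apply/eps2_iot_eq0 => // S S2 S3 S1; have [->//|SN] := eqVneq S (cS o1 o3).
  exact: (bideg22_supp v22 S1 S3).
Qed.

(** The torsion of type (2,0) and (0,2) contributes 1 and that of type (1,1) contributes $|a|^2$,
    with the same sign; hence the scalar never vanishes. *)
Lemma cdl_cdb (y : E) : cdl (cdb y) = esc ((dsc a)^-1 * (dsc a)^-1 * (1 + a * cj a))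
  (eps o0 (eps o1 (eps o3 (eps o4 (iot o2 (iot o5 y)))))).
Proof.
have nn i (w : E) : iot i (- w) = - iot i w := raddfN (iot i) w.
have en i (w : E) : eps i (- w) = - eps i w := raddfN (eps i) w.
have ez i : eps i (0 : E) = 0 := raddf0 (eps i).
have ie p q l (w : E) : iot p (eps q (eps l w)) = (if p == q then 1 else 0) *: 0 + iot p (eps q (eps l w)).
  by rewrite scaler0 add0r.
rewrite /cdl /cdb !(raddfD (iot _))/= !iot_esc.
rewrite !(@iot_eps _ _ o2 o3)// !(@iot_eps _ _ o5 o3)// !(@iot_eps _ _ o2 o4)// !(@iot_eps _ _ o5 o4)//.
rewrite !(@iot_eps _ _ o2 o1)// !(@iot_eps _ _ o5 o1)// !iot_iot0 !(en, ez, opprK, oppr0, escr0, addr0, add0r).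
rewrite !eps_esc !escA !(iot_iot o5 o2) !en (eps_eps o4 o3) !en (eps_eps o4 o1) !en (eps_eps o3 o1) !en !opprK.
move: (eps o0 _) => w; apply/ffunP => S; rewrite !ffunE; ring.
Qed.

(** The operator word reads the coefficient of the star at $\{2,5\}$. This is a nonzero multiple of
    the coefficient of $v$ at the complement, which conjugation of indices preserves. *)
Lemma cdl_cdb_star v :
  (cdl (cdb (star0 (swap bar6 [ffun S : {set 'I_6} => (hweight h0 h1 h2 S)%:C * v S]))) = 0 <->
   v (cS o2 o5) = 0).
Proof.
have n0 := dsc_neq0 a_lt1.
have s0 : (dsc a)^-1 * (dsc a)^-1 * (1 + a * cj a) != 0.
  have s1 : 1 + a * cj a != 0.
    apply/eqP => /(congr1 (@complex.Re R)); move: (a) => [x y] /= e.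
    by have := sqr_ge0 x; have := sqr_ge0 y; rewrite !expr2 => y2 x2; lra.
  by apply: mulf_neq0 => //; apply: mulf_neq0; rewrite invr_eq0.
rewrite cdl_cdb; set y := star0 _; move: s0; set k := _ * (1 + _) => s0.
have yE : y [set o2; o5]%SET = 0 <-> v (cS o2 o5) = 0.
  rewrite /y ffunE ffunE ffunE.
  have -> : (bar6 @: cS o2 o5 = cS o2 o5)%SET.
    have [[b0 b1 b2] [b3 b4 b5]] := bar6E.
    apply/setP => i; rewrite (mem_imset_b bar6K) !finset.inE.
    by elim/ord6P: i; rewrite ?(b0, b1, b2, b3, b4, b5).
  split=> [H|->]; last by rewrite !mulr0.
  have x1 := @xsg_sq C 6 (cS o2 o5) [set o2; o5]%SET.
  have x2 := @swap_sign_sq C 6 bar6 bar6K (cS o2 o5).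
  have w0 : (hweight h0 h1 h2 (cS o2 o5))%:C != 0.
    by rewrite (fmorph_eq0 (real_complex R)) gt_eqF// hweight_gt0.
  have xn : xsg (cS o2 o5) [set o2; o5]%SET != 0 :> C.
    by apply/eqP => e; move: x1; rewrite e mul0r => /esym/eqP; rewrite oner_eq0.
  have sn : swap_sign bar6 (cS o2 o5) != 0 :> C.
    by apply/eqP => e; move: x2; rewrite e mul0r => /esym/eqP; rewrite oner_eq0.
  by move/eqP: H; rewrite !mulf_eq0 (negbTE xn) (negbTE sn) (negbTE w0) /= => /eqP.
apply: iff_trans yE; clearbody y.
apply: iff_trans (esc_eq0 _ _) _.
have step : eps o0 (eps o1 (eps o3 (eps o4 (iot o2 (iot o5 y))))) = 0 <-> y [set o2; o5]%SET = 0.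
  apply: iff_trans (ext_vanish _) _; do 4![apply: iff_trans (eps_vanish_and _ _ _) _].
  do 2![apply: iff_trans (iot_vanish_and _ _ _) _].
  split=> [H|H S [S5 [S2 [S4 [S3 [S1 [S0 _]]]]]]].
    by apply: H; do 6?split; rewrite // !finset.inE.
  have m2 : (o2 \in S)%SET by move: S2; rewrite !finset.inE => /andP[].
  have nS0 : (o0 \notin S)%SET by apply: contra S0 => h; rewrite !finset.inE h.
  have nS1 : (o1 \notin S)%SET by apply: contra S1 => h; rewrite !finset.inE h.
  have nS3 : (o3 \notin S)%SET by apply: contra S3 => h; rewrite !finset.inE h.
  have nS4 : (o4 \notin S)%SET by apply: contra S4 => h; rewrite !finset.inE h.
  apply: etrans H; congr (y _); apply/setP; elim/ord6P;
    by rewrite !finset.inE ?m2 ?S5 ?(negbTE nS0) ?(negbTE nS1) ?(negbTE nS3) ?(negbTE nS4).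
by split=> [[/eqP|/step//]|H]; [rewrite (negbTE s0) | right; apply/step].
Qed.

(** The product has bidegree (3,3), hence is determined by its top coefficient, which is $i$ times
    the weighted trace. *)
Lemma wedge_phih_eq0 (v : E) : bideg (fun p q => (p == 2) && (q == 2)) v ->
  (wedge v (phih h0 h1 h2) = 0 <->
   h0%:C * v (cS o0 o3) + h1%:C * v (cS o1 o4) + h2%:C * v (cS o2 o5) = 0).
Proof.
move=> v22; rewrite wedge_phir.
have b33 (i j : 'I_6) : (i < 3)%N -> (3 <= j)%N -> bideg (fun p q => (p == 3) && (q == 3)) (eps i (eps j v)).
  move=> i3 j3; apply: (bidegW _ (@bideg_eps _ _ i _ (@bideg_eps _ _ j _ v22))) => p q.
  by rewrite i3 (ltnNge j) j3 /=; case: p q => [|[|p]] [|[|q]].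
have L33 : bideg (fun p q => (p == 3) && (q == 3)) (lefschetz (I * h0%:C) (I * h1%:C) (I * h2%:C) v).
  by rewrite /lefschetz; do 2?apply: bidegD; apply: bideg_esc; apply: b33.
have top i j : i != j -> eps i (eps j v) finset.setT =
    sg i (finset.setT :\ i)%SET * sg j (finset.setT :\ i :\ j)%SET * v (cS i j).
  move=> ij; rewrite ffunE finset.inE ffunE !finset.inE eq_sym ij /= mulrA; congr (_ * v _).
  by apply/setP => x; rewrite !finset.inE; do 2?case: eqP.
have sgE (i : 'I_6) (S : {set 'I_6}) : sg i S = \prod_(b < 6) (if b \in S then flip i b else 1) :> C.
  by rewrite /sg big_mkcond.
have t1 : lefschetz (I * h0%:C) (I * h1%:C) (I * h2%:C) v finset.setT =
    I * (h0%:C * v (cS o0 o3) + h1%:C * v (cS o1 o4) + h2%:C * v (cS o2 o5)).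
  have addE (u w : E) : (u + w) finset.setT = u finset.setT + w finset.setT by rewrite ffunE.
  have escE s (u : E) : esc s u finset.setT = s * u finset.setT by rewrite ffunE.
  rewrite /lefschetz !addE !escE !top// !sgE !big_ord6 /= !finset.inE /= /flip /=.
  by ring.
have iN : I != 0 by rewrite eq_complex /= negb_and oner_neq0 orbT.
split=> [H|H].
  by have := t1; rewrite /phih in H *; rewrite H ffunE => /esym/eqP; rewrite mulf_eq0 (negbTE iN) => /eqP.
by apply: (bideg33_eq0 L33); rewrite t1 H mulr0.
Qed.

Lemma const_spaceE v : const_space v <->
  bideg (fun p q => (p == 2) && (q == 2)) v /\
  [/\ a * v (cS o0 o4) = 0, a * v (cS o1 o3) = 0, v (cS o2 o5) = 0 &
      h0%:C * v (cS o0 o3) + h1%:C * v (cS o1 o4) = 0].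
Proof.
split=> [[v22 v1 v2 v3 v4]|[v22 [v1 v2 v3 v4]]].
  have e := (cdl_cdb_star v).1 v3.
  split=> //; split=> //; [exact: (cdl_eq0 v22).1|exact: (cdb_eq0 v22).1|].
  by have := (wedge_phih_eq0 v22).1 v4; rewrite e mulr0 addr0.
split=> //; [exact: (cdl_eq0 v22).2|exact: (cdb_eq0 v22).2|exact: (cdl_cdb_star v).2|].
by apply: (wedge_phih_eq0 v22).2; rewrite v3 mulr0 addr0.
Qed.

(* The extra basis vector is the one solving the trace condition. *)
Definition basis_vec (l : seq {set 'I_6}) (k : nat) : E :=
  if k is k'.+1 then ebasis R (nth finset.set0 l k')
  else esc h1%:C (ebasis R (cS o0 o3)) - esc h0%:C (ebasis R (cS o1 o4)).

(** [l] lists the coefficients that are free. Together with the one-dimensional solution space of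
    the equation linking the two remaining diagonal coefficients, they give a basis. *)
Lemma const_space_dim (l : seq {set 'I_6}) (n : nat) : n = (size l).+1 -> uniq l ->
  cS o0 o3 \notin l -> cS o1 o4 \notin l ->
  (forall v, const_space v <-> (forall S, S \notin l -> S != cS o0 o3 -> S != cS o1 o4 -> v S = 0) /\
      h0%:C * v (cS o0 o3) + h1%:C * v (cS o1 o4) = 0) ->
  has_dim (L22 Gam J F) n.
Proof.
move=> -> ul n03 n14 VE; exists (fun i x => ext_map (B x) (basis_vec l i)).
have n1 : h1%:C != 0 by rewrite (fmorph_eq0 (real_complex R)) gt_eqF.
have n0 : h0%:C != 0 by rewrite (fmorph_eq0 (real_complex R)) gt_eqF.
have d34 : cS o0 o3 != cS o1 o4.
  by apply/eqP => /setP/(_ o0); rewrite !finset.inE.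
have combE (s : 'I_(size l).+1 -> C) x : \sum_(i < (size l).+1) escale (s i) (ext_map (B x) (basis_vec l i)) =
    ext_map (B x) (\sum_(i < (size l).+1) esc (s i) (basis_vec l i)).
  rewrite (raddf_sum (ext_map (B x)))/=; apply: eq_bigr => i _.
  by rewrite ext_map_esc escaleE.
have coefS (s : 'I_(size l).+1 -> C) S : (\sum_(i < (size l).+1) esc (s i) (basis_vec l i)) S =
    s ord0 * (h1%:C * (S == cS o0 o3)%:R - h0%:C * (S == cS o1 o4)%:R) +
    \sum_(i < size l) s (lift ord0 i) * (S == nth finset.set0 l i)%:R.
  rewrite sum_ffunE big_ord_recl; congr (_ + _); first by rewrite !ffunE.
  by apply: eq_bigr => i _; rewrite !ffunE.
have coefl (s : 'I_(size l).+1 -> C) (j : 'I_(size l)) :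
    (\sum_(i < (size l).+1) esc (s i) (basis_vec l i)) (nth finset.set0 l j) = s (lift ord0 j).
  have jl : nth finset.set0 l j \in l by apply: mem_nth.
  rewrite coefS (_ : (_ == cS o0 o3) = false); last by apply: contraNF n03 => /eqP <-.
  rewrite (_ : (_ == cS o1 o4) = false); last by apply: contraNF n14 => /eqP <-.
  rewrite !mulr0 subrr mulr0 add0r (bigD1 j)//= eqxx mulr1 big1 ?addr0// => i ij.
  have ij' : i != j :> nat := ij.
  by rewrite nth_uniq// eq_sym (negbTE ij') mulr0.
have coef0 (s : 'I_(size l).+1 -> C) :
    (\sum_(i < (size l).+1) esc (s i) (basis_vec l i)) (cS o0 o3) = s ord0 * h1%:C.
  rewrite coefS eqxx (negbTE d34) mulr1 mulr0 subr0 big1 ?addr0// => i _.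
  rewrite (_ : (_ == _) = false) ?mulr0//; apply: contraNF n03 => /eqP ->; exact: mem_nth.
have coef1 (s : 'I_(size l).+1 -> C) :
    (\sum_(i < (size l).+1) esc (s i) (basis_vec l i)) (cS o1 o4) = - (s ord0 * h0%:C).
  rewrite coefS eqxx eq_sym (negbTE d34) mulr1 mulr0 sub0r mulrN big1 ?addr0// => i _.
  rewrite (_ : (_ == _) = false) ?mulr0//; apply: contraNF n14 => /eqP ->; exact: mem_nth.
split=> [al|s s0].
  split=> [/L22_const[v vS ->]|[s ->]].
    have [v0 vt] := (VE v).1 vS.
    pose s (i : 'I_(size l).+1) := if unlift ord0 i is Some j then v (nth finset.set0 l j)
      else v (cS o0 o3) / h1%:C.
    have sl j : s (lift ord0 j) = v (nth finset.set0 l j) by rewrite /s liftK.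
    have s00 : s ord0 = v (cS o0 o3) / h1%:C by rewrite /s unlift_none.
    exists s; apply/funext => x; rewrite combE; congr (ext_map _ _); apply/ffunP => S.
    have [Sl|Sl] := boolP (S \in l).
      have il : (index S l < size l)%N by rewrite index_mem.
      by rewrite -(nth_index finset.set0 Sl) (coefl s (Ordinal il)) sl.
    have [->|S03] := eqVneq S (cS o0 o3); first by rewrite coef0 s00 divfK.
    have [->|S14] := eqVneq S (cS o1 o4).
      rewrite coef1 s00; apply: (mulfI n1); rewrite mulrN.
      have -> : h1%:C * (v (cS o0 o3) / h1%:C * h0%:C) = h0%:C * v (cS o0 o3).
        by rewrite [v _ / _]mulrC !mulrA (mulfV n1) mul1r mulrC.
      by apply/eqP; rewrite -addr_eq0 addrC; apply/eqP.
    rewrite v0// coefS (negbTE S03) (negbTE S14) !mulr0 subrr mulr0 add0r big1// => i _.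
    rewrite (_ : (_ == _) = false) ?mulr0//; apply: contraNF Sl => /eqP ->; exact: mem_nth.
  apply/L22_const; exists (\sum_(i < (size l).+1) esc (s i) (basis_vec l i)); last first.
    by apply/funext => x; rewrite combE.
  apply/VE; split; last by rewrite coef0 coef1; ring.
  move=> S Sl S03 S14; rewrite coefS (negbTE S03) (negbTE S14) !mulr0 subrr mulr0 add0r big1// => i _.
  rewrite (_ : (_ == _) = false) ?mulr0//; apply: contraNF Sl => /eqP ->; exact: mem_nth.
have S0 : \sum_(i < (size l).+1) esc (s i) (basis_vec l i) = 0.
  have := s0 0; rewrite combE => /(congr1 (ext_map (invmx (B 0)))).
  by rewrite (ext_mapKV _ (heis_frame_unit c d1 d2 a_lt1 0)) (raddf0 (ext_map _)).
move=> i; have [j ->|->] := unliftP ord0 i.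
  by rewrite -coefl S0 ffunE.
by apply: (mulIf n1); rewrite -coef0 S0 ffunE mul0r.
Qed.

Lemma cS_inj (p q p' q' : 'I_6) : (p < 3)%N -> (p' < 3)%N -> (3 <= q)%N -> (3 <= q')%N ->
  (cS p q == cS p' q') = (p == p') && (q == q').
Proof.
move=> p3 p3' q3 q3'; apply/eqP/andP => [/setP H|[/eqP -> /eqP ->]//].
have := H p; have := H q; rewrite !finset.inE !eqxx /= orbT /=.
have qp' : (q == p') = false by apply/eqP => e; move: q3; rewrite e leqNgt p3'.
have pq' : (p == q') = false by apply/eqP => e; move: p3; rewrite e ltnNge q3'.
by rewrite qp' pq' orbF /= => /esym/negbFE -> /esym/negbFE ->.
Qed.

Lemma bideg22P (v : E) : bideg (fun p q => (p == 2) && (q == 2)) v <->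
  (forall S, (forall p q : 'I_6, (p < 3)%N -> (3 <= q)%N -> S != cS p q) -> v S = 0).
Proof.
split=> [v22 S H|H S nS].
  have [/andP[/eqP e1 /eqP e2]|/v22//] := boolP ((#|(S :&: hol6)%SET| == 2) && (#|(S :\: hol6)%SET| == 2)).
  have [p p3 pS] : exists2 p : 'I_6, (p < 3)%N & p \notin S.
    apply/exists2P; apply: contrapT => N; have : hol6 \subset (S :&: hol6)%SET.
      apply/fintype.subsetP => x xh; rewrite finset.inE xh andbT; apply/negPn/negP => xS; apply: N.
      by exists x; split=> //; rewrite -hol6E.
    by move/fintype.subset_leq_card; rewrite card_hol6 e1.
  have [q q3 qS] : exists2 q : 'I_6, (3 <= q)%N & q \notin S.
    apply/exists2P; apply: contrapT => N; have : (~: hol6)%SET \subset (S :\: hol6)%SET.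
      apply/fintype.subsetP => x xh; rewrite finset.inE; rewrite finset.inE in xh; rewrite xh /=.
      apply/negPn/negP => xS; apply: N.
      by exists x; split=> //; rewrite leqNgt -hol6E.
    move/fintype.subset_leq_card; rewrite e2; have := finset.cardsC hol6; rewrite card_hol6 card_ord.
    by move=> e; rewrite -(leq_add2l 3) e.
  apply: (bideg22_supp v22 pS qS); last exact: H.
  by apply: contraTneq p3 => ->; rewrite -leqNgt.
apply: H => p q p3 q3; apply: contra nS => /eqP ->.
have pq : p != q by apply: contraTneq p3 => ->; rewrite -leqNgt.
have h1' : (cS p q :&: hol6 = hol6 :\ p)%SET.
  apply/setP => x; rewrite !finset.inE; case: (x =P q) => [->|_]; last by rewrite orbF.
  by rewrite ltnNge q3 !andbF.
have h2' : (cS p q :\: hol6 = (~: hol6) :\ q)%SET.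
  apply/setP => x; rewrite !finset.inE; case: (x =P p) => [->|_]; last by rewrite andbC.
  by rewrite p3 !andbF.
rewrite h1' h2'.
have := finset.cardsD1 p hol6; rewrite card_hol6 hol6E p3 => e1.
have /addnI <- : (1 + 2 = 1 + #|(hol6 :\ p)%SET|)%N := e1.
have := finset.cardsC hol6; rewrite card_hol6 card_ord (finset.cardsD1 q) finset.inE hol6E ltnNge q3 => e2.
by have /addnI/addnI -> : (3 + (1 + #|((~: hol6) :\ q)%SET|) = 3 + (1 + 2))%N := e2.
Qed.

(** The off-diagonal coefficients of a (2,2)-form. The last two are those killed by closedness when
    $a\ne0$, so the first four form the list for that case. *)
Definition six_sets : seq {set 'I_6} := [:: cS o0 o5; cS o1 o5; cS o2 o3; cS o2 o4; cS o0 o4; cS o1 o3].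

Lemma six_setsP S : S \notin six_sets -> S != cS o0 o3 -> S != cS o1 o4 -> S != cS o2 o5 ->
  forall p q : 'I_6, (p < 3)%N -> (3 <= q)%N -> S != cS p q.
Proof.
rewrite !finset.inE !negb_or => /and5P[s1 s2 s3 s4 /andP[s5 s6]] s7 s8 s9 p q.
by elim/ord6P: p; elim/ord6P: q.
Qed.

Lemma L22_dim7 : a = 0 -> has_dim (L22 Gam J F) 7.
Proof.
move=> a0; apply: (@const_space_dim six_sets) => //.
- by rewrite /= !finset.inE !cS_inj.
- by rewrite !finset.inE !cS_inj.
- by rewrite !finset.inE !cS_inj.
move=> v; apply: iff_trans (const_spaceE v) _; split.
  move=> [/bideg22P v22 [_ _ v25 vt]]; split=> // S S6 S03 S14.
  have [->//|S25] := eqVneq S (cS o2 o5); apply: v22; exact: six_setsP.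
move=> [v0 vt]; split; last by rewrite a0 !mul0r v0 ?finset.inE ?cS_inj.
apply/bideg22P => S H; apply: v0; rewrite ?H//.
by rewrite !finset.inE !negb_or !H.
Qed.

Lemma L22_dim5 : a != 0 -> has_dim (L22 Gam J F) 5.
Proof.
move=> a0; apply: (@const_space_dim (take 4 six_sets)) => //.
- by rewrite /= !finset.inE !cS_inj.
- by rewrite !finset.inE !cS_inj.
- by rewrite !finset.inE !cS_inj.
move=> v; apply: iff_trans (const_spaceE v) _; split.
  move=> [/bideg22P v22 [v04 v13 v25 vt]]; split=> // S S6 S03 S14.
  have [->//|S25] := eqVneq S (cS o2 o5).
  have [->|S04] := eqVneq S (cS o0 o4); first by move/eqP: v04; rewrite mulf_eq0 (negbTE a0) => /eqP.
  have [->|S13] := eqVneq S (cS o1 o3); first by move/eqP: v13; rewrite mulf_eq0 (negbTE a0) => /eqP.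
  apply: v22; apply: six_setsP => //; move: S6; rewrite !finset.inE !negb_or => /and4P[-> -> -> ->].
  by rewrite S04 S13.
move=> [v0 vt]; split; last first.
  by split; rewrite ?(v0 (cS o0 o4)) ?(v0 (cS o1 o3)) ?(v0 (cS o2 o5)) ?mulr0 ?finset.inE ?cS_inj.
apply/bideg22P => S H; apply: v0; rewrite ?H//.
by rewrite !finset.inE !negb_or !H.
Qed.
End LSpace.

(** * A balanced metric on every fibre *)

Section Existence.
Context {R : realType}.
Local Notation C := R[i].
Local Notation G := 'rV[R]_6.
Local Notation E := (ext R 6).
Local Notation one6 := (ebasis R (finset.set0 : {set 'I_6})).
Local Notation cj := (@conjc R).
Local Notation I := ('i%C : C).
Context (a : C).
Context (a_lt1 : `|a| < 1).
Local Notation B := (heis_frame a 0 0 0).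
Local Notation F := ((fun x => ext_map (B x) (phih 1 1 1)) : dform R 5).

Lemma frame_bar r j : frame_mx a 0 0 0 (bar6 r) j = cj (frame_mx a 0 0 0 r j).
Proof.
have [[b0 b1 b2] [b3 b4 b5]] := bar6E.
have c0 : cj 0 = 0 := conjc0 _.
have cK x : cj (cj x) = x := conjcK x.
rewrite !mx6E; move: cK c0 (@conjcM R) (@conjcD R) (@conjcN R) (conjci : cj I = - I).
move: I cj => h cc cK c0 cM cD cN ci.
have c1 : cc 1 = 1 by have := cM (cc 1) 1; rewrite mulr1 cK mul1r => <-.
elim/ord6P: r; elim/ord6P: j; rewrite ?(b0, b1, b2, b3, b4, b5) /=;
  rewrite ?(cM, cN, cD, ci, c0, c1, cK); ring.
Qed.

Lemma heis_frame_bar x r j : B x (bar6 r) j = cj (B x r j).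
Proof.
rewrite [LHS]mxE [in RHS]mxE (rmorph_sum (@conjc R)); apply: eq_bigr => s _.
rewrite frame_bar (rmorphM (@conjc R))/=; congr (_ * _).
by rewrite [cplx_mx _ _ _]mxE; apply/eqP; rewrite eq_complex /= oppr0 !eqxx.
Qed.

Definition conj_ext (u : E) : E := [ffun S : {set 'I_6} => cj (u S)].

Lemma conj_ext_cov (t : 'rV[C]_6) u : conj_ext (cov t u) = cov (map_mx cj t) (conj_ext u).
Proof.
apply/ffunP => S; rewrite ffunE !cov_coef (rmorph_sum (@conjc R)); apply: eq_bigr => j _.
rewrite (rmorphM (@conjc R))/= mxE ffunE; congr (_ * _); rewrite (rmorphM (@conjc R))/=; congr (_ * _).
case: ifP => _; last exact: conjc0.
rewrite /sg (rmorph_prod (@conjc R)); apply: eq_bigr => b _; rewrite /flip; case: ifP => _; last exact: conjc1.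
by rewrite (rmorphN (@conjc R)); congr (- _); exact: conjc1.
Qed.

Lemma row_bar x r : map_mx cj (row r (B x)) = row (bar6 r) (B x).
Proof. by apply/rowP => j; rewrite [LHS]mxE [in LHS]mxE [RHS]mxE heis_frame_bar. Qed.

Lemma ext_map_phih x : ext_map (B x) (phih 1 1 1) =
  esc (I * 1%:C) (cov (row o0 (B x)) (cov (row o3 (B x)) one6)) +
  esc (I * 1%:C) (cov (row o1 (B x)) (cov (row o4 (B x)) one6)) +
  esc (I * 1%:C) (cov (row o2 (B x)) (cov (row o5 (B x)) one6)).
Proof.
by rewrite /phih /phi /lefschetz (raddfD (ext_map _))/= (raddfD (ext_map _))/= !ext_map_esc !ext_map_eps ext_map1.
Qed.

(** Conjugation exchanges $e_j$ with $\bar e_j$ and changes the sign of $i$; the two signs cancel,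
    so the form equals its conjugate. *)
Lemma phih_real x S : complex.Im (F x S) = 0.
Proof.
have cD (u v : E) : conj_ext (u + v) = conj_ext u + conj_ext v.
  by apply/ffunP => T; rewrite !ffunE (rmorphD (@conjc R)).
have cZ s (u : E) : conj_ext (esc s u) = esc (cj s) (conj_ext u).
  by apply/ffunP => T; rewrite !ffunE (rmorphM (@conjc R)).
have c1 : conj_ext one6 = one6.
  by apply/ffunP => T; rewrite !ffunE; case: eqP => _; [exact: conjc1 | exact: conjc0].
have [[b0 b1 b2] [b3 b4 b5]] := bar6E.
have iE : cj (I * 1%:C) = - (I * 1%:C).
  by apply/eqP; rewrite eq_complex /=; apply/andP; split; apply/eqP; ring.
have FE : conj_ext (F x) = F x.
  rewrite ext_map_phih !cD !cZ !conj_ext_cov !row_bar c1 b0 b1 b2 b3 b4 b5 iE.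
  rewrite !escN (cov_cov (row o3 _)) (cov_cov (row o4 _)) (cov_cov (row o5 _)).
  by rewrite !(raddfN (esc _))/= !opprK.
have := congr1 (fun w : E => w S) FE; rewrite ffunE; case: (F x S) => p q /= /eqP.
by rewrite eq_complex /= => /andP[_ /eqP e]; lra.
Qed.

Lemma phih_positive x (v : 'cV[R]_6) : v != 0 ->
  0 < ((cplx_mx v)^T *m metric_mx (fibre_mx a) (F x) *m cplx_mx v) 0 0.
Proof.
move=> v0; rewrite (metric_frame 0 0 0 1 1 1 a_lt1).
have [W WE] : exists W : 'cV[C]_6, W = B x *m cplx_mx v by exists (B x *m cplx_mx v).
rewrite (quad_mulmx _ (esym WE)).
have Wb r : W (bar6 r) 0 = cj (W r 0).
  rewrite WE [LHS]mxE [in RHS]mxE (rmorph_sum (@conjc R)); apply: eq_bigr => s _.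
  rewrite heis_frame_bar (rmorphM (@conjc R))/=; congr (_ * _).
  by rewrite [cplx_mx _ _ _]mxE; apply/eqP; rewrite eq_complex /= oppr0 !eqxx.
have W0 : W != 0.
  apply: contraNneq v0 => W0; have : cplx_mx v = 0.
    have U := heis_frame_unit 0 0 0 a_lt1 x.
    by rewrite -(mulKmx U (cplx_mx v)) -WE W0 mulmx0.
  move=> h; apply/eqP/matrixP => i j; have := congr1 (fun M : 'cV[C]_6 => M i j) h; rewrite !mxE.
  by move/(congr1 (@complex.Re R)).
have [[b0 b1 b2] [b3 b4 b5]] := bar6E.
have w3 := Wb o0; have w4 := Wb o1; have w5 := Wb o2; rewrite b0 b1 b2 in w3 w4 w5.
have -> : (W^T *m gram_mx 1 1 1 *m W) 0 0 = 2 * (W o0 0 * cj (W o0 0) + W o1 0 * cj (W o1 0) + W o2 0 * cj (W o2 0)).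
  have -> : (W^T *m gram_mx 1 1 1 *m W) 0 0 = \sum_j (\sum_i W i 0 * gram_mx 1 1 1 i j) * W j 0.
    rewrite mxE; apply: eq_bigr => j _; congr (_ * _); rewrite mxE.
    by apply: eq_bigr => i _; rewrite [X in X * _]mxE.
  rewrite !big_ord6 /= ?big_ord6 /= !mx6E /= w3 w4 w5.
  by rewrite (_ : 1%:C = 1 :> C)//; move: (W o0 0) (W o1 0) (W o2 0) => x0 x1 x2; ring.
rewrite pmulr_rgt0 ?ltr0n// -!sqr_normc.
have p0 (z : C) : 0 <= `|z| ^+ 2 by rewrite exprn_ge0.
rewrite lt_neqAle !addr_ge0// andbT eq_sym; apply: contra W0.
rewrite !paddr_eq0 ?addr_ge0// !expf_eq0 /= !normr_eq0 => /andP[/andP[/eqP z0 /eqP z1] /eqP z2].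
apply/eqP/matrixP => i j; rewrite (ord1 j) [RHS]mxE; elim/ord6P: i => //.
- by rewrite w3 z0 conjc0.
- by rewrite w4 z1 conjc0.
- by rewrite w5 z2 conjc0.
Qed.

Lemma phih_square_closed : torsion (d_frame a) (wedge (phih 1 1 1) (phih 1 1 1)) = 0.
Proof.
rewrite wedge_phil /phih /phi /lefschetz.
apply: (diagonal_square_closed eps_operators (T := torsion (@d_frame R a)) (m := - (dsc a)^-1)
  (k := (dsc a)^-1 * a) (l := (dsc a)^-1 * cj a)).
- exact: torsion_zmod (@d_frame_zmod R a).
- by move=> s v; exact: (torsion_esc (@d_frame_esc R a) s v).
- rewrite /torsion big1// => r _; rewrite iot_ebasis0.
  by have := @d_frame_zmod R a r 0 0; rewrite !subrr.
- by move=> i v i2 i5; exact: torsion_off.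
- by move=> v; exact: (torsion_eps (@d_frame_zmod R a) (@d_frame_eps R a) o2 v).
- by move=> v; exact: (torsion_eps (@d_frame_zmod R a) (@d_frame_eps R a) o5 v).
Qed.

Lemma balanced_exists : exists F : dform R 5, invariant_balanced ((fun _ => fibre_mx a) : acs R 5) F.
Proof.
exists F.
have FE : F = fform a 0 0 0 (cform setT (phih 1 1 1)).
  by apply/funext => x; rewrite fform_cform.
split.
- split.
  + rewrite FE; exact: fform_smooth.
  + apply: (of_type_const 0 0 0 1 1 _ a_lt1).2.
    have b11 (i j : 'I_6) : (i < 3)%N -> (3 <= j)%N -> bideg (fun p q => (p == 1) && (q == 1)) (eps i (eps j one6) : E).
      move=> i3 j3; apply: (bidegW _ (@bideg_eps _ _ i _ (@bideg_eps _ _ j _ (@bideg_one R)))) => p q.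
      by rewrite i3 (ltnNge j) j3 /=; case: p q => [|[|p]] [|[|q]].
    by rewrite /phih /phi /lefschetz; do 2?apply: bidegD; apply: bideg_esc; apply: b11.
  + exact: phih_real.
  + exact: phih_positive.
- rewrite FE; exact: fform_invariant.
- move=> x; have -> : fwedge F F = fun x => ext_map (B x) (wedge (phih 1 1 1) (phih 1 1 1)).
    by apply/funext => y; rewrite /fwedge ext_map_wedge.
  by rewrite (ext_d_const 0 0 a_lt1 (mulr0 a)) phih_square_closed (raddf0 (ext_map _)).
Qed.
End Existence.

(** * The holomorphic family over the disc *)

Section Family.
Context {R : realType}.
Local Notation C := R[i].
Local Notation G := 'rV[R]_6.
Local Notation P8 := 'rV[R]_8.
Local Notation cj := (@conjc R).
Local Notation I := ('i%C : C).
Local Notation sc1 := (@std_acs R 1 0).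

Lemma sum8 (K : pzRingType) (F : 'I_8 -> K) : \sum_(j < 8) F j =
  \sum_(j < 6) F (lshift 2 j : 'I_(6 + 2)) + \sum_(j < 2) F (rshift 6 j : 'I_(6 + 2)).
Proof.
first [exact: (@big_split_ord K 0 +%R 6 2 xpredT F) | exact: (@big_split_ord K 0 _ 6 2 xpredT F) |
  rewrite !big_ord_recl !big_ord0 /= ?addr0 -!addrA;
  do ?[congr (_ + _)]; congr (F _); apply/val_inj => //].
Qed.

Definition par_re (p : P8) : R := p 0 (rshift 6 0 : 'I_(6 + 2)).
Definition par_im (p : P8) : R := p 0 (rshift 6 1 : 'I_(6 + 2)).
Definition param (p : P8) : C := par_re p +i* par_im p.

(** The structure is block diagonal although the coordinate $z_0+a\bar z_0$ involves the parameter: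
    its differential is $dz_0+a\,d\bar z_0+\bar z_0\,da$, and the last term is a multiple of the
    (1,0)-form $da$. *)
Definition family_acs : acs R 7 :=
  fun p => @block_mx R 6 2 6 2 (fibre_mx (param p)) 0 0 sc1.

Lemma param_row_mx x a : param (@row_mx R 1 6 2 x (base_point a)) = a.
Proof.
rewrite /param.
have -> : par_re (@row_mx R 1 6 2 x (base_point a)) = base_point a 0 0 := @row_mxEr R 1 6 2 x (base_point a) 0 0.
have -> : par_im (@row_mx R 1 6 2 x (base_point a)) = base_point a 0 1 := @row_mxEr R 1 6 2 x (base_point a) 0 1.
by rewrite !mxE /=; case: a.
Qed.

Lemma fibre_family a : fibre_acs family_acs a = fun _ => fibre_mx a.
Proof. by apply/funext => x; rewrite /fibre_acs /family_acs block_mxKul param_row_mx. Qed.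

Lemma fibre_mx0 : fibre_mx 0 = @std_acs R 5 0.
Proof.
have inv1 : (1 - 0 ^+ 2 - 0 ^+ 2 : R)^-1 = 1 by rewrite !expr0n /= !subr0 invr1.
apply: matrix6P => i j; rewrite mx6E [RHS]mxE.
elim/ord6P: i; elim/ord6P: j; rewrite /= ?inv1 ?expr0n /= ?mulr0n ?mulr1n; ring.
Qed.

Lemma fibre_family0 : fibre_acs family_acs 0 = @std_acs R 5.
Proof. by rewrite fibre_family fibre_mx0; apply/funext => x; apply/matrixP => i j; rewrite !mxE. Qed.

Lemma fibre_mx_sq (a : C) : `|a| < 1 -> fibre_mx a *m fibre_mx a = - 1%:M.
Proof.
move=> a1; apply: (@map_mx_inj _ _ (real_complex R)).
rewrite map_mxM map_mxN map_mx1.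
have U : frame_mx a 0 0 0 \in unitmx by have [] := mulmx1_unit (vector_frame 0 0 0 a1).
have ff := frame_fibre 0 0 0 a1; rewrite /cplx_mx in ff.
have E : frame_mx a 0 0 0 *m (map_mx (real_complex R) (fibre_mx a) *m map_mx (real_complex R) (fibre_mx a)) =
    frame_mx a 0 0 0 *m - 1%:M.
  rewrite mulmxA ff -mulmxA ff mulmxA mulmxN mulmx1 mulmx_diag.
  apply/matrixP => i j; rewrite mul_diag_mx !mxE.
  have h : hol_sign i * hol_sign i = - 1 :> C.
    by rewrite /hol_sign; case: ifP => _; rewrite ?mulrNN; exact: mulii.
  by rewrite h mulN1r.
by have := congr1 (mulmx (invmx (frame_mx a 0 0 0))) E; rewrite !mulmxA !(mulVmx U) !mul1mx.
Qed.

Lemma std1_sq : sc1 *m sc1 = - 1%:M.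
Proof.
apply/matrixP => i j; rewrite [LHS]mxE !big_ord_recl big_ord0 !mxE /=.
case: i => [[|[|//]] ?]; case: j => [[|[|//]] ?]; rewrite /= ?mulr0n ?mulr1n; ring.
Qed.

Lemma family_sq p : `|param p| < 1 -> family_acs p *m family_acs p = - 1%:M.
Proof.
move=> p1; rewrite /family_acs (@mulmx_block R 6 2 6 2 6 2) !mul0mx !mulmx0 !addr0 !add0r.
rewrite fibre_mx_sq// std1_sq; have := @opp_block_mx R 6 2 6 2 1%:M 0 0 1%:M.
by rewrite !oppr0 -scalar_mx_block => <-.
Qed.

Lemma normc_lt1 (z : C) : (`|z| < 1) = (complex.Re z ^+ 2 + complex.Im z ^+ 2 < 1).
Proof.
have E : z * z^*%C = (complex.Re z ^+ 2 + complex.Im z ^+ 2)%:C.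
  by case: z => x y; apply/eqP; rewrite eq_complex /=; apply/andP; split; apply/eqP; ring.
by rewrite -(expr_lt1 (n := 2))// sqr_normc E -[1 in LHS]/(1%:C) ltcR.
Qed.

Lemma family_domainE : @family_domain R = [set p : P8 | par_re p ^+ 2 + par_im p ^+ 2 < 1].
Proof. by apply/seteqP; split=> p; rewrite /family_domain /= normc_lt1. Qed.

Lemma family_open : open (@family_domain R).
Proof.
rewrite family_domainE; apply: (@open_comp _ _ (fun p : P8 => par_re p ^+ 2 + par_im p ^+ 2) [set r | r < 1]).
  move=> p _; have sf : smooth_on setT (fun p : P8 => par_re p ^+ 2 + par_im p ^+ 2).
    by apply: (smooth_gen_smooth openT); apply: sg_add; apply: sg_mul; apply: sg_coord.
  exact: (sf [::] p Logic.I).1.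
exact: open_lt.
Qed.

Lemma smooth_on_ext n (U : set 'rV[R]_n.+1) f g : smooth_on U f -> f =1 g -> smooth_on U g.
Proof. by move=> sf /funext <-. Qed.

Lemma smooth_family i j : smooth_on (@family_domain R) (fun p => family_acs p i j).
Proof.
pose U := @family_domain R.
have sgc (s : R) := @sg_cst R 7 U s.
have sgr : smooth_gen U par_re := sg_coord _ _.
have sgi : smooth_gen U par_im := sg_coord _ _.
have sgN f : smooth_gen U f -> smooth_gen U (fun x => - f x).
  move=> sf; have -> : (fun x => - f x) = fun x => (-1) * f x by apply/funext => x; rewrite mulN1r.
  exact: sg_mul.
have sg2 f : smooth_gen U f -> smooth_gen U (fun x => f x ^+ 2).
  by move=> sf; exact: (sg_mul sf sf).
have sgm : smooth_gen U (fun p => (1 - par_re p ^+ 2 - par_im p ^+ 2)^-1).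
  apply: sg_inv => [|p]; first by apply: sg_add; [apply: sg_add|]; rewrite //; apply: sgN; apply: sg2.
  rewrite /U family_domainE /= => h; rewrite gt_eqF//.
  by rewrite -addrA -opprD subr_gt0.
have E p k l : family_acs p k l = match @fintype.split 6 2 k, @fintype.split 6 2 l with
    | inl k', inl l' => fibre_mx (param p) k' l' | inr k', inr l' => sc1 k' l' | _, _ => 0 end.
  rewrite /family_acs /block_mx mxE; case: (@fintype.split 6 2 k) => k'; rewrite mxE; case: (@fintype.split 6 2 l) => l' //; by rewrite mxE.
apply: (smooth_on_ext (f := fun p => match @fintype.split 6 2 i, @fintype.split 6 2 j with
    | inl k', inl l' => fibre_mx (param p) k' l' | inr k', inr l' => sc1 k' l' | _, _ => 0 end)) => [|p]; last by rewrite E.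
apply: smooth_gen_smooth; first exact: family_open.
case: (fintype.split _) => k; case: (fintype.split _) => l; rewrite //=; try exact: sgc.
have -> : (fun p => fibre_mx (param p) k l) = fun p =>
   (nth [::] [:: [:: - (2 * par_im p * (1 - par_re p ^+ 2 - par_im p ^+ 2)^-1);
                     - (((1 - par_re p) ^+ 2 + par_im p ^+ 2) * (1 - par_re p ^+ 2 - par_im p ^+ 2)^-1); 0; 0; 0; 0];
          [:: ((1 + par_re p) ^+ 2 + par_im p ^+ 2) * (1 - par_re p ^+ 2 - par_im p ^+ 2)^-1;
              2 * par_im p * (1 - par_re p ^+ 2 - par_im p ^+ 2)^-1; 0; 0; 0; 0];
          [:: 0; 0; 0; -1; 0; 0]; [:: 0; 0; 1; 0; 0; 0]; [:: 0; 0; 0; 0; 0; -1]; [:: 0; 0; 0; 0; 1; 0]] k)`_l.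
  by apply/funext => p; rewrite mx6E.
elim/ord6P: k; elim/ord6P: l; rewrite /=; try exact: sgc.
- exact: (sgN _ (sg_mul (sg_mul (sgc 2) sgi) sgm)).
- exact: (sgN _ (sg_mul (sg_add (sg2 _ (sg_add (sgc 1) (sgN _ sgr))) (sg2 _ sgi)) sgm)).
- exact: (sg_mul (sg_add (sg2 _ (sg_add (sgc 1) sgr)) (sg2 _ sgi)) sgm).
- exact: (sg_mul (sg_mul (sgc 2) sgi) sgm).
Qed.

Lemma affine_map n m (f : 'rV[R]_n.+1 -> 'rV[R]_m.+1) (b : 'I_m.+1 -> R) (M : 'M[R]_(m.+1, n.+1)) :
  (forall x i, f x 0 i = b i + \sum_j M i j * x 0 j) ->
  (forall U i, open U -> smooth_on U (fun x => f x 0 i)) /\ forall x, jacobian_mx f x = M.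
Proof.
move=> fE; have fF i : (fun x => f x 0 i) = fun x => b i + \sum_j M i j * x 0 j by apply/funext.
have fS i : (fun x => f x 0 i) = (fun=> b i) + \sum_j (M i j *: (fun x : 'rV[R]_n.+1 => x 0 j)).
  by rewrite fF; apply/funext => x; rewrite fctE fct_sumE.
split=> [U i oU|x].
  apply: smooth_gen_smooth => //; rewrite fF; apply: sg_add; first exact: sg_cst.
  elim: (index_enum _) => [|j s IH].
    have -> : (fun x : 'rV[R]_n.+1 => \sum_(j <- [::]) M i j * x 0 j) = fun=> 0.
      by apply/funext => x; rewrite big_nil.
    exact: sg_cst.
  have -> : (fun x : 'rV[R]_n.+1 => \sum_(j <- j :: s) M i j * x 0 j) =
      fun x => M i j * x 0 j + \sum_(j <- s) M i j * x 0 j.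
    by apply/funext => x; rewrite big_cons.
  by apply: sg_add => //; apply: sg_mul; [exact: sg_cst | exact: sg_coord].
apply/matrixP => i j; rewrite mxE /partial fS.
have D : is_derive x (delta_mx 0 j) ((fun=> b i) + \sum_l (M i l *: (fun x : 'rV[R]_n.+1 => x 0 l)))
    (0 + \sum_l M i l *: ((l == j)%:R : R)).
  apply: is_deriveD; apply: is_derive_sum => l; apply: is_deriveZ; exact: is_derive_coord.
rewrite (@derive_val _ _ _ _ _ _ _ D) add0r (bigD1 j)//= eqxx big1 ?addr0 => [|l /negbTE ->].
  exact: mulr1.
exact: mulr0.
Qed.

(** [coframe] carries its product term with a minus sign, hence the argument $-g$. *)
Lemma heis_mul_affine (g y : G) i : heis_mul g y 0 i = g 0 i + \sum_j coframe (- g) i j * y 0 j.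
Proof.
have cE j : coframe (- g) i j = (i == j)%:R + (g *m beta j) 0 i.
  have N : ((- g) *m beta j) 0 i = - ((g *m beta j) 0 i) by rewrite mulNmx [LHS]mxE.
  by rewrite [LHS]mxE N opprK.
rewrite heis_mulE [LHS]mxE [X in X + _]mxE -addrA; congr (_ + _).
under [RHS]eq_bigr => j _ do rewrite cE mulrDl.
have s1 : \sum_j (i == j)%:R * y 0 j = y 0 i.
  rewrite (bigD1 i)//= eqxx mul1r big1 ?addr0// => j.
  by rewrite eq_sym => /negbTE ->; rewrite mul0r.
rewrite big_split/= s1.
by congr (_ + _); rewrite summxE; apply: eq_bigr => r _; rewrite mxE mulrC.
Qed.

Lemma fibre_invariant (a : C) : invariant_acs (fun _ => fibre_mx a).
Proof.
move=> g; have [s1 s2] := affine_map (fun x i => heis_mul_affine g x i).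
split=> [i|x _]; first by apply: s1; exact: openT.
by rewrite s2 coframe_fibre.
Qed.

Lemma family_translation (g : G) : holomorphic_on (@family_domain R) family_acs family_acs
  (fun p => row_mx (heis_mul g (@lsubmx R 1 6 2 p)) (@rsubmx R 1 6 2 p)).
Proof.
pose f := (fun p : P8 => row_mx (heis_mul g (@lsubmx R 1 6 2 p)) (@rsubmx R 1 6 2 p) : P8).
pose b (i : 'I_8) : R := (@row_mx R 1 6 2 g 0) 0 i.
pose M : 'M[R]_8 := @block_mx R 6 2 6 2 (coframe (- g)) 0 0 1%:M.
have fE p i : f p 0 i = b i + \sum_j M i j * p 0 j.
  have sE : \sum_(j < 8) M i j * p 0 j =
      \sum_(j < 6) M i (lshift 2 j : 'I_(6 + 2)) * p 0 (lshift 2 j : 'I_(6 + 2)) +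
      \sum_(j < 2) M i (rshift 6 j : 'I_(6 + 2)) * p 0 (rshift 6 j : 'I_(6 + 2)) by exact: sum8.
  rewrite sE; case: (@split_ordP 6 2 i) => k ->.
    have -> : f p 0 (lshift 2 k : 'I_(6 + 2)) = heis_mul g (@lsubmx R 1 6 2 p) 0 k := @row_mxEl R 1 6 2 _ _ 0 k.
    have -> : b (lshift 2 k : 'I_(6 + 2)) = g 0 k := @row_mxEl R 1 6 2 g 0 0 k.
    have Ml (j : 'I_6) : M (lshift 2 k : 'I_(6 + 2)) (lshift 2 j : 'I_(6 + 2)) = coframe (- g) k j := @block_mxEul R 6 2 6 2 _ _ _ _ k j.
    have Mr (j : 'I_2) : M (lshift 2 k : 'I_(6 + 2)) (rshift 6 j : 'I_(6 + 2)) = 0.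
      by apply: etrans (@block_mxEur R 6 2 6 2 _ _ _ _ k j) _; rewrite mxE.
    rewrite heis_mul_affine; congr (_ + _); rewrite [X in _ = _ + X]big1 ?addr0 => [|j _].
      apply: eq_bigr => j _; rewrite Ml; apply: (congr1 (fun u => coframe (- g) k j * u)).
      by rewrite mxE.
    by rewrite Mr mul0r.
  have -> : f p 0 (rshift 6 k : 'I_(6 + 2)) = p 0 (rshift 6 k : 'I_(6 + 2)).
    by apply: etrans (@row_mxEr R 1 6 2 _ _ 0 k) _; rewrite mxE.
  have -> : b (rshift 6 k : 'I_(6 + 2)) = 0 by apply: etrans (@row_mxEr R 1 6 2 g 0 0 k) _; rewrite mxE.
  have Ml (j : 'I_6) : M (rshift 6 k : 'I_(6 + 2)) (lshift 2 j : 'I_(6 + 2)) = 0.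
    by apply: etrans (@block_mxEdl R 6 2 6 2 _ _ _ _ k j) _; rewrite mxE.
  have Mr (j : 'I_2) : M (rshift 6 k : 'I_(6 + 2)) (rshift 6 j : 'I_(6 + 2)) = (k == j)%:R.
    by apply: etrans (@block_mxEdr R 6 2 6 2 _ _ _ _ k j) _; rewrite mxE.
  rewrite add0r [X in _ = X + _]big1 ?add0r => [|j _]; last by rewrite Ml mul0r.
  rewrite (bigD1 k)//= Mr eqxx mul1r big1 ?addr0// => j jk.
  by rewrite Mr eq_sym (negbTE jk) mul0r.
have [s1 s2] := affine_map fE.
split=> [i|p pU]; first by apply: s1; exact: family_open.
have rE k : f p 0 (rshift 6 k : 'I_(6 + 2)) = p 0 (rshift 6 k : 'I_(6 + 2)).
  by apply: etrans (@row_mxEr R 1 6 2 _ _ 0 k) _; rewrite mxE.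
have pE : param (f p) = param p by rewrite /param /par_re /par_im !rE.
rewrite -/(f p) s2 /family_acs pE /M !(@mulmx_block R 6 2 6 2 6 2) !mul0mx !mulmx0 !mul1mx !mulmx1 !addr0 !add0r.
by rewrite coframe_fibre.
Qed.

Lemma family_projection : holomorphic_on (@family_domain R) family_acs (@std_acs R 1) (@rsubmx R 1 6 2).
Proof.
pose M : 'M[R]_(2, 8) := @row_mx R 2 6 2 0 1%:M.
have fE (p : P8) i : (@rsubmx R 1 6 2 p) 0 i = 0 + \sum_j M i j * p 0 j.
  have sE : \sum_(j < 8) M i j * p 0 j =
      \sum_(j < 6) M i (lshift 2 j : 'I_(6 + 2)) * p 0 (lshift 2 j : 'I_(6 + 2)) +
      \sum_(j < 2) M i (rshift 6 j : 'I_(6 + 2)) * p 0 (rshift 6 j : 'I_(6 + 2)) by exact: sum8.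
  have Ml j : M i (lshift 2 j : 'I_(6 + 2)) = 0.
    by apply: etrans (@row_mxEl R 2 6 2 _ _ i j) _; rewrite mxE.
  have Mr j : M i (rshift 6 j : 'I_(6 + 2)) = (i == j)%:R.
    by apply: etrans (@row_mxEr R 2 6 2 _ _ i j) _; rewrite mxE.
  rewrite add0r sE [X in _ = X + _]big1 ?add0r => [|j _]; last by rewrite Ml mul0r.
  rewrite [LHS]mxE (bigD1 i)//= Mr eqxx mul1r big1 ?addr0// => j ji.
  by rewrite Mr eq_sym (negbTE ji) mul0r.
have [s1 s2] := affine_map fE.
split=> [i|p pU]; first by apply: s1; exact: family_open.
rewrite s2 /M /family_acs (@mul_mx_row R 2 2 6 2) (@mul_row_block R 2 6 2 6 2) !mul0mx !mulmx0 !mul1mx !mulmx1 ?addr0 ?add0r.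
exact: erefl.
Qed.

Definition family_coord (k : 'I_4) (p : P8) : C :=
  let x i := p 0 (lshift 2 i : 'I_(6 + 2)) in
  [:: (x o0 +i* x o1) + param p * (x o0 -i* x o1); x o2 +i* x o3; x o4 +i* x o5; param p]`_k.

(** The real and imaginary parts of $z_0+a\bar z_0$ have this shape, with $s=1$ and $s=-1$. *)
Lemma partial_quad (j i a b c d : 'I_8) (s : R) (p : P8) :
  partial j (fun y : P8 => y 0 i + (y 0 a * y 0 b + s * (y 0 c * y 0 d))) p =
  (i == j)%:R + (p 0 a * (b == j)%:R + p 0 b * (a == j)%:R +
    s * (p 0 c * (d == j)%:R + p 0 d * (c == j)%:R)).
Proof.
have D k : is_derive p (delta_mx 0 j) (fun y : P8 => y 0 k) (k == j)%:R := is_derive_coord k j p.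
have := is_deriveD (D i) (is_deriveD (is_deriveM (D a) (D b)) (is_deriveZ s (is_deriveM (D c) (D d)))).
by move=> [_ h]; exact: h.
Qed.

Lemma partial_coord8 (j i : 'I_8) (p : P8) : partial j (fun y : P8 => y 0 i) p = (i == j)%:R.
Proof. by rewrite /partial; have [_ ->] := is_derive_coord i j p. Qed.

Lemma family_dz (p : P8) (k : 'I_4) (j : 'I_8) : cpartial j (family_coord k) p =
  match @fintype.split 6 2 j with
  | inl l => if (k < 3)%N then (nth [::]
      [:: [:: 1 + param p; I - I * param p; 0; 0; 0; 0];
          [:: 0; 0; 1; I; 0; 0]; [:: 0; 0; 0; 0; 1; I]] k)`_l else 0
  | inr l => ((k == 0 :> nat)%:R * (p 0 (lshift 2 o0 : 'I_(6 + 2)) -i* p 0 (lshift 2 o1 : 'I_(6 + 2))) +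
              (k == 3 :> nat)%:R) * [:: 1; I]`_l
  end.
Proof.
pose x i : 'I_8 := (lshift 2 i : 'I_(6 + 2)); pose r i : 'I_8 := (rshift 6 i : 'I_(6 + 2)).
have re0 : (fun y => complex.Re (family_coord (@Ordinal 4 0 isT) y)) =
    (fun y : P8 => y 0 (x o0) + (y 0 (r 0) * y 0 (x o0) + 1 * (y 0 (r 1) * y 0 (x o1)))).
  by apply/funext => y; rewrite /family_coord /= /par_re /par_im mulrN opprK mul1r.
have im0 : (fun y => complex.Im (family_coord (@Ordinal 4 0 isT) y)) =
    (fun y : P8 => y 0 (x o1) + (y 0 (r 1) * y 0 (x o0) + (-1) * (y 0 (r 0) * y 0 (x o1)))).
  apply/funext => y; rewrite /family_coord /= /par_re /par_im mulrN mulN1r.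
  by rewrite [X in _ + X]addrC.
have pE : param p = p 0 (r 0) +i* p 0 (r 1) by [].
rewrite /cpartial; case: (@split_ordP 6 2 j) => l ->; rewrite ?(@unsplitK 6 2 (inl l)) ?(@unsplitK 6 2 (inr l)) ?pE.
  case: k => [[|[|[|[|//]]]] Hk]; rewrite ?(bool_irrelevance Hk isT);
    [rewrite re0 im0 !partial_quad|rewrite !partial_coord8|rewrite !partial_coord8|rewrite !partial_coord8];
    elim/ord6P: l; apply/eqP; rewrite eq_complex /=; apply/andP; split; apply/eqP;
    rewrite /= ?mulr0n ?mulr1n; ring.
case: l => [[|[|//]] Hl]; rewrite ?(bool_irrelevance Hl isT);
  case: k => [[|[|[|[|//]]]] Hk]; rewrite ?(bool_irrelevance Hk isT);
  rewrite ?re0 ?im0 ?partial_quad ?partial_coord8; apply/eqP; rewrite eq_complex /=; apply/andP; split; apply/eqP;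
  rewrite /= ?mulr0n ?mulr1n; ring.
Qed.

Lemma family_coord_smooth k : csmooth_on (@family_domain R) (family_coord k).
Proof.
have sg i : smooth_gen (@family_domain R) (fun y : P8 => y 0 i) := sg_coord _ i.
have S f : smooth_gen (@family_domain R) f -> smooth_on (@family_domain R) f.
  exact: (smooth_gen_smooth family_open).
case: k => [[|[|[|[|//]]]] Hk]; split; apply: S; rewrite /family_coord /= ; try exact: sg.
  have -> : (fun y : P8 => y 0 (lshift 2 o0 : 'I_(6 + 2)) + (par_re y * y 0 (lshift 2 o0 : 'I_(6 + 2)) - par_im y * - y 0 (lshift 2 o1 : 'I_(6 + 2)))) =
    (fun y : P8 => y 0 (lshift 2 o0 : 'I_(6 + 2)) + (par_re y * y 0 (lshift 2 o0 : 'I_(6 + 2)) + par_im y * y 0 (lshift 2 o1 : 'I_(6 + 2)))).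
    by apply/funext => y; rewrite mulrN opprK.
  by apply: sg_add => //; apply: sg_add; apply: sg_mul => //; exact: sg_coord.
have -> : (fun y : P8 => y 0 (lshift 2 o1 : 'I_(6 + 2)) + (par_re y * - y 0 (lshift 2 o1 : 'I_(6 + 2)) + par_im y * y 0 (lshift 2 o0 : 'I_(6 + 2)))) =
  (fun y : P8 => y 0 (lshift 2 o1 : 'I_(6 + 2)) + ((-1) * (par_re y * y 0 (lshift 2 o1 : 'I_(6 + 2))) + par_im y * y 0 (lshift 2 o0 : 'I_(6 + 2)))).
  by apply/funext => y; rewrite mulrN mulN1r.
apply: sg_add => //; apply: sg_add; last by apply: sg_mul => //; exact: sg_coord.
by apply: sg_mul; [exact: sg_cst|apply: sg_mul => //; exact: sg_coord].
Qed.

Local Notation q0 := (@Ordinal 4 0 isT).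
Local Notation q1 := (@Ordinal 4 1 isT).
Local Notation q2 := (@Ordinal 4 2 isT).
Local Notation q3 := (@Ordinal 4 3 isT).

Lemma sum4 (K : pzRingType) (F : 'I_4 -> K) : \sum_(k < 4) F k = F q0 + (F q1 + (F q2 + F q3)).
Proof.
rewrite !big_ord_recl big_ord0 addr0.
by congr (F _ + (F _ + (F _ + F _))); apply/val_inj.
Qed.

Lemma family_complex : complex_structure_on (@family_domain R) family_acs.
Proof.
split; [exact: smooth_family | by move=> p pU; apply: family_sq |].
move=> p pU; exists (@family_domain R), family_coord; split=> //.
- exact: family_open.
- exact: family_coord_smooth.
move=> y yU dz; have y1 : `|param y| < 1 by [].
have dzE k j : dz k j = cpartial j (family_coord k) y by rewrite mxE.
have dl k l : dz k (lshift 2 l : 'I_(6 + 2)) = if (k < 3)%N then frame_mx (param y) 0 0 0 (inord k) l else 0.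
  rewrite dzE family_dz (@unsplitK 6 2 (inl l)) mx6E.
  case: k => [[|[|[|[|//]]]] Hk]; rewrite //= inordK//=; elim/ord6P: l => //=; ring.
have dr k l : dz k (rshift 6 l : 'I_(6 + 2)) =
   ((k == 0 :> nat)%:R * (y 0 (lshift 2 o0 : 'I_(6 + 2)) -i* y 0 (lshift 2 o1 : 'I_(6 + 2))) + (k == 3 :> nat)%:R) * [:: 1; I]`_l.
  by rewrite dzE family_dz (@unsplitK 6 2 (inr l)).
split.
  apply/matrixP => k j; rewrite [LHS]mxE [RHS]mxE.
  have -> : \sum_(l < 8) dz k l * cplx_mx (family_acs y) l j =
      \sum_(l < 6) dz k (lshift 2 l : 'I_(6 + 2)) * cplx_mx (family_acs y) (lshift 2 l : 'I_(6 + 2)) j +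
      \sum_(l < 2) dz k (rshift 6 l : 'I_(6 + 2)) * cplx_mx (family_acs y) (rshift 6 l : 'I_(6 + 2)) j by exact: sum8.
  have cE l m : cplx_mx (family_acs y) l m = (family_acs y l m)%:C by rewrite mxE.
  case: (@split_ordP 6 2 j) => m ->.
    have Jl l : family_acs y (lshift 2 l : 'I_(6 + 2)) (lshift 2 m) = fibre_mx (param y) l m := @block_mxEul R 6 2 6 2 _ _ _ _ l m.
    have Jr l : family_acs y (rshift 6 l : 'I_(6 + 2)) (lshift 2 m) = 0.
      by apply: etrans (@block_mxEdl R 6 2 6 2 _ _ _ _ l m) _; rewrite mxE.
    rewrite [X in _ + X]big1 ?addr0 => [|l _]; last by rewrite cE Jr mulr0.
    rewrite dl; under eq_bigr => l _ do rewrite dl cE Jl.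
    case: ifP => k3; last by rewrite mulr0 big1// => l _; rewrite mul0r.
    have := congr1 (fun N : 'M[C]_6 => N (inord k) m) (frame_fibre 0 0 0 y1).
    rewrite mul_diag_mx [RHS]mxE [X in _ = X * _]mxE /hol_sign inordK ?k3 => [<-|]; last by rewrite (leq_trans k3).
    by rewrite [RHS]mxE; apply: eq_bigr => l _; rewrite [cplx_mx _ _ _]mxE.
  have Jl l : family_acs y (lshift 2 l : 'I_(6 + 2)) (rshift 6 m) = 0.
    by apply: etrans (@block_mxEur R 6 2 6 2 _ _ _ _ l m) _; rewrite mxE.
  have Jr l : family_acs y (rshift 6 l : 'I_(6 + 2)) (rshift 6 m) = sc1 l m := @block_mxEdr R 6 2 6 2 _ _ _ _ l m.
  rewrite [X in X + _]big1 ?add0r => [|l _]; last by rewrite cE Jl mulr0.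
  rewrite dr; under eq_bigr => l _ do rewrite dr cE Jr.
  move: (_ + _ : C) => z; rewrite !big_ord_recl big_ord0 !mxE.
  rewrite -[RHS]/(I * (z * [:: 1; I]`_m)).
  have c0 : (0 : R)%:C = 0 by [].
  have c1 : (1 : R)%:C = 1 by [].
  have cN : (- 1 : R)%:C = - 1 by apply/eqP; rewrite eq_complex /= oppr0 !eqxx.
  have iE : I * I = - 1 by exact: mulii.
  clear Jl Jr; case: m => [[|[|//]] Hm]; rewrite /= !(mulr0n, mulr1n, subr0, sub0r, oppr0) ?c0 ?c1 ?cN ?c0; last by ring: iE.
  by ring.
(* On the fibre directions the first three differentials are rows of the invertible coframe matrix
   and $da$ vanishes, so their coefficients are zero; a parameter direction then gives the last
   one. *)
apply: inj_row_free => v v0.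
have vE j : v 0 q0 * dz q0 j + (v 0 q1 * dz q1 j + (v 0 q2 * dz q2 j + v 0 q3 * dz q3 j)) = 0.
  have := congr1 (fun N : 'rV[C]_8 => N 0 j) v0; rewrite [LHS]mxE [RHS]mxE => e.
  by apply: etrans e; exact: esym (sum4 (fun k => v 0 k * dz k j)).
pose w : 'rV[C]_6 := \row_i [:: v 0 q0; v 0 q1; v 0 q2; 0; 0; 0]`_i.
have wE i : w 0 i = [:: v 0 q0; v 0 q1; v 0 q2; 0; 0; 0]`_i by rewrite mxE.
have w0 : w = 0.
  have U : frame_mx (param y) 0 0 0 \in unitmx by have [] := mulmx1_unit (vector_frame 0 0 0 y1).
  rewrite -[w](mulmxK U) (_ : w *m _ = 0) ?mul0mx//.
  apply/rowP => l; rewrite [LHS]mxE [RHS]mxE; apply: etrans (vE (lshift 2 l : 'I_(6 + 2))).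
  have e0 : inord 0 = o0 by apply/val_inj; rewrite /= inordK.
  have e1 : inord 1 = o1 by apply/val_inj; rewrite /= inordK.
  have e2 : inord 2 = o2 by apply/val_inj; rewrite /= inordK.
  by rewrite !dl big_ord6 /= !wE /= e0 e1 e2 !mul0r mulr0 !addr0.
have wi i : w 0 i = 0 by rewrite w0 mxE.
have v00 : v 0 q0 = 0 by have := wi o0; rewrite wE.
have v01 : v 0 q1 = 0 by have := wi o1; rewrite wE.
have v02 : v 0 q2 = 0 by have := wi o2; rewrite wE.
have v03 : v 0 q3 = 0.
  have := vE (rshift 6 0 : 'I_(6 + 2)); rewrite !dr v00 v01 v02 !mul0r !add0r /=.
  by rewrite ?mulr0n ?mulr1n ?mul0r ?add0r ?mulr1.
apply/rowP => k; rewrite [RHS]mxE.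
case: k => [[|[|[|[|//]]]] Hk].
- by apply: etrans v00; congr (v _ _); apply/val_inj.
- by apply: etrans v01; congr (v _ _); apply/val_inj.
- by apply: etrans v02; congr (v _ _); apply/val_inj.
- by apply: etrans v03; congr (v _ _); apply/val_inj.
Qed.
End Family.

Theorem proposition5p5 (R : realType) (Gam : set 'rV[R]_6)
    (hGam : heis_lattice Gam) :
  exists J : acs R 7,
    [/\ holomorphic_family Gam J /\ fibre_acs J 0 = @std_acs R 5,
        forall a : R[i], `|a| < 1 -> invariant_acs (fibre_acs J a),
        forall a : R[i], `|a| < 1 ->
          exists F : dform R 5, invariant_balanced (fibre_acs J a) F,
        forall F : dform R 5, invariant_balanced (fibre_acs J 0) F ->
          has_dim (L22 Gam (fibre_acs J 0) F) 7
      & forall a : R[i], 0 < `|a| < 1 ->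
          forall F : dform R 5, invariant_balanced (fibre_acs J a) F ->
            has_dim (L22 Gam (fibre_acs J a) F) 5].
Proof.
have z1 : `|0 : R[i]| < 1 by rewrite normr0 ltr01.
exists family_acs; split.
- split; last exact: fibre_family0.
  by split; [exact: family_complex | move=> g _; exact: family_translation | exact: family_projection].
- by move=> a _; rewrite fibre_family; exact: fibre_invariant.
- by move=> a a1; rewrite fibre_family; exact: balanced_exists.
- rewrite fibre_family => F /(adapted_frame z1)[c [d1 [d2 [h0 [h1 [h2 [[p0 p1 p2] [ac FE]]]]]]]].
  rewrite (_ : F = fun x => ext_map (heis_frame 0 c d1 d2 x) (phih h0 h1 h2)); last exact/funext.
  exact: L22_dim7.
move=> a /andP[a0 a1] F; rewrite fibre_family.
move=> /(adapted_frame a1)[c [d1 [d2 [h0 [h1 [h2 [[p0 p1 p2] [ac FE]]]]]]]].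
rewrite (_ : F = fun x => ext_map (heis_frame a c d1 d2 x) (phih h0 h1 h2)); last exact/funext.
by apply: L22_dim5 => //; rewrite -normr_gt0.
Qed.
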